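(* Let $N=3$ and let $0\le\Omega<\infty$ be fixed. Suppose $w_a\in\mathcal H$ is a normalized concentrating solution of (GP) concentrating at $P_0=(0,0,1)$ as $a\searrow0$, where the maximum point $x_a$ of $|w_a|$ satisfies $x_a=(0,0,p_a)$ with $p_a\to1$ as $a\searrow0$. Then for all sufficiently small $a>0$, up to a constant phase, $w_a$ is real-valued and free of vortices.
   Context: For $x=(x_1,x_2,x_3)\in\mathbb R^3$ put $x^\Omega:=\frac{\Omega}{2}(-x_2,x_1,0)$; $-\Delta_{x^\Omega}:=-(\nabla-ix^\Omega)^2=-\Delta+2i\,x^\Omega\cdot\nabla+|x^\Omega|^2$. Let $V(x)=|x|^4+(\frac{\Omega^2}{4}-2)(x_1^2+x_2^2)-2x_3^2$ and $\mathcal H:=\{u\in H^1(\mathbb R^3,\mathbb C):\int_{\mathbb R^3}[|\nabla u|^2+(1+V(x))|u|^2]dx<\infty\}$. Problem (GP), for $a>0$, is: find $u\in\mathcal H$ and a Lagrange multiplier $\mu_a\in\mathbb R$ with $$(-\Delta_{x^\Omega})u+(|x|^2-1)^2u-a|u|^2u=\mu_a u\ \text{ in }\mathbb R^3,\qquad \int_{\mathbb R^3}|u|^2dx=1.$$ $Q=Q(|x|)>0$ is the unique positive solution of $-\Delta u+u-u^3=0$ in $\mathbb R^3$, $u\in H^1(\mathbb R^3,\mathbb R)$. Normalized concentrating solution concentrating at $P\in\mathbb R^3$ as $a\searrow0$: a family $w_a\in\mathcal H$ for which there is $\mu_a<0$ such that $w_a$ satisfies (GP) with multiplier $\mu_a$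 and $$\sqrt{\tfrac{a}{-\mu_a}}\;w_a\Big(\tfrac{x}{\sqrt{-\mu_a}}+x_a\Big)e^{-i\sigma_a-\frac{i}{\sqrt{-\mu_a}}x\cdot x_a^\Omega}=Q(x)+v_a(x)\quad\text{as }a\searrow0,$$ where $x_a\in\mathbb R^3$ is a global maximum point of $|w_a|$, $\sigma_a\in[0,2\pi)$ is a constant phase, $x_a\to P$ and $\mu_a\to-\infty$ as $a\searrow0$, and $v_a$ is a lower order term in the sense that $\|v_a\|_{\varepsilon_a}\to0$ as $a\searrow0$, with $\varepsilon_a:=1/\sqrt{-\mu_a}$ and $\|v\|_{\varepsilon_a}^2:=\int_{\mathbb R^3}\{|(\nabla-i\varepsilon_a^2x^\Omega)v|^2+[1+\varepsilon_a^2(|\varepsilon_ax+x_a|^2-1)^2]|v|^2\}dx$. ''Up to a constant phase, $w_a$ is real-valued'' means $e^{-i\theta_a}w_a$ is real-valued for some $\theta_a\in[0,2\pi)$. ''Free of vortices'' means that there is no closed curve in $\{w_a\ne0\}$ along which the phase $w_a/|w_a|$ has nonzero winding number. *)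

(* Defs.v *)
From HB Require Import structures.
From mathcomp Require Import all_boot all_order all_algebra.
From mathcomp Require Import all_classical all_reals all_analysis.
From mathcomp Require Import complex.

Set Implicit Arguments.
Unset Strict Implicit.
Unset Printing Implicit Defensive.

Import Order.TTheory GRing.Theory Num.Theory.
Import numFieldNormedType.Exports.
Import ComplexField.Normc.

Local Open Scope classical_set_scope.
Local Open Scope ring_scope.
Local Open Scope complex_scope.

(* The norm that [R * R * R] carries in the library is the sup norm (with the
   same topology); the Euclidean norm is [enorm2] below. *)
Notation R3 R := (R * R * R)%type.

Section Euclidean.
Context {R : realType}.
Implicit Types x y : R3 R.

Definition coord3 x (j : 'I_3) : R := tnth [tuple x.1.1; x.1.2; x.2] j.

Definition axis_vec (j : 'I_3) : R3 R :=
  ((j == 0 :> nat)%:R, (j == 1 :> nat)%:R, (j == 2 :> nat)%:R).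

Definition dot x y : R := \sum_(j < 3) coord3 x j * coord3 y j.

Definition enorm2 x : R := dot x x.

End Euclidean.

Definition lebesgue3 (R : realType) :
    {measure set (measurableTypeR R * measurableTypeR R * measurableTypeR R)
       -> \bar R} :=
  ((@lebesgue_measure R \x @lebesgue_measure R) \x @lebesgue_measure R)%E.

Section Sobolev.
Context {R : realType}.
Implicit Types (f g phi : R3 R -> R) (u : R3 R -> R[i]).

Definition partial (j : 'I_3) f : R3 R -> R := fun x => 'D_(axis_vec j) f x.

Definition smooth f := forall s : seq 'I_3,
  continuous (foldr partial f s) /\
  forall j x, derivable (foldr partial f s) x (axis_vec j).

Definition test_function phi :=
  smooth phi /\ compact (closure [set x | phi x != 0]).

Definition square_integrable f :=
  measurable_fun [set: R3 R] f /\
  (\int[lebesgue3 R]_x ((f x) ^+ 2)%:E < +oo)%E.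

Definition weak_partial (j : 'I_3) f g := forall phi, test_function phi ->
  \int[lebesgue3 R]_x (f x * partial j phi x) =
  - \int[lebesgue3 R]_x (g x * phi x).

Definition in_H1 f := square_integrable f /\
  forall j, exists g, square_integrable g /\ weak_partial j f g.

(* A representative, unique up to a null set, of the weak partial derivative;
   only meaningful when [in_H1 f] holds. *)
Definition wD (j : 'I_3) f : R3 R -> R :=
  xget (fun=> 0) [set g | square_integrable g /\ weak_partial j f g].

Definition in_H1C u :=
  in_H1 (fun x => complex.Re (u x)) /\ in_H1 (fun x => complex.Im (u x)).

Definition wDC (j : 'I_3) u : R3 R -> R[i] := fun x =>
  wD j (fun y => complex.Re (u y)) x +i* wD j (fun y => complex.Im (u y)) x.

Definition Cintegral u : R[i] :=
  (\int[lebesgue3 R]_x complex.Re (u x)) +i*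
  (\int[lebesgue3 R]_x complex.Im (u x)).

Definition continuousC u :=
  continuous (fun x => complex.Re (u x)) /\
  continuous (fun x => complex.Im (u x)).

Definition cis (t : R) : R[i] := cos t +i* sin t.

End Sobolev.

Section GrossPitaevskii.
Context {R : realType}.
Implicit Types (Omega a mu eps : R) (u v w : R3 R -> R[i]) (Q : R3 R -> R).

Definition rot_field Omega (x : R3 R) : R3 R :=
  (- (Omega / 2 * x.1.2), Omega / 2 * x.1.1, 0).

Definition potential Omega (x : R3 R) : R :=
  enorm2 x ^+ 2 + (Omega ^+ 2 / 4 - 2) * (x.1.1 ^+ 2 + x.1.2 ^+ 2)
  - 2 * x.2 ^+ 2.

Definition in_H Omega u := in_H1C u /\
  (\int[lebesgue3 R]_x
     ((\sum_(j < 3) normc (wDC j u x) ^+ 2) +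
      (1 + potential Omega x) * normc (u x) ^+ 2)%:E < +oo)%E.

(* Weak form of
   - Delta u + 2 i x^Omega . nabla u + |x^Omega|^2 u
     + (|x|^2 - 1)^2 u - a |u|^2 u = mu u;
   real test functions suffice, the identity being complex. *)
Definition GP_equation Omega a mu u := forall phi, test_function phi ->
  Cintegral (fun x =>
    (\sum_(j < 3) wDC j u x * (partial j phi x)%:C)
    + 2 * (0 +i* 1) * (\sum_(j < 3) (coord3 (rot_field Omega x) j)%:C * wDC j u x)
      * (phi x)%:C
    + (enorm2 (rot_field Omega x) + (enorm2 x - 1) ^+ 2 - a * normc (u x) ^+ 2)%:C
      * u x * (phi x)%:C)
  = Cintegral (fun x => mu%:C * u x * (phi x)%:C).

(* Solutions are identified with their continuous representatives, since their
   pointwise values (maximum points, zeros) are used below. *)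
Definition GP_solution Omega a mu u :=
  [/\ continuousC u, in_H Omega u, GP_equation Omega a mu u
    & (\int[lebesgue3 R]_x (normc (u x) ^+ 2)%:E = 1)%E].

(* Among the positive H^1 solutions, which are unique up to translation, radial
   symmetry selects the one called Q. *)
Definition ground_state Q :=
  [/\ continuous Q, in_H1 Q, (forall x, 0 < Q x),
      (forall x y, enorm2 x = enorm2 y -> Q x = Q y)
    & forall phi, test_function phi ->
        \int[lebesgue3 R]_x
          ((\sum_(j < 3) wD j Q x * partial j phi x)
           + Q x * phi x - Q x ^+ 3 * phi x) = 0].

Definition eps_norm Omega eps (xa : R3 R) v : \bar R :=
  sqrte (\int[lebesgue3 R]_x
    ((\sum_(j < 3)
        normc (wDC j v x
               - (0 +i* 1) * (eps ^+ 2 * coord3 (rot_field Omega x) j)%:C * v x) ^+ 2)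
     + (1 + eps ^+ 2 * (enorm2 (eps *: x + xa) - 1) ^+ 2) * normc (v x) ^+ 2)%:E)%E.

Definition rescaled Omega a mu (sigma : R) (xa : R3 R) w : R3 R -> R[i] :=
  fun x => let eps := (Num.sqrt (- mu))^-1 in
    (Num.sqrt (a / - mu))%:C * w (eps *: x + xa)
    * cis (- sigma - eps * dot x (rot_field Omega xa)).

Definition concentrating Omega Q (w : R -> R3 R -> R[i]) (xmax : R -> R3 R)
    (P : R3 R) :=
  exists mu sigma : R -> R,
  [/\ \forall a \near 0^'+,
        [/\ mu a < 0, GP_solution Omega a (mu a) (w a),
            (forall y, normc (w a y) <= normc (w a (xmax a)))
          & 0 <= sigma a < 2 * pi],
      xmax a @[a --> 0^'+] --> P,
      mu a @[a --> 0^'+] --> -oo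
    & eps_norm Omega (Num.sqrt (- mu a))^-1 (xmax a)
        (fun x => rescaled Omega a (mu a) (sigma a) (xmax a) (w a) x - (Q x)%:C)
      @[a --> 0^'+] --> 0%E].

Definition real_up_to_phase w :=
  exists theta : R, 0 <= theta < 2 * pi /\
    forall x, complex.Im (cis (- theta) * w x) = 0.

Definition phase (z : R[i]) : R[i] := z / (normc z)%:C.

Definition closed_curve_off_zeros w (c : R -> R3 R) :=
  [/\ {within `[0, 1], continuous c}, c 0 = c 1
    & forall t, t \in `[0, 1] -> w (c t) != 0].

(* [theta] is a continuous determination of the argument along the curve. *)
Definition winding_number w (c : R -> R3 R) (k : int) :=
  exists theta : R -> R,
    [/\ {within `[0, 1], continuous theta},
        (forall t, t \in `[0, 1] -> phase (w (c t)) = cis (theta t))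
      & theta 1 - theta 0 = 2 * pi * k%:~R].

Definition vortex_free w :=
  ~ exists (c : R -> R3 R) (k : int),
      [/\ closed_curve_off_zeros w c, winding_number w c k & k != 0].

End GrossPitaevskii.

(* Main.v *)
(* Rescaling at the maximum point [(0, 0, p)] turns [w a] into a solution
   [u + i v] of an equation whose magnetic field is of order [eps ^ 2], which is
   H^1-close to [Q]. Potential estimates with a truncated Newton kernel (after a
   gauge change centred at the point considered) make this closeness uniform,
   and a constant rotation of the phase achieves [v 0 = 0].

   The reflection [x_1 -> - x_1] followed by complex conjugation preserves the
   rescaled equation. Hence [D = u - u o refl1] and [E = v + v o refl1] solve an
   equation close to the linearization [(-Delta + 1 - 3 Q^2) D = 0],
   [(-Delta + 1 - Q^2) E = 0] at [Q]. With [psi = - d_1 Q] positive on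
   [x_1 > 0] and [Q > 0], Jacobi's identity writes the quadratic forms as
   [Int (psi^2 |grad (D / psi)|^2)] and [Int (Q^2 |grad (E / Q)|^2)], so that
   [D / psi] and [E / Q] are nearly constant on large boxes. Since [u] is
   critical at the maximum point, [d_1 D] vanishes at [0], as does [E]; so both
   constants are small relative to the L^2 norm of [(D, E)], and [D = E = 0].
   Thus [v] vanishes on the plane [x_1 = 0]. The equation and the normalization
   are invariant under rotations about the [x_3]-axis, so [v] vanishes on every
   plane containing that axis, i.e. everywhere. *)

Require Import Defs.
From HB Require Import structures.
From mathcomp Require Import all_boot all_order all_algebra.
From mathcomp Require Import all_classical all_reals all_analysis.
From mathcomp Require Import measurable_realfun complex.
From mathcomp Require Import ring lra.

Set Implicit Arguments.
Unset Strict Implicit.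
Unset Printing Implicit Defensive.

Import Order.TTheory GRing.Theory Num.Theory.
Import numFieldNormedType.Exports.

Local Open Scope classical_set_scope.
Local Open Scope ring_scope.

(** * Lebesgue measure on [R^3] *)

Section Measurability.
Context {R : realType}.
Implicit Types (x y : R3 R).

(** Three obstacles shape the argument. No [L^infinity] bound is given, and the nonlinearity is
    cubic. At the maximum point the cubic term is, up to bounded terms, at most the maximum times
    [h = (u - Q)^2 + v^2]; Hardy's inequality makes the Newton potential of [h] small there, and the
    maximum is absorbed. Next, the vector potential grows linearly, so that the constants of the
    gauge argument depend on the point: they serve on a fixed cube only, and outside it the
    subsolution property of [u^2 + v^2], which does not feel the magnetic field, takes over. For the
    same reason the field is no small perturbation of the linearized problem, where the trap has to
    pay for it. Finally, closeness to [Q] could never give an exact symmetry. But [D] and [E] solve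
    a problem that is linear in them, so every estimate is relative to the [L^2] norm of [(D, E)],
    and a factor below one already means vanishing. Being odd in [x_1], [D] meets the kernel of the
    linearization only along [psi], and criticality at the maximum removes that direction because
    the derivative of [psi] at [0] is not zero. *)

Lemma near_sup_lt x y e : (`|x - y| < e) = [&& `|x.1.1 - y.1.1| < e, `|x.1.2 - y.1.2| < e & `|x.2 - y.2| < e].
Proof. by rewrite !prod_normE /= !gt_max andbA. Qed.

(** The sigma-algebra is a product of one-dimensional ones; countably many rational cubes tie it to
    the topology and make continuous functions measurable. *)
Definition ratcube (k : (rat * rat * rat * rat)%type) : set (R3 R) :=
  [set x : R3 R| [&& `|x.1.1 - ratr k.1.1.1| < ratr k.2, `|x.1.2 - ratr k.1.1.2| < ratr k.2 & `|x.2 - ratr k.1.2| < ratr k.2]].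

Lemma measurable_ratcube k : measurable (ratcube k : set (measurableTypeR R * measurableTypeR R * measurableTypeR R)).
Proof.
have mb (a e : R) : measurable ([set t | `|t - a| < e] : set (measurableTypeR R)).
  rewrite (_ : [set t | _] = `]a - e, a + e[%classic); first exact: measurable_itv.
  by apply/seteqP; split => t /=; rewrite ltr_distl in_itv.
have -> : ratcube k = ([set t | `|t - ratr k.1.1.1| < ratr k.2] `*` [set t | `|t - ratr k.1.1.2| < ratr k.2])
   `*` [set t | `|t - ratr k.1.2| < ratr k.2].
  by apply/seteqP; split => x /=; rewrite /ratcube /=; [move=> /and3P[]|move=> [[-> ->] ->]].
by apply: measurableX => //; apply: measurableX.
Qed.

Lemma open_bigcup_ratcube (U : set (R3 R)) : open U ->
  U = \bigcup_(k in [set k | ratcube k `<=` U]) ratcube k.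
Proof.
move=> oU; apply/seteqP; split; last by move=> x [k /= kU] /kU.
move=> x Ux; have := open_nbhs_nbhs (conj oU Ux) => /nbhs_ballP[e /= e0 eU].
have [r /andP[r0 re]] : exists r : rat, (0 < (ratr r : R)) && (ratr r < e / 2).
  have : 0 < e / 2 by rewrite divr_gt0.
  by move=> /rat_in_itvoo[r]; rewrite in_itv /= => ?; exists r.
have ap (t : R) : exists q : rat, `|t - ratr q| < (ratr r : R).
  have : t < t + ratr r by rewrite ltrDl.
  move=> /rat_in_itvoo[q]; rewrite in_itv /= => /andP[h1 h2]; exists q.
  by rewrite ltr_distl; apply/andP; split; lra.
have [q1 h1] := ap x.1.1; have [q2 h2] := ap x.1.2; have [q3 h3] := ap x.2.
exists (q1, q2, q3, r); last by rewrite /ratcube /= h1 h2 h3.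
move=> y; rewrite /ratcube /= => /and3P[g1 g2 g3]; apply: eU.
rewrite -ball_normE /= near_sup_lt; move: h1 h2 h3 g1 g2 g3; rewrite !ltr_distl => *.
by apply/and3P; split; lra.
Qed.

Lemma measurable_cont (f : R3 R -> R) : continuous f ->
  measurable_fun (setT : set (measurableTypeR R * measurableTypeR R * measurableTypeR R)) (f : _ -> measurableTypeR R).
Proof.
move=> /continuousP cf; apply: (measurability _ (measurable_realfun.RGenOInfty.measurableE R)).
move=> _ [_ [a ->] <-]; rewrite setTI.
have /open_bigcup_ratcube -> : open (f @^-1` `]a, +oo[%classic) by apply: cf; exact: interval_open.
rewrite bigcup_mkcond; apply: countable_bigcupT_measurable => // k.
by case: ifP => // _; exact: measurable_ratcube.
Qed.
End Measurability.

(** * Sigma-finite products and iterated integrals *)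

Section ProductSigmaFinite.
Local Open Scope ereal_scope.
Context d1 d2 (T1 : measurableType d1) (T2 : measurableType d2) (R : realType).
Variable m1 : {sigma_finite_measure set T1 -> \bar R}.
Variable m2 : {sigma_finite_measure set T2 -> \bar R}.

(** Fubini is applied twice on [R^3], so the measure on the first two coordinates has to be
    sigma-finite itself; products of two exhaustions exhaust the product. *)
Lemma product_measure_sigma_finite : sigma_finite setT (m1 \x m2).
Proof.
have /sigma_finiteP[F [TF ndF Foo]] := sigma_finiteT m1.
have /sigma_finiteP[G [TG ndG Goo]] := sigma_finiteT m2.
exists (fun n => F n `*` G n).
  apply/seteqP; split => // -[x y] _.
  have : (\bigcup_i F i) x by rewrite -TF.
  have : (\bigcup_i G i) y by rewrite -TG.
  move=> [k _ Gky] [n _ Fnx]; exists (maxn n k) => //; split.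
    by move: x Fnx; exact/subsetPset/ndF/leq_maxl.
  by move: y Gky; exact/subsetPset/ndG/leq_maxr.
move=> k; have [? ?] := Foo k; have [? ?] := Goo k.
split; first exact: measurableX.
by rewrite product_measure1E// lte_mul_pinfty// ge0_fin_numE.
Qed.

Definition product_sf : {sigma_finite_measure set (T1 * T2)%type -> \bar R} :=
  HB.pack (m1 \x m2) (Measure_isSigmaFinite.Build _ _ _ (m1 \x m2) product_measure_sigma_finite).
End ProductSigmaFinite.

Section IteratedIntegrals.
Context {R : realType}.
Local Notation X1 := (measurableTypeR R).
Local Notation X3 := (measurableTypeR R * measurableTypeR R * measurableTypeR R)%type.
Local Notation la := (@lebesgue_measure R).
Local Notation mu := (@lebesgue3 R).
Local Open Scope ereal_scope.

(** Uniqueness of Lebesgue measure: [al] times the image measure gives every interval its length. *)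
Lemma lebesgue_affine (al b : R) (A : set X1) : (0 < al)%R -> measurable A ->
  la ((fun t : R => (al * t + b)%R) @^-1` A) = (al^-1)%:E * la A.
Proof.
move=> al0 mA.
have mT : measurable_fun setT ((fun t : R => (al * t + b)%R) : X1 -> X1).
  by apply: continuous_measurable_fun => t; apply: cvgD; [apply: cvgM; [exact: cvg_cst|exact: cvg_id]|exact: cvg_cst].
have ali0 : (0 <= al)%R by exact: ltW.
pose pf : {measure set X1 -> \bar R} := measure_function_pushforward__canonical__measure_function_Measure la mT.
pose m : {measure set X1 -> \bar R} := mscale (NngNum ali0) pf.
have -> : la A = m A.
  apply: (@lebesgue_measure_unique R m) => // _ [[c d]] _ <- /=.
  rewrite /m /mscale /= /pf /= /pushforward.
  rewrite (_ : _ @^-1` _ = `]((c - b) / al)%R, ((d - b) / al)%R]%classic); last first.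
    apply/seteqP; split => t /=; rewrite !in_itv /= ltr_pdivrMr// ler_pdivlMr// ltrBlDr lerBrDr.
      by rewrite [(t * al)%R]mulrC.
    by rewrite [(t * al)%R]mulrC.
  rewrite !lebesgue_measure_itv /= !lte_fin ltr_pM2r ?invr_gt0// ltrD2r.
  case: ifP => _; last by rewrite mule0.
  rewrite -!EFinB -EFinM; congr (_%:E); rewrite -mulrBl mulrC -mulrA mulVf ?gt_eqF// mulr1; ring.
by rewrite /m /mscale /= /pf /= /pushforward muleA -EFinM mulVf ?gt_eqF// mul1e.
Qed.

Lemma ge0_integral_affine (al b : R) (f : R -> \bar R) : (0 < al)%R ->
  measurable_fun setT (f : X1 -> \bar R) -> (forall t, 0 <= f t) ->
  \int[la]_t f (al * t + b)%R = (al^-1)%:E * \int[la]_t f t.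
Proof.
move=> al0 mf f0.
have mT : measurable_fun setT ((fun t : R => (al * t + b)%R) : X1 -> X1).
  by apply: continuous_measurable_fun => t; apply: cvgD; [apply: cvgM; [exact: cvg_cst|exact: cvg_id]|exact: cvg_cst].
have ali0 : (0 <= al^-1)%R by rewrite invr_ge0 ltW.
transitivity (\int[pushforward la ((fun t : R => (al * t + b)%R) : X1 -> X1)]_y f y).
  by rewrite ge0_integral_pushforward.
rewrite -(ge0_integral_mscale la measurableT (NngNum ali0)) => //.
by apply: eq_measure_integral => A mA _; rewrite /= /pushforward /mscale /= lebesgue_affine.
Qed.

Lemma ge0_integral_opp (f : R -> \bar R) :
  measurable_fun setT (f : X1 -> \bar R) -> (forall t, 0 <= f t) ->
  \int[la]_t f (- t)%R = \int[la]_t f t.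
Proof.
move=> mf f0.
transitivity (\int[pushforward la ((-%R : R -> R) : X1 -> X1)]_y f y).
  by rewrite ge0_integral_pushforward.
by apply: eq_measure_integral => A mA _; exact: lebesgue_measureN.
Qed.

Let la2 := product_sf la la.

Lemma integral3_3 (f : X3 -> \bar R) : measurable_fun setT f -> (forall x, 0 <= f x) ->
  \int[mu]_x f x = \int[la2]_p \int[la]_t f (p, t).
Proof. by move=> mf f0; exact: (fubini_tonelli1 (m1 := la2) (m2 := la) f mf f0). Qed.

Lemma measurable_section1 (f : X3 -> \bar R) z : measurable_fun setT f ->
  measurable_fun setT (fun p => f (p, z)).
Proof. by move=> mf; apply: measurableT_comp => //; exact: pair2_measurable. Qed.

Lemma integral3_1 (f : X3 -> \bar R) : measurable_fun setT f -> (forall x, 0 <= f x) ->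
  \int[mu]_x f x = \int[la]_z \int[la]_y \int[la]_t f ((t, y), z).
Proof.
move=> mf f0; have h := fubini_tonelli2 (m1 := la2) (m2 := la) f mf f0.
rewrite [LHS]h; apply: eq_integral => z _.
exact: (fubini_tonelli2 (m1 := la) (m2 := la) (fun p => f (p, z)) (measurable_section1 z mf)).
Qed.

Lemma integral3_2 (f : X3 -> \bar R) : measurable_fun setT f -> (forall x, 0 <= f x) ->
  \int[mu]_x f x = \int[la]_z \int[la]_y \int[la]_t f ((y, t), z).
Proof.
move=> mf f0; have h := fubini_tonelli2 (m1 := la2) (m2 := la) f mf f0.
rewrite [LHS]h; apply: eq_integral => z _.
exact: (fubini_tonelli1 (m1 := la) (m2 := la) (fun p => f (p, z)) (measurable_section1 z mf)).
Qed.
End IteratedIntegrals.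

Notation Int f := (\int[lebesgue3 _]_x f x)%R.
Definition intg (R : realType) (f : R3 R -> R) : Prop := (lebesgue3 R).-integrable setT (EFin \o f).

(** * Changes of variables: dilations, shears, rotations, reflections *)

Section ChangeOfVariables.
Context {R : realType}.
Local Notation X1 := (measurableTypeR R).
Local Notation X3 := (measurableTypeR R * measurableTypeR R * measurableTypeR R)%type.
Local Notation la := (@lebesgue_measure R).
Local Notation mu := (@lebesgue3 R).

(** For a linear [T], [c] is the inverse of the absolute determinant. Nonnegative integrands come
    first, since Tonelli asks for no integrability; [scales_Int] passes to integrable ones. *)
Definition scales_measure (T : R3 R -> R3 R) (c : R) :=
  [/\ 0 <= c, measurable_fun setT (T : X3 -> X3) &
  forall f : X3 -> \bar R, measurable_fun setT f -> (forall x, 0 <= f x)%E ->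
   (\int[mu]_x f (T x) = c%:E * \int[mu]_x f x)%E].

Lemma scales_comp T1 T2 c1 c2 : scales_measure T1 c1 -> scales_measure T2 c2 ->
  scales_measure (T1 \o T2) (c1 * c2).
Proof.
move=> [c10 m1 h1] [c20 m2 h2]; split; [exact: mulr_ge0| |].
  have h := measurableT_comp m1 m2; exact h.
move=> f mf f0; have h := measurableT_comp mf m1; rewrite (h2 _ h (fun x => f0 (T1 x))) h1//.
by rewrite muleA -EFinM mulrC.
Qed.

Lemma scales_intg T c (f : R3 R -> R) : scales_measure T c -> intg f -> intg (f \o T).
Proof.
move=> [c0 mT hT] /integrableP[mf foo]; apply/integrableP; split.
  by have h := measurableT_comp mf mT; exact h.
have mf' : measurable_fun setT (fun x : X3 => `|(f x)%:E|%E) by exact: measurableT_comp.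
rewrite [X in (X < _)%E](hT _ mf')//.
by rewrite lte_mul_pinfty// lee_fin.
Qed.

Lemma scales_Int T c (f : R3 R -> R) : scales_measure T c -> intg f ->
  Int (fun x => f (T x)) = c * Int f.
Proof.
move=> sT intf; move: sT => [c0 mT hT].
have mf := measurable_int _ intf.
rewrite /Rintegral integralE [in RHS]integralE.
have -> : (\int[mu]_x ((fun x => (f (T x))%:E)^\+ x) = c%:E * \int[mu]_x ((fun x => (f x)%:E)^\+ x))%E.
  have h := measurable_funepos mf; rewrite (_ : (fun x => _)^\+%E = (fun x => (EFin \o f)^\+%E (T x))).
    exact (hT _ h (funepos_ge0 _)).
  by apply/funext => x; rewrite !funeposE.
have -> : (\int[mu]_x ((fun x => (f (T x))%:E)^\- x) = c%:E * \int[mu]_x ((fun x => (f x)%:E)^\- x))%E.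
  have h := measurable_funeneg mf; rewrite (_ : (fun x => _)^\-%E = (fun x => (EFin \o f)^\-%E (T x))).
    exact (hT _ h (funeneg_ge0 _)).
  by apply/funext => x; rewrite !funenegE.
have p1 : (\int[mu]_x ((fun x => (f x)%:E)^\+ x))%E \is a fin_num.
  apply: integrable_fin_num => //; exact: integrable_funepos.
have p2 : (\int[mu]_x ((fun x => (f x)%:E)^\- x))%E \is a fin_num.
  apply: integrable_fin_num => //; exact: integrable_funeneg.
by rewrite -(fineK p1) -(fineK p2) -!EFinM -!EFinB /= mulrBr.
Qed.

Lemma measurable_pairs (f1 f2 f3 : R3 R -> R) : continuous f1 -> continuous f2 -> continuous f3 ->
  measurable_fun setT ((fun x => (f1 x, f2 x, f3 x)) : X3 -> X3).
Proof.
move=> c1 c2 c3.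
have h := measurable_fun_pair (measurable_fun_pair (measurable_cont c1) (measurable_cont c2)) (measurable_cont c3).
exact h.
Qed.

Lemma continuous_c1 : continuous (fun x : R3 R => x.1.1).
Proof. by move=> [[a b] c]; apply: (@cvg_comp _ _ _ fst fst _ (nbhs (a, b))); exact: cvg_fst. Qed.
Lemma continuous_c2 : continuous (fun x : R3 R => x.1.2).
Proof. by move=> [[a b] c]; apply: (@cvg_comp _ _ _ fst snd _ (nbhs (a, b))); [exact: cvg_fst|exact: cvg_snd]. Qed.
Lemma continuous_c3 : continuous (fun x : R3 R => x.2).
Proof. by move=> x; exact: cvg_snd. Qed.

Lemma measurable_slice1 (f : X3 -> \bar R) y z : measurable_fun setT f ->
  measurable_fun setT (fun t : X1 => f (t, y, z)).
Proof.
move=> mf; apply: (@measurableT_comp _ _ _ X1 (X1 * X1)%type _ (fun p => f (p, z)) setT (fun t => (t, y))) => //.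
exact: measurable_section1.
Qed.

(** With the first coordinate integrated innermost, the other two are mere parameters of [S]; this
    is what makes shears accessible without determinants. *)
Lemma scales_coord1 (S : R -> R -> R -> R) (c : R) : 0 <= c ->
  continuous (fun x : R3 R => S x.1.2 x.2 x.1.1) ->
  (forall y z (g : R -> \bar R), measurable_fun setT (g : X1 -> \bar R) -> (forall t, 0 <= g t)%E ->
    (\int[la]_t g (S y z t) = c%:E * \int[la]_t g t)%E) ->
  scales_measure (fun x => (S x.1.2 x.2 x.1.1, x.1.2, x.2)) c.
Proof.
move=> c0 cS hS.
have mT : measurable_fun setT ((fun x => (S x.1.2 x.2 x.1.1, x.1.2, x.2)) : X3 -> X3).
  by apply: measurable_pairs; [exact: cS|exact: continuous_c2|exact: continuous_c3].
split => // f mf f0; have mfT := measurableT_comp mf mT; rewrite !integral3_1//.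
have ms z : measurable_fun setT (fun p : X1 * X1 => f (p, z)) by exact: measurable_section1.
have m1 z : measurable_fun setT (fun y : X1 => \int[la]_t f (t, y, z))%E.
  exact: (measurable_fun_fubini_tonelli_G (m1 := la) (T2 := X1) (fun p : X1 * X1 => f (p, z)) (ms z)).
have m2 : measurable_fun setT (fun z : X1 => \int[la]_y \int[la]_t f (t, y, z))%E.
  have := measurable_fun_fubini_tonelli_G (m1 := product_sf la la) (T2 := X1) f mf f0.
  apply: eq_measurable_fun => z _; rewrite /fubini_G.
  exact: (fubini_tonelli2 (m1 := la) (m2 := la) (fun p => f (p, z)) (ms z)).
rewrite -ge0_integralZl//=; last by move=> z _; apply: integral_ge0 => y _; apply: integral_ge0.
apply: eq_integral => z _; rewrite -ge0_integralZl//=; last by move=> y _; apply: integral_ge0.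
apply: eq_integral => y _; rewrite (hS y z (fun t => f (t, y, z)))//; exact: measurable_slice1.
Qed.

Lemma scales_coord3 (S : R -> R) (c : R) : 0 <= c -> continuous S ->
  (forall (g : R -> \bar R), measurable_fun setT (g : X1 -> \bar R) -> (forall t, 0 <= g t)%E ->
    (\int[la]_t g (S t) = c%:E * \int[la]_t g t)%E) ->
  scales_measure (fun x => (x.1, S x.2)) c.
Proof.
move=> c0 cS hS.
have mT : measurable_fun setT ((fun x => (x.1, S x.2)) : X3 -> X3).
  rewrite (_ : (fun x => _) = (fun x : R3 R => (x.1.1, x.1.2, S x.2))); last by apply/funext => -[[]].
  apply: measurable_pairs; [exact: continuous_c1|exact: continuous_c2|].
  by move=> x; apply: (@cvg_comp _ _ _ snd S _ (nbhs x.2)); [exact: cvg_snd|exact: cS].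
split => // f mf f0; have mfT := measurableT_comp mf mT; rewrite !integral3_3//.
have m1 : measurable_fun setT (fun p : X1 * X1 => \int[la]_t f (p, t))%E.
  exact: (measurable_fun_fubini_tonelli_F (m2 := la) (T2 := X1) f mf).
rewrite -ge0_integralZl//=; last by move=> z _; apply: integral_ge0.
apply: eq_integral => p _; rewrite (hS (fun t => f (p, t)))//.
have h := measurableT_comp mf (pair1_measurable p); exact h.
Qed.

Lemma scales_swap : scales_measure (fun x : R3 R => (x.1.2, x.1.1, x.2)) 1.
Proof.
have mT : measurable_fun setT ((fun x => (x.1.2, x.1.1, x.2)) : X3 -> X3).
  by apply: measurable_pairs; [exact: continuous_c2|exact: continuous_c1|exact: continuous_c3].
split => // f mf f0; have mfT := measurableT_comp mf mT.
by rewrite integral3_1// [in RHS]integral3_2// mul1e.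
Qed.

Lemma scales_eq T1 T2 c1 c2 : T1 =1 T2 -> c1 = c2 -> scales_measure T1 c1 -> scales_measure T2 c2.
Proof. by move=> /funext -> ->. Qed.

Lemma continuous_affine (al b : R) : continuous (fun t : R => al * t + b).
Proof. by move=> t; apply: cvgD; [apply: cvgM; [exact: cvg_cst|exact: cvg_id]|exact: cvg_cst]. Qed.

Lemma scales_shear1 (al : R) (be : R -> R -> R) : 0 < al ->
  continuous (fun x : R3 R => be x.1.2 x.2) ->
  scales_measure (fun x => (al * x.1.1 + be x.1.2 x.2, x.1.2, x.2)) al^-1.
Proof.
move=> al0 cb; apply: (scales_coord1 (S := fun y z t => al * t + be y z)).
- by rewrite invr_ge0 ltW.
- by move=> x; apply: cvgD; [apply: cvgM; [exact: cvg_cst|exact: continuous_c1]|exact: cb].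
- by move=> y z g mg g0; exact: ge0_integral_affine.
Qed.

Lemma scales_shear2 (al : R) (be : R -> R -> R) : 0 < al ->
  continuous (fun x : R3 R => be x.1.2 x.2) ->
  scales_measure (fun x => (x.1.1, al * x.1.2 + be x.1.1 x.2, x.2)) al^-1.
Proof.
move=> al0 cb; have := scales_comp scales_swap (scales_comp (scales_shear1 al0 cb) scales_swap).
by apply: scales_eq => //; rewrite mul1r mulr1.
Qed.

Lemma scales_opp1 : scales_measure (fun x : R3 R => (- x.1.1, x.1.2, x.2)) 1.
Proof.
apply: (scales_coord1 (S := fun y z t => - t)) => //.
- by move=> x; apply: cvgN; exact: continuous_c1.
- by move=> y z g mg g0; rewrite mul1e; exact: ge0_integral_opp.
Qed.

Lemma scales_affine (al : R) (a : R3 R) : 0 < al ->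
  scales_measure (fun x => al *: x + a) (al^-1 ^+ 3).
Proof.
move=> al0; have cc (b : R) : continuous (fun x : R3 R => b) by move=> x; exact: cvg_cst.
have h3 : scales_measure (fun x => (x.1, al * x.2 + a.2)) al^-1.
  apply: (@scales_coord3 (fun t => al * t + a.2)); [by rewrite invr_ge0 ltW|exact: continuous_affine|].
  by move=> g mg g0; exact: ge0_integral_affine.
have := scales_comp h3 (scales_comp (@scales_shear1 al (fun _ _ => a.1.1) al0 (cc _)) (@scales_shear2 al (fun _ _ => a.1.2) al0 (cc _))).
by apply: scales_eq => //; rewrite !exprS expr0 mulr1.
Qed.

Definition rotz (c s : R) (x : R3 R) : R3 R := (c * x.1.1 - s * x.1.2, s * x.1.1 + c * x.1.2, x.2).

(* A rotation is a product of three shears. *)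
Lemma scales_rotz (c s : R) : c ^+ 2 + s ^+ 2 = 1 -> scales_measure (rotz c s) 1.
Proof.
(* For [s = 0] the shear parameter below is undefined; the map is then the identity or a product of
   two reflections. *)
move=> cs1; have [s0|s0] := eqVneq s 0.
  have cE : (c - 1) * (c + 1) = 0 by move: cs1; rewrite s0 => h; lra.
  have hid : scales_measure (@id (R3 R)) 1.
    by apply: scales_eq (scales_comp scales_swap scales_swap) => [[[]]|] //; rewrite mulr1.
  move/eqP: cE; rewrite mulf_eq0 subr_eq0 addr_eq0 => /orP[]/eqP cE; rewrite s0 cE.
    by apply: scales_eq hid => // -[[a b] d]; rewrite /rotz /= !mul0r !mul1r subr0 add0r.
  have := scales_comp (scales_comp scales_swap (scales_comp scales_opp1 scales_swap)) scales_opp1.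
  apply: scales_eq => [[[a b] d]|]; last by rewrite !mulr1.
  by rewrite /rotz /= !mul0r !mulN1r subr0 add0r.
(* The tangent of half the angle: the rotation is the shear by [- t], then by [s] in the other
   direction, then by [- t] again. *)
pose t := (1 - c) / s.
have cl (k : R) : continuous (fun x : R3 R => k * x.1.2).
  by move=> x; apply: cvgM; [exact: cvg_cst|exact: continuous_c2].
have ht := @scales_shear1 1 (fun y _ => - t * y) ltr01 (cl _).
have hs := @scales_shear2 1 (fun y _ => s * y) ltr01 (cl _).
have := scales_comp ht (scales_comp hs ht).
apply: scales_eq => [[[a b] d]|]; last by rewrite invr1 !mulr1.
have ts : t * s = 1 - c by rewrite /t mulfVK.
have tc : t * (1 + c) = s.
  by apply: (mulIf s0); rewrite -mulrA [_ * s]mulrC mulrA ts; lra.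
rewrite /rotz /=; congr (_, _, _); last by rewrite mul1r; ring: ts.
  transitivity (a * (1 - t * s) - b * (t * (1 - t * s) + t)); first by ring.
  rewrite ts; have -> : t * (1 - (1 - c)) + t = s by rewrite -tc; ring.
  by ring.
Qed.
End ChangeOfVariables.

(** * Integrals over [R^3] and over cubes *)

Definition box (R : realType) (r : R) : set (R3 R) := [set x | `|x| <= r].
Notation IntBox r f := (\int[lebesgue3 _]_(x in box r) f x)%R.

Section Integrals.
Context {R : realType}.
Local Notation X1 := (measurableTypeR R).
Local Notation X3 := (measurableTypeR R * measurableTypeR R * measurableTypeR R)%type.
Local Notation la := (@lebesgue_measure R).
Local Notation mu := (@lebesgue3 R).
Implicit Types (f g : R3 R -> R).

Lemma boxE (r : R) (x : R3 R) : (`|x| <= r) = [&& `|x.1.1| <= r, `|x.1.2| <= r & `|x.2| <= r].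
Proof. by rewrite !prod_normE /= !ge_max andbA. Qed.

Lemma box_itv (r : R) : box r = (`[- r, r] `*` `[- r, r]) `*` `[- r, r] :> set (R3 R).
Proof.
apply/seteqP; split => x /=; rewrite /box /= boxE !in_itv /= !ler_norml.
  by move=> /and3P[-> -> ->].
by move=> [[-> ->] ->].
Qed.

Lemma measurable_box (r : R) : measurable (box r : set X3).
Proof. by rewrite box_itv; apply: measurableX => //; apply: measurableX. Qed.

Lemma mu_box (r : R) : 0 <= r -> mu (box r) = ((2 * r) ^+ 3)%:E.
Proof.
move=> r0; rewrite box_itv.
have m1 : measurable (`[- r, r]%classic : set X1) by [].
pose J : set X1 := `[- r, r]%classic.
have h : ((la \x la) (J `*` J) = la J * la J)%E by exact: product_measure1E.
have h2 := @product_measure1E _ _ _ _ R (product_sf la la) la (J `*` J) J.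
have {}h2 : mu ((J `*` J) `*` J) = ((la \x la)%E (J `*` J) * la J)%E by apply: h2 => //; exact: measurableX.
rewrite [LHS]h2 h.
have -> : la J = if - r < r then (r + r)%:E else 0%E.
  by rewrite lebesgue_measure_itv /= lte_fin; case: ifP => // _; rewrite -EFinB opprK.
case: ltP => [h3|h3].
  by rewrite -!EFinM (_ : (r + r) * (r + r) * (r + r) = (2 * r) ^+ 3)//; ring.
have -> : r = 0 by lra.
by rewrite !mul0e mulr0 expr0n.
Qed.

Definition Cc f := continuous f /\ exists r, forall x, r < `|x| -> f x = 0.

Lemma intg_bounded f (C r : R) : 0 <= r -> measurable_fun setT (f : X3 -> X1) ->
  (forall x, `|x| <= r -> `|f x| <= C) -> (forall x, r < `|x| -> f x = 0) ->
  intg f /\ `|Int f| <= C * (2 * r) ^+ 3.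
Proof.
move=> r0 mf fC f0.
have /measurable_EFinP mE := mf.
have mb := measurable_box r.
have le1 : (\int[mu]_x `|(f x)%:E| <= (C * (2 * r) ^+ 3)%:E)%E.
  have ic := @integral_cst _ _ _ mu _ mb C%:E.
  rewrite EFinM -(mu_box r0) -ic integral_mkcond.
  have mr := measurable_cst C%:E : measurable_fun (box r : set X3) _.
  have mr' := proj1 (measurable_restrictT _ mb) mr.
  have ma := measurableT_comp (@abse_measurable R setT) mE.
  apply: ge0_le_integral; [exact: measurableT|by []|exact ma|exact mr'|].
  - move=> x _; rewrite patchE; case: ifPn; rewrite ?notin_setE ?inE /box /=.
      by move=> /fC; rewrite lee_fin.
    by move=> /negP; rewrite -ltNge => /f0 ->; rewrite normr0.
have fi : intg f by apply/integrableP; split => //; apply: le_lt_trans le1 _; rewrite ltry.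
split => //; apply: le_trans (le_normr_Rintegral measurableT fi) _.
by rewrite -lee_fin fineK//; have /integrableP[_] := fi; rewrite ge0_fin_numE// integral_ge0.
Qed.

Lemma compact_box (r : R) : compact (box r : set (R3 R)).
Proof. by rewrite box_itv; apply: compact_setX; [apply: compact_setX|]; exact: segment_compact. Qed.

Lemma cont_bounded f (r : R) : continuous f -> exists2 C : R, 0 <= C & forall x, `|x| <= r -> `|f x| <= C.
Proof.
move=> cf; have [r0|r0] := ltP r 0.
  by exists 0 => // x xr; have := le_lt_trans xr r0; rewrite normr_lt0.
have [|||c _ hc] := @compact_EVT_max _ R (fun x => `|f x|) (box r).
- by exists 0; rewrite /box /= normr0.
- exact: compact_box.
- by apply: continuous_subspaceT => x; apply: cvg_norm; exact: cf.
by exists `|f c| => // x xr; apply: hc; rewrite inE.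
Qed.

(** The near-covering form of compactness yields one [d] for all [x] in the cube, while [y] is free
    to leave it. *)
Lemma unif_cont f (r e : R) : continuous f -> 0 < e ->
  exists2 d : R, 0 < d & forall x y, `|x| <= r -> `|x - y| < d -> `|f x - f y| < e.
Proof.
move=> cf e0.
have := compact_near_coveringP (box r : set (R3 R)) => -[/(_ (@compact_box r)) h _].
have := h R (0^'+) (fun d x => forall y, `|x - y| < d -> `|f x - f y| < e) _.
case.
- move=> x _.
  have e20 : 0 < e / 2 by rewrite divr_gt0.
  have /cvgrPdist_lt /(_ _ e20) /nbhs_ballP[rho /= rho0 hr] := cf x.
  have hr' y : `|x - y| < rho -> `|f x - f y| < e / 2.
    by move=> xy; apply: hr; rewrite -ball_normE.
  exists (ball x (rho / 2), [set d | d < rho / 2]).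
    split => /=; first by apply: nbhsx_ballx; rewrite divr_gt0.
    exact: nbhs_right_lt (divr_gt0 rho0 _).
  move=> [x' d] [/= xx' dr] y x'y; move: xx'; rewrite -ball_normE /= => xx'.
  have h1 := hr' x'; have h2 := hr' y.
  have h3 : `|x - x'| < rho by apply: lt_le_trans xx' _; lra.
  have h4 : `|x - y| < rho.
    apply: le_lt_trans (ler_distD x' _ _) _.
    by have := lt_trans x'y dr; lra.
  apply: le_lt_trans (ler_distD (f x) _ _) _.
  by rewrite [`|f x' - _|]distrC; move: (h1 h3) (h2 h4); lra.
- move=> d /= d0 hd; exists (d / 2); first by rewrite divr_gt0.
  move=> x y xr xy; apply: (hd (d / 2) _ _ x xr y xy).
    by rewrite /ball /= sub0r normrN gtr0_norm; lra.
  by rewrite divr_gt0.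
Qed.

Lemma Cc_intg f : Cc f -> intg f.
Proof.
move=> [cf [r f0]].
have f0' x : Num.max r 0 < `|x| -> f x = 0 by rewrite gt_max => /andP[/f0].
have [C _ hC] := cont_bounded (Num.max r 0) cf.
have h : 0 <= Num.max r 0 by rewrite le_max lexx orbT.
by have [] := intg_bounded h (measurable_cont cf) hC f0'.
Qed.

Lemma IntD f g : intg f -> intg g -> Int (fun x => f x + g x) = Int f + Int g.
Proof. by move=> hf hg; rewrite RintegralD. Qed.
Lemma IntB f g : intg f -> intg g -> Int (fun x => f x - g x) = Int f - Int g.
Proof. by move=> hf hg; rewrite RintegralB. Qed.
Lemma IntZ k f : intg f -> Int (fun x => k * f x) = k * Int f.
Proof. by move=> hf; rewrite RintegralZl. Qed.
Lemma IntN f : intg f -> Int (fun x => - f x) = - Int f.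
Proof. by move=> hf; rewrite -[RHS]mulN1r -IntZ//; apply: eq_Rintegral => x _; rewrite mulN1r. Qed.
Lemma le_Int f g : intg f -> intg g -> (forall x, f x <= g x) -> Int f <= Int g.
Proof. by move=> hf hg h; apply: le_Rintegral => // x _; exact: h. Qed.
Lemma Int_ge0 f : (forall x, 0 <= f x) -> 0 <= Int f.
Proof. by move=> h; apply: Rintegral_ge0 => x _; exact: h. Qed.
Lemma eq_Int f g : f =1 g -> Int f = Int g.
Proof. by move=> h; apply: eq_Rintegral => x _; exact: h. Qed.
Lemma intgD f g : intg f -> intg g -> intg (fun x => f x + g x).
Proof. by move=> hf hg; exact: (integrableD measurableT hf hg). Qed.
Lemma intgB f g : intg f -> intg g -> intg (fun x => f x - g x).
Proof. by move=> hf hg; exact: (integrableB measurableT hf hg). Qed.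
Lemma intgZ k f : intg f -> intg (fun x => k * f x).
Proof. by move=> hf; exact: (integrableZl measurableT k hf). Qed.

Lemma Int_bounded f (C r : R) : 0 <= r -> continuous f ->
  (forall x, `|x| <= r -> `|f x| <= C) -> (forall x, r < `|x| -> f x = 0) ->
  `|Int f| <= C * (2 * r) ^+ 3.
Proof. by move=> r0 cf h1 h2; have [] := intg_bounded r0 (measurable_cont cf) h1 h2. Qed.

Lemma Int_cvg (f_ : (R3 R -> R)^nat) f g : (forall n, continuous (f_ n)) -> intg g ->
  (forall n x, `|f_ n x| <= g x) -> (forall x, f_ n x @[n --> \oo] --> f x) ->
  (Int (f_ n) @[n --> \oo] --> Int f) /\ intg f.
Proof.
move=> cf ig hb hc.
have [] := @dominated_convergence _ _ _ mu setT measurableT (fun n x => (f_ n x)%:E)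
  (fun x => (f x)%:E) (fun x => (g x)%:E).
- by move=> n; have /measurable_EFinP h := measurable_cont (cf n); exact h.
- have mfl : measurable_fun setT (f : X3 -> X1).
    apply: (@measurable_fun_cvg _ X3 R setT f_); first by move=> n; exact: measurable_cont.
    by move=> x _; exact: hc.
  by have /measurable_EFinP h := mfl; exact h.
- by apply: aeW => x _; apply: cvg_EFin; [exact: nearW|exact: hc].
- exact: ig.
- by apply: aeW => x n _; rewrite lee_fin.
move=> i1 _ h; split => //.
by apply: (fine_cvg (f := fun n => _)); rewrite fineK//; apply: integrable_fin_num.
Qed.

Lemma box_restrict (r : R) f x : (f \_ (box r)) x = if `|x| <= r then f x else 0.
Proof.
rewrite patchE; case: ifPn; rewrite ?notin_setE ?inE /box /=; first by move=> ->.
by move=> /negP/negbTE ->.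
Qed.

Lemma intg_restrict (r : R) f : continuous f -> intg (f \_ (box r)).
Proof.
move=> cf; have [r0|r0] := ltP r 0.
  have -> : f \_ (box r) = cst 0; last first.
    exact: (integrable0 mu setT).
  by apply/funext => x; rewrite box_restrict; case: leP => // /le_lt_trans /(_ r0); rewrite normr_lt0.
have [C C0 hC] := cont_bounded r cf.
have mf := proj1 (measurable_restrictT (f : X3 -> X1) (measurable_box r)) (measurable_funTS (measurable_cont cf)).
have [] := @intg_bounded _ C r r0 mf => //.
  by move=> x xr; rewrite box_restrict xr hC.
by move=> x; rewrite box_restrict; case: leP.
Qed.

Lemma intg_box (r : R) f : continuous f -> mu.-integrable (box r) (EFin \o f).
Proof.
move=> /(@intg_restrict r) h; apply/(integrable_mkcond _ (measurable_box r)).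
by rewrite restrict_EFin.
Qed.

Lemma IntBoxE (r : R) f : IntBox r f = Int (f \_ (box r)).
Proof. by rewrite Rintegral_mkcond. Qed.

Lemma IntBox_le (r : R) f : continuous f -> intg f -> (forall x, 0 <= f x) -> IntBox r f <= Int f.
Proof.
move=> cf fi f0; rewrite IntBoxE; apply: le_Int => //; first exact: intg_restrict.
by move=> x; rewrite box_restrict; case: ifP.
Qed.

Lemma IntBox_full (r : R) f : (forall x, r < `|x| -> f x = 0) -> IntBox r f = Int f.
Proof.
move=> fr; rewrite IntBoxE; apply: eq_Int => x; rewrite box_restrict.
by case: leP => // /fr ->.
Qed.

Lemma le_IntBox (r : R) f g : continuous f -> continuous g ->
  (forall x, `|x| <= r -> f x <= g x) -> IntBox r f <= IntBox r g.
Proof.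
by move=> cf cg h; apply: le_Rintegral; [exact: measurable_box|exact: intg_box|exact: intg_box|].
Qed.

Lemma IntBox_mono (r1 r2 : R) f : r1 <= r2 -> continuous f -> (forall x, 0 <= f x) ->
  IntBox r1 f <= IntBox r2 f.
Proof.
move=> r12 cf f0; rewrite !IntBoxE; apply: le_Int; [exact: intg_restrict|exact: intg_restrict|].
move=> x; rewrite !box_restrict; case: (leP `|x| r1) => h; first by rewrite (le_trans h r12).
by case: ifP.
Qed.

Lemma IntBox_cst (r k : R) : 0 <= r -> IntBox r (fun=> k) = k * (2 * r) ^+ 3.
Proof.
move=> r0; rewrite Rintegral_cst; last exact: measurable_box.
by have h := mu_box r0; rewrite [X in fine X]h.
Qed.

Lemma IntBoxD (r : R) f g : continuous f -> continuous g ->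
  IntBox r (fun x => f x + g x) = IntBox r f + IntBox r g.
Proof. by move=> cf cg; apply: RintegralD; [exact: measurable_box|exact: intg_box|exact: intg_box]. Qed.
Lemma IntBoxZ (r k : R) f : continuous f -> IntBox r (fun x => k * f x) = k * IntBox r f.
Proof. by move=> cf; apply: RintegralZl; [exact: measurable_box|exact: intg_box]. Qed.
Lemma IntBox_ge0 (r : R) f : (forall x, 0 <= f x) -> 0 <= IntBox r f.
Proof. by move=> h; apply: Rintegral_ge0 => x _; exact: h. Qed.
Lemma eq_IntBox (r : R) f g : (forall x, `|x| <= r -> f x = g x) -> IntBox r f = IntBox r g.
Proof. by move=> h; apply: eq_Rintegral => x; rewrite inE; exact: h. Qed.

Lemma Int_affine f (al : R) (a : R3 R) : 0 < al -> intg f ->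
  intg (fun x => f (al *: x + a)) /\ Int (fun x => f (al *: x + a)) = al^-1 ^+ 3 * Int f.
Proof.
move=> al0 fi; split; first exact: (scales_intg (scales_affine a al0) fi).
exact: (scales_Int (scales_affine a al0) fi).
Qed.

Lemma Int_translate f (a : R3 R) : intg f -> intg (fun x => f (x + a)) /\ Int (fun x => f (x + a)) = Int f.
Proof.
move=> fi; have [] := Int_affine a (ltr01 : 0 < 1 :> R) fi.
rewrite invr1 expr1n mul1r; under eq_Int do rewrite scale1r.
by move=> h <-; split => //; move: h; congr (is_true (integrable _ _ _)); apply/funext => x /=; rewrite scale1r.
Qed.

Lemma Int_rotz f (c s : R) : c ^+ 2 + s ^+ 2 = 1 -> intg f -> Int (fun x => f (rotz c s x)) = Int f.
Proof. by move=> cs fi; rewrite (scales_Int (scales_rotz cs) fi) mul1r. Qed.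

Definition refl1 (x : R3 R) : R3 R := (- x.1.1, x.1.2, x.2).

Lemma Int_refl1 f : intg f -> Int (fun x => f (refl1 x)) = Int f.
Proof. by move=> fi; rewrite (scales_Int scales_opp1 fi) mul1r. Qed.

Lemma Int_gt0 f x0 : Cc f -> (forall x, 0 <= f x) -> 0 < f x0 -> 0 < Int f.
Proof.
move=> ccf f0 fx0; have [cf _] := ccf; have fi := Cc_intg ccf.
have [d d0 hd] := unif_cont `|x0| cf (divr_gt0 fx0 (ltr0n _ 2)).
have [gi <-] := Int_translate x0 fi.
have cg : continuous (fun x : R3 R => f (x + x0)).
  by move=> x; apply: (@continuous_comp _ _ _ (fun y : R3 R => y + x0) f); [apply: cvgD; [exact: cvg_id|exact: cvg_cst]|exact: cf].
have := @IntBox_le (d / 2) _ cg gi (fun x => f0 _); apply: lt_le_trans.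
have d20 : 0 <= d / 2 by lra.
apply: (@lt_le_trans _ _ (IntBox (d / 2) (fun=> f x0 / 2))).
  by rewrite IntBox_cst// mulr_gt0 ?exprn_gt0//; lra.
apply: le_IntBox => //; first by move=> x; exact: cvg_cst.
move=> x xd; have := hd x0 (x + x0) (lexx _); rewrite opprD addrCA subrr addr0 normrN => /(_ _).
move=> /(_ (le_lt_trans xd _)); rewrite ltr_distl => h.
have /h/andP[] : d / 2 < d by lra.
by lra.
Qed.
End Integrals.

(** * Differentiation and integration by parts *)

Section Calculus.
Context {R : realType}.
Implicit Types (f g : R3 R -> R) (x v : R3 R).
Local Notation e_ := (@axis_vec R).

(** Restriction to a line: one-variable results such as the chain rule and the mean value theorem
    reach directional derivatives through this equivalence. *)
Lemma slice_derive f x v d : is_derive x v f d <-> is_derive (0 : R) (1 : R) (fun t => f (t *: v + x)) d.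
Proof.
have E : (fun h => h^-1 *: ((f \o shift x) (h *: v) - f x)) =
  (fun h : R => h^-1 *: (((fun t => f (t *: v + x)) \o shift 0) (h *: (1 : R)) - f (0 *: v + x))).
  by apply/funext => h /=; rewrite addr0 scale0r add0r /GRing.scale /= mulr1.
by split => -[h1 h2]; split; rewrite /derivable /derive ?E -?E in h1 h2 *.
Qed.

Lemma slice_derive_at f v (d : R3 R -> R) x (t : R) : (forall y, is_derive y v f (d y)) ->
  is_derive t 1 (fun s => f (s *: v + x)) (d (t *: v + x)).
Proof.
move=> h; have /slice_derive := h (t *: v + x).
have E : (fun h0 : R => h0^-1 *: (((fun s => f (s *: v + x)) \o shift t) (h0 *: (1:R)) - f (t *: v + x))) =
  (fun h0 : R => h0^-1 *: (((fun s => f (s *: v + (t *: v + x))) \o shift 0) (h0 *: (1 : R)) - f (0 *: v + (t *: v + x)))).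
  apply/funext => s /=; rewrite addr0 scale0r add0r /GRing.scale /= mulr1.
  by rewrite addrA -scalerDl.
by case=> h1 h2; split; rewrite /derivable /derive E.
Qed.

Lemma derD (V : normedModType R) (f g : V -> R) (x v : V) (df dg : R) : is_derive x v f df -> is_derive x v g dg -> is_derive x v (fun y => f y + g y) (df + dg).
Proof. by move=> hf hg; exact: is_deriveD. Qed.
Lemma derB (V : normedModType R) (f g : V -> R) (x v : V) (df dg : R) : is_derive x v f df -> is_derive x v g dg -> is_derive x v (fun y => f y - g y) (df - dg).
Proof. by move=> hf hg; exact: is_deriveB. Qed.
Lemma derN (V : normedModType R) (f : V -> R) (x v : V) (df : R) : is_derive x v f df -> is_derive x v (fun y => - f y) (- df).
Proof. by move=> hf; exact: is_deriveN. Qed.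
Lemma derM (V : normedModType R) (f g : V -> R) (x v : V) (df dg : R) : is_derive x v f df -> is_derive x v g dg ->
  is_derive x v (fun y => f y * g y) (df * g x + f x * dg).
Proof. by move=> hf hg; apply: (@is_derive_eq _ _ _ _ _ _ _ _ (is_deriveM hf hg)); rewrite /GRing.scale /=; ring. Qed.
Lemma der_cst (V : normedModType R) (x v : V) (k : R) : is_derive x v (fun=> k) 0.
Proof. exact: is_derive_cst. Qed.
Lemma derZ (V : normedModType R) (f : V -> R) (x v : V) (df k : R) : is_derive x v f df -> is_derive x v (fun y => k * f y) (k * df).
Proof. by move=> hf; apply: (@is_derive_eq _ _ _ _ _ _ _ _ (derM (der_cst x v k) hf)); rewrite mul0r add0r. Qed.

Lemma der_eq (V : normedModType R) (f : V -> R) (x v : V) (d d' : R) :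
  is_derive x v f d -> d = d' -> is_derive x v f d'.
Proof. by move=> h <-. Qed.

Lemma derX (V : normedModType R) (f : V -> R) (x v : V) (df : R) n : is_derive x v f df ->
  is_derive x v (fun y => f y ^+ n.+1) (n.+1%:R * f x ^+ n * df).
Proof.
move=> hf; elim: n => [|n IH]; first by rewrite mul1r mul1r.
rewrite (_ : (fun y => _) = fun y => f y * f y ^+ n.+1); last by apply/funext => y; rewrite exprS.
by apply: (@is_derive_eq _ _ _ _ _ _ _ _ (derM hf IH)); rewrite exprS [n.+2%:R]mulrS; ring.
Qed.

Lemma der_comp f x v df (h : R -> R) (dh : R) : is_derive x v f df -> is_derive (f x) 1 h dh ->
  is_derive x v (fun y => h (f y)) (dh * df).
Proof.
move=> /slice_derive hf hh; apply/slice_derive.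
have hh' : is_derive ((fun t : R => f (t *: v + x)) 0) (1:R) h dh by rewrite /= scale0r add0r.
exact: (is_derive1_comp hh' hf).
Qed.

Lemma der_linear f x v : (forall (t : R) y, f (t *: v + y) = t * f v + f y) -> is_derive x v f (f v).
Proof.
move=> fl; apply/slice_derive.
rewrite (_ : (fun t => _) = (fun t : R => f v *: t + cst (f x) t)); last first.
  by apply/funext => t; rewrite fl mulrC.
apply: (@is_derive_eq _ _ _ _ _ _ _ _ (is_deriveD (is_deriveZ _ (is_derive_id _ _)) (is_derive_cst _ _ _))).
by rewrite addr0 /GRing.scale /= mulr1.
Qed.

Lemma der_eqf f g x v d : f =1 g -> is_derive x v f d -> is_derive x v g d.
Proof. by move=> /funext ->. Qed.

Lemma der_unique f x v d1 d2 : is_derive x v f d1 -> is_derive x v f d2 -> d1 = d2.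
Proof. by move=> [_ <-] [_ <-]. Qed.

Lemma coordZD j (t : R) x y : coord3 (t *: x + y) j = t * coord3 x j + coord3 y j.
Proof. by rewrite /coord3; case: j => -[|[|[|]]]. Qed.
Lemma coordD j x y : coord3 (x + y) j = coord3 x j + coord3 y j.
Proof. by case: j => -[|[|[|]]]. Qed.
Lemma coordN j x : coord3 (- x) j = - coord3 x j.
Proof. by case: j => -[|[|[|]]]. Qed.
Lemma coordB j x y : coord3 (x - y) j = coord3 x j - coord3 y j.
Proof. by rewrite coordD coordN. Qed.
Lemma coord0 j : coord3 (0 : R3 R) j = 0.
Proof. by case: j => -[|[|[|]]]. Qed.

Lemma coord_axis i j : coord3 (e_ i) j = (i == j)%:R.
Proof. by rewrite /coord3 /axis_vec; case: i => -[|[|[|]]] //= ?; case: j => -[|[|[|]]]. Qed.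

Lemma norm_axis j : `|e_ j| = 1.
Proof.
rewrite !prod_normE /axis_vec /=; case: j => -[|[|[|]]] //= i;
 by rewrite ?normr1 ?normr0 ?[Num.max 0 1](max_r ler01) ?[Num.max 1 0](max_l ler01) ?maxxx ?[Num.max 0 1](max_r ler01) ?[Num.max 1 0](max_l ler01).
Qed.

Lemma le_coord j x : `|coord3 x j| <= `|x|.
Proof. by have := lexx `|x|; rewrite {1}boxE => /and3P[*]; case: j => -[|[|[|]]]. Qed.

Lemma sup_ge0_coord (x : R3 R) (c : R) : (forall j, `|coord3 x j| <= c) -> `|x| <= c.
Proof.
move=> h; rewrite boxE; apply/and3P; split.
- exact: (h (Ordinal (isT : 0 < 3)%N)).
- exact: (h (Ordinal (isT : 1 < 3)%N)).
- exact: (h (Ordinal (isT : 2 < 3)%N)).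
Qed.

Lemma cont_coord j : continuous (fun x : R3 R => coord3 x j).
Proof. by case: j => -[|[|[|]]] //= i; [exact: continuous_c1|exact: continuous_c2|exact: continuous_c3]. Qed.

Lemma contD f g : continuous f -> continuous g -> continuous (fun x => f x + g x).
Proof. by move=> cf cg x; apply: cvgD; [exact: cf|exact: cg]. Qed.
Lemma contB f g : continuous f -> continuous g -> continuous (fun x => f x - g x).
Proof. by move=> cf cg x; apply: cvgB; [exact: cf|exact: cg]. Qed.
Lemma contM f g : continuous f -> continuous g -> continuous (fun x => f x * g x).
Proof. by move=> cf cg x; apply: cvgM; [exact: cf|exact: cg]. Qed.
Lemma contN f : continuous f -> continuous (fun x => - f x).
Proof. by move=> cf x; apply: cvgN; exact: cf. Qed.
Lemma contX f n : continuous f -> continuous (fun x => f x ^+ n).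
Proof. by move=> cf x; apply: (@continuous_comp _ _ _ f (fun y => y ^+ n)); [exact: cf|exact: exprn_continuous]. Qed.
Lemma cont_cst (k : R) : continuous (fun _ : R3 R => k).
Proof. by move=> x; exact: cvg_cst. Qed.
Lemma cont_norm f : continuous f -> continuous (fun x => `|f x|).
Proof. by move=> cf x; apply: cvg_norm; exact: cf. Qed.
Lemma cont_sum (F : 'I_3 -> R3 R -> R) : (forall j, continuous (F j)) -> continuous (fun x => \sum_j F j x).
Proof.
move=> h; rewrite (_ : (fun x => _) = fun x => F ord0 x + (F (lift ord0 ord0) x + F (lift ord0 (lift ord0 ord0)) x)).
  by apply: contD => //; apply: contD.
by apply/funext => x; rewrite !big_ord_recl big_ord0 addr0.
Qed.
Lemma cont_comp f (h : R -> R) : continuous f -> continuous h -> continuous (fun x => h (f x)).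
Proof. by move=> cf ch x; apply: (@continuous_comp _ _ _ f h); [exact: cf|exact: ch]. Qed.
Lemma cont_affine f (al : R) (a : R3 R) : continuous f -> continuous (fun x : R3 R => f (al *: x + a)).
Proof.
move=> cf x; apply: (@continuous_comp _ _ _ (fun y : R3 R => al *: y + a) f); last exact: cf.
by apply: cvgD; [apply: cvgZr; exact: cvg_id|exact: cvg_cst].
Qed.

Definition C1 f (df : 'I_3 -> R3 R -> R) := [/\ continuous f, forall j, continuous (df j) &
  forall j x, is_derive x (e_ j) f (df j x)].

Definition vanish (r : R) f := forall x, r < `|x| -> f x = 0.

Lemma C1_vanish f df r : C1 f df -> vanish r f -> forall j, vanish r (df j).
Proof.
move=> [cf _ hf] fr j x xr.
have nx : \forall y \near x, r < `|y|.
  apply/nbhs_ballP; exists (`|x| - r); first by rewrite /= subr_gt0.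
  by move=> y; rewrite -ball_normE /= => h; have := lerB_dist x y; lra.
apply: (der_unique (hf j x)).
apply: near_eq_is_derive (is_derive_cst 0 x (e_ j)).
by near=> y; rewrite /= fr//; near: y.
Unshelve. all: by end_near. Qed.

Lemma C1_lip f df r C j : C1 f df -> (forall x, `|x| <= r -> `|df j x| <= C) ->
  forall x (t : R), `|x| <= r -> `|t *: e_ j + x| <= r -> `|f (t *: e_ j + x) - f x| <= C * `|t|.
Proof.
move=> [cf _ hf] hC x t xr xtr.
have seg (s : R) : Num.min 0 t <= s <= Num.max 0 t -> `|s *: e_ j + x| <= r.
  move=> hs; apply: sup_ge0_coord => i; rewrite coordZD.
  have h1 := le_trans (le_coord i _) xr; have h2 := le_trans (le_coord i _) xtr.
  move: h1 h2; rewrite coordZD coord_axis !ler_norml; case: (j == i) => /=; last by rewrite !mulr0 !add0r.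
  rewrite !mulr1; move: hs; case: (leP 0 t) => ht; rewrite ?(min_l ht) ?(max_r ht) ?(min_r (ltW ht)) ?(max_l (ltW ht)) => *; lra.
have D (s : R) : is_derive s 1 (fun s => f (s *: e_ j + x)) (df j (s *: e_ j + x)).
  exact: (slice_derive_at x s (hf j)).
have cs : forall a b : R, {within `[a, b], continuous (fun s => f (s *: e_ j + x))}.
  move=> a b; apply: continuous_subspaceT => s; apply: differentiable_continuous.
  by apply/derivable1_diffP; case: (D s).
have f0E : f x = f (0 *: e_ j + x) by rewrite scale0r add0r.
case: (leP 0 t) => ht.
  have [c cab E] := @MVT_segment R _ _ 0 t ht (fun s _ => D s) (cs _ _).
  rewrite f0E E subr0 normrM ler_wpM2r//; apply: hC; apply: seg.
  by move: cab; rewrite in_itv /= (min_l ht) (max_r ht).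
have [c cab E] := @MVT_segment R _ _ t 0 (ltW ht) (fun s _ => D s) (cs _ _).
rewrite f0E distrC E sub0r normrM normrN ler_wpM2r//; apply: hC; apply: seg.
by move: cab; rewrite in_itv /= (min_r (ltW ht)) (max_l (ltW ht)).
Qed.

Lemma cvg_diffquot f x v d : is_derive x v f d ->
  n.+1%:R * (f (n.+1%:R^-1 *: v + x) - f x) @[n --> \oo] --> d.
Proof.
move=> [df <-].
have /cvgr_dnbhsP h : h^-1 *: (f (h *: v + x) - f x) @[h --> (0 : R)^'] --> 'D_v f x by exact: df.
rewrite (_ : (fun n => _) = fun n : nat => (n.+1%:R^-1 : R)^-1 *: (f ((n.+1%:R^-1 : R) *: v + x) - f x)); last first.
  by apply/funext => n; rewrite invrK.
apply: (h (fun n => n.+1%:R^-1)); split; last exact: cvg_harmonic.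
by move=> n; rewrite invr_eq0 pnatr_eq0.
Qed.

(** Difference quotients have integral zero by translation invariance, and they converge boundedly
    on a fixed cube. *)
Lemma Int_deriv0 f df j : C1 f df -> Cc f -> Int (df j) = 0.
Proof.
move=> hC [_ [r0 fr0]]; have [cf cdf hd] := hC.
pose r := Num.max r0 0.
have fr : vanish r f by move=> x; rewrite gt_max => /andP[/fr0].
have [C C0 hb] := cont_bounded (r + 2) (cdf j).
pose q n x := n.+1%:R * (f (n.+1%:R^-1 *: e_ j + x) - f x) : R.
have fi : intg f by apply: Cc_intg; split => //; exists r.
have tE n (x : R3 R) : f (n.+1%:R^-1 *: e_ j + x) = f (x + n.+1%:R^-1 *: e_ j) by rewrite addrC.
have ci n : continuous (fun x : R3 R => f (n.+1%:R^-1 *: e_ j + x)).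
  move=> x; rewrite (_ : (fun x => _) = fun x : R3 R => f (1 *: x + n.+1%:R^-1 *: e_ j)).
    exact: cont_affine.
  by apply/funext => y; rewrite scale1r addrC.
have n1 n : `|n.+1%:R^-1 : R| <= 1 by rewrite ger0_norm ?invr_ge0// invf_le1 ?ler1n// ltr0n.
have nn n : `|n.+1%:R^-1 *: e_ j| <= 1 by rewrite normrZ norm_axis mulr1 n1.
have [] := @Int_cvg R q (df j) ((fun=> C) \_ (box (r + 1))).
- by move=> n; apply: contM; [exact: cont_cst|apply: contB].
- exact: (@intg_restrict _ (r + 1) _ (@cont_cst C)).
- move=> n x; rewrite box_restrict /q; case: (leP `|x| (r + 1)) => xr.
    rewrite normrM ger0_norm//.
    have := C1_lip hC hb (x := x) (t := n.+1%:R^-1).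
    rewrite [`|n.+1%:R^-1|]ger0_norm ?invr_ge0// => /(_ _ _) h.
    rewrite -ler_pdivlMl ?ltr0n// mulrC; apply: h.
      by apply: le_trans xr _; lra.
    by apply: le_trans (ler_normD _ _) _; have := nn n; lra.
  rewrite !fr ?subrr ?mulr0 ?normr0//; first by lra.
  have := lerB_normD x (n.+1%:R^-1 *: e_ j); rewrite [x + _]addrC.
  by have := nn n; lra.
- by move=> x; exact: cvg_diffquot.
move=> h _; have q0 n : Int (q n) = 0.
  have [ti te] := Int_translate (n.+1%:R^-1 *: e_ j) fi.
  rewrite (@eq_Int _ _ (fun x => n.+1%:R * (f (x + n.+1%:R^-1 *: e_ j) - f x))).
    by rewrite IntZ ?IntB ?te ?subrr ?mulr0//; exact: intgB.
  by move=> x; rewrite /q tE.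
have : (Int (q n) @[n --> \oo] --> (0 : R)) by under eq_fun do rewrite q0; exact: cvg_cst.
by move=> /(cvg_unique _ h) ->.
Qed.

Lemma C1D f g df dg : C1 f df -> C1 g dg -> C1 (fun x => f x + g x) (fun j x => df j x + dg j x).
Proof. by move=> [c1 c2 c3] [d1 d2 d3]; split => [|j|j x]; [exact: contD|exact: contD|exact: derD]. Qed.
Lemma C1B f g df dg : C1 f df -> C1 g dg -> C1 (fun x => f x - g x) (fun j x => df j x - dg j x).
Proof. by move=> [c1 c2 c3] [d1 d2 d3]; split => [|j|j x]; [exact: contB|exact: contB|exact: derB]. Qed.
Lemma C1N f df : C1 f df -> C1 (fun x => - f x) (fun j x => - df j x).
Proof. by move=> [c1 c2 c3]; split => [|j|j x]; [exact: contN|exact: contN|exact: derN]. Qed.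
Lemma C1M f g df dg : C1 f df -> C1 g dg -> C1 (fun x => f x * g x) (fun j x => df j x * g x + f x * dg j x).
Proof.
by move=> [c1 c2 c3] [d1 d2 d3]; split => [|j|j x]; [exact: contM|apply: contD; exact: contM|exact: derM].
Qed.
Lemma C1_cst (k : R) : C1 (fun=> k) (fun _ _ => 0).
Proof. by split => [|j|j x]; [exact: cont_cst|exact: cont_cst|exact: der_cst]. Qed.
Lemma C1Z f df k : C1 f df -> C1 (fun x => k * f x) (fun j x => k * df j x).
Proof.
by move=> [c1 c2 c3]; split => [|j|j x]; [apply: contM => //; exact: cont_cst|apply: contM => //; exact: cont_cst|exact: derZ].
Qed.
Lemma C1_coord i : C1 (fun x => coord3 x i) (fun j _ => (i == j)%:R).
Proof.
split => [|j|j x]; [exact: cont_coord|exact: cont_cst|].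
by rewrite eq_sym -coord_axis; apply: der_linear => t y; exact: coordZD.
Qed.
Lemma C1_comp f df (h h' : R -> R) : C1 f df -> (forall x, is_derive (f x) 1 h (h' (f x))) ->
  continuous h -> continuous (fun x => h' (f x)) -> C1 (fun x => h (f x)) (fun j x => h' (f x) * df j x).
Proof.
move=> [c1 c2 c3] hh ch ch'; split => [|j|j x]; [exact: cont_comp|exact: contM|].
exact: (der_comp (c3 j x) (hh x)).
Qed.
Lemma C1_ext f g df dg : (forall x, f x = g x) -> (forall j x, df j x = dg j x) -> C1 f df -> C1 g dg.
Proof.
by move=> /funext -> h; have -> : df = dg by apply/funext => j; apply/funext => x; exact: h.
Qed.

Lemma enorm2E x : enorm2 x = x.1.1 ^+ 2 + x.1.2 ^+ 2 + x.2 ^+ 2.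
Proof. by rewrite /enorm2 /dot !big_ord_recl big_ord0 /coord3 /= /tnth /=; ring. Qed.

Lemma C1_enorm2 : C1 (@enorm2 R) (fun j x => 2 * coord3 x j).
Proof.
have h i := C1M (C1_coord i) (C1_coord i).
have := C1D (h ord0) (C1D (h (lift ord0 ord0)) (h (lift ord0 (lift ord0 ord0)))).
apply: C1_ext => [x|j x]; first by rewrite /enorm2 /dot !big_ord_recl big_ord0 addr0.
by case: j => -[|[|[|]]] //= i; rewrite !(mul0r, mulr0, mul1r, mulr1, addr0, add0r) mulrDl mul1r; congr (_ + _); congr coord3; apply: val_inj.
Qed.

Lemma ibp f g df dg j : C1 f df -> C1 g dg -> (Cc f \/ Cc g) ->
  Int (fun x => f x * dg j x) = - Int (fun x => df j x * g x).
Proof.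
move=> hf hg hc; have [cf cdf _] := hf; have [cg cdg _] := hg.
have h := C1M hf hg.
have ccfg : Cc (fun x => f x * g x).
  split; first exact: contM.
  by case: hc => -[_ [r hr]]; exists r => x /hr ->; rewrite ?mul0r ?mulr0.
have ccl : Cc (fun x => df j x * g x).
  split; first exact: contM.
  case: hc => -[_ [r hr]]; exists r => x xr; last by rewrite hr ?mulr0.
  by rewrite (C1_vanish hf hr) ?mul0r.
have ccr : Cc (fun x => f x * dg j x).
  split; first exact: contM.
  case: hc => -[_ [r hr]]; exists r => x xr; first by rewrite hr ?mul0r.
  by rewrite (C1_vanish hg hr) ?mulr0.
have := Int_deriv0 j h ccfg.
by rewrite IntD; [move/eqP; rewrite addrC addr_eq0 => /eqP|exact: Cc_intg|exact: Cc_intg].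
Qed.
End Calculus.

(** * A truncated Newton kernel *)

Section NewtonKernel.
Context {R : realType}.
Implicit Types (s t : R).

Lemma glue_derive (a : R) (g h g' h' : R -> R) :
  (forall s, s <= a -> is_derive s 1 g (g' s)) -> (forall s, a <= s -> is_derive s 1 h (h' s)) ->
  g a = h a -> g' a = h' a ->
  forall s, is_derive s 1 (fun s => if s <= a then g s else h s) (if s <= a then g' s else h' s).
Proof.
move=> hg hh ga ga' s; have [sa|sa|->] := ltgtP s a.
- apply: near_eq_is_derive (hg s (ltW sa)); near=> y.
  by rewrite ifT// ltW//; near: y; exact: lt_nbhsl.
- apply: near_eq_is_derive (hh s (ltW sa)); near=> y.
  by rewrite ifF//; apply/negbTE; rewrite -ltNge; near: y; exact: lt_nbhsr.
set f := fun s => _.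
have [[/cvg_ex [l1 h1] E1] [/cvg_ex[l2 h2] E2]] := (hg a (lexx a), hh a (lexx a)).
have {}E1 : l1 = g' a by rewrite -E1; apply/esym/cvg_lim.
have {}E2 : l2 = g' a by rewrite ga' -E2; apply/esym/cvg_lim.
have H : h0^-1 *: ((f \o shift a) (h0 *: (1 : R)) - f a) @[h0 --> 0^'] --> g' a.
  apply/cvgrPdist_lt => e e0.
  move/cvgrPdist_lt : h1 => /(_ e e0) h1; move/cvgrPdist_lt : h2 => /(_ e e0) h2.
  near=> t; rewrite /f /= lexx.
  case: (leP (t *: (1 : R) + a) a) => ta; first by rewrite -E1; near: t; exact: h1.
  by rewrite ga -E2; near: t; exact: h2.
split; first by apply/cvg_ex; exists (g' a).
exact: cvg_lim.
Unshelve. all: by end_near. Qed.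

Lemma derive_continuous (h h' : R -> R) : (forall s, is_derive s 1 h (h' s)) -> continuous h.
Proof. by move=> hh s; apply: differentiable_continuous; apply/derivable1_diffP; case: (hh s). Qed.

Lemma glue_continuous (a : R) (g h : R -> R) : continuous g -> (forall s, a <= s -> {for s, continuous h}) ->
  g a = h a -> continuous (fun s => if s <= a then g s else h s).
Proof.
move=> cg ch ga s; apply/cvgrPdist_lt => e e0.
have [sa|sa|sa] := ltgtP s a.
- move/cvgrPdist_lt : (cg s) => /(_ e e0) hg; near=> y.
  rewrite ifT; first by near: y.
  by rewrite ltW//; near: y; exact: lt_nbhsl.
- have /cvgrPdist_lt/(_ e e0) hg : h x @[x --> s] --> h s by exact: ch (ltW sa).
  near=> y.
  rewrite ifF; first by near: y.
  by apply/negbTE; rewrite -ltNge; near: y; exact: lt_nbhsr.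
move/cvgrPdist_lt : (cg s) => /(_ e e0); rewrite sa => hg.
have /cvgrPdist_lt/(_ e e0) hh : h x @[x --> a] --> h a by exact: ch (lexx a).
near=> y; case: (leP y a) => ya; first by near: y.
by rewrite ga; near: y; exact: hh.
Unshelve. all: by end_near. Qed.

(** The squared positive part: the [C^1] brick of the density [nbump] and of the cutoff [step]. *)
Definition sqp s : R := if s <= 0 then 0 else s ^+ 2.
Definition sqp' s : R := if s <= 0 then 0 else 2 * s.

Lemma sqp_derive s : is_derive s 1 sqp (sqp' s).
Proof.
have h1 t : is_derive t (1 : R) (fun s : R => s ^+ 2) (2 * t).
  apply: (@is_derive_eq _ _ _ _ _ _ _ _ (derX 1 (is_derive_id t 1))).
  by rewrite expr1 mulr1.
have e1 : 0 = 0 ^+ 2 :> R by rewrite expr0n.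
have e2 : 0 = 2 * 0 :> R by rewrite mulr0.
exact: (@glue_derive 0 (fun=> 0) (fun s => s ^+ 2) (fun=> 0) (fun s => 2 * s) (fun t _ => is_derive_cst _ _ _) (fun t _ => h1 t) e1 e2 s).
Qed.

Lemma sqp'_continuous : continuous sqp'.
Proof.
apply: glue_continuous; [by move=> t; exact: cvg_cst| |by rewrite mulr0].
by move=> t _; apply: cvgM; [exact: cvg_cst|exact: cvg_id].
Qed.
Lemma sqp_ge0 s : 0 <= sqp s.
Proof. by rewrite /sqp; case: ifP => // _; exact: sqr_ge0. Qed.

Lemma sqrt_pow_derive (k : nat) s : 0 < s ->
  is_derive s 1 (fun s => Num.sqrt s ^- k.+1) (- (k.+1%:R / 2) * Num.sqrt s ^- k.+3).
Proof.
move=> s0; have r0 : Num.sqrt s != 0 by rewrite gt_eqF// sqrtr_gt0.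
have h := is_deriveV _ (derX k (is_derive1_sqrt s0)).
have rk : Num.sqrt s ^+ k.+1 != 0 by rewrite expf_neq0.
apply: (der_eq (h rk)).
rewrite !exprS /GRing.scale /=; set a := Num.sqrt s ^+ k.
have a0 : a != 0 by rewrite expf_neq0.
by field; rewrite a0 r0.
Qed.

(* The C^3 modification of the Newton kernel [s |-> s^(-1/2)], [s = |x|^2],
   by its third order Taylor polynomial at 1; [newt1], [newt2], [newt3] are its
   derivatives in [s]. *)
Definition newt0 s : R :=
  if s <= 1 then 1 - 2^-1 * (s - 1) + 3 / 8 * (s - 1) ^+ 2 - 5 / 16 * (s - 1) ^+ 3 else Num.sqrt s ^- 1.
Definition newt1 s : R :=
  if s <= 1 then - 2^-1 + 3 / 4 * (s - 1) - 15 / 16 * (s - 1) ^+ 2 else - (1 / 2) * Num.sqrt s ^- 3.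
Definition newt2 s : R :=
  if s <= 1 then 3 / 4 - 15 / 8 * (s - 1) else - (1 / 2) * (- (3 / 2) * Num.sqrt s ^- 5).
Definition newt3 s : R :=
  if s <= 1 then - (15 / 8) else - (1 / 2) * (- (3 / 2) * (- (5 / 2) * Num.sqrt s ^- 7)).

Let d1 s : is_derive s (1 : R) (fun s => s - 1) (1 : R).
Proof. by apply: (der_eq (derB (is_derive_id s (1:R)) (der_cst s 1 1))); rewrite subr0. Qed.

Lemma newt0_derive s : is_derive s 1 newt0 (newt1 s).
Proof.
apply: (@glue_derive 1 (fun s => 1 - 2^-1 * (s - 1) + 3 / 8 * (s - 1) ^+ 2 - 5 / 16 * (s - 1) ^+ 3)
  (fun s => Num.sqrt s ^- 1) (fun s => - 2^-1 + 3 / 4 * (s - 1) - 15 / 16 * (s - 1) ^+ 2)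
  (fun s => - (1 / 2) * Num.sqrt s ^- 3)).
- move=> t _; apply: (der_eq (derB (derD (derB (der_cst _ _ _) (derZ _ (d1 t))) (derZ _ (derX 1 (d1 t)))) (derZ _ (derX 2 (d1 t))))).
  by rewrite !expr1; field.
- by move=> t t1; apply: sqrt_pow_derive; exact: lt_le_trans t1.
- by rewrite sqrtr1 subrr expr1n invr1 !(expr0n, mulr0) /=; lra.
- by rewrite sqrtr1 subrr expr1n invr1 !(expr0n, mulr0) /=; lra.
Qed.

Lemma newt1_derive s : is_derive s 1 newt1 (newt2 s).
Proof.
apply: (@glue_derive 1 (fun s => - 2^-1 + 3 / 4 * (s - 1) - 15 / 16 * (s - 1) ^+ 2)
  (fun s => - (1 / 2) * Num.sqrt s ^- 3) (fun s => 3 / 4 - 15 / 8 * (s - 1))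
  (fun s => - (1 / 2) * (- (3 / 2) * Num.sqrt s ^- 5))).
- move=> t _; apply: (der_eq (derB (derD (der_cst _ _ _) (derZ _ (d1 t))) (derZ _ (derX 1 (d1 t))))).
  by rewrite !expr1; field.
- by move=> t t1; apply: derZ; apply: sqrt_pow_derive; exact: lt_le_trans t1.
- by rewrite sqrtr1 subrr expr1n invr1 !(expr0n, mulr0) /=; lra.
- by rewrite sqrtr1 subrr expr1n invr1 !(expr0n, mulr0) /=; lra.
Qed.

Lemma newt2_derive s : is_derive s 1 newt2 (newt3 s).
Proof.
apply: (@glue_derive 1 (fun s => 3 / 4 - 15 / 8 * (s - 1))
  (fun s => - (1 / 2) * (- (3 / 2) * Num.sqrt s ^- 5)) (fun s => - (15 / 8))
  (fun s => - (1 / 2) * (- (3 / 2) * (- (5 / 2) * Num.sqrt s ^- 7)))).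
- move=> t _; apply: (der_eq (derB (der_cst _ _ _) (derZ _ (d1 t)))).
  by rewrite mulr1 sub0r.
- by move=> t t1; apply: derZ; apply: derZ; apply: sqrt_pow_derive; exact: lt_le_trans t1.
- by rewrite sqrtr1 subrr expr1n invr1 !(expr0n, mulr0) /=; lra.
- by rewrite sqrtr1 expr1n invr1; lra.
Qed.

Lemma newt3_continuous : continuous newt3.
Proof.
apply: glue_continuous; first by move=> t; exact: cvg_cst.
- move=> s s1; have s0 : 0 < s by apply: lt_le_trans s1.
  apply: differentiable_continuous; apply/derivable1_diffP.
  by have [] := derZ (- (1 / 2)) (derZ (- (3 / 2)) (derZ (- (5 / 2)) (sqrt_pow_derive 6 s0))).
- by rewrite sqrtr1 expr1n invr1; lra.
Qed.

Definition nbump s : R := 105 / 8 * sqp (1 - s).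

(** In dimension three the Laplacian of [p (|x|^2)] is [6 p' + 4 s p'']. It vanishes for [1/|x|],
    and inside the unit ball the Taylor polynomial leaves exactly [105/8 (1 - s)^2]. *)
Lemma newt_laplacian s : 0 <= s -> - (6 * newt1 s + 4 * s * newt2 s) = nbump s.
Proof.
rewrite /newt1 /newt2 /nbump /sqp subr_le0 => s0; case: (leP s 1) => s1.
  case: (leP 1 s) => s1'; last by field.
  have -> : s = 1 by apply/eqP; rewrite eq_le s1 s1'.
  by field.
rewrite ltW//; have r0 : Num.sqrt s != 0 by rewrite gt_eqF// sqrtr_gt0; lra.
by rewrite -[X in 4 * X](sqr_sqrtr s0); field.
Qed.

Lemma sqrtVn_le1 (k : nat) s : 1 <= s -> 0 < Num.sqrt s ^- k <= 1.
Proof.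
move=> s1; have r1 : 1 <= Num.sqrt s by rewrite -sqrtr1 ler_sqrt//; lra.
rewrite invr_gt0 exprn_gt0 ?(lt_le_trans ltr01)//= invf_le1 ?exprn_gt0 ?(lt_le_trans ltr01)//.
exact: exprn_ege1.
Qed.

Lemma newt0_bound s : 0 <= s -> 0 <= newt0 s <= 35 / 16.
Proof.
rewrite /newt0 => s0; case: (leP s 1) => s1; last by have := sqrtVn_le1 1 (ltW s1); lra.
have t0 : 0 <= 1 - s <= 1 by lra.
have -> : 1 - 2^-1 * (s - 1) + 3 / 8 * (s - 1) ^+ 2 - 5 / 16 * (s - 1) ^+ 3 =
  1 + 2^-1 * (1 - s) + 3 / 8 * (1 - s) ^+ 2 + 5 / 16 * (1 - s) ^+ 3 by ring.
move: t0 => /andP[t0 t1]; have h2 : 0 <= (1 - s) ^+ 2 <= 1 by rewrite exprn_ge0// exprn_ile1.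
have h3 : 0 <= (1 - s) ^+ 3 <= 1 by rewrite exprn_ge0// exprn_ile1.
lra.
Qed.

Lemma newt1_bound s : 0 <= s -> `|newt1 s| <= 35 / 16.
Proof.
rewrite /newt1 ler_norml => s0; case: (leP s 1) => s1; last by have := sqrtVn_le1 3 (ltW s1); lra.
have h2 : 0 <= (s - 1) ^+ 2 <= 1 by rewrite -sqrrN opprB exprn_ge0 ?exprn_ile1//; lra.
lra.
Qed.

(* [16 - 35 r + 35 r^3 - 21 r^5 + 5 r^7 = (1 - r)^4 (16 + 29 r + 20 r^2 + 5 r^3)] *)
Lemma newt0_le s : 0 < s -> newt0 s <= Num.sqrt s ^- 1.
Proof.
rewrite /newt0 => s0; case: (leP s 1) => s1 //.
have r0 : 0 < Num.sqrt s by rewrite sqrtr_gt0.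
rewrite -{1 2 3}(sqr_sqrtr (ltW s0)) expr1; set r := Num.sqrt s in r0 *.
rewrite -subr_ge0.
have -> : r^-1 - (1 - 2^-1 * (r ^+ 2 - 1) + 3 / 8 * (r ^+ 2 - 1) ^+ 2 - 5 / 16 * (r ^+ 2 - 1) ^+ 3) =
  (1 - r) ^+ 4 * (16 + 29 * r + 20 * r ^+ 2 + 5 * r ^+ 3) / (16 * r).
  by field; rewrite gt_eqF.
have r2 : 0 <= r ^+ 2 by exact: sqr_ge0.
have r3 : 0 <= r ^+ 3 by rewrite exprn_ge0// ltW.
apply: divr_ge0; last by rewrite mulr_ge0// ltW.
by apply: mulr_ge0; [exact: exprn_even_ge0|lra].
Qed.
End NewtonKernel.

(** * Weak solutions and potential estimates *)

Definition o0 : 'I_3 := @Ordinal 3 0 isT.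
Definition o1 : 'I_3 := @Ordinal 3 1 isT.
Definition o2 : 'I_3 := @Ordinal 3 2 isT.

Lemma sum3 (R : realType) (F : 'I_3 -> R) : \sum_j F j = F o0 + F o1 + F o2.
Proof.
rewrite !big_ord_recl big_ord0 addr0 addrA.
by congr (F _ + F _ + F _); apply: val_inj.
Qed.

Ltac cont := lazymatch goal with
 | |- continuous (fun x => @?f x - @?g x) => refine (@contB _ f g _ _); cont
 | |- continuous (fun x => @?f x + @?g x) => refine (@contD _ f g _ _); cont
 | |- continuous (fun x => @?f x * @?g x) => refine (@contM _ f g _ _); cont
 | |- continuous (fun x => - @?f x) => refine (@contN _ f _); cont
 | |- continuous (fun x => @?f x ^+ ?n) => refine (@contX _ f n _); cont
 | |- continuous (fun x => `|@?f x|) => refine (@cont_norm _ f _); cont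
 | |- continuous (fun x => coord3 x ?j) => exact: cont_coord
 | |- continuous (fun x => x.1.1) => exact: continuous_c1
 | |- continuous (fun x => x.1.2) => exact: continuous_c2
 | |- continuous (fun x => x.2) => exact: continuous_c3
 | |- continuous (fun x => \sum_j _) => apply: cont_sum => ?; cont
 | |- continuous (fun _ => ?k) => first [exact: cont_cst | fail 1]
 | |- _ => first [assumption | match goal with H : forall _, continuous _ |- _ => exact: H end | idtac]
 end.

Section WeakSolutions.
Context {R : realType}.
Implicit Types (f g u v Phi : R3 R -> R) (du dv dPhi : 'I_3 -> R3 R -> R) (x : R3 R).

Definition gdot du dv x := \sum_j du j x * dv j x.
Definition rotd du x := x.1.1 * du o1 x - x.1.2 * du o0 x.

(* [(-Delta + 2 i A . grad) (u + i v) = f + i g] in weak form, with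
   [A x = ka (- x_2, x_1, 0)], so that [A . grad = ka rotd]. *)
Definition sol (ka : R) u v f g du dv :=
  [/\ C1 u du, C1 v dv, continuous f, continuous g &
   forall Phi dPhi, C1 Phi dPhi -> Cc Phi ->
     Int (fun x => gdot du dPhi x + 2 * ka * (v x * rotd dPhi x)) = Int (fun x => f x * Phi x) /\
     Int (fun x => gdot dv dPhi x - 2 * ka * (u x * rotd dPhi x)) = Int (fun x => g x * Phi x)].

(** Multiplication by [- i]. Through it every estimate proved for the real part passes to the
    imaginary part. *)
Lemma sol_sym ka u v f g du dv : sol ka u v f g du dv ->
  sol ka v (fun x => - u x) g (fun x => - f x) dv (fun j x => - du j x).
Proof.
move=> [c1 c2 cf cg h]; split => //; [exact: C1N|cont|].
move=> Phi dPhi hP cP; have [h1 h2] := h _ _ hP cP; split.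
  by rewrite -h2; apply: eq_Int => x; rewrite mulNr mulrN.
have ccm (k : R3 R -> R) : continuous k -> intg (fun x => k x * Phi x).
  move=> ck; apply: Cc_intg; split; first by apply: contM => //; case: cP.
  by have [_ [r hr]] := cP; exists r => x /hr ->; rewrite mulr0.
have -> : Int (fun x => - f x * Phi x) = - Int (fun x => f x * Phi x).
  by rewrite -IntN; [apply: eq_Int => x; rewrite mulNr|exact: ccm].
rewrite -h1 -IntN.
  by apply: eq_Int => x; rewrite /gdot !sum3; ring.
have [_ [r hr]] := cP; have [cPhi cdPhi _] := hP; have [cu cdu _] := c1; have [cv _ _] := c2.
apply: Cc_intg; split; first by rewrite /gdot /rotd; cont.
by exists r => x xr; rewrite /gdot /rotd sum3 !(C1_vanish hP hr _ xr) !(mulr0, addr0, subr0).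
Qed.

Lemma enorm2_ge0 x : 0 <= enorm2 x.
Proof. by rewrite enorm2E !addr_ge0 ?sqr_ge0. Qed.

Lemma sqr_norm_le_enorm2 x : `|x| ^+ 2 <= enorm2 x.
Proof.
have h := enorm2_ge0 x; rewrite -[leRHS](sqr_sqrtr h) ler_sqr ?nnegrE ?sqrtr_ge0//.
apply: sup_ge0_coord => j; rewrite -sqrtr_sqr ler_wsqrtr// /enorm2 /dot.
rewrite (bigD1 j)//= expr2 lerDl; apply: sumr_ge0 => i _; rewrite -expr2; exact: sqr_ge0.
Qed.

Lemma enorm2_le x : enorm2 x <= 3 * `|x| ^+ 2.
Proof.
rewrite /enorm2 /dot sum3; have h j : coord3 x j * coord3 x j <= `|x| ^+ 2.
  by rewrite -expr2 -real_normK ?num_real// ler_sqr ?nnegrE// le_coord.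
by have := h o0; have := h o1; have := h o2; lra.
Qed.

Lemma enorm2_gt r x : 0 <= r -> r < `|x| -> r ^+ 2 < enorm2 x.
Proof. by move=> r0 xr; apply: lt_le_trans (sqr_norm_le_enorm2 x); rewrite ltr_sqr ?nnegrE. Qed.

Lemma cont_enorm2 : continuous (@enorm2 R).
Proof. by have [] := @C1_enorm2 R. Qed.

Section Radial.
Variables (p p1 : R -> R).
Hypothesis dp : forall s, is_derive (s : R) (1 : R) p (p1 s).
Hypothesis cp1 : continuous p1.

Lemma C1_radial : C1 (fun x => p (enorm2 x)) (fun j x => 2 * (coord3 x j * p1 (enorm2 x))).
Proof.
apply: C1_ext (C1_comp C1_enorm2 (fun x => dp _) (derive_continuous dp) (cont_comp cont_enorm2 cp1)) => // j x.
by ring.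
Qed.

Lemma C1_radial_coord j : C1 (fun x => coord3 x j * p (enorm2 x))
  (fun i x => (j == i)%:R * p (enorm2 x) + 2 * (coord3 x i * coord3 x j * p1 (enorm2 x))).
Proof.
apply: C1_ext (C1M (C1_coord j) C1_radial) => // i x; ring.
Qed.
End Radial.

Lemma rotd_radial (q : R3 R -> R) x : rotd (fun j x => 2 * (coord3 x j * q x)) x = 0.
Proof. by rewrite /rotd /coord3 /tnth /=; ring. Qed.

Lemma Cc_mul f k r : continuous f -> continuous k -> vanish r k -> Cc (fun x => f x * k x).
Proof. by move=> cf ck hr; split; [exact: contM|exists r => x /hr ->; rewrite mulr0]. Qed.

Lemma intg_mul f k r : continuous f -> continuous k -> vanish r k -> intg (fun x => f x * k x).
Proof. by move=> cf ck hr; apply: Cc_intg; exact: Cc_mul hr. Qed.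

Lemma Int_gdot u du Phi dPhi ddPhi r : C1 u du -> C1 Phi dPhi -> vanish r Phi ->
  (forall j, C1 (dPhi j) (ddPhi j)) ->
  Int (gdot du dPhi) = - Int (fun x => u x * \sum_j ddPhi j j x).
Proof.
move=> hu hP hr hd; have [cu cdu _] := hu; have [cP cdP _] := hP.
have vj j := C1_vanish hP hr j.
have cdd j i : continuous (ddPhi j i) by have [] := hd j.
have vjj j i : vanish r (ddPhi j i) by exact: C1_vanish (hd j) (vj j) i.
have i1 j : intg (fun x => du j x * dPhi j x) by exact: intg_mul (vj j).
have i2 j : intg (fun x => u x * ddPhi j j x) by exact: intg_mul (vjj j j).
have E j : Int (fun x => du j x * dPhi j x) = - Int (fun x => u x * ddPhi j j x).
  rewrite (ibp _ hu (hd j)) ?opprK//; right; split => //; exists r; exact: vj.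
rewrite (@eq_Int _ _ (fun x => du o0 x * dPhi o0 x + du o1 x * dPhi o1 x + du o2 x * dPhi o2 x)); last first.
  by move=> x; rewrite /gdot sum3.
rewrite !IntD//; last exact: intgD.
rewrite [in RHS](@eq_Int _ _ (fun x => u x * ddPhi o0 o0 x + u x * ddPhi o1 o1 x + u x * ddPhi o2 o2 x)); last first.
  by move=> x; rewrite sum3; ring.
by rewrite !IntD// ?E; [ring|exact: intgD].
Qed.

(** A radial test function is constant along rotations, so the magnetic term drops out. This favours
    the origin, and is the reason for the gauge change at other points. *)
Lemma sol_radial ka u v f g du dv (p p1 p2 p3 : R -> R) (r : R) : sol ka u v f g du dv ->
  (forall s, is_derive (s : R) (1 : R) p (p1 s)) -> (forall s, is_derive (s : R) (1 : R) p1 (p2 s)) -> (forall s, is_derive (s : R) (1 : R) p2 (p3 s)) ->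
  0 <= r -> (forall s, r ^+ 2 < s -> p s = 0) ->
  Int (fun x => u x * - (6 * p1 (enorm2 x) + 4 * enorm2 x * p2 (enorm2 x))) = Int (fun x => f x * p (enorm2 x)).
Proof.
move=> [hu hv cf cg h] dp dp1 dp2 r0 pr.
have cp2 := derive_continuous dp2.
have cp1 := derive_continuous dp1.
have hP := C1_radial dp cp1.
have vr : vanish r (fun x => p (enorm2 x)) by move=> x xr; apply: pr; exact: enorm2_gt.
have ccP : Cc (fun x => p (enorm2 x)) by split; [have [] := hP|exists r].
have [<- _] := h _ _ hP ccP.
rewrite [RHS](@eq_Int _ _ (gdot du (fun j x => 2 * (coord3 x j * p1 (enorm2 x))))); last first.
  by move=> x; rewrite rotd_radial !mulr0 addr0.
have hd j := C1Z 2 (C1_radial_coord dp1 cp2 j).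
rewrite (Int_gdot hu hP vr hd) -IntN; last first.
  have cdd j i : continuous (fun x => 2 * ((j == i)%:R * p1 (enorm2 x) + 2 * (coord3 x i * coord3 x j * p2 (enorm2 x)))) by have [] := hd j.
  apply: (@intg_mul u _ r); [by case: hu|apply: cont_sum => j; exact: cdd|].
  move=> x xr; rewrite big1// => j _; exact: (C1_vanish (hd j) (C1_vanish hP vr j) j xr).
apply: eq_Int => x; rewrite sum3 !eqxx !mul1r.
have -> : enorm2 x = coord3 x o0 * coord3 x o0 + coord3 x o1 * coord3 x o1 + coord3 x o2 * coord3 x o2.
  by rewrite /enorm2 /dot sum3.
ring.
Qed.

(* [- Delta (x_j p (|x|^2)) = - x_j (10 p' + 4 |x|^2 p'')] *)
Lemma sol_radial_coord ka u v f g du dv j (p p1 p2 : R -> R) (r : R) : sol ka u v f g du dv ->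
  (forall s, is_derive (s : R) (1 : R) p (p1 s)) -> (forall s, is_derive (s : R) (1 : R) p1 (p2 s)) -> continuous p2 ->
  0 <= r -> (forall s, r ^+ 2 < s -> p s = 0) ->
  Int (fun x => u x * - (coord3 x j * (10 * p1 (enorm2 x) + 4 * enorm2 x * p2 (enorm2 x)))) =
  Int (fun x => f x * (coord3 x j * p (enorm2 x)))
  - 2 * ka * Int (fun x => v x * (((j == o1)%:R * x.1.1 - (j == o0)%:R * x.1.2) * p (enorm2 x))).
Proof.
move=> [hu hv cf cg h] dp dp1 cp2 r0 pr.
have cp1 := derive_continuous dp1; have cp := derive_continuous dp.
pose dP (i : 'I_3) (x : R3 R) : R := (j == i)%:R * p (enorm2 x) + 2 * (coord3 x i * coord3 x j * p1 (enorm2 x)).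
have hP : C1 (fun x => coord3 x j * p (enorm2 x)) dP := C1_radial_coord dp cp1 j.
have pv x : r < `|x| -> p (enorm2 x) = 0 by move=> xr; apply: pr; exact: enorm2_gt.
have vr : vanish r (fun x => coord3 x j * p (enorm2 x)) by move=> x /pv ->; rewrite mulr0.
have ccP : Cc (fun x => coord3 x j * p (enorm2 x)) by split; [have [] := hP|exists r].
have [<- _] := h _ _ hP ccP.
have [cu cdu _] := hu; have [cv _ _] := hv; have [cP cdP _] := hP.
have cpe := cont_comp cont_enorm2 cp.
pose dd i k x : R := (j == i)%:R * (2 * (coord3 x k * p1 (enorm2 x))) + 2 * (((i == k)%:R * (coord3 x j * p1 (enorm2 x)))
   + coord3 x i * ((j == k)%:R * p1 (enorm2 x) + 2 * (coord3 x k * coord3 x j * p2 (enorm2 x)))).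
have hd i : C1 (dP i) (dd i).
  have := C1D (C1Z (j == i)%:R (C1_radial dp cp1)) (C1Z 2 (C1M (C1_coord i) (C1_radial_coord dp1 cp2 j))).
  by apply: C1_ext => [x|k x]; rewrite ?/dd ?/dP; ring.
have crot : continuous (fun x : R3 R => ((j == o1)%:R * x.1.1 - (j == o0)%:R * x.1.2) * p (enorm2 x)) by cont.
have vrot : vanish r (fun x : R3 R => ((j == o1)%:R * x.1.1 - (j == o0)%:R * x.1.2) * p (enorm2 x)).
  by move=> x /pv ->; rewrite mulr0.
rewrite [in X in _ = X - _](@eq_Int _ _ (fun x => gdot du dP x + 2 * ka * (v x * (((j == o1)%:R * x.1.1 - (j == o0)%:R * x.1.2) * p (enorm2 x))))); last first.
  by move=> x; congr (_ + _ * (_ * _)); rewrite /rotd /dP /coord3 /tnth /=; ring.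
have irot := intg_mul cv crot vrot.
have idot : intg (gdot du dP).
  apply: Cc_intg; split; first by rewrite /gdot; apply: cont_sum => i; apply: contM.
  by exists r => x xr; rewrite /gdot big1// => i _; rewrite (C1_vanish hP vr i xr) mulr0.
rewrite IntD//; last exact: intgZ.
rewrite IntZ// addrK (Int_gdot hu hP vr hd) -IntN; last first.
  have cdd i k : continuous (dd i k) by have [] := hd i.
  apply: (@intg_mul u _ r) => //; first by apply: cont_sum => i; exact: cdd.
  move=> x xr; rewrite big1// => i _; exact: (C1_vanish (hd i) (C1_vanish hP vr i) i xr).
apply: eq_Int => x; rewrite mulrN; congr (- (_ * _)).
have hE : enorm2 x = coord3 x o0 * coord3 x o0 + coord3 x o1 * coord3 x o1 + coord3 x o2 * coord3 x o2.
  by rewrite /enorm2 /dot sum3.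
rewrite sum3 /dd !eqxx.
have : [\/ j = o0, j = o1 | j = o2].
  by case: j {hP dP cdP dd hd crot vrot irot idot vr ccP cP} => -[|[|[|]]] // i; [constructor 1|constructor 2|constructor 3]; apply: val_inj.
by case=> ->; rewrite /=; set a := p1 _; set b := p2 _; rewrite hE; ring.
Qed.
End WeakSolutions.

(** * Rescaled kernels and an approximate identity *)

Section ScaledKernel.
Context {R : realType}.
Implicit Types (x : R3 R) (s b : R).

Lemma scale_derive (h h' : R -> R) (a s : R) : (forall t : R, is_derive t (1:R) h (h' t)) ->
  is_derive s (1 : R) (fun s => h (a * s)) (a * h' (a * s)).
Proof.
move=> hh; have ha : is_derive s (1 : R) (fun s => a * s) a.
  by apply: (der_eq (derZ a (is_derive_id s (1:R)))); rewrite mulr1.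
by apply: (der_eq (is_derive1_comp (hh (a * s)) ha)); rewrite mulrC.
Qed.

(** Let [N_b (x) = b newt0 (b^2 |x|^2)], which is [1/|x|] outside radius [1/b]. As a function of
    [s = |x|^2] this is [N_(4b) - N_b]: it is supported in radius [1/b], and its [- Delta] is
    [rho (4 b) - rho b]. *)
Definition ker b s : R := b * (4 * newt0 (16 * b ^+ 2 * s) - newt0 (b ^+ 2 * s)).
Definition ker1 b s : R := b * (4 * (16 * b ^+ 2 * newt1 (16 * b ^+ 2 * s)) - b ^+ 2 * newt1 (b ^+ 2 * s)).
Definition ker2 b s : R :=
  b * (4 * (16 * b ^+ 2 * (16 * b ^+ 2 * newt2 (16 * b ^+ 2 * s))) - b ^+ 2 * (b ^+ 2 * newt2 (b ^+ 2 * s))).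
Definition ker3 b s : R :=
  b * (4 * (16 * b ^+ 2 * (16 * b ^+ 2 * (16 * b ^+ 2 * newt3 (16 * b ^+ 2 * s))))
       - b ^+ 2 * (b ^+ 2 * (b ^+ 2 * newt3 (b ^+ 2 * s)))).

Lemma ker_derive b s : is_derive s (1 : R) (ker b) (ker1 b s).
Proof. exact: derZ (derB (derZ _ (scale_derive _ _ newt0_derive)) (scale_derive _ _ newt0_derive)). Qed.
Lemma ker1_derive b s : is_derive s (1 : R) (ker1 b) (ker2 b s).
Proof. exact: derZ (derB (derZ _ (derZ _ (scale_derive _ _ newt1_derive))) (derZ _ (scale_derive _ _ newt1_derive))). Qed.
Lemma ker2_derive b s : is_derive s (1 : R) (ker2 b) (ker3 b s).
Proof.
exact: derZ (derB (derZ _ (derZ _ (derZ _ (scale_derive _ _ newt2_derive)))) (derZ _ (derZ _ (scale_derive _ _ newt2_derive)))).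
Qed.

Lemma cont1_scale (h : R -> R) (a : R) : continuous h -> continuous (fun s => h (a * s)).
Proof.
by move=> ch s; apply: (@continuous_comp _ _ _ (fun s => a * s) h); [apply: cvgM; [exact: cvg_cst|exact: cvg_id]|exact: ch].
Qed.
Lemma cont1Z (h : R -> R) (a : R) : continuous h -> continuous (fun s => a * h s).
Proof. by move=> ch s; apply: cvgM; [exact: cvg_cst|exact: ch]. Qed.
Lemma ker3_continuous b : continuous (ker3 b).
Proof.
apply: cont1Z => s; apply: cvgB; move: s.
  by do 4 apply: cont1Z; apply: cont1_scale; exact: newt3_continuous.
by do 3 apply: cont1Z; apply: cont1_scale; exact: newt3_continuous.
Qed.

Lemma ker_vanish b s : 0 < b -> b^-1 ^+ 2 < s -> ker b s = 0.
Proof.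
move=> b0 bs; have t1 : 1 < b ^+ 2 * s.
  by rewrite -ltr_pdivrMl ?exprn_gt0// mulr1 -exprVn.
rewrite /ker -mulrA /newt0 !leNgt t1 /= (_ : 1 < 16 * (b ^+ 2 * s)) /=; last by lra.
rewrite (_ : 16 * (b ^+ 2 * s) = 4 ^+ 2 * (b ^+ 2 * s)); last by ring.
rewrite sqrtrM ?sqr_ge0// sqrtr_sqr ger0_norm// !expr1 invfM mulrA divff// mul1r subrr mulr0 //.
Qed.

Lemma ker_ge0 b s : 0 < b -> 0 <= s -> 0 <= ker b s.
Proof.
move=> b0 s0; apply: mulr_ge0; first exact: ltW.
rewrite -mulrA; have : 0 <= b ^+ 2 * s by rewrite mulr_ge0 ?sqr_ge0.
move: (b ^+ 2 * s) => t t0; rewrite subr_ge0.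
(* For [16 t <= 1] the first kernel is at least [4], above the bound [35/16] of the second. Beyond,
   [4 newt0 (16 t)] is exactly [t^(-1/2)], which dominates [newt0 t]. *)
have [t1|t1] := leP t (1 / 16).
  have /andP[_ h] := newt0_bound t0; apply: le_trans h _.
  rewrite /newt0 ifT; last by lra.
  have : 1 <= 1 - 2^-1 * (16 * t - 1) + 3 / 8 * (16 * t - 1) ^+ 2 - 5 / 16 * (16 * t - 1) ^+ 3.
    have h2 : 0 <= (16 * t - 1) ^+ 2 by exact: sqr_ge0.
    have h3 : 0 <= (1 - 16 * t) ^+ 3 by rewrite exprn_ge0//; lra.
    have -> : (16 * t - 1) ^+ 3 = - (1 - 16 * t) ^+ 3 by ring.
    lra.
  lra.
have tp : 0 < t by apply: lt_trans t1; lra.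
apply: le_trans (newt0_le tp) _.
rewrite /newt0; case: (leP (16 * t) 1) => t16; first by lra.
rewrite (_ : 16 * t = 4 ^+ 2 * t); last by ring.
by rewrite sqrtrM ?sqr_ge0// sqrtr_sqr ger0_norm// !expr1 invfM mulrA divff// mul1r lexx.
Qed.

Lemma ker_bound b s : 0 < b -> 0 <= s -> `|ker b s| <= 9 * b.
Proof.
move=> b0 s0; rewrite normrM gtr0_norm// mulrC ler_pM2r// ler_norml.
have h1 : 0 <= 16 * b ^+ 2 * s by rewrite mulr_ge0// mulr_ge0// ?sqr_ge0.
have h2 : 0 <= b ^+ 2 * s by rewrite mulr_ge0 ?sqr_ge0.
by have := newt0_bound h1; have := newt0_bound h2; lra.
Qed.

Lemma ker1_bound b s : 0 < b -> 0 <= s -> `|ker1 b s| <= 143 * b ^+ 3.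
Proof.
move=> b0 s0.
have h1 : 0 <= 16 * b ^+ 2 * s by rewrite mulr_ge0// mulr_ge0// ?sqr_ge0.
have h2 : 0 <= b ^+ 2 * s by rewrite mulr_ge0 ?sqr_ge0.
have -> : ker1 b s = b ^+ 3 * (64 * newt1 (16 * b ^+ 2 * s) - newt1 (b ^+ 2 * s)) by rewrite /ker1; ring.
have b3 : 0 < b ^+ 3 by rewrite exprn_gt0.
rewrite normrM gtr0_norm// mulrC ler_pM2r//.
have := newt1_bound h1; have := newt1_bound h2; rewrite !ler_norml; lra.
Qed.

Definition nbump' s : R := - (105 / 4) * (if 1 - s <= 0 then 0 else 1 - s).

Lemma nbump_derive s : is_derive s (1 : R) nbump (nbump' s).
Proof.
have d1 : is_derive s (1 : R) (fun s => 1 - s) (-1 : R).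
  by apply: (der_eq (derB (der_cst s (1:R) 1) (is_derive_id s (1:R)))); rewrite sub0r.
have h := @is_derive1_comp R sqp (fun s => 1 - s) s _ _ (sqp_derive (1 - s)) d1.
have h2 := derZ (105 / 8) h.
have e : (fun y => 105 / 8 * (sqp \o (fun s => 1 - s)) y) = nbump by [].
rewrite e in h2; apply: (der_eq h2).
by rewrite /sqp' /nbump'; case: ifP => _; lra.
Qed.

Lemma nbump'_continuous : continuous nbump'.
Proof.
have -> : nbump' = fun s => - (105 / 8) * sqp' (1 - s).
  by apply/funext => s; rewrite /nbump' /sqp'; case: ifP => _; lra.
apply: cont1Z => s; apply: (@continuous_comp _ _ _ (fun s : R => 1 - s) sqp'); last exact: sqp'_continuous.
by apply: cvgB; [exact: cvg_cst|exact: cvg_id].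
Qed.

(** The derivative in [s] of [newt_laplacian]; it is the form taken by the Laplacian of
    [x_j p (|x|^2)]. *)
Lemma newt_laplacian' s : 0 <= s -> - (10 * newt2 s + 4 * s * newt3 s) = nbump' s.
Proof.
rewrite /newt2 /newt3 /nbump' subr_le0 => s0; case: (leP s 1) => s1.
  case: (leP 1 s) => s1'; last by field.
  have -> : s = 1 by apply/eqP; rewrite eq_le s1 s1'.
  by field.
rewrite ltW//; have r0 : Num.sqrt s != 0 by rewrite gt_eqF// sqrtr_gt0; lra.
by rewrite -[X in 4 * X](sqr_sqrtr s0); field.
Qed.

Lemma nbump_ge0 s : 0 <= nbump s.
Proof. by rewrite mulr_ge0 ?sqp_ge0//; lra. Qed.
Lemma nbump_bound s : 0 <= s -> nbump s <= 105 / 8.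
Proof.
move=> s0; rewrite /nbump /sqp; case: ifPn => h; first by lra.
rewrite -ltNge in h; have : (1 - s) ^+ 2 <= 1 by rewrite exprn_ile1//; lra.
lra.
Qed.
Lemma nbump_vanish s : 1 < s -> nbump s = 0.
Proof. by move=> s1; rewrite /nbump /sqp ifT ?mulr0//; lra. Qed.
Lemma nbump'_bound s : 0 <= s -> `|nbump' s| <= 105 / 4.
Proof. by move=> s0; rewrite /nbump' ler_norml; case: (leP (1 - s) 0) => h; lra. Qed.

(** Minus the Laplacian of [N_b]: an unnormalized approximate identity as [b] grows. Its integral
    [mass] is [4 pi] for every [b], as befits the kernel [1/|x|]. *)
Definition rho b x : R := b ^+ 3 * nbump (b ^+ 2 * enorm2 x).
Definition mass : R := Int (rho 1).

Lemma C1_rho b : C1 (rho b) (fun j x => 2 * (coord3 x j * (b ^+ 3 * (b ^+ 2 * nbump' (b ^+ 2 * enorm2 x))))).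
Proof.
apply: (C1_radial (p := fun s => b ^+ 3 * nbump (b ^+ 2 * s)) (p1 := fun s => b ^+ 3 * (b ^+ 2 * nbump' (b ^+ 2 * s)))).
  by move=> s; exact: derZ (scale_derive _ _ nbump_derive).
by do 2 apply: cont1Z; apply: cont1_scale; exact: nbump'_continuous.
Qed.
Lemma rho_continuous b : continuous (rho b). Proof. by have [] := C1_rho b. Qed.
Lemma rho_ge0 b x : 0 < b -> 0 <= rho b x.
Proof. by move=> b0; rewrite mulr_ge0 ?nbump_ge0// exprn_ge0// ltW. Qed.
Lemma rho_vanish b : 0 < b -> vanish b^-1 (rho b).
Proof.
move=> b0 x xb; rewrite /rho nbump_vanish ?mulr0//.
have bi : 0 <= b^-1 by rewrite invr_ge0 ltW.
have := enorm2_gt bi xb; rewrite exprVn => h.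
by rewrite -ltr_pdivrMl ?exprn_gt0// mulr1.
Qed.
Lemma rho_intg b : 0 < b -> intg (rho b).
Proof. by move=> b0; apply: Cc_intg; split; [exact: rho_continuous|exists b^-1; exact: rho_vanish]. Qed.

Lemma enorm2Z (a : R) x : enorm2 (a *: x) = a ^+ 2 * enorm2 x.
Proof. by rewrite !enorm2E /= /GRing.scale /=; ring. Qed.

Lemma Int_rho b : 0 < b -> Int (rho b) = mass.
Proof.
move=> b0; have [_] := Int_affine 0 b0 (rho_intg ltr01).
rewrite /mass => h; rewrite -[RHS](mulKf (_ : b^-1 ^+ 3 != 0)) ?expf_neq0 ?invr_eq0 ?gt_eqF// -h.
rewrite -exprVn invrK -IntZ.
  by apply: eq_Int => x; rewrite /rho addr0 enorm2Z !expr1n !mul1r.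
by have [] := Int_affine 0 b0 (rho_intg ltr01).
Qed.

Lemma mass_gt0 : 0 < mass.
Proof.
apply: (@Int_gt0 _ _ 0).
- by split; [exact: rho_continuous|exists 1; have := rho_vanish ltr01; rewrite invr1].
- by move=> x; exact: rho_ge0.
- by rewrite /rho /nbump /sqp enorm2E /= !expr0n /= !addr0 mulr0 subr0 lt_geF//; lra.
Qed.

Lemma near_inv4 (d : R) : 0 < d -> \forall n \near \oo, (4 ^+ n)^-1 < d.
Proof.
move=> d0; have := @cvg_expr R 4^-1 => /(_ _) /cvgrPdist_lt /(_ d d0) h.
have : \forall n \near \oo, `|0 - 4^-1 ^+ n| < d by apply: h; rewrite ger0_norm; lra.
by apply: filterS => n; rewrite sub0r normrN exprVn ger0_norm ?invr_ge0 ?exprn_ge0.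
Qed.

Lemma rho_approx (h : R3 R -> R) (e : R) : continuous h -> 0 < e ->
  \forall n \near \oo, `|Int (fun x => h x * rho (4 ^+ n) x) - mass * h 0| <= mass * e.
Proof.
move=> ch e0; have [d d0 hd] := unif_cont 0 ch e0.
near=> n; have b0 : 0 < 4 ^+ n :> R by rewrite exprn_gt0.
have hi : intg (fun x => h x * rho (4 ^+ n) x) by exact: intg_mul ch (@rho_continuous _) (rho_vanish b0).
have eZ k : mass * k = Int (fun x => k * rho (4 ^+ n) x).
  by rewrite (IntZ k (rho_intg b0)) (Int_rho b0) mulrC.
rewrite !eZ -IntB//; last exact: intgZ (rho_intg b0).
rewrite ler_norml -IntN; last exact: intgZ (rho_intg b0).
have bd : (4 ^+ n)^-1 < d by near: n; exact: near_inv4.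
have key x : `|h x * rho (4 ^+ n) x - h 0 * rho (4 ^+ n) x| <= e * rho (4 ^+ n) x.
  rewrite -mulrBl normrM [`|rho _ _|]ger0_norm ?rho_ge0//.
  have [xb|xb] := leP `|x| (4 ^+ n)^-1; last by rewrite (rho_vanish b0 xb) !mulr0.
  apply: ler_wpM2r; first exact: rho_ge0.
  by rewrite distrC ltW// hd ?normr0// sub0r normrN; exact: le_lt_trans bd.
have i1 := intgB hi (intgZ (h 0) (rho_intg b0)).
have i2 := intgZ e (rho_intg b0).
apply/andP; split; apply: le_Int => //.
- by have := intgZ (-1) i2; under eq_fun do rewrite mulN1r.
- by move=> x; have := key x; rewrite ler_norml => /andP[].
- by move=> x; have := key x; rewrite ler_norml => /andP[].
Unshelve. all: by end_near. Qed.
End ScaledKernel.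

(** * Sup and gradient estimates at the origin *)

Section PotentialEstimate.
Context {R : realType}.
Implicit Types (f g u v : R3 R -> R) (du dv : 'I_3 -> R3 R -> R) (x : R3 R) (s b : R).
Local Notation m := (@mass R).

Lemma geom_bound (a : nat -> R) (D : R) : (forall i, `|a i.+1 - a i| <= D * 2^-1 ^+ i) ->
  forall n, `|a n - a 0%N| <= 2 * D.
Proof.
move=> h n; have D0 : 0 <= D by have := le_trans (normr_ge0 _) (h 0%N); rewrite expr0 mulr1.
have : `|a n - a 0%N| <= D * (2 - 2 * 2^-1 ^+ n).
  elim: n => [|n IH]; first by rewrite subrr normr0 expr0; lra.
  apply: le_trans (ler_distD (a n) _ _) _.
  by have := h n; rewrite exprS; lra.
have : 0 <= D * 2^-1 ^+ n by rewrite mulr_ge0// exprn_ge0.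
lra.
Qed.

(** Testing with [ker b] compares the averages of [u] at two scales. Summing over [b = 4^i] stands
    for the representation of [u 0] by its Newton potential, and no singular integral is ever
    formed. *)
Lemma sol_tele ka u v f g du dv b : 0 < b -> sol ka u v f g du dv ->
  Int (fun x => u x * rho (4 * b) x) - Int (fun x => u x * rho b x) = Int (fun x => f x * ker b (enorm2 x)).
Proof.
move=> b0 h; have b4 : 0 < 4 * b by lra.
have bi : 0 <= b^-1 by rewrite invr_ge0 ltW.
rewrite -(sol_radial h (ker_derive b) (ker1_derive b) (ker2_derive b) bi (fun s => ker_vanish b0)).
have [[cu _ _] _ _ _ _] := h.
have ir c : 0 < c -> intg (fun x => u x * rho c x).
  by move=> c0; exact: intg_mul cu (@rho_continuous _ _) (rho_vanish c0).
rewrite -(IntB (ir _ b4) (ir _ b0)); apply: eq_Int => x; rewrite -mulrBr; congr (_ * _).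
have e0 := enorm2_ge0 x; rewrite /rho.
have h2 : 0 <= b ^+ 2 * enorm2 x by rewrite mulr_ge0// sqr_ge0.
have h1 : 0 <= (4 * b) ^+ 2 * enorm2 x by rewrite mulr_ge0// sqr_ge0.
rewrite -(newt_laplacian h1) -(newt_laplacian h2) /ker1 /ker2.
have -> : (4 * b) ^+ 2 = 16 * b ^+ 2 by ring.
ring.
Qed.

(** Young's inequality on the support of [k], a cube of volume [8 r^3]. The weight [la] stays free
    so that each scale can choose its own. *)
Lemma young_ker f (k : R3 R -> R) (K r la : R) : continuous f -> continuous k -> 0 <= r <= 1 ->
  (forall x, `|k x| <= K) -> vanish r k -> 0 < la ->
  `|Int (fun x => f x * k x)| <= K / 2 * (la * IntBox 1 (fun x => f x ^+ 2) + 8 * r ^+ 3 / la).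
Proof.
move=> cf ck /andP[r0 r1] hK hr la0.
have K0 : 0 <= K by exact: le_trans (hK 0).
have cf2 : continuous (fun x => f x ^+ 2) by cont.
pose G x : R := K / 2 * (la * f x ^+ 2) + K / 2 / la.
have cG : continuous G by rewrite /G; cont.
have key x : `|f x * k x| <= G x.
  apply: le_trans (_ : `|f x| * K <= _); first by rewrite normrM ler_wpM2l.
  have : 0 <= K / 2 * (la * (`|f x| - la^-1) ^+ 2).
    by apply: mulr_ge0; [lra|apply: mulr_ge0; [exact: ltW|exact: sqr_ge0]].
  rewrite /G -[f x ^+ 2]real_normK ?num_real//.
  have -> : K / 2 * (la * (`|f x| - la^-1) ^+ 2) = K / 2 * (la * `|f x| ^+ 2) + K / 2 / la - `|f x| * K.
    by field; rewrite gt_eqF.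
  by rewrite subr_ge0.
have IG : IntBox r G <= K / 2 * (la * IntBox 1 (fun x => f x ^+ 2) + 8 * r ^+ 3 / la).
  rewrite /G IntBoxD; [|by cont|by cont]; rewrite IntBox_cst// IntBoxZ; last by cont.
  rewrite IntBoxZ//.
  have h := @IntBox_mono _ r 1 _ r1 cf2 (fun x => sqr_ge0 _).
  rewrite [leRHS]mulrDr; apply: lerD; last by rewrite le_eqVlt; apply/orP; left; apply/eqP; field; rewrite gt_eqF.
  by apply: ler_wpM2l; [lra|apply: ler_wpM2l; [exact: ltW|]].
apply: le_trans IG; rewrite -(@IntBox_full _ r); last by move=> x /hr ->; rewrite mulr0.
have cfk : continuous (fun x => f x * k x) by cont.
rewrite ler_norml; apply/andP; split; last first.
  by apply: le_IntBox => // x _; have := key x; rewrite ler_norml => /andP[].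
rewrite -mulN1r -IntBoxZ//; apply: le_IntBox => //; first by cont.
by move=> x _; have := key x; rewrite ler_norml mulN1r => /andP[].
Qed.

Lemma Int_rho_cvg_bound (h : R3 R -> R) (B : R) : continuous h ->
  (forall n, `|Int (fun x => h x * rho (4 ^+ n) x)| <= B) -> m * `|h 0| <= B.
Proof.
move=> ch hB; have m0 := @mass_gt0 R; apply/ler_addgt0Pr => e e0.
have e1 : 0 < e / m by rewrite divr_gt0.
have [n hn] := filter_ex (rho_approx ch e1).
have h1 := hB n; have me : m * (e / m) = e by rewrite mulrC divfK ?gt_eqF.
rewrite me in hn.
have -> : m * `|h 0| = `|m * h 0| by rewrite normrM gtr0_norm.
have := ler_distD (Int (fun x => h x * rho (4 ^+ n) x)) (m * h 0) 0.
by rewrite !subr0 [`|m * h 0 - _|]distrC; lra.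
Qed.

Lemma inv4_pow n : (4 ^+ n)^-1 = 2^-1 ^+ n * 2^-1 ^+ n :> R.
Proof. by rewrite -exprMn -exprVn; congr (_ ^+ _); field. Qed.

Lemma sol_sup0 ka u v f g du dv (la : R) : 0 < la -> sol ka u v f g du dv ->
  m * `|u 0| <= 20 * (la * (IntBox 1 (fun x => u x ^+ 2) + IntBox 1 (fun x => f x ^+ 2)) + 8 / la).
Proof.
move=> la0 h; have [[cu _ _] _ cf _ _] := h.
set U := IntBox 1 (fun x => u x ^+ 2); set F := IntBox 1 (fun x => f x ^+ 2).
have U0 : 0 <= U by apply: IntBox_ge0 => x; exact: sqr_ge0.
have F0 : 0 <= F by apply: IntBox_ge0 => x; exact: sqr_ge0.
apply: Int_rho_cvg_bound => // n.
pose a i := Int (fun x => u x * rho (4 ^+ i) x).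
have ha i : `|a i.+1 - a i| <= 9 / 2 * (la * F + 8 / la) * 2^-1 ^+ i.
  have b0 : 0 < 4 ^+ i :> R by rewrite exprn_gt0.
  rewrite /a exprS (sol_tele b0 h).
  have q0 : 0 < 2^-1 ^+ i :> R by rewrite exprn_gt0.
  have r1 : 0 <= ((4 : R) ^+ i)^-1 <= 1.
    by rewrite invr_ge0 ltW//= invf_le1// exprn_ege1// ler1n.
  have ck : continuous (fun x : R3 R => ker (4 ^+ i) (enorm2 x)).
    by apply: cont_comp; [exact: cont_enorm2|exact: derive_continuous (ker_derive _)].
  have hv : vanish (4 ^+ i)^-1 (fun x : R3 R => ker (4 ^+ i) (enorm2 x)).
    by move=> x xr; apply: ker_vanish => //; apply: enorm2_gt => //; case/andP: r1.
  have hb x : `|ker (4 ^+ i) (enorm2 x)| <= 9 * 4 ^+ i by apply: ker_bound => //; exact: enorm2_ge0.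
  (* With a kernel of size [9 * 4^i] on radius [4^-i], the weight [la * 8^-i] makes both terms of
     [young_ker] decay like [2^-i]. *)
  have la' : 0 < la * (2^-1 ^+ i * 2^-1 ^+ i * 2^-1 ^+ i) by rewrite !mulr_gt0.
  apply: le_trans (young_ker cf ck r1 hb hv la') _.
  have E4 : 4 ^+ i = (2^-1 ^+ i * 2^-1 ^+ i)^-1 :> R by rewrite -inv4_pow invrK.
  rewrite E4 invrK -/F; move: (2^-1 ^+ i) q0 => q q0.
  by rewrite le_eqVlt; apply/orP; left; apply/eqP; field; rewrite !gt_eqF.
have h0 : `|a 0%N| <= 105 / 16 * (la * U + 8 / la).
  rewrite /a expr0.
  have hb x : `|rho 1 x| <= 105 / 8.
    rewrite ger0_norm ?rho_ge0// /rho !expr1n !mul1r; apply: nbump_bound; exact: enorm2_ge0.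
  have r1 : 0 <= (1 : R) <= 1 by lra.
  have hv : vanish 1 (@rho R 1) by have := @rho_vanish R 1 ltr01; rewrite invr1.
  have := young_ker cu (@rho_continuous _ 1) r1 hb hv la0.
  by rewrite expr1n mulr1 -/U; lra.
have := geom_bound ha n.
have la8 : 0 < 8 / la by rewrite divr_gt0.
have lU : 0 <= la * U by rewrite mulr_ge0// ltW.
have lF : 0 <= la * F by rewrite mulr_ge0// ltW.
move=> hn; have := ler_distD (a 0%N) (a n) 0; rewrite !subr0 /a => h1.
by move: hn h0 h1; rewrite /a; lra.
Qed.

Definition Csup : R := (180 / m) ^+ 2.

(** Optimization of the weight in [sol_sup0]: with [la = S^(-1/2)] its bound [20 (la S + 8 / la)]
    becomes [180 S^(1/2)]. *)
Lemma sol_sup_origin ka u v f g du dv : sol ka u v f g du dv ->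
  u 0 ^+ 2 <= Csup * (IntBox 1 (fun x => u x ^+ 2) + IntBox 1 (fun x => f x ^+ 2)).
Proof.
move=> h; have H la := @sol_sup0 ka u v f g du dv la ^~ h; move: H.
set S := _ + _ => H.
have S0 : 0 <= S by apply: addr_ge0; apply: IntBox_ge0 => x; exact: sqr_ge0.
have m0 : 0 < m := mass_gt0.
(* For [S = 0] no weight is optimal; arbitrarily large ones give [u 0 = 0]. *)
have [Sp|Sz] := ltP 0 S; last first.
  have S00 : S = 0 by apply/eqP; rewrite eq_le Sz S0.
  suff -> : u 0 = 0 by rewrite expr0n S00 mulr0.
  apply/eqP; rewrite -normr_le0; apply/ler_addgt0Pr => e e0; rewrite add0r.
  have la0 : 0 < 160 / (m * e) by rewrite divr_gt0// mulr_gt0.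
  have := H _ la0; rewrite S00 mulr0 add0r.
  have -> : 20 * (8 / (160 / (m * e))) = m * e by field; rewrite !gt_eqF.
  by rewrite ler_pM2l.
have q0 : 0 < Num.sqrt S by rewrite sqrtr_gt0.
have la0 : 0 < (Num.sqrt S)^-1 by rewrite invr_gt0.
have := H _ la0; have := sqr_sqrtr S0; move: (Num.sqrt S) q0 {la0 H} => q q0; clearbody S => <-.
have -> : 20 * (q^-1 * q ^+ 2 + 8 / q^-1) = 180 * q by field; rewrite gt_eqF.
move=> h1; have hh : `|u 0| <= 180 / m * q by rewrite mulrAC ler_pdivlMr// mulrC.
rewrite -real_normK ?num_real// /Csup -exprMn.
by apply: lerXn2r; rewrite ?nnegrE//; exact: le_trans (normr_ge0 _) hh.
Qed.

(** The average of [du j] against [rho] is, by parts, minus that of [u] against the derivative of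
    [rho]. Consecutive scales are compared through the test function [2 x_j ker1 b (|x|^2)], the
    derivative of the kernel. It is not radial, so the magnetic term survives and brings the factor
    [1 + 2 |ka|]. The constant covers [2 * 2288 + 420]. *)
Lemma sol_grad_origin ka u v f g du dv j (M : R) : sol ka u v f g du dv ->
  (forall x, `|x| <= 1 -> [/\ `|u x| <= M, `|v x| <= M & `|f x| <= M]) ->
  m * `|du j 0| <= 5000 * (1 + 2 * `|ka|) * M.
Proof.
move=> h hM; have [hu [cv _ _] cf _ _] := h; have [cu cdu _] := hu.
have M0 : 0 <= M by have [h0 _ _] := hM 0 (eq_ind_r (fun t => t <= 1) ler01 (normr0 _)); exact: le_trans h0.
have jx x : `|coord3 x j| <= `|x| by exact: le_coord.
pose dr b x : R := 2 * (coord3 x j * (b ^+ 3 * (b ^+ 2 * nbump' (b ^+ 2 * enorm2 x)))).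
have cdr b : continuous (dr b) by have [_ h1 _] := @C1_rho R b; exact: h1.
have vdr b : 0 < b -> vanish b^-1 (dr b) by move=> b0; exact: (C1_vanish (C1_rho b) (rho_vanish b0) j).
pose a i := Int (fun x => u x * dr (4 ^+ i) x).
have ha i : `|a i.+1 - a i| <= 2288 * (1 + 2 * `|ka|) * M * 2^-1 ^+ i.
  have b0 : 0 < 4 ^+ i :> R by rewrite exprn_gt0.
  rewrite /a exprS; move Eb : (4 ^+ i) b0 => b b0.
  have b1 : 1 <= b by rewrite -Eb exprn_ege1// ler1n.
  have bi : 0 < b^-1 by rewrite invr_gt0.
  have bi1 : b^-1 <= 1 by rewrite invf_le1.
  have b4 : 0 < 4 * b by lra.
  have k1v s : b^-1 ^+ 2 < s -> 2 * ker1 b s = 0.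
    move=> hs.
    have hz : is_derive (s : R) (1 : R) (ker b) 0.
      apply: near_eq_is_derive (is_derive_cst 0 s 1); near=> t.
      by rewrite ker_vanish//; near: t; exact: lt_nbhsr.
    by have [_ <-] := ker_derive b s; have [_ ->] := hz; rewrite mulr0.
  have := sol_radial_coord j h (fun s => derZ 2 (ker1_derive b s)) (fun s => derZ 2 (ker2_derive b s))
     (cont1Z (@ker3_continuous _ b)) (ltW bi) k1v.
  rewrite [LHS](@eq_Int _ _ (fun x => u x * dr (4 * b) x - u x * dr b x)); last first.
    move=> x; rewrite -mulrBr; congr (_ * _); rewrite /dr.
    have e0 := enorm2_ge0 x.
    have h2 : 0 <= b ^+ 2 * enorm2 x by rewrite mulr_ge0// sqr_ge0.
    have h1 : 0 <= (4 * b) ^+ 2 * enorm2 x by rewrite mulr_ge0// sqr_ge0.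
    rewrite -(newt_laplacian' h1) -(newt_laplacian' h2) /ker2 /ker3.
    have -> : (4 * b) ^+ 2 = 16 * b ^+ 2 by ring.
    ring.
  have idr c : 0 < c -> intg (fun x => u x * dr c x) by move=> c0; exact: intg_mul cu (cdr c) (vdr c c0).
  rewrite (IntB (idr _ b4) (idr _ b0)) => ->.
  have cke : continuous (fun x : R3 R => ker1 b (enorm2 x)).
    by apply: cont_comp; [exact: cont_enorm2|exact: derive_continuous (ker1_derive b)].
  have k1z x : b^-1 < `|x| -> 2 * ker1 b (enorm2 x) = 0.
    by move=> xb; apply: k1v; apply: enorm2_gt => //; exact: ltW.
  have bnd (F c : R3 R -> R) : continuous F -> continuous c -> (forall x, `|x| <= 1 -> `|F x| <= M) ->
     (forall x, `|c x| <= `|x|) -> `|Int (fun x => F x * (c x * (2 * ker1 b (enorm2 x))))| <= 2288 * M * 2^-1 ^+ i.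
    move=> cF cc hF hc.
    have cFc : continuous (fun x => F x * (c x * (2 * ker1 b (enorm2 x)))) by cont.
    have B1 x : `|x| <= b^-1 -> `|F x * (c x * (2 * ker1 b (enorm2 x)))| <= M * (b^-1 * (2 * (143 * b ^+ 3))).
      move=> xb; rewrite normrM; apply: ler_pM => //; first by apply: hF; exact: le_trans bi1.
      rewrite normrM; apply: ler_pM => //; first exact: le_trans (hc x) xb.
      by rewrite normrM ger0_norm// ler_pM2l//; apply: ker1_bound => //; exact: enorm2_ge0.
    have B2 x : b^-1 < `|x| -> F x * (c x * (2 * ker1 b (enorm2 x))) = 0 by move=> xb; rewrite k1z ?mulr0.
    apply: le_trans (Int_bounded (ltW bi) cFc B1 B2) _.
    have -> : M * (b^-1 * (2 * (143 * b ^+ 3))) * (2 * b^-1) ^+ 3 = 2288 * M * b^-1 by field; rewrite gt_eqF.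
    rewrite -Eb inv4_pow; apply: ler_wpM2l; first by lra.
    by rewrite ler_piMr ?exprn_ge0// exprn_ile1//; lra.
  apply: le_trans (ler_normB _ _) _; rewrite normrM.
  have -> : 2288 * (1 + 2 * `|ka|) * M * 2^-1 ^+ i = 2288 * M * 2^-1 ^+ i + 2 * `|ka| * (2288 * M * 2^-1 ^+ i) by ring.
  rewrite normrM [`|2|]ger0_norm//; apply: lerD.
    by apply: bnd => // [|x /hM[]//]; exact: cont_coord.
  apply: ler_wpM2l; first by rewrite mulr_ge0.
  apply: bnd => // [|x /hM[]//|x].
    by cont.
  have h0 := le_coord o0 x; have h1 := le_coord o1 x.
  by case: j {jx dr cdr vdr a idr k1z k1v} => -[|[|[|]]] //= ?; rewrite ?mul0r ?mul1r ?sub0r ?subr0 ?normrN ?normr0.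
have h0 : `|a 0%N| <= 420 * M.
  have cud : continuous (fun x => u x * dr 1 x) by have := cdr 1 => ?; cont.
  have B1 x : `|x| <= 1 -> `|u x * dr 1 x| <= M * (2 * (1 * (105 / 4))).
    move=> x1; rewrite normrM; apply: ler_pM => //; first by have [] := hM x x1.
    rewrite /dr !expr1n !mul1r normrM [`|2|]ger0_norm// ler_pM2l// normrM -[leRHS]mul1r; apply: ler_pM => //.
      exact: le_trans (jx x) x1.
    by apply: nbump'_bound; exact: enorm2_ge0.
  have B2 x : 1 < `|x| -> u x * dr 1 x = 0 by move=> x1; rewrite (vdr 1 ltr01) ?mulr0// invr1.
  have := Int_bounded ler01 cud B1 B2; rewrite /a expr0.
  by lra.
have key n : `|Int (fun x => du j x * rho (4 ^+ n) x)| <= 5000 * (1 + 2 * `|ka|) * M.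
  have b0 : 0 < 4 ^+ n :> R by rewrite exprn_gt0.
  have ccr : Cc (@rho R (4 ^+ n)) by split; [exact: rho_continuous|exists (4 ^+ n)^-1; exact: rho_vanish].
  have E := ibp j hu (@C1_rho R (4 ^+ n)) (or_intror ccr).
  rewrite -normrN -E -/(a n); have hn := geom_bound ha n.
  have := ler_distD (a 0%N) (a n) 0; rewrite !subr0.
  have : 0 <= `|ka| * M by rewrite mulr_ge0.
  clear -M0 h0 hn; lra.
exact: Int_rho_cvg_bound (cdu j) key.
Unshelve. all: by end_near. Qed.
End PotentialEstimate.

(** * Gauge change: estimates at an arbitrary point *)

Section GaugeEstimate.
Context {R : realType}.
Implicit Types (f g u v Phi : R3 R -> R) (du dv dPhi : 'I_3 -> R3 R -> R) (x : R3 R).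

Lemma cont_shift f (a : R3 R) : continuous f -> continuous (fun x : R3 R => f (x + a)).
Proof.
move=> cf; have h := @cont_affine _ f 1 a cf.
suff -> : (fun x : R3 R => f (x + a)) = (fun x : R3 R => f (1 *: x + a)) by [].
by apply/funext => x; rewrite scale1r.
Qed.

Lemma der_shift f (a x w : R3 R) d : is_derive (x + a) w f d -> is_derive x w (fun y : R3 R => f (y + a)) d.
Proof.
move/slice_derive => h; apply/slice_derive.
suff -> : (fun t : R => f (t *: w + x + a)) = (fun t : R => f (t *: w + (x + a))) by [].
by apply/funext => t; rewrite addrA.
Qed.

Lemma C1_shift f df (a : R3 R) : C1 f df -> C1 (fun x : R3 R => f (x + a)) (fun j (x : R3 R) => df j (x + a)).
Proof.
move=> [cf cdf h]; split; [exact: cont_shift|by move=> j; exact: cont_shift|].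
by move=> j x; apply: der_shift; exact: h.
Qed.

Lemma Cc_shift f (a : R3 R) : Cc f -> Cc (fun x : R3 R => f (x + a)).
Proof.
move=> [cf [r hr]]; split; first exact: cont_shift.
exists (r + `|a|) => x xr; apply: hr.
have := ler_normB (x + a) a; rewrite addrK; lra.
Qed.

Lemma Cc_mulr f g : continuous f -> Cc g -> Cc (fun x => f x * g x).
Proof. by move=> cf [cg [r hr]]; exact: Cc_mul hr. Qed.

Lemma C1_Cc f df j : C1 f df -> Cc f -> Cc (df j).
Proof. by move=> h [_ [r hr]]; split; [case: h|exists r; exact: C1_vanish h hr j]. Qed.

(** The [j]-th component at [x0] of the vector potential [A = ka (- x_2, x_1, 0)]. *)
Definition drift (x0 : R3 R) (ka : R) (j : 'I_3) : R :=
  ka * ((j == o1)%:R * x0.1.1 - (j == o0)%:R * x0.1.2).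

Section Gauge.
Variables (x0 : R3 R) (ka : R).
Local Notation a := (drift x0 ka).
Definition ang (z : R3 R) : R := a o0 * coord3 z o0 + a o1 * coord3 z o1.
Local Notation al := ang.
(** This is [|A (z) + a|^2 - |A (z)|^2]: the operator of [sol] lacks the term [|A|^2] of the full
    magnetic Laplacian, so the gauge change leaves this difference behind. *)
Definition gpot (z : R3 R) : R := (a o0 ^+ 2 + a o1 ^+ 2) + 2 * (ka * (z.1.1 * a o1 - z.1.2 * a o0)).
(** [gre + i gim] is [exp (- i a . z) (u + i v) (z + x0)]. As [A] is linear,
    [A (z + x0) = A (z) + a], and the phase cancels the constant part. *)
Definition gre u v (z : R3 R) : R := cos (al z) * u (z + x0) + sin (al z) * v (z + x0).
Definition gim u v (z : R3 R) : R := cos (al z) * v (z + x0) - sin (al z) * u (z + x0).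

Lemma C1_ang : C1 al (fun j _ => a j).
Proof.
apply: C1_ext (C1D (C1Z (a o0) (C1_coord o0)) (C1Z (a o1) (C1_coord o1))) => // j x.
by case: j => -[|[|[|]]] //= i; rewrite /drift /=; ring.
Qed.

Lemma C1_cosang : C1 (fun x => cos (al x)) (fun j x => - (a j * sin (al x))).
Proof.
have h := C1_comp (h := cos) (h' := fun s => - sin s) C1_ang (fun x => is_derive_cos (al x)).
have [ca _ _] := C1_ang.
apply: C1_ext (h (@continuous_cos R) (contN (cont_comp ca (@continuous_sin R)))) => // j x; ring.
Qed.

Lemma C1_sinang : C1 (fun x => sin (al x)) (fun j x => a j * cos (al x)).
Proof.
have h := C1_comp (h := sin) (h' := cos) C1_ang (fun x => is_derive_sin (al x)).
have [ca _ _] := C1_ang.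
apply: C1_ext (h (@continuous_sin R) (cont_comp ca (@continuous_cos R))) => // j x; ring.
Qed.

Definition dgre u v du dv j (z : R3 R) : R := gre (du j) (dv j) z + a j * gim u v z.
Definition dgim u v du dv j (z : R3 R) : R := gim (du j) (dv j) z - a j * gre u v z.

Lemma C1_gre u v du dv : C1 u du -> C1 v dv -> C1 (gre u v) (dgre u v du dv).
Proof.
move=> hu hv.
apply: C1_ext (C1D (C1M C1_cosang (C1_shift x0 hu)) (C1M C1_sinang (C1_shift x0 hv))) => // j x.
rewrite /dgre /gre /gim; ring.
Qed.

Lemma C1_gim u v du dv : C1 u du -> C1 v dv -> C1 (gim u v) (dgim u v du dv).
Proof.
move=> hu hv.
apply: C1_ext (C1B (C1M C1_cosang (C1_shift x0 hv)) (C1M C1_sinang (C1_shift x0 hu))) => // j x.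
rewrite /dgim /gre /gim; ring.
Qed.

Lemma cont_gre u v : continuous u -> continuous v -> continuous (gre u v).
Proof.
move=> cu cv; have := @cont_shift _ x0 cu; have := @cont_shift _ x0 cv.
by have [cc _ _] := C1_cosang; have [cs _ _] := C1_sinang => h1 h2; rewrite /gre; cont.
Qed.

Lemma cont_gim u v : continuous u -> continuous v -> continuous (gim u v).
Proof.
move=> cu cv; have := @cont_shift _ x0 cu; have := @cont_shift _ x0 cv.
by have [cc _ _] := C1_cosang; have [cs _ _] := C1_sinang => h1 h2; rewrite /gim; cont.
Qed.

Lemma cont_gpot : continuous gpot.
Proof. by rewrite /gpot; cont. Qed.

Definition ldr dPsi (z : R3 R) : R := ka * rotd dPsi z + (a o0 * dPsi o0 z + a o1 * dPsi o1 z).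

Lemma sol_shift u v f g du dv Psi dPsi : sol ka u v f g du dv -> C1 Psi dPsi -> Cc Psi ->
  Int (fun z : R3 R => \sum_j du j (z + x0) * dPsi j z + 2 * (v (z + x0) * ldr dPsi z)) = Int (fun z : R3 R => f (z + x0) * Psi z) /\
  Int (fun z : R3 R => \sum_j dv j (z + x0) * dPsi j z - 2 * (u (z + x0) * ldr dPsi z)) = Int (fun z : R3 R => g (z + x0) * Psi z).
Proof.
move=> [hu hv cf cg h] hP cP.
have hP' := C1_shift (- x0) hP; have cP' := Cc_shift (- x0) cP.
have [h1 h2] := h _ _ hP' cP'.
have [cu cdu _] := hu; have [cv cdv _] := hv.
have cdP j := C1_Cc j hP' cP'.
have cdP1 j : continuous (fun x : R3 R => dPsi j (x - x0)) by case: (cdP j).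
have [_ [r hr]] := cP'.
have sh k : Cc k -> Int k = Int (fun z : R3 R => k (z + x0)) by move=> ck; have [_ ->] := Int_translate x0 (Cc_intg ck).
rewrite (sh _ (Cc_mulr cf cP')) (sh _ ) in h1; last first.
  split; first by rewrite /gdot /rotd; cont.
  by exists r => x xr; rewrite /gdot /rotd sum3 !(C1_vanish hP' hr _ xr); ring.
rewrite (sh _ (Cc_mulr cg cP')) (sh _ ) in h2; last first.
  split; first by rewrite /gdot /rotd; cont.
  by exists r => x xr; rewrite /gdot /rotd sum3 !(C1_vanish hP' hr _ xr); ring.
split.
  rewrite [RHS](@eq_Int _ _ (fun z : R3 R => f (z + x0) * Psi (z + x0 - x0))); last by move=> z; rewrite addrK.
  rewrite -h1; apply: eq_Int => z; rewrite /gdot /rotd /ldr /rotd /drift /=.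
  under [in RHS]eq_bigr do rewrite addrK.
  by rewrite !addrK; ring.
rewrite [RHS](@eq_Int _ _ (fun z : R3 R => g (z + x0) * Psi (z + x0 - x0))); last by move=> z; rewrite addrK.
rewrite -h2; apply: eq_Int => z; rewrite /gdot /rotd /ldr /rotd /drift /=.
under [in RHS]eq_bigr do rewrite addrK.
by rewrite !addrK; ring.
Qed.

Lemma sol_gauge1 u v f g du dv Phi dPhi : sol ka u v f g du dv -> C1 Phi dPhi -> Cc Phi ->
  Int (fun x => gdot (dgre u v du dv) dPhi x + 2 * ka * (gim u v x * rotd dPhi x)) =
  Int (fun x => (gre f g x + gpot x * gre u v x) * Phi x).
Proof.
move=> hs hP cP; have [hu hv cf cg _] := hs.
have [cu cdu _] := hu; have [cv cdv _] := hv.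
have [cP0 cdP _] := hP; have [_ [r hr]] := cP.
have hc := C1M C1_cosang hP; have hsn := C1M C1_sinang hP.
have [cc _ _] := C1_cosang; have [cs _ _] := C1_sinang.
have [h1 _] := sol_shift hs hc (Cc_mulr cc cP).
have [_ h2] := sol_shift hs hsn (Cc_mulr cs cP).
have hgim := C1_gim hu hv; have hgre := C1_gre hu hv.
(* The derivative of [gim * Phi] along [a] integrates to zero; subtracting it removes the
   first-order terms left over by the change of phase. *)
have hgP := C1M hgim hP; have cgP : Cc (fun x => gim u v x * Phi x) by apply: Cc_mulr cP; case: hgim.
have z0 := Int_deriv0 o0 hgP cgP; have z1 := Int_deriv0 o1 hgP cgP.
have cu' := @cont_shift _ x0 cu; have cv' := @cont_shift _ x0 cv.
have cf' := @cont_shift _ x0 cf; have cg' := @cont_shift _ x0 cg.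
have cdu' j := @cont_shift _ x0 (cdu j); have cdv' j := @cont_shift _ x0 (cdv j).
have [cgre cdgre _] := hgre.
have vP j := C1_vanish hP hr j.
have i1 : intg (fun z : R3 R => f (z + x0) * (cos (al z) * Phi z)) by apply: Cc_intg; do 2 apply: Cc_mulr => //.
have i2 : intg (fun z : R3 R => g (z + x0) * (sin (al z) * Phi z)) by apply: Cc_intg; do 2 apply: Cc_mulr => //.
have i3 : intg (fun x => gpot x * gre u v x * Phi x).
  by apply: Cc_intg; apply: Cc_mulr => //; apply: contM => //; exact: cont_gpot.
have id j : intg (fun x => dgim u v du dv j x * Phi x + gim u v x * dPhi j x).
  by apply: Cc_intg; apply: C1_Cc hgP cgP.
pose L1 (z : R3 R) : R := \sum_j du j (z + x0) * (- (a j * sin (al z)) * Phi z + cos (al z) * dPhi j z) +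
   2 * (v (z + x0) * ldr (fun j z => - (a j * sin (al z)) * Phi z + cos (al z) * dPhi j z) z).
pose L2 (z : R3 R) : R := \sum_j dv j (z + x0) * (a j * cos (al z) * Phi z + sin (al z) * dPhi j z) -
   2 * (u (z + x0) * ldr (fun j z => a j * cos (al z) * Phi z + sin (al z) * dPhi j z) z).
have iL1 : intg L1.
  apply: Cc_intg; split; first by rewrite /L1 /ldr /rotd; cont.
  by exists r => x xr; rewrite /L1 /ldr /rotd sum3 !vP// hr//; ring.
have iL2 : intg L2.
  apply: Cc_intg; split; first by rewrite /L2 /ldr /rotd; cont.
  by exists r => x xr; rewrite /L2 /ldr /rotd sum3 !vP// hr//; ring.
have E : Int (fun x => gdot (dgre u v du dv) dPhi x + 2 * ka * (gim u v x * rotd dPhi x)) =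
  Int (fun x => L1 x + L2 x + gpot x * gre u v x * Phi x
     - (a o0 * (dgim u v du dv o0 x * Phi x + gim u v x * dPhi o0 x) + a o1 * (dgim u v du dv o1 x * Phi x + gim u v x * dPhi o1 x))).
  apply: eq_Int => z; rewrite /L1 /L2 /gdot !sum3 /dgre /dgim /gpot /gre /gim /ldr /rotd.
  have -> : a o2 = 0 by rewrite /drift /=; ring.
  ring.
rewrite E IntB; [|exact: intgD (intgD iL1 iL2) i3|exact: intgD (intgZ _ (id o0)) (intgZ _ (id o1))].
rewrite (IntD (intgZ _ (id o0)) (intgZ _ (id o1))) !IntZ// z0 z1 !mulr0 addr0 subr0.
rewrite IntD//; last exact: intgD.
rewrite IntD// h1 h2 -IntD// -IntD//; last exact: intgD.
by apply: eq_Int => x; rewrite /gre; ring.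
Qed.

Lemma sol_gauge u v f g du dv : sol ka u v f g du dv ->
  sol ka (gre u v) (gim u v) (fun x => gre f g x + gpot x * gre u v x)
    (fun x => gim f g x + gpot x * gim u v x) (dgre u v du dv) (dgim u v du dv).
Proof.
move=> hs; have [hu hv cf cg _] := hs; have [cu _ _] := hu; have [cv _ _] := hv.
have cgr := cont_gre cu cv; have cgi := cont_gim cu cv.
have cgrf := cont_gre cf cg; have cgif := cont_gim cf cg; have cp := cont_gpot.
split; [exact: C1_gre|exact: C1_gim|by cont|by cont|move=> Phi dPhi hP cP; split].
  exact: sol_gauge1.
have := sol_gauge1 (sol_sym hs) hP cP.
have e1 k l z : gre l (fun x => - k x) z = gim k l z by rewrite /gre /gim; ring.
have e2 k l z : gim l (fun x => - k x) z = - gre k l z by rewrite /gre /gim; ring.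
rewrite (@eq_Int _ (fun x => gdot (dgre v _ dv _) dPhi x + _) (fun x => gdot (dgim u v du dv) dPhi x - 2 * ka * (gre u v x * rotd dPhi x))); last first.
  move=> x; rewrite e2 mulNr mulrN; congr (_ - _); rewrite /gdot; apply: eq_bigr => j _; congr (_ * _).
  by rewrite /dgre /dgim e1 e2 mulrN.
by move=> ->; apply: eq_Int => x; rewrite !e1.
Qed.

Lemma ang0 : ang 0 = 0. Proof. by rewrite /ang /coord3 /tnth /= !mulr0 addr0. Qed.

Lemma gre0 u v : gre u v 0 = u x0.
Proof. by rewrite /gre ang0 cos0 sin0 add0r mul1r mul0r addr0. Qed.
Lemma gim0 u v : gim u v 0 = v x0.
Proof. by rewrite /gim ang0 cos0 sin0 add0r mul1r mul0r subr0. Qed.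

Lemma gre_sqr u v z : gre u v z ^+ 2 <= u (z + x0) ^+ 2 + v (z + x0) ^+ 2.
Proof.
rewrite -subr_ge0 /gre; set p := u _; set q := v _.
have -> : p ^+ 2 + q ^+ 2 - (cos (al z) * p + sin (al z) * q) ^+ 2 = (cos (al z) * q - sin (al z) * p) ^+ 2
   + (1 - (cos (al z) ^+ 2 + sin (al z) ^+ 2)) * (p ^+ 2 + q ^+ 2) by ring.
by rewrite cos2Dsin2 subrr mul0r addr0 sqr_ge0.
Qed.

Lemma norm_gre u v z (M : R) : `|u (z + x0)| <= M -> `|v (z + x0)| <= M -> `|gre u v z| <= 2 * M.
Proof.
move=> hu hv; have M0 := le_trans (normr_ge0 _) hu.
rewrite -(@ler_pXn2r _ 2)// ?nnegrE ?mulr_ge0// real_normK ?num_real//.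
apply: le_trans (gre_sqr _ _ _) _.
have s2 t : `|t| <= M -> t ^+ 2 <= M ^+ 2 by move=> h; rewrite -real_normK ?num_real// ler_sqr ?nnegrE.
by have := s2 _ hu; have := s2 _ hv; have := sqr_ge0 M; rewrite exprMn; lra.
Qed.

Lemma norm_gim u v z (M : R) : `|u (z + x0)| <= M -> `|v (z + x0)| <= M -> `|gim u v z| <= 2 * M.
Proof.
move=> hu hv; have -> : gim u v z = gre v (fun x => - u x) z by rewrite /gre /gim; ring.
by apply: norm_gre => //; rewrite normrN.
Qed.

Variable K : R.
Hypothesis K0 : 0 <= K.
Hypothesis x0K : `|x0| <= K.
Hypothesis ka1 : `|ka| <= 1.

Lemma drift_le j : `|a j| <= K.
Proof.
rewrite /drift normrM -[leRHS]mul1r; apply: ler_pM => //.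
have h0 := le_trans (le_coord o0 x0) x0K; have h1 := le_trans (le_coord o1 x0) x0K.
by case: j => -[|[|[|]]] //= ?; rewrite ?mul0r ?mul1r ?sub0r ?subr0 ?normrN ?normr0//.
Qed.

Definition gbd : R := 2 * K ^+ 2 + 4 * K.

Lemma gpot_le z : `|z| <= 1 -> `|gpot z| <= gbd.
Proof.
move=> z1; have s2 j : a j ^+ 2 <= K ^+ 2 by rewrite -real_normK ?num_real// ler_sqr ?nnegrE// drift_le.
have p i j : `|coord3 z i * a j| <= K.
  by rewrite normrM -[leRHS]mul1r ler_pM// ?drift_le//; exact: le_trans (le_coord _ _) z1.
have k i j i' j': `|ka * (coord3 z i * a j - coord3 z i' * a j')| <= 2 * K.
  rewrite normrM -[leRHS]mul1r ler_pM//; apply: le_trans (ler_normB _ _) _.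
  by have := p i j; have := p i' j'; lra.
rewrite /gpot /gbd; apply: le_trans (ler_normD _ _) _; rewrite normrM [`|2|]ger0_norm//.
rewrite [X in X + _]ger0_norm; last by rewrite addr_ge0 ?sqr_ge0.
by have := k o0 o1 o1 o0; rewrite /coord3 /tnth /=; have := s2 o0; have := s2 o1; lra.
Qed.

(** The estimate at the origin, applied after the gauge change. Through [gbd] the constant grows
    with the distance of [x0] from the origin, so this is of use on a fixed cube only. *)
Lemma sol_sup u v f g du dv : sol ka u v f g du dv ->
  u x0 ^+ 2 <= Csup * (3 + 2 * gbd ^+ 2) * IntBox 1 (fun z : R3 R => u (z + x0) ^+ 2 + v (z + x0) ^+ 2 + f (z + x0) ^+ 2 + g (z + x0) ^+ 2).
Proof.
move=> hs; have [[cu _ _] [cv _ _] cf cg _] := hs.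
have := sol_sup_origin (sol_gauge hs); rewrite gre0 => h; apply: le_trans h _.
have cu' := @cont_shift _ x0 cu; have cv' := @cont_shift _ x0 cv.
have cf' := @cont_shift _ x0 cf; have cg' := @cont_shift _ x0 cg.
have cgr := cont_gre cu cv; have cgrf := cont_gre cf cg; have cp := cont_gpot.
rewrite -mulrA; apply: ler_wpM2l; first exact: sqr_ge0.
rewrite -IntBoxD -?IntBoxZ; [|by cont|by cont|by cont].
apply: le_IntBox => [||x x1]; [by cont|by cont|].
have h1 := gre_sqr u v x; have h2 := gre_sqr f g x.
have h3 : gpot x ^+ 2 <= gbd ^+ 2.
  by rewrite -real_normK ?num_real// ler_sqr ?nnegrE ?gpot_le// (le_trans _ (gpot_le x1)).
move: (gre u v x) (gre f g x) h1 h2 => p q h1 h2.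
have h4 : gpot x ^+ 2 * p ^+ 2 <= gbd ^+ 2 * (u (x + x0) ^+ 2 + v (x + x0) ^+ 2) by apply: ler_pM => //; exact: sqr_ge0.
have h5 : (q + gpot x * p) ^+ 2 <= 2 * q ^+ 2 + 2 * (gpot x ^+ 2 * p ^+ 2).
  by have := sqr_ge0 (q - gpot x * p); rewrite sqrrB sqrrD exprMn; lra.
have h6 : 0 <= gbd ^+ 2 * (f (x + x0) ^+ 2 + g (x + x0) ^+ 2) by rewrite mulr_ge0 ?addr_ge0 ?sqr_ge0.
have := sqr_ge0 (u (x + x0)); have := sqr_ge0 (v (x + x0)); have := sqr_ge0 (f (x + x0)); have := sqr_ge0 (g (x + x0)).
lra.
Qed.

(** For [|ka| <= 1] the factor [5000 (1 + 2 |ka|)] is at most [15000], and the transformed data are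
    at most [2 (1 + gbd) M]. The summand [K] undoes the derivative [a_j v] of the phase. *)
Definition Cgrad : R := 300 * 100 * (1 + gbd) / mass + K.

Lemma sol_grad u v f g du dv j (M : R) : sol ka u v f g du dv ->
  (forall x, `|x - x0| <= 1 -> [/\ `|u x| <= M, `|v x| <= M, `|f x| <= M & `|g x| <= M]) ->
  `|du j x0| <= Cgrad * M.
Proof.
move=> hs hM.
have M0 : 0 <= M.
  have x00 : `|x0 - x0| <= 1 by rewrite subrr normr0.
  by have [h0 _ _ _] := hM _ x00; exact: le_trans h0.
have gb0 : 0 <= gbd by rewrite /gbd addr_ge0// mulr_ge0// sqr_ge0.
have hM' z : `|z| <= 1 -> [/\ `|u (z + x0)| <= M, `|v (z + x0)| <= M, `|f (z + x0)| <= M & `|g (z + x0)| <= M].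
  by move=> z1; apply: hM; rewrite addrK.
have hb x : `|x| <= 1 -> [/\ `|gre u v x| <= 2 * (1 + gbd) * M, `|gim u v x| <= 2 * (1 + gbd) * M
    & `|gre f g x + gpot x * gre u v x| <= 2 * (1 + gbd) * M].
  move=> x1; have [h1 h2 h3 h4] := hM' x x1.
  have a1 := norm_gre h1 h2; have a2 := norm_gim h1 h2; have a3 := norm_gre h3 h4.
  have gM : 0 <= gbd * M by exact: mulr_ge0.
  split; [by lra|by lra|].
  apply: le_trans (ler_normD _ _) _; rewrite normrM.
  have : `|gpot x| * `|gre u v x| <= gbd * (2 * M) by apply: ler_pM => //; exact: gpot_le.
  lra.
have := sol_grad_origin j (sol_gauge hs) hb.
rewrite /dgre gre0 gim0 => h.
have m0 := @mass_gt0 R.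
have h1 : `|du j x0 + a j * v x0| <= 300 * 100 * (1 + gbd) / mass * M.
  rewrite -(ler_pM2l m0); apply: le_trans h _.
  have -> : mass * (300 * 100 * (1 + gbd) / mass * M) = 300 * 100 * (1 + gbd) * M by field; rewrite gt_eqF.
  have gM : 0 <= (1 + gbd) * M by apply: mulr_ge0 => //; lra.
  have : `|ka| * ((1 + gbd) * M) <= 1 * ((1 + gbd) * M) by apply: ler_wpM2r.
  lra.
have h2 : `|a j * v x0| <= K * M.
  rewrite normrM; apply: ler_pM => //; first exact: drift_le.
  by have [] := hM x0; rewrite ?subrr ?normr0.
have := ler_normB (du j x0 + a j * v x0) (a j * v x0); rewrite addrK /Cgrad; clear -K0 x0K ka1 h1 h2; lra.
Qed.
End Gauge.

End GaugeEstimate.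

(** * Regularization by smooth radial bumps *)

Section Bumps.
Context {R : realType}.
Implicit Types (f g u v : R3 R -> R) (x y z : R3 R) (s t la : R).

Lemma der_comp1 (h k : R -> R) (s : R) dh dk : is_derive (k s) (1 : R) h dh -> is_derive s (1 : R) k dk ->
  is_derive s (1 : R) (fun t => h (k t)) (dk * dh).
Proof. by move=> h1 h2; have h3 := @is_derive1_comp R h k s _ _ h1 h2; apply: (der_eq h3); rewrite mulrC. Qed.

(** [t^-k exp (- 1 / t)] extended by zero. All powers are taken together because the family is
    closed under differentiation up to linear combinations, which gives smoothness without a formula
    for higher derivatives. *)
Definition ebump (k : nat) t : R := if t <= 0 then 0 else t^-1 ^+ k * expR (- t^-1).
Definition ebump' (k : nat) t : R := ebump k.+2 t - k%:R * ebump k.+1 t.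

Lemma ebump_ge0 k t : 0 <= ebump k t.
Proof.
rewrite /ebump; case: ifPn => // t0; rewrite mulr_ge0 ?expR_ge0// exprn_ge0// invr_ge0.
by move: t0; rewrite -ltNge => /ltW.
Qed.

Lemma ebump_gt0 k t : 0 < t -> 0 < ebump k t.
Proof. by move=> t0; rewrite /ebump leNgt t0 /= mulr_gt0 ?expR_gt0// exprn_gt0// invr_gt0. Qed.

Lemma ebump_le0 k t : t <= 0 -> ebump k t = 0.
Proof. by rewrite /ebump => ->. Qed.

Lemma ebump_bound k t : `|ebump k t| <= k.+2`!%:R * t ^+ 2.
Proof.
rewrite ger0_norm ?ebump_ge0// /ebump; case: ifPn => t0; first by rewrite mulr_ge0// sqr_ge0.
have {}t0 : 0 < t by rewrite ltNge.
have i0 : 0 < t^-1 by rewrite invr_gt0.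
have h := @expR_ge1Dxn R t^-1 k.+1 (ltW i0).
have h1 : t^-1 ^+ k.+2 / k.+2`!%:R <= expR t^-1 by lra.
rewrite expRN; rewrite ler_pdivrMr ?expR_gt0//.
apply: le_trans (_ : k.+2`!%:R * t ^+ 2 * (t^-1 ^+ k.+2 / k.+2`!%:R) <= _); last first.
  by apply: ler_wpM2l h1; rewrite mulr_ge0// sqr_ge0.
rewrite le_eqVlt; apply/orP; left; apply/eqP; rewrite !exprS; set q := t^-1 ^+ k.
by field; rewrite !gt_eqF.
Qed.

Lemma der0_sqbound (h : R -> R) (C : R) : (forall t, `|h t| <= C * t ^+ 2) -> is_derive (0 : R) (1 : R) h 0.
Proof.
move=> hC; have C0 : 0 <= C by have := le_trans (normr_ge0 _) (hC 1); rewrite expr1n mulr1.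
have h0 : h 0 = 0 by apply/eqP; rewrite -normr_le0; have := hC 0; rewrite expr0n mulr0.
have H : t^-1 *: ((h \o shift 0) (t *: (1 : R)) - h 0) @[t --> 0^'] --> (0 : R).
  apply/cvgrPdist_le => e e0; near=> t; rewrite /= h0 subr0 addr0 sub0r normrN /GRing.scale /= mulr1 normrM normfV.
  have tn : t != 0 by near: t; exact: nbhs_dnbhs_neq.
  rewrite ler_pdivrMl ?normr_gt0//; apply: le_trans (hC t) _.
  rewrite -real_normK ?num_real// expr2 mulrA mulrC ler_wpM2l//.
  have : `|t| < e / (C + 1).
    by near: t; apply: dnbhs0_lt; rewrite divr_gt0//; lra.
  rewrite ltr_pdivlMr; last by lra.
  by have := normr_ge0 t; lra.
by split; [apply/cvg_ex; exists 0|exact: cvg_lim].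
Unshelve. all: by end_near. Qed.

Lemma ebump_derive k t : is_derive (t : R) (1 : R) (ebump k) (ebump' k t).
Proof.
have [t0|t0|->] := ltgtP t 0.
- rewrite /ebump' !ebump_le0 ?(ltW t0)// mulr0 subr0.
  apply: near_eq_is_derive (is_derive_cst 0 t 1); near=> s.
  by rewrite ebump_le0// ltW//; near: s; exact: lt_nbhsl.
- have h1 : is_derive (t : R) (1 : R) (fun s : R => s^-1) (- t^-1 ^+ 2).
    have tn : t != 0 by rewrite gt_eqF.
    have h := is_deriveV _ (is_derive_id t (1 : R)); apply: (der_eq (h tn)).
    by rewrite /GRing.scale /= mulr1 exprVn.
  have h2 : is_derive (t : R) (1 : R) (fun s : R => expR (- s^-1)) (t^-1 ^+ 2 * expR (- t^-1)).
    apply: (der_eq (@der_comp1 expR (fun s => - s^-1) t _ _ (is_derive_expR (- t^-1)) (derN h1))).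
    by rewrite opprK.
  have h3 : is_derive (t : R) (1 : R) (fun s : R => s^-1 ^+ k) (- (k%:R * t^-1 ^+ k.+1)).
    case: k => [|k]; first by rewrite mul0r oppr0; exact: der_cst.
    by apply: (der_eq (derX k h1)); rewrite !exprS; ring.
  have := derM h3 h2 => h4.
  have : is_derive (t : R) (1 : R) (ebump k) (- (k%:R * t^-1 ^+ k.+1) * expR (- t^-1) + t^-1 ^+ k * (t^-1 ^+ 2 * expR (- t^-1))).
    apply: near_eq_is_derive h4; near=> s.
    have s0 : 0 < s by near: s; exact: lt_nbhsr.
    by rewrite /ebump leNgt s0.
  by move=> h5; apply: (der_eq h5); rewrite /ebump' /ebump leNgt t0 /= !exprS; ring.
- rewrite /ebump' !ebump_le0// mulr0 subr0.
  exact: der0_sqbound (@ebump_bound k).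
Unshelve. all: by end_near. Qed.

Lemma ebump_continuous k : continuous (ebump k).
Proof. exact: derive_continuous (ebump_derive k). Qed.

(** Test functions must have partial derivatives of all orders. This class of expressions contains
    the bumps and is stable under [partial], so that smoothness follows by structural induction. *)
Inductive smf : (R3 R -> R) -> Prop :=
| smf_cst k : smf (fun=> k)
| smf_coord j : smf (fun x => coord3 x j)
| smf_add f g of smf f & smf g : smf (fun x => f x + g x)
| smf_mul f g of smf f & smf g : smf (fun x => f x * g x)
| smf_eta k f of smf f : smf (fun x => ebump k (f x)).

Lemma smf_C1 f : smf f -> exists df, C1 f df /\ forall j, smf (df j).
Proof.
elim => {f} [k|j|f g hf [df [Cf sf]] hg [dg [Cg sg]]|f g hf [df [Cf sf]] hg [dg [Cg sg]]|k f hf [df [Cf sf]]].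
- by exists (fun _ _ => 0); split; [exact: C1_cst|move=> j; exact: smf_cst].
- by exists (fun i _ => (j == i)%:R); split; [exact: C1_coord|move=> i; exact: smf_cst].
- by exists (fun j x => df j x + dg j x); split; [exact: C1D|move=> j; exact: smf_add].
- exists (fun j x => df j x * g x + f x * dg j x); split; first exact: C1M.
  by move=> j; apply: smf_add; apply: smf_mul.
- exists (fun j x => ebump' k (f x) * df j x); split.
    have ce : continuous (ebump' k).
      move=> t; apply: cvgB; first exact: ebump_continuous.
      by apply: cvgM; [exact: cvg_cst|exact: ebump_continuous].
    apply: (C1_comp Cf (fun x => ebump_derive k (f x)) (@ebump_continuous k)).
    by apply: cont_comp => //; case: Cf.
  move=> j; apply: smf_mul => //.
  have := smf_add (smf_eta k.+2 hf) (smf_mul (smf_cst (- k%:R)) (smf_eta k.+1 hf)).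
  by congr smf; apply/funext => x; rewrite mulNr.
Qed.

Lemma smf_partial f j : smf f -> smf (partial j f).
Proof.
move=> /smf_C1 [df [[_ _ hd] sf]].
suff -> : partial j f = df j by [].
by apply/funext => x; have [_ <-] := hd j x.
Qed.

Lemma C1_partial f df : C1 f df -> forall j, partial j f = df j.
Proof. by move=> [_ _ h] j; apply/funext => x; have [_ <-] := h j x. Qed.

Lemma smf_smooth f : smf f -> smooth f.
Proof.
move=> hf s; have : smf (foldr partial f s) by elim: s => //= j s; exact: smf_partial.
move=> /smf_C1 [df [[c _ d] _]]; split=> // j x; by case: (d j x).
Qed.

Lemma smf_test f r : smf f -> vanish r f -> test_function f.
Proof.
move=> hf hr; split; first exact: smf_smooth.
apply: (@subclosed_compact _ _ (box r : set (R3 R))); [exact: closed_closure|exact: compact_box|].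
have cb : closed (box r : set (R3 R)).
  by apply: compact_closed; [exact: norm_hausdorff|exact: compact_box].
rewrite (closure_id (box r)).1//; apply: closure_subset => x /= h.
by rewrite /box /= leNgt; apply/negP => /hr h0; rewrite h0 eqxx in h.
Qed.

(** [exp (- 1 / (1 - la s))] for [la s < 1]: [Bm la] is the standard bump of radius [la^(-1/2)]. *)
Definition bmp la s : R := ebump 0 (1 - la * s).
Definition bmp1 la s : R := - la * ebump 2 (1 - la * s).
Definition bmp2 la s : R := la ^+ 2 * (ebump 4 (1 - la * s) - 2 * ebump 3 (1 - la * s)).

Lemma affine_comp_derive (h h' : R -> R) la s : (forall t, is_derive (t : R) (1 : R) h (h' t)) ->
  is_derive (s : R) (1 : R) (fun s => h (1 - la * s)) (- la * h' (1 - la * s)).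
Proof.
move=> hd.
have h1 : is_derive (s : R) (1 : R) (fun s : R => 1 - la * s) (- la).
  by apply: (der_eq (derB (der_cst s (1 : R) 1) (derZ la (is_derive_id s (1 : R))))); rewrite sub0r mulr1.
exact: (@der_comp1 h (fun s => 1 - la * s) s _ _ (hd (1 - la * s)) h1).
Qed.

Lemma bmp_derive la s : is_derive (s : R) (1 : R) (bmp la) (bmp1 la s).
Proof.
by apply: (der_eq (affine_comp_derive la s (ebump_derive 0))); rewrite /ebump' mul0r subr0.
Qed.

Lemma bmp1_derive la s : is_derive (s : R) (1 : R) (bmp1 la) (bmp2 la s).
Proof.
by apply: (der_eq (derZ (- la) (affine_comp_derive la s (ebump_derive 2)))); rewrite /ebump' /bmp2; ring.
Qed.

Lemma eta1_cont k la : continuous (fun s => ebump k (1 - la * s)).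
Proof. by apply: derive_continuous => s; exact: affine_comp_derive (ebump_derive k). Qed.

Lemma bmp2_cont la : continuous (bmp2 la).
Proof.
move=> s; apply: cvgM; first exact: cvg_cst.
by apply: cvgB; [exact: eta1_cont|apply: cvgM; [exact: cvg_cst|exact: eta1_cont]].
Qed.
Lemma bmp1_cont la : continuous (bmp1 la). Proof. exact: derive_continuous (bmp1_derive la). Qed.

Definition Bm la z : R := bmp la (enorm2 z).
Definition dBm la (j : 'I_3) z : R := 2 * (coord3 z j * bmp1 la (enorm2 z)).
Definition ddBm la (j i : 'I_3) z : R := 2 * ((j == i)%:R * bmp1 la (enorm2 z) + 2 * (coord3 z i * coord3 z j * bmp2 la (enorm2 z))).

Lemma C1_Bm la : C1 (Bm la) (dBm la).
Proof. exact: C1_radial (bmp_derive la) (@bmp1_cont la). Qed.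
Lemma C1_dBm la j : C1 (dBm la j) (ddBm la j).
Proof. exact: C1Z 2 (C1_radial_coord (bmp1_derive la) (@bmp2_cont la) j). Qed.

Lemma Bm_ge0 la z : 0 <= Bm la z. Proof. exact: ebump_ge0. Qed.

Lemma Bm_vanish la r : 0 < la -> 0 <= r -> 1 <= la * r ^+ 2 -> vanish r (Bm la).
Proof.
move=> la0 r0 h z /(enorm2_gt r0) hz; apply: ebump_le0.
by have := @ltr_pM2l _ la la0 (r ^+ 2) (enorm2 z); rewrite hz; lra.
Qed.

Lemma Cc_Bm la : 0 < la -> Cc (Bm la).
Proof.
move=> la0; split; first by case: (C1_Bm la).
exists (1 + la^-1); have i0 : 0 < la^-1 by rewrite invr_gt0.
apply: Bm_vanish => //; first by lra.
have -> : la * (1 + la^-1) ^+ 2 = la + 2 + la^-1 by field; rewrite gt_eqF.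
lra.
Qed.

Lemma smf_sub y j : smf (fun x => coord3 (x - y) j).
Proof.
have := smf_add (smf_coord j) (smf_cst (- coord3 y j)).
by congr smf; apply/funext => x; rewrite coordB.
Qed.

Lemma smf_eta_sub k la y : smf (fun x => ebump k (1 - la * enorm2 (x - y))).
Proof.
have q j := smf_mul (smf_sub y j) (smf_sub y j).
have := smf_add (smf_cst 1) (smf_mul (smf_cst (- la)) (smf_add (smf_add (q o0) (q o1)) (q o2))).
move=> /(smf_eta k); congr smf; apply/funext => x.
by rewrite mulNr /enorm2 /dot sum3.
Qed.

Lemma smf_Bm la y : smf (fun x => Bm la (x - y)).
Proof. exact: smf_eta_sub. Qed.

Lemma smf_dBm la y j : smf (fun x => dBm la j (x - y)).
Proof.
have := smf_mul (smf_cst 2) (smf_mul (smf_sub y j) (smf_mul (smf_cst (- la)) (smf_eta_sub 2 la y))).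
by congr smf.
Qed.

(* [sol] tested with the radial functions [Bm la (. - y)] only, all
   derivatives being on the test function. *)
Definition magsol (ka : R) u v f g :=
  [/\ continuous u, continuous v, continuous f, continuous g & forall la y, 0 < la ->
   Int (fun x => u x * - (\sum_j ddBm la j j (x - y)) + 2 * ka * (v x * (x.1.1 * dBm la o1 (x - y) - x.1.2 * dBm la o0 (x - y)))) = Int (fun x => f x * Bm la (x - y)) /\
   Int (fun x => v x * - (\sum_j ddBm la j j (x - y)) - 2 * ka * (u x * (x.1.1 * dBm la o1 (x - y) - x.1.2 * dBm la o0 (x - y)))) = Int (fun x => g x * Bm la (x - y))].
End Bumps.

Ltac genInt := repeat match goal with |- context [Rintegral ?m ?D ?f] =>
  generalize (Rintegral m D f); intro end.

(** * Mollification and regularity of weak solutions *)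

Section Mollification.
Context {R : realType}.
Implicit Types (f g u v k Phi : R3 R -> R) (du dv dk dPhi : 'I_3 -> R3 R -> R) (x y z : R3 R) (t la : R).

(** The kernel is taken at [x - y], as in the test functions of [magsol]; hence a minus sign for
    each derivative in [y]. *)
Definition cconv u k y : R := Int (fun x : R3 R => u x * k (x - y)).

Lemma conv_intg u k y : continuous u -> Cc k -> intg (fun x : R3 R => u x * k (x - y)).
Proof. by move=> cu ck; apply: Cc_intg; apply: Cc_mulr => //; exact: Cc_shift. Qed.

Lemma convE u k y : continuous u -> Cc k -> cconv u k y = Int (fun z : R3 R => u (z + y) * k z).
Proof.
move=> cu ck; have [_ te] := Int_translate y (conv_intg y cu ck); rewrite /cconv -te.
by apply: eq_Int => z; rewrite addrK.
Qed.

Lemma vanish_ge0 k : Cc k -> exists2 r : R, 0 <= r & vanish r k.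
Proof.
move=> [_ [r hr]]; exists (Num.max 0 r); first by rewrite le_max lexx.
by move=> x; rewrite gt_max => /andP[_ /hr].
Qed.

Lemma Cc_bounded k : Cc k -> exists2 C : R, 0 <= C & forall x, `|k x| <= C.
Proof.
move=> ck; have [r r0 hr] := vanish_ge0 ck; have [c _] := ck.
have [C C0 hC] := cont_bounded r c; exists C => // x.
by have [xr|/hr ->] := leP `|x| r; [exact: hC|rewrite normr0].
Qed.

Lemma Int_diff_bound u1 u2 k (K r e : R) : continuous u1 -> continuous u2 -> continuous k -> 0 <= r -> 0 <= e ->
  vanish r k -> (forall x, `|k x| <= K) -> (forall x, `|x| <= r -> `|u1 x - u2 x| <= e) ->
  `|Int (fun x => u1 x * k x) - Int (fun x => u2 x * k x)| <= e * K * (2 * r) ^+ 3.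
Proof.
move=> c1 c2 ck r0 e0 hr hK he.
rewrite -IntB; [|exact: intg_mul hr|exact: intg_mul hr].
apply: Int_bounded => //; first by cont.
- move=> x xr; rewrite -mulrBl normrM; apply: ler_pM => //; exact: he.
- by move=> x xr; rewrite hr// !mulr0 subr0.
Qed.

Lemma conv_cont u k : continuous u -> Cc k -> continuous (cconv u k).
Proof.
move=> cu ck y; have [r r0 hr] := vanish_ge0 ck; have [K K0 hK] := Cc_bounded ck; have [c _] := ck.
apply/cvgrPdist_le => e e0.
have D0 : 0 < K * (2 * r) ^+ 3 + 1 by rewrite ltr_pwDr// mulr_ge0// exprn_ge0// mulr_ge0.
have e1 : 0 < e / (K * (2 * r) ^+ 3 + 1) by rewrite divr_gt0.
have [d d0 hd] := unif_cont (r + `|y|) cu e1.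
near=> y'; rewrite !convE//.
have cs a : continuous (fun z : R3 R => u (z + a)) by exact: cont_shift.
apply: le_trans (Int_diff_bound (cs y) (cs y') c r0 (ltW e1) hr hK _) _.
  move=> x xr; apply: ltW; apply: hd.
    by apply: le_trans (ler_normD _ _) _; rewrite lerD2r.
  have -> : x + y - (x + y') = y - y' by rewrite opprD addrACA subrr add0r.
  by near: y'; exact: cvgr_dist_lt.
rewrite -mulrA mulrAC ler_pdivrMr// ler_pM2l//; lra.
Unshelve. all: by end_near. Qed.

Lemma der_reflect f x y (w : R3 R) d : is_derive (x - y) w f d -> is_derive y w (fun y : R3 R => f (x - y)) (- d).
Proof.
move=> /slice_derive h; apply/slice_derive.
have h1 : is_derive (0 : R) (1 : R) (fun t : R => - t) (- 1) by exact: derN (is_derive_id (0 : R) (1 : R)).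
have h' : is_derive (- (0 : R)) (1 : R) (fun t : R => f (t *: w + (x - y))) d by rewrite oppr0.
have h2 := @der_comp1 _ (fun t : R => f (t *: w + (x - y))) (fun t => - t) 0 _ _ h' h1.
rewrite mulN1r in h2.
suff -> : (fun t : R => f (x - (t *: w + y))) = (fun t : R => f (- t *: w + (x - y))) by [].
by apply/funext => t; congr f; rewrite opprD scaleNr addrCA.
Qed.

Lemma C1_glip k dk (C : R) j : C1 k dk -> (forall x, `|dk j x| <= C) ->
  forall x (t : R), `|k (t *: axis_vec j + x) - k x| <= C * `|t|.
Proof.
move=> hk hC x t.
apply: (@C1_lip _ k dk (Num.max `|x| `|t *: axis_vec j + x|) C j hk (fun y _ => hC y)).
  by rewrite le_max lexx.
by rewrite le_max lexx orbT.
Qed.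

Lemma conv_derive u k dk j y : continuous u -> C1 k dk -> Cc k ->
  is_derive y (axis_vec j) (cconv u k) (- cconv u (dk j) y).
Proof.
move=> cu hk ck; have cdk := C1_Cc j hk ck.
have [r r0 hr] := vanish_ge0 ck; have [C C0 hC] := Cc_bounded cdk.
have [ckk ckd hkd] := hk; have L := C1_glip hk hC.
have H : h^-1 *: ((cconv u k \o shift y) (h *: axis_vec j) - cconv u k y) @[h --> (0 : R)^'] --> - cconv u (dk j) y.
  apply/cvgr_dnbhsP => t [tn0 tc].
  have [B B0 hB] : exists2 B : R, 0 < B & forall n, `|t n| <= B.
    have /cvg_seq_bounded/pinfty_ex_gt0[B B0 hB] : cvgn t by apply/cvg_ex; exists 0.
    by exists B => // n; exact: hB.
  pose f_ n x : R := u x * ((t n)^-1 * (k (x - (t n *: axis_vec j + y)) - k (x - y))).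
  have E n : (t n)^-1 *: ((cconv u k \o shift y) (t n *: axis_vec j) - cconv u k y) = Int (f_ n).
    rewrite /= /GRing.scale /= -IntB; [|exact: conv_intg|exact: conv_intg].
    rewrite -IntZ; last by apply: intgB; exact: conv_intg.
    by apply: eq_Int => x; rewrite /f_; ring.
  rewrite (_ : (fun n => _) = fun n => Int (f_ n)); last by apply/funext => n; exact: E.
  have -> : - cconv u (dk j) y = Int (fun x : R3 R => u x * - dk j (x - y)).
    rewrite /cconv -IntN; last exact: conv_intg.
    by apply: eq_Int => x; rewrite mulrN.
  have cua : continuous (fun x => `|u x| * C) by cont.
  apply: (proj1 (@Int_cvg _ f_ _ ((fun x => `|u x| * C) \_ (box (r + B + `|y|))) _ _ _ _)).
  - move=> n; rewrite /f_; have h1 := @cont_shift _ k (- (t n *: axis_vec j + y)) ckk.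
    by have h2 := @cont_shift _ k (- y) ckk; cont.
  - exact: intg_restrict.
  - move=> n x; have tp : 0 < `|t n| by rewrite normr_gt0.
    have Ex : x - (t n *: axis_vec j + y) = - t n *: axis_vec j + (x - y) by rewrite opprD scaleNr addrCA.
    rewrite box_restrict /f_; case: (leP `|x| (r + B + `|y|)) => xb.
      rewrite normrM; apply: ler_wpM2l => //; rewrite normrM normfV ler_pdivrMl// mulrC Ex.
      by have := L (x - y) (- t n); rewrite normrN.
    rewrite !hr ?subrr ?mulr0 ?normr0//.
      have := lerB_normD (x - y) y; rewrite subrK; have := ler_normB x y.
      by have := lerB_dist x y; lra.
    rewrite Ex; have := lerB_dist x (t n *: axis_vec j + y); rewrite Ex.
    have := ler_normD (t n *: axis_vec j) y; rewrite normrZ norm_axis mulr1.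
    by have := hB n; lra.
  move=> x; apply: cvgM; first exact: cvg_cst.
  have [d1 d2] := der_reflect (hkd j (x - y)).
  have /cvgr_dnbhsP h : h^-1 *: (((fun y : R3 R => k (x - y)) \o shift y) (h *: axis_vec j) - k (x - y)) @[h --> (0 : R)^'] --> - dk j (x - y).
    by rewrite -d2; exact: d1.
  exact: (h t (conj tn0 tc)).
by split; [apply/cvg_ex; eexists; exact: H|exact: cvg_lim].
Qed.

Lemma conv_C1 u k dk : continuous u -> C1 k dk -> Cc k -> C1 (cconv u k) (fun j y => - cconv u (dk j) y).
Proof.
move=> cu hk ck; split; first exact: conv_cont.
- by move=> j; apply: contN; apply: conv_cont => //; exact: C1_Cc hk ck.
- by move=> j y; exact: conv_derive.
Qed.

Lemma classical_sol1 ka u v f du dv ddu : C1 u du -> C1 v dv -> (forall j, C1 (du j) (ddu j)) -> continuous f ->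
  (forall y, - (\sum_j ddu j j y) - 2 * ka * rotd dv y = f y) -> forall Phi dPhi, C1 Phi dPhi -> Cc Phi ->
  Int (fun x => gdot du dPhi x + 2 * ka * (v x * rotd dPhi x)) = Int (fun x => f x * Phi x).
Proof.
move=> hu hv hd cf eq Phi dPhi hP cP.
have [_ [r hr]] := cP; have vP j := C1_vanish hP hr j.
have [_ cdP _] := hP; have [cu cdu _] := hu.
have E1 j : Int (fun x => du j x * dPhi j x) = - Int (fun x => ddu j j x * Phi x) by exact: ibp (hd j) hP (or_intror cP).
have hx0 := C1M (C1_coord o0) hv; have hx1 := C1M (C1_coord o1) hv.
have E2 := ibp o1 hx0 hP (or_intror cP); have E3 := ibp o0 hx1 hP (or_intror cP).
have i1 j : intg (fun x => du j x * dPhi j x) by exact: intg_mul (vP j).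
have cdd j : continuous (ddu j j) by case: (hd j).
have j1 j : intg (fun x => ddu j j x * Phi x) by apply: Cc_intg; exact: Cc_mulr.
have [cx0 cdx0 _] := hx0; have [cx1 cdx1 _] := hx1.
have i2 : intg (fun x => coord3 x o0 * v x * dPhi o1 x) by exact: intg_mul (vP _).
have i3 : intg (fun x => coord3 x o1 * v x * dPhi o0 x) by exact: intg_mul (vP _).
have j2 := Cc_intg (Cc_mulr (cdx0 o1) cP); have j3 := Cc_intg (Cc_mulr (cdx1 o0) cP).
have i23 := intgZ (2 * ka) (intgB i2 i3); have j23 := intgZ (2 * ka) (intgB j2 j3).
transitivity (Int (fun x => du o0 x * dPhi o0 x + du o1 x * dPhi o1 x + du o2 x * dPhi o2 x
   + 2 * ka * (coord3 x o0 * v x * dPhi o1 x - coord3 x o1 * v x * dPhi o0 x))).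
  by apply: eq_Int => x; rewrite /gdot sum3 /rotd /coord3 /tnth /=; ring.
rewrite (IntD (intgD (intgD (i1 _) (i1 _)) (i1 _)) i23) (IntD (intgD (i1 _) (i1 _)) (i1 _)) (IntD (i1 _) (i1 _)).
rewrite (IntZ _ (intgB i2 i3)) (IntB i2 i3) E2 E3 !E1.
transitivity (- (Int (fun x => ddu o0 o0 x * Phi x + ddu o1 o1 x * Phi x + ddu o2 o2 x * Phi x
   + 2 * ka * (((o0 == o1)%:R * v x + coord3 x o0 * dv o1 x) * Phi x - ((o1 == o0)%:R * v x + coord3 x o1 * dv o0 x) * Phi x)))).
  rewrite (IntD (intgD (intgD (j1 _) (j1 _)) (j1 _)) j23) (IntD (intgD (j1 _) (j1 _)) (j1 _)) (IntD (j1 _) (j1 _)).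
  by rewrite (IntZ _ (intgB j2 j3)) (IntB j2 j3); ring.
rewrite -IntN; last exact: intgD (intgD (intgD (j1 _) (j1 _)) (j1 _)) j23.
by apply: eq_Int => x; rewrite -eq sum3 /rotd /coord3 /tnth /=; ring.
Qed.

Lemma classical_sol ka u v f g du dv ddu ddv : C1 u du -> C1 v dv -> (forall j, C1 (du j) (ddu j)) ->
  (forall j, C1 (dv j) (ddv j)) -> continuous f -> continuous g ->
  (forall y, - (\sum_j ddu j j y) - 2 * ka * rotd dv y = f y) ->
  (forall y, - (\sum_j ddv j j y) + 2 * ka * rotd du y = g y) -> sol ka u v f g du dv.
Proof.
move=> hu hv hdu hdv cf cg e1 e2; split => // Phi dPhi hP cP; split; first exact: (classical_sol1 hu hv hdu cf e1 hP cP).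
have e2' y : - (\sum_j ddv j j y) - 2 * ka * rotd (fun j x => - du j x) y = g y by rewrite -e2 /rotd; ring.
rewrite -(classical_sol1 hv (C1N hu) hdv cg e2' hP cP).
by apply: eq_Int => x; rewrite mulNr mulrN.
Qed.

(** The coefficient of the magnetic term is taken at [x], where it should be taken at [y]. The error
    vanishes: the rotated vector [x - y] is orthogonal to the gradient of a radial kernel at
    [x - y], so mollification commutes with the rotation derivative. *)
Lemma mollify_sol1 ka u v (c : R) la y : continuous u -> continuous v -> 0 < la ->
   Int (fun x => u x * - (\sum_j ddBm la j j (x - y)) + 2 * ka * (v x * (x.1.1 * dBm la o1 (x - y) - x.1.2 * dBm la o0 (x - y)))) = c ->
   - (\sum_j - - cconv u (ddBm la j j) y) - 2 * ka * rotd (fun j y => - cconv v (dBm la j) y) y = c.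
Proof.
move=> cu cv la0 <-; have hc := Cc_Bm la0; have hd j := C1_Cc j (C1_Bm la) hc.
have hdd j i := C1_Cc i (C1_dBm la j) (hd j).
have i1 j := conv_intg y cu (hdd j j); have i2 j := conv_intg y cv (hd j).
rewrite sum3 /rotd /cconv.
transitivity (Int (fun x : R3 R => (2 * ka) * (y.1.1 * (v x * dBm la o1 (x - y)) - y.1.2 * (v x * dBm la o0 (x - y)))
  - (u x * ddBm la o0 o0 (x - y) + u x * ddBm la o1 o1 (x - y) + u x * ddBm la o2 o2 (x - y)))).
  have k1 := intgB (intgZ y.1.1 (i2 o1)) (intgZ y.1.2 (i2 o0)).
  rewrite (IntB (intgZ _ k1) (intgD (intgD (i1 o0) (i1 o1)) (i1 o2))) (IntZ _ k1) (IntB (intgZ y.1.1 (i2 o1)) (intgZ y.1.2 (i2 o0))).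
  rewrite (IntD (intgD (i1 o0) (i1 o1)) (i1 o2)) (IntD (i1 o0) (i1 o1)) !IntZ//; genInt; ring.
apply: eq_Int => x; rewrite sum3 /dBm !coordB /coord3 /tnth /=; ring.
Qed.

Lemma mollify_sol ka u v f g la : magsol ka u v f g -> 0 < la ->
  sol ka (cconv u (Bm la)) (cconv v (Bm la)) (cconv f (Bm la)) (cconv g (Bm la))
   (fun j y => - cconv u (dBm la j) y) (fun j y => - cconv v (dBm la j) y).
Proof.
move=> [cu cv cf cg h] la0; have hc := Cc_Bm la0; have hB := C1_Bm la.
have hd j := C1_Cc j hB hc.
apply: classical_sol; [exact: conv_C1|exact: conv_C1| | |exact: conv_cont|exact: conv_cont| |].
- by move=> j; exact: C1N (conv_C1 cu (C1_dBm la j) (hd j)).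
- by move=> j; exact: C1N (conv_C1 cv (C1_dBm la j) (hd j)).
- by move=> y; apply: mollify_sol1 => //; have [] := h la y la0.
- move=> y; have [_ h2] := h la y la0.
  have := @mollify_sol1 ka v (fun x => - u x) _ la y cv (contN cu) la0 erefl.
  move=> e; rewrite -[RHS]h2 [RHS](@eq_Int _ _ (fun x => v x * - (\sum_j ddBm la j j (x - y))
    + 2 * ka * (- u x * (x.1.1 * dBm la o1 (x - y) - x.1.2 * dBm la o0 (x - y))))); last by move=> x; ring.
  rewrite -e /rotd.
  have eN j : cconv (fun x => - u x) (dBm la j) y = - cconv u (dBm la j) y.
    rewrite /cconv -IntN; last exact: conv_intg.
    by apply: eq_Int => x; rewrite mulNr.
  by rewrite !eN; ring.
Qed.

Lemma Bm_mass_gt0 la : 0 < la -> 0 < Int (Bm la).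
Proof.
move=> la0; apply: (@Int_gt0 _ _ 0); [exact: Cc_Bm|by move=> x; exact: Bm_ge0|].
by rewrite /Bm /bmp enorm2E /= !expr0n /= !addr0 mulr0 subr0 ebump_gt0.
Qed.

Definition mol u (n : nat) y : R := (Int (Bm n.+1%:R))^-1 * cconv u (Bm n.+1%:R) y.

Definition locunif (u_ : nat -> R3 R -> R) u := forall r e : R, 0 < e ->
  exists N, forall n, (N <= n)%N -> forall x, `|x| <= r -> `|u_ n x - u x| <= e.

Lemma mol_locunif u : continuous u -> locunif (mol u) u.
Proof.
move=> cu r e e0; have [d d0 hd] := unif_cont r cu e0.
(* The index makes [n + 1] at least the square of [truncn (2 / d) + 1], so that the bump
   [Bm (n + 1)], of radius [(n + 1)^(-1/2)], is supported within [d / 2]. *)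
exists (Num.truncn (2 / d) ^ 2 + 2 * Num.truncn (2 / d) + 1)%N => n hn y yr; rewrite /mol.
set la : R := n.+1%:R; have la0 : 0 < la by rewrite ltr0n.
have m0 := Bm_mass_gt0 la0; have hc := Cc_Bm la0; have iB := Cc_intg hc.
have d2 : 0 <= d / 2 by lra.
have laB : 1 <= la * (d / 2) ^+ 2.
  have h1 : 2 / d < (Num.truncn (2 / d)).+1%:R by exact: truncnS_gt.
  have h2 : (Num.truncn (2 / d)).+1%:R ^+ 2 <= la.
    by rewrite -natrX ler_nat -addn1 sqrnD muln1 exp1n addnAC; apply: leq_trans hn (leqnSn _).
  have q0 : 0 < 2 / d by rewrite divr_gt0.
  have h3 : (2 / d) ^+ 2 <= la by apply: le_trans h2; rewrite ler_sqr ?nnegrE// ltW.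
  apply: le_trans (_ : (2 / d) ^+ 2 * (d / 2) ^+ 2 <= _).
    by rewrite -exprMn (_ : 2 / d * (d / 2) = 1) ?expr1n//; field; rewrite gt_eqF.
  by apply: ler_wpM2r => //; exact: sqr_ge0.
have hv := Bm_vanish la0 d2 laB.
rewrite -(ler_pM2l m0) -[X in X * `|_|](gtr0_norm m0) -normrM mulrBr mulVKf ?gt_eqF// convE//.
have cs := @cont_shift _ u y cu.
have i1 : intg (fun z : R3 R => u (z + y) * Bm la z) by apply: Cc_intg; exact: Cc_mulr.
rewrite [Int (Bm la) * u y]mulrC -[X in _ - X](IntZ _ iB) -IntB//; last exact: intgZ.
have key z : `|u (z + y) * Bm la z - u y * Bm la z| <= e * Bm la z.
  rewrite -mulrBl normrM [`|Bm _ _|]ger0_norm ?Bm_ge0//.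
  have [zd|/hv ->] := leP `|z| (d / 2); last by rewrite !mulr0.
  apply: ler_wpM2r; first exact: Bm_ge0.
  rewrite distrC ltW// hd// opprD addrCA subrr addr0 normrN; lra.
have ib := intgB i1 (intgZ (u y) iB); have ie := intgZ e iB.
rewrite mulrC -(IntZ _ iB) ler_norml -IntN//; apply/andP; split; apply: le_Int => //.
- by have := intgZ (-1) ie; under eq_fun do rewrite mulN1r.
- by move=> x; have := key x; rewrite ler_norml => /andP[].
- by move=> x; have := key x; rewrite ler_norml => /andP[].
Qed.

Lemma sol_lin ka (a b : R) u v f g du dv u' v' f' g' du' dv' : sol ka u v f g du dv -> sol ka u' v' f' g' du' dv' ->
  sol ka (fun x => a * u x + b * u' x) (fun x => a * v x + b * v' x) (fun x => a * f x + b * f' x)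
    (fun x => a * g x + b * g' x) (fun j x => a * du j x + b * du' j x) (fun j x => a * dv j x + b * dv' j x).
Proof.
move=> [hu hv cf cg h] [hu' hv' cf' cg' h'].
split; [exact: C1D (C1Z a hu) (C1Z b hu')|exact: C1D (C1Z a hv) (C1Z b hv')|by cont|by cont|].
move=> Phi dPhi hP cP; have [h1 h2] := h _ _ hP cP; have [h1' h2'] := h' _ _ hP cP.
have [cu cdu _] := hu; have [cv cdv _] := hv; have [cu' cdu' _] := hu'; have [cv' cdv' _] := hv'.
have [cP0 cdP _] := hP; have [_ [r hr]] := cP.
have iP (c : R3 R -> R) : continuous c -> intg (fun x => c x * Phi x) by move=> cc; apply: Cc_intg; exact: Cc_mulr.
have i1 (c : R) (w : R3 R -> R) (dw : 'I_3 -> R3 R -> R) : (forall j, continuous (dw j)) -> continuous w -> intg (fun x => gdot dw dPhi x + 2 * c * (w x * rotd dPhi x)).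
  move=> cdw cw; apply: Cc_intg; split; first by rewrite /gdot /rotd; cont.
  by exists r => x xr; rewrite /gdot /rotd sum3 !(C1_vanish hP hr _ xr) !(mulr0, addr0, subr0).
have E (c : R) (w : R3 R -> R) (dw : 'I_3 -> R3 R -> R) (w' : R3 R -> R) (dw' : 'I_3 -> R3 R -> R) (F F' : R3 R -> R) : (forall j, continuous (dw j)) -> continuous w ->
   (forall j, continuous (dw' j)) -> continuous w' -> continuous F -> continuous F' ->
   Int (fun x => gdot dw dPhi x + 2 * c * (w x * rotd dPhi x)) = Int (fun x => F x * Phi x) ->
   Int (fun x => gdot dw' dPhi x + 2 * c * (w' x * rotd dPhi x)) = Int (fun x => F' x * Phi x) ->
   Int (fun x => gdot (fun j x => a * dw j x + b * dw' j x) dPhi x + 2 * c * ((a * w x + b * w' x) * rotd dPhi x)) =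
   Int (fun x => (a * F x + b * F' x) * Phi x).
  move=> c1 c2 c3 c4 c5 c6 e1 e2.
  have j1 := i1 c _ _ c1 c2; have j2 := i1 c _ _ c3 c4; have j3 := iP _ c5; have j4 := iP _ c6.
  rewrite [RHS](@eq_Int _ _ (fun x => a * (F x * Phi x) + b * (F' x * Phi x))); last by move=> x; ring.
  rewrite (IntD (intgZ a j3) (intgZ b j4)) (IntZ a j3) (IntZ b j4) -e1 -e2 -(IntZ a j1) -(IntZ b j2).
  rewrite -(IntD (intgZ a j1) (intgZ b j2)); apply: eq_Int => x; rewrite /gdot !sum3; ring.
split; first exact: E.
have S (c : R) (w : R3 R -> R) (dw : 'I_3 -> R3 R -> R) : Int (fun x => gdot dw dPhi x - 2 * c * (w x * rotd dPhi x)) =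
   Int (fun x => gdot dw dPhi x + 2 * - c * (w x * rotd dPhi x)) by apply: eq_Int => x; ring.
by rewrite S; apply: E => //; rewrite -S.
Qed.

Lemma near_ge_cauchy (a : nat -> R) (l : R) (e : R) N : a n @[n --> \oo] --> l ->
  (forall n m, (N <= n)%N -> (N <= m)%N -> `|a n - a m| <= e) -> forall n, (N <= n)%N -> `|a n - l| <= e.
Proof.
move=> al h n Nn; apply/ler_addgt0Pr => d d0.
move/cvgrPdist_le : al => /(_ d d0) hd.
near \oo => m; have h1 : `|a n - a m| <= e by apply: h => //; near: m; exact: nbhs_infty_ge.
have h2 : `|l - a m| <= d by near: m.
by have := ler_distD (a m) (a n) l; rewrite [`|a m - l|]distrC; lra.
Unshelve. all: by end_near. Qed.

Lemma locunif_cont (u_ : nat -> R3 R -> R) u : (forall n, continuous (u_ n)) -> locunif u_ u -> continuous u.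
Proof.
move=> cu h x; apply/cvgrPdist_le => e e0; have e3 : 0 < e / 3 by lra.
have [N hN] := h (`|x| + 1) _ e3.
move/cvgrPdist_le : (cu N x) => /(_ _ e3) hc.
near=> y; have h1 : `|u_ N x - u_ N y| <= e / 3 by near: y.
have h2 : `|u_ N x - u x| <= e / 3 by apply: hN => //; lra.
have h3 : `|u_ N y - u y| <= e / 3.
  apply: hN => //; have : `|x - y| < 1 by near: y; exact: cvgr_dist_lt.
  by have := ler_distD x y 0; rewrite !subr0 [`|y - x|]distrC; lra.
have := ler_distD (u_ N x) (u x) (u y); have := ler_distD (u_ N y) (u_ N x) (u y).
by rewrite [`|u x - u_ N x|]distrC; lra.
Unshelve. all: by end_near. Qed.

Definition loccauchy (d_ : nat -> R3 R -> R) := forall r e : R, 0 < e -> exists N, forall n m, (N <= n)%N -> (N <= m)%N ->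
  forall x, `|x| <= r -> `|d_ n x - d_ m x| <= e.

Lemma loccauchy_lim (d_ : nat -> R3 R -> R) : loccauchy d_ -> exists d, locunif d_ d.
Proof.
move=> h.
have cv x : cvgn (fun n => d_ n x).
  apply: cauchy_cvg; apply: cauchy_exP => e e0; have e2 : 0 < e / 2 by lra.
  have [N hN] := h `|x| _ e2; exists (d_ N x).
  change (\forall n \near \oo, ball (d_ N x) e (d_ n x)); near=> n.
  rewrite /ball /=; apply: le_lt_trans (_ : e / 2 < e); last by lra.
  by apply: hN => //; near: n; exact: nbhs_infty_ge.
exists (fun x => lim (d_ n x @[n --> \oo])) => r e e0.
have [N hN] := h r e e0; exists N => n Nn x xr.
exact: (near_ge_cauchy (cv x) (fun n m Nn Nm => hN n m Nn Nm x xr) Nn).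
Unshelve. all: by end_near. Qed.

(** The mean value theorem is applied to [u_n - u_m], and then [m] tends to infinity: the difference
    quotients converge uniformly in the step, which allows the two limits to be exchanged. *)
Lemma C1_limit (u_ : nat -> R3 R -> R) (du_ : nat -> 'I_3 -> R3 R -> R) u : (forall n, C1 (u_ n) (du_ n)) ->
  locunif u_ u -> (forall j, loccauchy (du_ ^~ j)) -> exists du, C1 u du /\ forall j, locunif (du_ ^~ j) (du j).
Proof.
move=> hC lu hd; have hd' j := cid (loccauchy_lim (hd j)).
pose du j := sval (hd' j); have ldu j : locunif (du_ ^~ j) (du j) := svalP (hd' j).
exists du; split => //; split; first by apply: (@locunif_cont u_) => // n; case: (hC n).
  by move=> j; apply: (@locunif_cont (du_ ^~ j)) => // n; case: (hC n).
move=> j x.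
have cvu y : u_ n y @[n --> \oo] --> u y.
  apply/cvgrPdist_le => e e0; have [N hN] := lu `|y| e e0.
  by near=> n; rewrite distrC; apply: hN => //; near: n; exact: nbhs_infty_ge.
have H : h^-1 *: ((u \o shift x) (h *: axis_vec j) - u x) @[h --> (0 : R)^'] --> du j x.
  apply/cvgrPdist_le => e e0; have e3 : 0 < e / 3 by lra.
  have [N hN] := hd j (`|x| + 1) _ e3; have [N' hN'] := ldu j (`|x| + 1) _ e3.
  pose M := maxn N N'; have NM : (N <= M)%N by rewrite leq_maxl.
  have N'M : (N' <= M)%N by rewrite leq_maxr.
  have [_ _ hM] := hC M; have [d1 d2] := hM j x.
  have /cvgrPdist_le/(_ _ e3) hq : h^-1 *: ((u_ M \o shift x) (h *: axis_vec j) - u_ M x) @[h --> (0 : R)^'] --> du_ M j x.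
    by rewrite -d2; exact: d1.
  near=> t; have tn : t != 0 by near: t; exact: nbhs_dnbhs_neq.
  have t1 : `|t| < 1 by near: t; exact: dnbhs0_lt.
  have h1 : `|du_ M j x - t^-1 *: ((u_ M \o shift x) (t *: axis_vec j) - u_ M x)| <= e / 3 by near: t.
  have h2 : `|du_ M j x - du j x| <= e / 3 by apply: hN' => //; lra.
  have tp : 0 < `|t| by rewrite normr_gt0.
  have h3 : `|(u_ M (t *: axis_vec j + x) - u_ M x) - (u (t *: axis_vec j + x) - u x)| <= e / 3 * `|t|.
    have cvd : u_ n (t *: axis_vec j + x) - u_ n x @[n --> \oo] --> u (t *: axis_vec j + x) - u x by exact: cvgB.
    apply: (near_ge_cauchy cvd (N := N)) => // n m Nn Nm.
    have := @C1_lip _ (fun y => u_ n y - u_ m y) _ (`|x| + 1) (e / 3) j (C1B (hC n) (hC m)) (fun y => hN n m Nn Nm y) x t.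
    have -> : u_ n (t *: axis_vec j + x) - u_ n x - (u_ m (t *: axis_vec j + x) - u_ m x) =
      u_ n (t *: axis_vec j + x) - u_ m (t *: axis_vec j + x) - (u_ n x - u_ m x) by ring.
    apply; first by lra.
    by apply: le_trans (ler_normD _ _) _; rewrite normrZ norm_axis mulr1; lra.
  have h4 : `|t^-1 *: ((u_ M \o shift x) (t *: axis_vec j) - u_ M x) - t^-1 *: ((u \o shift x) (t *: axis_vec j) - u x)| <= e / 3.
    by rewrite /GRing.scale /= -mulrBr normrM normfV ler_pdivrMl// mulrC.
  move: h1 h2 h4; set A := t^-1 *: _; set B := t^-1 *: _ => h1 h2 h4.
  have := ler_distD (du_ M j x) (du j x) B; have := ler_distD A (du_ M j x) B.
  by rewrite [`|du j x - du_ M j x|]distrC; lra.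
by split; [apply/cvg_ex; eexists; exact: H|exact: cvg_lim].
Unshelve. all: by end_near. Qed.

Lemma lin5 (k a0 a1 a2 a3 a4 b0 b1 b2 b3 b4 c0 c1 c2 c3 c4 : R) : b0 + b1 + b2 + k * b3 = b4 ->
  `|b0 - a0| <= c0 -> `|b1 - a1| <= c1 -> `|b2 - a2| <= c2 -> `|b3 - a3| <= c3 -> `|b4 - a4| <= c4 ->
  `|a0 + a1 + a2 + k * a3 - a4| <= c0 + c1 + c2 + `|k| * c3 + c4.
Proof.
move=> E h0 h1 h2 h3 h4.
have h5 : `|k * b3 - k * a3| <= `|k| * c3 by rewrite -mulrBr normrM ler_wpM2l.
move: h0 h1 h2 h4 h5; rewrite !ler_norml => /andP[? ?] /andP[? ?] /andP[? ?] /andP[? ?] /andP[? ?].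
apply/andP; split; lra.
Qed.

Lemma sol_limit1 ka (v_ f_ : nat -> R3 R -> R) (du_ : nat -> 'I_3 -> R3 R -> R) v f du Phi dPhi :
  (forall n, Int (fun x => gdot (du_ n) dPhi x + 2 * ka * (v_ n x * rotd dPhi x)) = Int (fun x => f_ n x * Phi x)) ->
  (forall n, continuous (v_ n)) -> (forall n, continuous (f_ n)) -> (forall n j, continuous (du_ n j)) ->
  locunif v_ v -> locunif f_ f -> (forall j, locunif (du_ ^~ j) (du j)) ->
  C1 Phi dPhi -> Cc Phi ->
  Int (fun x => gdot du dPhi x + 2 * ka * (v x * rotd dPhi x)) = Int (fun x => f x * Phi x).
Proof.
move=> E cv_ cf_ cdu_ lv lf ldu hP cP.
have cv := locunif_cont cv_ lv; have cf := locunif_cont cf_ lf.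
have cdu j := locunif_cont (fun n => cdu_ n j) (ldu j).
have [r r0 hr] := vanish_ge0 cP; have vP j := C1_vanish hP hr j.
have [cP0 cdP _] := hP.
have crot : continuous (rotd dPhi) by rewrite /rotd; cont.
have vrot : vanish r (rotd dPhi) by move=> x xr; rewrite /rotd !vP// !mulr0 subr0.
have bnd k : continuous k -> exists2 C : R, 0 <= C & vanish r k -> forall x, `|k x| <= C.
  move=> ck; have [C C0 hC] := cont_bounded r ck; exists C => // hv x.
  by have [xr|/hv ->] := leP `|x| r; [exact: hC|rewrite normr0].
have [C0 C00 /(_ (vP o0)) hC0] := bnd _ (cdP o0); have [C1 C10 /(_ (vP o1)) hC1] := bnd _ (cdP o1).
have [C2 C20 /(_ (vP o2)) hC2] := bnd _ (cdP o2); have [C3 C30 /(_ vrot) hC3] := bnd _ crot.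
have [C4 C40 /(_ hr) hC4] := bnd _ cP0.
pose W : R := (2 * r) ^+ 3; have W0 : 0 <= W by rewrite exprn_ge0// mulr_ge0.
apply/eqP; rewrite -subr_eq0 -normr_le0; apply/ler_addgt0Pr => e e0; rewrite add0r.
pose D : R := (C0 + C1 + C2 + 2 * `|ka| * C3 + C4) * W + 1.
have kC : 0 <= 2 * `|ka| * C3 by rewrite !mulr_ge0.
have D0 : 0 < D by rewrite ltr_pwDr// mulr_ge0//; lra.
have e1 : 0 < e / D by rewrite divr_gt0.
have [N0 h0] := ldu o0 r _ e1; have [N1 h1] := ldu o1 r _ e1; have [N2 h2] := ldu o2 r _ e1.
have [N3 h3] := lv r _ e1; have [N4 h4] := lf r _ e1.
pose n := (N0 + N1 + N2 + N3 + N4)%N.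
have l0 : (N0 <= n)%N by rewrite /n -!addnA leq_addr.
have l1 : (N1 <= n)%N by rewrite /n (addnC N0) -!addnA leq_addr.
have l2 : (N2 <= n)%N by rewrite /n (addnC (N0 + N1)%N) -!addnA leq_addr.
have l3 : (N3 <= n)%N by rewrite /n (addnC _ N3) -!addnA leq_addr.
have l4 : (N4 <= n)%N by rewrite /n leq_addl.
have i0 (w : R3 R -> R) j : continuous w -> intg (fun x => w x * dPhi j x) by move=> cw; exact: intg_mul (vP j).
have i3 (w : R3 R -> R) : continuous w -> intg (fun x => w x * rotd dPhi x) by move=> cw; exact: intg_mul vrot.
have ex (dw : 'I_3 -> R3 R -> R) (w : R3 R -> R) : (forall j, continuous (dw j)) -> continuous w ->
  Int (fun x => gdot dw dPhi x + 2 * ka * (w x * rotd dPhi x)) = Int (fun x => dw o0 x * dPhi o0 x) +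
   Int (fun x => dw o1 x * dPhi o1 x) + Int (fun x => dw o2 x * dPhi o2 x) + 2 * ka * Int (fun x => w x * rotd dPhi x).
  move=> cdw cw; have k0 := i0 _ o0 (cdw o0); have k1 := i0 _ o1 (cdw o1); have k2 := i0 _ o2 (cdw o2).
  rewrite -(IntZ _ (i3 _ cw)) -(IntD k0 k1) -(IntD (intgD k0 k1) k2) -(IntD (intgD (intgD k0 k1) k2) (intgZ _ (i3 _ cw))).
  by apply: eq_Int => x; rewrite /gdot sum3.
have EE := E n; rewrite !ex// in EE *.
apply: le_trans (lin5 EE (Int_diff_bound (cdu_ n o0) (cdu o0) (cdP o0) r0 (ltW e1) (vP o0) hC0 (h0 n l0))
  (Int_diff_bound (cdu_ n o1) (cdu o1) (cdP o1) r0 (ltW e1) (vP o1) hC1 (h1 n l1))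
  (Int_diff_bound (cdu_ n o2) (cdu o2) (cdP o2) r0 (ltW e1) (vP o2) hC2 (h2 n l2))
  (Int_diff_bound (cv_ n) cv crot r0 (ltW e1) vrot hC3 (h3 n l3))
  (Int_diff_bound (cf_ n) cf cP0 r0 (ltW e1) hr hC4 (h4 n l4))) _.
rewrite -/W normrM [`|2|]ger0_norm//.
have -> : e / D * C0 * W + e / D * C1 * W + e / D * C2 * W + 2 * `|ka| * (e / D * C3 * W) + e / D * C4 * W =
  e * (D - 1) / D by rewrite /D; ring.
by rewrite ler_pdivrMr// ler_pM2l//; clear; lra.
Qed.

Lemma sol_limit ka (u_ v_ f_ g_ : nat -> R3 R -> R) (du_ dv_ : nat -> 'I_3 -> R3 R -> R) u v f g : `|ka| <= 1 ->
  (forall n, sol ka (u_ n) (v_ n) (f_ n) (g_ n) (du_ n) (dv_ n)) ->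
  locunif u_ u -> locunif v_ v -> locunif f_ f -> locunif g_ g -> exists du dv, sol ka u v f g du dv.
Proof.
move=> ka1 hs lu lv lf lg.
have lc (w_ : nat -> R3 R -> R) w (r e : R) : locunif w_ w -> 0 < e -> exists N, forall n m, (N <= n)%N -> (N <= m)%N ->
   forall x, `|x| <= r -> `|1 * w_ n x + -1 * w_ m x| <= e.
  move=> h e0; have e2 : 0 < e / 2 by lra.
  have [N hN] := h r _ e2; exists N => n m Nn Nm x xr.
  have := hN n Nn x xr; have := hN m Nm x xr; have := ler_distD (w x) (w_ n x) (w_ m x).
  by rewrite mul1r mulN1r [`|w x - _|]distrC; lra.
have grad (u1_ v1_ f1_ g1_ : nat -> R3 R -> R) (du1_ dv1_ : nat -> 'I_3 -> R3 R -> R) (u1 v1 f1 g1 : R3 R -> R) : (forall n, sol ka (u1_ n) (v1_ n) (f1_ n) (g1_ n) (du1_ n) (dv1_ n)) ->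
  locunif u1_ u1 -> locunif v1_ v1 -> locunif f1_ f1 -> locunif g1_ g1 -> forall j, loccauchy (du1_ ^~ j).
  move=> hs1 lu1 lv1 lf1 lg1 j r0 e e0; pose r := Num.max 0 r0.
  have r_ge0 : 0 <= r by rewrite le_max lexx.
  have gb0 : 0 <= @gbd R r by rewrite /gbd addr_ge0// mulr_ge0// sqr_ge0.
  have m0 := @mass_gt0 R.
  have C0 : 0 <= @Cgrad R r.
    have q0 : 0 <= (1 + @gbd R r) / mass by apply: divr_ge0; [lra|exact: ltW].
    by rewrite /Cgrad -mulrA; lra.
  have e1 : 0 < e / (@Cgrad R r + 1) by rewrite divr_gt0//; lra.
  have [N1 h1] := lc _ _ (r + 1) _ lu1 e1; have [N2 h2] := lc _ _ (r + 1) _ lv1 e1.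
  have [N3 h3] := lc _ _ (r + 1) _ lf1 e1; have [N4 h4] := lc _ _ (r + 1) _ lg1 e1.
  exists (maxn (maxn N1 N2) (maxn N3 N4)) => n m; rewrite !geq_max => /andP[/andP[n1 n2] /andP[n3 n4]] /andP[/andP[m1 m2] /andP[m3 m4]] x xr.
  have xr' : `|x| <= r by apply: le_trans xr _; rewrite le_max lexx orbT.
  have := sol_grad r_ge0 xr' ka1 j (sol_lin 1 (-1) (hs1 n) (hs1 m)).
  move=> /(_ (e / (@Cgrad R r + 1))) /=; rewrite mul1r mulN1r => hh.
  apply: le_trans (hh _) _.
    move=> y yx; have yr : `|y| <= r + 1.
      by have := ler_distD x y 0; rewrite !subr0; clear -xr' yx; lra.
    by split; [exact: h1|exact: h2|exact: h3|exact: h4].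
  by rewrite mulrA ler_pdivrMr ?(mulrC _ e) ?ler_pM2l//; clear -C0; lra.
have hs' n := sol_sym (hs n).
have lN (w_ : nat -> R3 R -> R) w : locunif w_ w -> locunif (fun n x => - w_ n x) (fun x => - w x).
  move=> h r e e0; have [N hN] := h r e e0; exists N => n Nn x xr.
  by rewrite -opprD normrN; exact: hN.
have cu n : C1 (u_ n) (du_ n) by case: (hs n).
have cv n : C1 (v_ n) (dv_ n) by case: (hs n).
have cf n : continuous (f_ n) by case: (hs n).
have cg n : continuous (g_ n) by case: (hs n).
have [du [hu ldu]] := C1_limit cu lu (grad _ _ _ _ _ _ _ _ _ _ hs lu lv lf lg).
have [dv [hv ldv]] := C1_limit cv lv (grad _ _ _ _ _ _ _ _ _ _ hs' lv (lN _ _ lu) lg (lN _ _ lf)).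
exists du, dv; split => //; [exact: locunif_cont cf lf|exact: locunif_cont cg lg|].
move=> Phi dPhi hP cP; split.
  have h1 n : Int (fun x => gdot (du_ n) dPhi x + 2 * ka * (v_ n x * rotd dPhi x)) = Int (fun x => f_ n x * Phi x).
    by have [_ _ _ _ h] := hs n; have [] := h _ _ hP cP.
  have h2 n : continuous (v_ n) by case: (cv n).
  have h3 n j : continuous (du_ n j) by case: (cu n).
  exact: (sol_limit1 h1 h2 cf h3 lv lf ldu hP cP).
have eN (ww : R3 R -> R) (dw : 'I_3 -> R3 R -> R) : Int (fun x => gdot dw dPhi x - 2 * ka * (ww x * rotd dPhi x)) = Int (fun x => gdot dw dPhi x + 2 * ka * (- ww x * rotd dPhi x)).
  by apply: eq_Int => x; ring.
have h1 n : Int (fun x => gdot (dv_ n) dPhi x + 2 * ka * (- u_ n x * rotd dPhi x)) = Int (fun x => g_ n x * Phi x).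
  by have [_ _ _ _ h] := hs n; have [_ <-] := h _ _ hP cP; rewrite eN.
have h2 n : continuous (fun x => - u_ n x) by apply: contN; case: (cu n).
have h3 n j : continuous (dv_ n j) by case: (cv n).
by rewrite eN; exact: (sol_limit1 h1 h2 cg h3 (lN _ _ lu) lg ldv hP cP).
Qed.

(** Elliptic regularity. It serves alike for the Gross-Pitaevskii solution, for [Q], for the
    derivatives of [Q], and for the pair [(D, E)]. *)
Theorem magsol_sol ka u v f g : `|ka| <= 1 -> magsol ka u v f g -> exists du dv, sol ka u v f g du dv.
Proof.
move=> ka1 hm; have [cu cv cf cg _] := hm.
have n0 n : 0 < n.+1%:R :> R by rewrite ltr0n.
have hs n := sol_lin (Int (Bm n.+1%:R))^-1 0 (mollify_sol hm (n0 n)) (mollify_sol hm (n0 n)).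
have E (w : R3 R -> R) : continuous w -> locunif (fun n x => (Int (Bm n.+1%:R))^-1 * cconv w (Bm n.+1%:R) x + 0 * cconv w (Bm n.+1%:R) x) w.
  move=> cw r e e0; have [N hN] := mol_locunif cw r e0; exists N => n Nn x xr.
  by rewrite mul0r addr0; exact: hN.
exact: (sol_limit ka1 hs (E _ cu) (E _ cv) (E _ cf) (E _ cg)).
Qed.
End Mollification.

(** * Square integrable weak derivatives and test functions *)

Section WeakDerivatives.
Context {R : realType}.
Local Notation X1 := (measurableTypeR R).
Local Notation X3 := (measurableTypeR R * measurableTypeR R * measurableTypeR R)%type.
Local Notation mu := (@lebesgue3 R).
Implicit Types (f g h u k phi : R3 R -> R) (dk : 'I_3 -> R3 R -> R) (x y : R3 R) (s t : R).

Definition meas f := measurable_fun setT (f : X3 -> X1).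

Lemma meas_cont f : continuous f -> meas f.
Proof. by move=> cf; have h := measurable_cont cf; exact h. Qed.

Lemma measM f g : meas f -> meas g -> meas (fun x => f x * g x).
Proof. by move=> mf mg; have h := @measurable_funM _ X3 R setT f g mf mg; exact h. Qed.
Lemma measD f g : meas f -> meas g -> meas (fun x => f x + g x).
Proof. by move=> mf mg; have h := @measurable_funD _ X3 R setT f g mf mg; exact h. Qed.
Lemma measX2 f : meas f -> meas (fun x => f x ^+ 2).
Proof. by move=> mf; have := measM mf mf; congr meas; apply/funext => x; rewrite expr2. Qed.

Lemma intg_le f g : meas f -> (forall x, `|f x| <= g x) -> intg g -> intg f.
Proof.
move=> mf fg ig; have /measurable_EFinP mE := mf.
apply: (@le_integrable _ X3 R mu setT measurableT (EFin \o f) (EFin \o g)) => //.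
by move=> x _ /=; rewrite lee_fin (le_trans (fg x))// ler_norm.
Qed.

Lemma sqintE f : square_integrable f <-> meas f /\ intg (fun x => f x ^+ 2).
Proof.
split=> -[mf h]; split; [exact mf| |exact mf|].
  apply/integrableP; split.
    by have /measurable_EFinP h' := @measX2 f mf; exact h'.
  under eq_integral do rewrite /= ger0_norm ?sqr_ge0//; exact h.
have /integrableP[_] := h; under eq_integral do rewrite /= ger0_norm ?sqr_ge0//; by move=> h'; exact h'.
Qed.

Lemma sqintM f g : meas f -> intg (fun x => f x ^+ 2) -> meas g -> intg (fun x => g x ^+ 2) -> intg (fun x => f x * g x).
Proof.
move=> mf i1 mg i2; apply: intg_le (measM mf mg) _ (intgD i1 i2) => x.
rewrite normrM; have := sqr_ge0 (`|f x| - `|g x|); have := sqr_ge0 (f x); have := sqr_ge0 (g x).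
by rewrite sqrrB !real_normK ?num_real//; lra.
Qed.

Lemma Cc_sq f : Cc f -> Cc (fun x => f x ^+ 2).
Proof.
by move=> [cf [r hr]]; split; [cont|exists r => x /hr ->; rewrite expr0n].
Qed.

Lemma sqint_Cc f phi : square_integrable f -> Cc phi -> intg (fun x => f x * phi x).
Proof.
move=> /sqintE[mf i1] cp; apply: sqintM => //; last exact: Cc_intg (Cc_sq cp).
by apply: meas_cont; case: cp.
Qed.

Lemma Int_eq0 f : (forall x, f x = 0) -> Int f = 0.
Proof. by move=> /funext ->; rewrite /Rintegral integral0. Qed.

Lemma test_vanish phi : test_function phi -> exists r, vanish r phi.
Proof.
move=> [_ /compact_bounded hb].
have [M M0 hM] := pinfty_ex_gt0 hb.
exists M => x Mx; apply/eqP/negPn/negP => x0.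
suff: `|x| <= M by rewrite leNgt Mx.
exact: hM x (@subset_closure _ _ x x0).
Qed.

Lemma test_Cc phi : test_function phi -> Cc phi.
Proof. by move=> h; split; [exact: (h.1 [::]).1|exact: test_vanish]. Qed.

Lemma smooth_test phi r : smooth phi -> vanish r phi -> test_function phi.
Proof.
move=> sp hr; split=> //.
apply: (@subclosed_compact _ _ (box r : set (R3 R))); [exact: closed_closure|exact: compact_box|].
have cb : closed (box r : set (R3 R)).
  by apply: compact_closed; [exact: norm_hausdorff|exact: compact_box].
rewrite (closure_id (box r)).1//; apply: closure_subset => x /= h.
by rewrite /box /= leNgt; apply/negP => /hr h0; rewrite h0 eqxx in h.
Qed.

Lemma test_C1 phi : test_function phi -> C1 phi (fun j => partial j phi).
Proof.
move=> [h _]; split; [exact: (h [::]).1|by move=> j; exact: (h [:: j]).1|].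
by move=> j x; split => //; exact: (h [::]).2.
Qed.

Lemma der_scale f (al : R) (a x w : R3 R) d : is_derive (al *: x + a) w f d ->
  is_derive x w (fun y : R3 R => f (al *: y + a)) (al * d).
Proof.
move=> /slice_derive h; apply/slice_derive.
have h1 : is_derive (0 : R) (1 : R) (fun t : R => al * t) al.
  by apply: (der_eq (derZ al (is_derive_id (0 : R) (1 : R)))); rewrite mulr1.
have h' : is_derive (al * (0 : R)) (1 : R) (fun t : R => f (t *: w + (al *: x + a))) d by rewrite mulr0.
have h2 := @der_comp1 _ (fun t : R => f (t *: w + (al *: x + a))) (fun t => al * t) 0 _ _ h' h1.
suff -> : (fun t : R => f (al *: (t *: w + x) + a)) = (fun t : R => f ((al * t) *: w + (al *: x + a))) by [].
by apply/funext => t; congr f; rewrite scalerDr scalerA addrA.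
Qed.

Lemma smooth_affine phi (al : R) (a : R3 R) : smooth phi -> smooth (fun x : R3 R => phi (al *: x + a)).
Proof.
move=> h s.
have E : foldr partial (fun x : R3 R => phi (al *: x + a)) s = fun x : R3 R => al ^+ size s * foldr partial phi s (al *: x + a).
  elim: s => [|j s IH]; first by apply/funext => x; rewrite expr0 mul1r.
  apply/funext => x; rewrite [LHS]/= IH /partial.
  have hd : is_derive (al *: x + a) (axis_vec j) (foldr partial phi s) (foldr partial phi (j :: s) (al *: x + a)).
    by split => //; exact: (h s).2.
  have [_ ->] := derZ (al ^+ size s) (der_scale hd).
  by rewrite [size (j :: s)]/= exprS mulrA [al * _]mulrC.
split; first by rewrite E; apply: contM; [exact: cont_cst|apply: cont_affine; exact: (h s).1].
move=> j x; rewrite E.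
have hd : is_derive (al *: x + a) (axis_vec j) (foldr partial phi s) (partial j (foldr partial phi s) (al *: x + a)).
  by split => //; exact: (h s).2.
by case: (derZ (al ^+ size s) (der_scale hd)).
Qed.

Lemma test_affine phi (al : R) (a : R3 R) : 0 < al -> test_function phi -> test_function (fun x : R3 R => phi (al *: x + a)).
Proof.
move=> al0 tp; have [r hr] := test_vanish tp.
apply: (@smooth_test _ ((r + `|a|) / al)); first exact: smooth_affine tp.1.
move=> x; rewrite ltr_pdivrMr// => xr; apply: hr.
have := lerB_normD (al *: x) a; rewrite normrZ gtr0_norm//; lra.
Qed.

Lemma sqint_lin (a b : R) f g : square_integrable f -> square_integrable g -> square_integrable (fun x => a * f x + b * g x).
Proof.
move=> /sqintE[mf i1] /sqintE[mg i2]; apply/sqintE.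
have mfg : meas (fun x => a * f x + b * g x).
  by apply: measD; apply: measM => //; apply: meas_cont; exact: cont_cst.
split => //; apply: intg_le (measX2 mfg) _ (intgD (intgZ (2 * a ^+ 2) i1) (intgZ (2 * b ^+ 2) i2)) => x.
rewrite ger0_norm ?sqr_ge0//; have := sqr_ge0 (a * f x - b * g x).
by rewrite sqrrB sqrrD !exprMn; lra.
Qed.

Lemma weak_lin j (a b : R) f g f' g' : square_integrable f -> square_integrable g -> square_integrable f' -> square_integrable g' ->
  weak_partial j f f' -> weak_partial j g g' -> weak_partial j (fun x => a * f x + b * g x) (fun x => a * f' x + b * g' x).
Proof.
move=> sf sg sf' sg' h1 h2 phi tp; have cp := test_Cc tp; have cdp := C1_Cc j (test_C1 tp) cp.
have i1 := sqint_Cc sf cdp; have i2 := sqint_Cc sg cdp; have j1 := sqint_Cc sf' cp; have j2 := sqint_Cc sg' cp.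
rewrite [LHS](@eq_Int _ _ (fun x => a * (f x * partial j phi x) + b * (g x * partial j phi x))); last by move=> x; ring.
rewrite [X in - X](@eq_Int _ _ (fun x => a * (f' x * phi x) + b * (g' x * phi x))); last by move=> x; ring.
rewrite (IntD (intgZ a i1) (intgZ b i2)) (IntZ a i1) (IntZ b i2) h1// h2//.
by rewrite (IntD (intgZ a j1) (intgZ b j2)) (IntZ a j1) (IntZ b j2); genInt; ring.
Qed.

Lemma sqint_affine f (al : R) (a : R3 R) : 0 < al -> square_integrable f -> square_integrable (fun x : R3 R => f (al *: x + a)).
Proof.
move=> al0 /sqintE[mf i1]; apply/sqintE; split.
  have [_ mT _] := scales_affine a al0; have h := measurableT_comp mf mT; exact h.
by have [] := Int_affine a al0 i1.
Qed.

Lemma weak_affine j f f' (al : R) (a : R3 R) : 0 < al -> square_integrable f -> square_integrable f' -> weak_partial j f f' ->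
  weak_partial j (fun x : R3 R => f (al *: x + a)) (fun x : R3 R => al * f' (al *: x + a)).
Proof.
move=> al0 sf sf' h phi tp.
have ai : 0 < al^-1 by rewrite invr_gt0.
pose psi (y : R3 R) := phi (al^-1 *: y + - (al^-1 *: a)).
have tpsi : test_function psi by exact: test_affine.
have Ti x : al^-1 *: (al *: x + a) + - (al^-1 *: a) = x.
  by rewrite scalerDr addrK scalerA mulVf ?gt_eqF// scale1r.
have E x : phi x = psi (al *: x + a) by rewrite /psi Ti.
clearbody psi.
have Ed x : partial j phi x = al * partial j psi (al *: x + a).
  have [_ _ hd] := test_C1 tpsi.
  have [_ <-] := der_scale (hd j (al *: x + a)).
  have Ef : phi = (fun y : R3 R => psi (al *: y + a)) by apply/funext.
  by rewrite /partial Ef.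
have cp := test_Cc tpsi; have cdp := C1_Cc j (test_C1 tpsi) cp.
have i1 := sqint_Cc sf cdp; have j1 := sqint_Cc sf' cp.
have [k1 e1] := Int_affine a al0 i1; have [k2 e2] := Int_affine a al0 j1.
rewrite [LHS](@eq_Int _ _ (fun x => al * (f (al *: x + a) * partial j psi (al *: x + a)))); last by move=> x; rewrite Ed; ring.
rewrite [X in - X](@eq_Int _ _ (fun x => al * (f' (al *: x + a) * psi (al *: x + a)))); last by move=> x; rewrite E; ring.
by rewrite (IntZ _ k1) (IntZ _ k2) e1 e2 (h _ tpsi); genInt; ring.
Qed.

Lemma in_H1_lin (a b : R) f g : in_H1 f -> in_H1 g -> in_H1 (fun x => a * f x + b * g x).
Proof.
move=> [sf hf] [sg hg]; split; first exact: sqint_lin.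
move=> j; have [f' [sf' wf]] := hf j; have [g' [sg' wg]] := hg j.
by exists (fun x => a * f' x + b * g' x); split; [exact: sqint_lin|exact: weak_lin].
Qed.

Lemma in_H1_affine f (al : R) (a : R3 R) : 0 < al -> in_H1 f -> in_H1 (fun x : R3 R => f (al *: x + a)).
Proof.
move=> al0 [sf hf]; split; first exact: sqint_affine.
move=> j; have [f' [sf' wf]] := hf j; exists (fun x : R3 R => al * f' (al *: x + a)); split; last exact: weak_affine.
have := sqint_lin al 0 (sqint_affine a al0 sf') (sqint_affine a al0 sf').
by congr square_integrable; apply/funext => x; rewrite mul0r addr0.
Qed.

Lemma wDP j f : in_H1 f -> square_integrable (wD j f) /\ weak_partial j f (wD j f).
Proof.
move=> [_ /(_ j) [g hg]].
exact: (@xgetI _ (fun=> 0) [set g | square_integrable g /\ weak_partial j f g] g hg).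
Qed.

Lemma smooth_cconv u k : continuous u -> smf k -> Cc k -> smooth (cconv u k).
Proof.
move=> cu sk ck s.
have [k' [sk' ck' ->]] : exists k', [/\ smf k', Cc k' & foldr partial (cconv u k) s = cconv u k'].
  elim: s => [|j s [k' [sk' ck' E]]]; first by exists k.
  have [dk [hk sdk]] := smf_C1 sk'.
  exists (fun x => -1 * dk j x); split; first exact: smf_mul (smf_cst _) (sdk j).
    exact: Cc_mulr (@cont_cst _ _) (C1_Cc j hk ck').
  rewrite /= E (C1_partial (conv_C1 cu hk ck')); apply/funext => y.
  have i := conv_intg y cu (C1_Cc j hk ck').
  by rewrite /cconv -(IntN i); apply: eq_Int => x; ring.
have [dk [hk sdk]] := smf_C1 sk'; have [c _ d] := conv_C1 cu hk ck'.
by split => // j x; case: (d j x).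
Qed.

Lemma mol_test u n r : Cc u -> vanish r u -> test_function (mol u n) /\ vanish (r + 1) (mol u n).
Proof.
move=> [cu _] hr; have n0 : 0 < n.+1%:R :> R by rewrite ltr0n.
have hc := Cc_Bm n0; set c : R := (Int (Bm n.+1%:R))^-1.
have sB : smf (@Bm R n.+1%:R).
  by have := smf_Bm n.+1%:R (0 : R3 R); congr smf; apply/funext => x; rewrite subr0.
have E : mol u n = cconv u (fun x => c * Bm n.+1%:R x).
  apply/funext => y; rewrite /mol -/c /cconv -(IntZ c (conv_intg y cu hc)).
  by apply: eq_Int => x; ring.
have hv : vanish (r + 1) (mol u n).
  move=> y yr; rewrite /mol /cconv [X in _ * X]Int_eq0 ?mulr0// => x.
  have [xr|/hr ->] := leP `|x| r; last by rewrite mul0r.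
  rewrite (Bm_vanish n0 ler01) ?mulr0// ?expr1n ?mulr1 ?ler1n//.
  by have := lerB_dist y x; rewrite [`|y - x|]distrC; lra.
split => //; apply: smooth_test hv; rewrite E; apply: smooth_cconv => //.
  exact: smf_mul (smf_cst c) sB.
exact: Cc_mulr (@cont_cst _ _) hc.
Qed.

Lemma Int_close f g (e r : R) : 0 <= r -> continuous f -> continuous g -> vanish r f -> vanish r g ->
  (forall x, `|x| <= r -> `|f x - g x| <= e) -> `|Int f - Int g| <= e * (2 * r) ^+ 3.
Proof.
move=> r0 cf cg vf vg h; rewrite -IntB; [|by apply: Cc_intg; split => //; exists r|by apply: Cc_intg; split => //; exists r].
by apply: Int_bounded => // [|x xr]; [cont|rewrite vf// vg// subr0].
Qed.

(** The hypotheses of the theorem measure weak derivatives, the potential estimates need classical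
    ones. Duality transfers the bound: with [X = chi^2 H] one has [Int (H X) = Int (ga X)], at most
    half of [Int ga^2 + Int X^2], and [X^2 <= H X]. As [X] is no test function, it is mollified. *)
Lemma weak_grad_L2 (H : R3 R -> R) (ga chi : R3 R -> R) : continuous H -> square_integrable ga ->
  (forall phi, test_function phi -> Int (fun x => H x * phi x) = Int (fun x => ga x * phi x)) ->
  Cc chi -> (forall x, `|chi x| <= 1) -> Int (fun x => chi x ^+ 2 * H x ^+ 2) <= Int (fun x => ga x ^+ 2).
Proof.
move=> cH sga E cchi chi1; have [mga iga] := (sqintE ga).1 sga.
pose X x := chi x ^+ 2 * H x.
have cX : Cc X.
  have [c [r hr]] := cchi; split; first by rewrite /X; cont.
  by exists r => x /hr h; rewrite /X h expr0n mul0r.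
have [cX0 _] := cX.
have [r r0 hr] := vanish_ge0 cX.
have key : Int (fun x => H x * X x) <= 2^-1 * (Int (fun x => ga x ^+ 2) + Int (fun x => X x ^+ 2)).
  apply/ler_addgt0Pr => e e0.
  have [C C0 hC] := cont_bounded (r + 1) cH; have [K K0 hK] := Cc_bounded cX.
  pose W : R := (2 * (r + 1)) ^+ 3; have W0 : 0 <= W by rewrite exprn_ge0//; lra.
  have D0 : 0 < C * W + (2 * K + 1) * W + 1.
    by apply: ltr_pwDr => //; apply: addr_ge0; apply: mulr_ge0 => //; lra.
  (* [t] bounds the uniform error of the mollification; the denominator collects the resulting
     errors of both integrals over the enlarged cube. *)
  pose t : R := Num.min 1 (e / (C * W + (2 * K + 1) * W + 1)).
  have t0 : 0 < t by rewrite lt_min ltr01 divr_gt0.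
  have t1 : t <= 1 by rewrite ge_min lexx.
  have te : t * (C * W + (2 * K + 1) * W) <= e.
    have : t * (C * W + (2 * K + 1) * W + 1) <= e by rewrite -ler_pdivlMr// ge_min lexx orbT.
    lra.
  have [N hN] := mol_locunif cX0 (r + 1) t0.
  have [tX vX] := mol_test N cX hr; have cXN : continuous (mol X N) := (test_Cc tX).1.
  have r10 : 0 <= r + 1 by lra.
  have vX' : vanish (r + 1) X by move=> x xr; apply: hr; lra.
  have d1 : `|Int (fun x => H x * mol X N x) - Int (fun x => H x * X x)| <= C * t * W.
    apply: Int_close => //; [by cont|by cont|by move=> x xr; rewrite vX ?mulr0|by move=> x xr; rewrite vX' ?mulr0|].
    by move=> x xr; rewrite -mulrBr normrM; apply: ler_pM => //; [exact: hC|exact: hN].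
  have d2 : `|Int (fun x => mol X N x ^+ 2) - Int (fun x => X x ^+ 2)| <= t * (2 * K + 1) * W.
    apply: Int_close => //; [by cont|by cont|by move=> x xr; rewrite vX ?expr0n|by move=> x xr; rewrite vX' ?expr0n|].
    move=> x xr; rewrite subr_sqr normrM; have h := hN N (leqnn _) x xr.
    apply: ler_pM => //; apply: le_trans (_ : `|mol X N x - X x + 2 * X x| <= _); first by rewrite (_ : mol X N x + X x = mol X N x - X x + 2 * X x)//; ring.
    by apply: le_trans (ler_normD _ _) _; rewrite normrM [`|2|]ger0_norm//; have := hK x; clear -t1 h; lra.
  have h3 : Int (fun x => H x * mol X N x) <= 2^-1 * (Int (fun x => ga x ^+ 2) + Int (fun x => mol X N x ^+ 2)).
    have iX := Cc_intg (Cc_sq (test_Cc tX)).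
    rewrite (E _ tX) -(IntD iga iX) -(IntZ _ (intgD iga iX)); apply: le_Int.
    - exact: sqint_Cc sga (test_Cc tX).
    - exact: intgZ (intgD iga iX).
    - move=> x; have := sqr_ge0 (ga x - mol X N x); rewrite sqrrB; clear; lra.
  move: d1 d2 h3; rewrite !ler_norml => /andP[d1 d1'] /andP[d2 d2'] h3.
  clear -te d1 d2 d2' h3; lra.
have e1 : Int (fun x => H x * X x) = Int (fun x => chi x ^+ 2 * H x ^+ 2) by apply: eq_Int => x; rewrite /X; ring.
have e2 : Int (fun x => X x ^+ 2) <= Int (fun x => chi x ^+ 2 * H x ^+ 2).
  apply: le_Int; first exact: Cc_intg (Cc_sq cX).
    have := Cc_mulr cH cX => /Cc_intg; congr intg; apply/funext => x; rewrite /X; ring.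
  move=> x; rewrite /X exprMn; apply: ler_wpM2r; first exact: sqr_ge0.
  rewrite -[leRHS]mulr1 expr2; apply: ler_wpM2l; first exact: sqr_ge0.
  by rewrite -real_normK ?num_real// expr_le1.
by lra.
Qed.
End WeakDerivatives.

Ltac genwD := repeat match goal with
 | |- context [wD ?j ?f ?x] => generalize (wD j f x); intro
 | |- context [partial ?j ?f ?x] => generalize (partial j f x); intro
 | |- context [Bm ?l ?x] => generalize (Bm l x); intro
 | |- context [complex.Re (?f ?x)] => generalize (complex.Re (f x)); intro
 | |- context [complex.Im (?f ?x)] => generalize (complex.Im (f x)); intro
 end.

(** * The equation tested with bumps, and its symmetries *)

Section GrossPitaevskiiTests.
Import ComplexField.Normc.
Local Open Scope complex_scope.
Context {R : realType}.
Implicit Types (f g h u v k : R3 R -> R) (x y z : R3 R) (s t la ka : R).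

Definition lapB la s : R := 6 * bmp1 la s + 4 * s * bmp2 la s.
(** As the bump is radial, its rotation derivative at [x - y] involves [x] and [y] only through this
    planar cross product. The effect of an isometry is then read off from [enorm2] and [crs]. *)
Definition crs x y : R := x.1.2 * y.1.1 - x.1.1 * y.1.2.
Definition rotB la y x : R := 2 * bmp1 la (enorm2 (x - y)) * crs x y.
Definition Lint ka la y u v x : R := u x * - lapB la (enorm2 (x - y)) + 2 * ka * (v x * rotB la y x).

Lemma lapBE la z : \sum_j ddBm la j j z = lapB la (enorm2 z).
Proof.
have hE : enorm2 z = coord3 z o0 * coord3 z o0 + coord3 z o1 * coord3 z o1 + coord3 z o2 * coord3 z o2.
  by rewrite /enorm2 /dot sum3.
by rewrite sum3 /ddBm /lapB !eqxx !mul1r; move: (bmp1 _ _) (bmp2 _ _) => a b; rewrite hE; ring.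
Qed.

Lemma rotBE la y x : x.1.1 * dBm la o1 (x - y) - x.1.2 * dBm la o0 (x - y) = rotB la y x.
Proof. by rewrite /dBm /rotB /crs !coordB /coord3 /tnth /=; move: (bmp1 _ _) => a; ring. Qed.

Lemma magsolE ka u v f g : magsol ka u v f g <->
  [/\ continuous u, continuous v, continuous f, continuous g & forall la y, 0 < la ->
   Int (Lint ka la y u v) = Int (fun x => f x * Bm la (x - y)) /\
   Int (Lint ka la y v (fun x => - u x)) = Int (fun x => g x * Bm la (x - y))].
Proof.
have E1 la y : (fun x => u x * - (\sum_j ddBm la j j (x - y)) + 2 * ka * (v x * (x.1.1 * dBm la o1 (x - y) - x.1.2 * dBm la o0 (x - y)))) = Lint ka la y u v.
  by apply/funext => x; rewrite lapBE rotBE.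
have E2 la y : (fun x => v x * - (\sum_j ddBm la j j (x - y)) - 2 * ka * (u x * (x.1.1 * dBm la o1 (x - y) - x.1.2 * dBm la o0 (x - y)))) = Lint ka la y v (fun x => - u x).
  by apply/funext => x; rewrite lapBE rotBE /Lint; ring.
by split=> -[c1 c2 c3 c4 h]; split => // la y la0; have := h la y la0; rewrite E1 E2.
Qed.

Lemma Lint_intg ka la y u v : 0 < la -> continuous u -> continuous v -> intg (Lint ka la y u v).
Proof.
move=> la0 cu cv; have hc := Cc_Bm la0; have cd j := C1_Cc j (C1_Bm la) hc.
have cdd j := C1_Cc j (C1_dBm la j) (cd j).
have i0 j := conv_intg y cu (cdd j).
have cx0 : continuous (fun x : R3 R => v x * x.1.1) by cont.
have cx1 : continuous (fun x : R3 R => v x * x.1.2) by cont.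
have := intgD (intgZ (-1) (intgD (intgD (i0 o0) (i0 o1)) (i0 o2)))
  (intgZ (2 * ka) (intgB (conv_intg y cx0 (cd o1)) (conv_intg y cx1 (cd o0)))).
congr intg; apply/funext => x; rewrite /Lint -lapBE -rotBE sum3; ring.
Qed.

Lemma Lint_lin ka la y (a b : R) u v u' v' : 0 < la -> continuous u -> continuous v -> continuous u' -> continuous v' ->
  Int (Lint ka la y (fun x => a * u x + b * u' x) (fun x => a * v x + b * v' x)) =
  a * Int (Lint ka la y u v) + b * Int (Lint ka la y u' v').
Proof.
move=> la0 c1 c2 c3 c4; have i1 := Lint_intg ka y la0 c1 c2; have i2 := Lint_intg ka y la0 c3 c4.
rewrite -(IntZ a i1) -(IntZ b i2) -(IntD (intgZ a i1) (intgZ b i2)); apply: eq_Int => x; rewrite /Lint; ring.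
Qed.

Lemma magsol_lin ka (a b : R) u v f g u' v' f' g' : magsol ka u v f g -> magsol ka u' v' f' g' ->
  magsol ka (fun x => a * u x + b * u' x) (fun x => a * v x + b * v' x) (fun x => a * f x + b * f' x) (fun x => a * g x + b * g' x).
Proof.
move=> /magsolE[c1 c2 c3 c4 h] /magsolE[d1 d2 d3 d4 h']; apply/magsolE; split; [by cont|by cont|by cont|by cont|].
move=> la y la0; have [h1 h2] := h la y la0; have [h1' h2'] := h' la y la0; have hc := Cc_Bm la0.
have E (F F' : R3 R -> R) : continuous F -> continuous F' -> Int (fun x => (a * F x + b * F' x) * Bm la (x - y)) =
  a * Int (fun x => F x * Bm la (x - y)) + b * Int (fun x => F' x * Bm la (x - y)).
  move=> cF cF'; have i1 := conv_intg y cF hc; have i2 := conv_intg y cF' hc.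
  by rewrite -(IntZ a i1) -(IntZ b i2) -(IntD (intgZ a i1) (intgZ b i2)); apply: eq_Int => x; ring.
split; first by rewrite Lint_lin// h1 h1' E.
rewrite E// -h2 -h2' -Lint_lin//; [|exact: contN|exact: contN].
by apply: eq_Int => x; rewrite /Lint; ring.
Qed.

Lemma magsol_i ka u v f g : magsol ka u v f g -> magsol ka (fun x => - v x) u (fun x => - g x) f.
Proof.
move=> /magsolE[c1 c2 c3 c4 h]; apply/magsolE; split; [by cont|by cont|by cont|by cont|].
move=> la y la0; have [h1 h2] := h la y la0; split.
  have := Lint_lin ka y (-1) 0 la0 c2 (contN c1) c2 (contN c1).
  rewrite h2 mul0r addr0 mulN1r -IntN; last exact: conv_intg (Cc_Bm la0).
  move=> e; transitivity (Int (fun x => - (g x * Bm la (x - y)))); last by apply: eq_Int => x; ring.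
  by rewrite -e; apply: eq_Int => x; rewrite /Lint; ring.
by rewrite -h1; apply: eq_Int => x; rewrite /Lint opprK.
Qed.

Lemma magsol_ext ka u v f g u' v' f' g' : u =1 u' -> v =1 v' -> f =1 f' -> g =1 g' ->
  magsol ka u v f g -> magsol ka u' v' f' g'.
Proof. by move=> /funext -> /funext -> /funext -> /funext ->. Qed.

Lemma magsol_cmul ka (al be : R) u v f g : magsol ka u v f g ->
  magsol ka (fun x => al * u x - be * v x) (fun x => al * v x + be * u x)
    (fun x => al * f x - be * g x) (fun x => al * g x + be * f x).
Proof.
move=> h; apply: magsol_ext (magsol_lin al be h (magsol_i h)) => x; ring.
Qed.

(** [s] is the orientation of [T] in the horizontal plane. A map reversing it reverses the magnetic
    field, which complex conjugation restores; rotations and the reflection are the two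
    instances. *)
Lemma magsol_iso ka (T : R3 R -> R3 R) s u v f g : s ^+ 2 = 1 ->
  (forall h, continuous h -> continuous (fun x => h (T x))) ->
  (forall x y, enorm2 (T x - T y) = enorm2 (x - y)) -> (forall x y, crs (T x) (T y) = s * crs x y) ->
  (forall h, intg h -> Int (fun x => h (T x)) = Int h) ->
  magsol ka u v f g -> magsol ka (fun x => u (T x)) (fun x => s * v (T x)) (fun x => f (T x)) (fun x => s * g (T x)).
Proof.
move=> s2 cT eT kT iT /magsolE[c1 c2 c3 c4 h]; apply/magsolE; split; [exact: cT| |exact: cT| |].
- by apply: contM; [exact: cont_cst|exact: cT].
- by apply: contM; [exact: cont_cst|exact: cT].
move=> la y la0; have [h1 h2] := h la (T y) la0.
have kT' x : crs x y = s * crs (T x) (T y) by rewrite kT mulrA -expr2 s2 mul1r.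
have eB x : Bm la (x - y) = Bm la (T x - T y) by rewrite /Bm eT.
split.
  rewrite (@eq_Int _ _ (fun x => Lint ka la (T y) u v (T x))); last first.
    move=> x; rewrite /Lint /rotB eT kT'; move: (bmp1 _ _) => b.
    have -> // : 2 * ka * (s * v (T x) * (2 * b * (s * crs (T x) (T y)))) = 2 * ka * (v (T x) * (2 * b * crs (T x) (T y))).
    by rewrite -[RHS]mul1r -s2; ring.
  rewrite (iT _ (Lint_intg ka (T y) la0 c1 c2)) h1 -(iT _ (conv_intg (T y) c3 (Cc_Bm la0))).
  by apply: eq_Int => x; rewrite eB.
rewrite (@eq_Int _ _ (fun x => s * Lint ka la (T y) v (fun x => - u x) (T x))); last first.
  by move=> x; rewrite /Lint /rotB eT kT'; move: (bmp1 _ _) => b; ring.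
have i2 := Lint_intg ka (T y) la0 c2 (contN c1).
pose LT x := Lint ka la (T y) v (fun x => - u x) x.
have -> : Int (fun x => s * Lint ka la (T y) v (fun x => - u x) (T x)) = Int (fun x => s * LT x).
  exact: (iT (fun x => s * LT x) (intgZ s i2)).
rewrite (IntZ s i2) h2 -(IntZ s (conv_intg (T y) c4 (Cc_Bm la0))).
rewrite -(iT _ (intgZ s (conv_intg (T y) c4 (Cc_Bm la0)))).
by apply: eq_Int => x; rewrite eB; ring.
Qed.

(** The translation is along the axis, where the vector potential does not change; the dilation
    multiplies the field by [al^2]. *)
Lemma magsol_scale ka (al p : R) u v f g : 0 < al -> magsol ka u v f g ->
  magsol (al ^+ 2 * ka) (fun x : R3 R => u (al *: x + (0, 0, p))) (fun x : R3 R => v (al *: x + (0, 0, p)))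
   (fun x : R3 R => al ^+ 2 * f (al *: x + (0, 0, p))) (fun x : R3 R => al ^+ 2 * g (al *: x + (0, 0, p))).
Proof.
move=> al0 /magsolE[c1 c2 c3 c4 h]; pose T (x : R3 R) : R3 R := al *: x + (0, 0, p).
have cT (k : R3 R -> R) : continuous k -> continuous (fun x => k (T x)) by exact: cont_affine.
apply/magsolE; split; [exact: cT|exact: cT| | |].
- by apply: contM; [exact: cont_cst|exact: (cT _ c3)].
- by apply: contM; [exact: cont_cst|exact: (cT _ c4)].
move=> la y la0; have al2 : 0 < al ^+ 2 by rewrite exprn_gt0.
have la0' : 0 < la / al ^+ 2 by rewrite divr_gt0.
have [h1 h2] := h _ (T y) la0'.
have eT x : enorm2 (T x - T y) = al ^+ 2 * enorm2 (x - y).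
  by rewrite /T opprD addrACA subrr addr0 -scalerBr enorm2Z.
have kT x : crs (T x) (T y) = al ^+ 2 * crs x y.
  by rewrite /crs /T /= !addr0 /GRing.scale /=; ring.
have ar x : 1 - la / al ^+ 2 * enorm2 (T x - T y) = 1 - la * enorm2 (x - y).
  by rewrite eT mulrA divfK// gt_eqF.
have b0 x : Bm (la / al ^+ 2) (T x - T y) = Bm la (x - y) by rewrite /Bm /bmp ar.
have b1 x : bmp1 la (enorm2 (x - y)) = al ^+ 2 * bmp1 (la / al ^+ 2) (enorm2 (T x - T y)).
  by rewrite /bmp1 ar; field; rewrite gt_eqF.
have b2 x : bmp2 la (enorm2 (x - y)) = al ^+ 2 * (al ^+ 2 * bmp2 (la / al ^+ 2) (enorm2 (T x - T y))).
  by rewrite /bmp2 ar; field; rewrite gt_eqF.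
have EL (U W : R3 R -> R) x : Lint (al ^+ 2 * ka) la y (fun x => U (T x)) (fun x => W (T x)) x = al ^+ 2 * Lint ka (la / al ^+ 2) (T y) U W (T x).
  by rewrite /Lint /rotB /lapB b1 b2 kT eT; move: (bmp1 _ _) (bmp2 _ _) => a b; ring.
have IT k : intg k -> intg (fun x => k (T x)) /\ Int (fun x => k (T x)) = al^-1 ^+ 3 * Int k by exact: Int_affine.
have fin (U W F : R3 R -> R) : continuous U -> continuous W -> continuous F ->
  Int (Lint ka (la / al ^+ 2) (T y) U W) = Int (fun x => F x * Bm (la / al ^+ 2) (x - T y)) ->
  Int (Lint (al ^+ 2 * ka) la y (fun x => U (T x)) (fun x => W (T x))) = Int (fun x => al ^+ 2 * F (T x) * Bm la (x - y)).
  move=> cU cW cF e; have [k1 e1] := IT _ (Lint_intg ka (T y) la0' cU cW).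
  have [k2 e2] := IT _ (conv_intg (T y) cF (Cc_Bm la0')).
  rewrite (eq_Int (EL U W)) (IntZ _ k1) e1 e -e2 -(IntZ _ k2).
  by apply: eq_Int => x; rewrite b0; ring.
split; [exact: (fin u v f)|exact: (fin v (fun x => - u x) g c2 (contN c1) c4 h2)].
Qed.

Lemma ReM (a b : R[i]) : complex.Re (a * b) = complex.Re a * complex.Re b - complex.Im a * complex.Im b.
Proof. by case: a => ? ?; case: b. Qed.
Lemma ImM (a b : R[i]) : complex.Im (a * b) = complex.Re a * complex.Im b + complex.Im a * complex.Re b.
Proof. by case: a => ? ?; case: b. Qed.
Lemma ReD (a b : R[i]) : complex.Re (a + b) = complex.Re a + complex.Re b.
Proof. by case: a => ? ?; case: b. Qed.
Lemma ImD (a b : R[i]) : complex.Im (a + b) = complex.Im a + complex.Im b.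
Proof. by case: a => ? ?; case: b. Qed.
Lemma sumC3 (F : 'I_3 -> R[i]) : \sum_j F j = F o0 + F o1 + F o2.
Proof.
rewrite !big_ord_recl big_ord0 addr0 addrA.
by congr (F _ + F _ + F _); apply: val_inj.
Qed.
Lemma C2E : (2 : R[i]) = (2 : R) +i* 0.
Proof. by rewrite -[2 : R[i]](rmorph_nat (real_complex R)). Qed.
Lemma normc_sqr (z : R[i]) : normc z ^+ 2 = complex.Re z ^+ 2 + complex.Im z ^+ 2.
Proof. by case: z => a b /=; rewrite sqr_sqrtr// addr_ge0// sqr_ge0. Qed.

(** The real factor of [w] on the right-hand side once [- Delta + 2 i A . grad] alone is kept on the
    left. *)
Definition gpF (Omega a mu : R) (w : R3 R -> R[i]) (x : R3 R) : R :=
  mu - (enorm2 (rot_field Omega x) + (enorm2 x - 1) ^+ 2 - a * normc (w x) ^+ 2).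

Lemma GPre (A0 A1 A2 z : R[i]) (p0 p1 p2 r0 r1 r2 t g : R) :
  complex.Re (A0 * p0%:C + A1 * p1%:C + A2 * p2%:C + 2 * (0 +i* 1) * (r0%:C * A0 + r1%:C * A1 + r2%:C * A2) * t%:C + g%:C * z * t%:C) =
  complex.Re A0 * p0 + complex.Re A1 * p1 + complex.Re A2 * p2
  - 2 * (r0 * complex.Im A0 + r1 * complex.Im A1 + r2 * complex.Im A2) * t + g * complex.Re z * t.
Proof. by rewrite C2E !(ReD, ReM, ImM, ImD) /=; ring. Qed.

Lemma GPim (A0 A1 A2 z : R[i]) (p0 p1 p2 r0 r1 r2 t g : R) :
  complex.Im (A0 * p0%:C + A1 * p1%:C + A2 * p2%:C + 2 * (0 +i* 1) * (r0%:C * A0 + r1%:C * A1 + r2%:C * A2) * t%:C + g%:C * z * t%:C) =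
  complex.Im A0 * p0 + complex.Im A1 * p1 + complex.Im A2 * p2
  + 2 * (r0 * complex.Re A0 + r1 * complex.Re A1 + r2 * complex.Re A2) * t + g * complex.Im z * t.
Proof. by rewrite C2E !(ReD, ReM, ImM, ImD) /=; ring. Qed.

Section Weak.
Variables (U V : R3 R -> R).
Hypotheses (hU : in_H1 U) (hV : in_H1 V) (cU : continuous U) (cV : continuous V).

Lemma weak_Bm la y : 0 < la ->
  Int (fun x => \sum_j wD j U x * partial j (fun x => Bm la (x - y)) x) = Int (fun x => U x * - lapB la (enorm2 (x - y))) /\
  intg (fun x => \sum_j wD j U x * partial j (fun x => Bm la (x - y)) x).
Proof.
move=> la0; have hc := Cc_shift (- y) (Cc_Bm la0).
have hP := C1_shift (- y) (C1_Bm la); have pE := C1_partial hP.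
have cd j := C1_Cc j hP hc.
have hdP j := C1_shift (- y) (C1_dBm la j).
have cdd j := C1_Cc j (hdP j) (cd j).
have [r hr] := hc.2.
have td j : test_function (fun x : R3 R => dBm la j (x - y)).
  exact: smf_test (smf_dBm la y j) (C1_vanish hP hr j).
have i1 j : intg (fun x => wD j U x * dBm la j (x - y)) by exact: sqint_Cc (wDP j hU).1 (cd j).
have i2 j : intg (fun x => U x * ddBm la j j (x - y)) by exact: sqint_Cc hU.1 (cdd j).
have E : (fun x => \sum_j wD j U x * partial j (fun x => Bm la (x - y)) x) =
  (fun x => wD o0 U x * dBm la o0 (x - y) + wD o1 U x * dBm la o1 (x - y) + wD o2 U x * dBm la o2 (x - y)).
  by apply/funext => x; rewrite sum3 !pE.
rewrite E; split; last exact: intgD (intgD (i1 _) (i1 _)) (i1 _).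
have W j : Int (fun x => wD j U x * dBm la j (x - y)) = - Int (fun x => U x * ddBm la j j (x - y)).
  by have := (wDP j hU).2 _ (td j); rewrite (C1_partial (hdP j)) => ->; rewrite opprK.
rewrite (IntD (intgD (i1 _) (i1 _)) (i1 _)) (IntD (i1 _) (i1 _)) !W.
transitivity (- Int (fun x => U x * ddBm la o0 o0 (x - y) + U x * ddBm la o1 o1 (x - y) + U x * ddBm la o2 o2 (x - y))).
  by rewrite (IntD (intgD (i2 _) (i2 _)) (i2 _)) (IntD (i2 _) (i2 _)); genInt; ring.
rewrite -IntN; last exact: intgD (intgD (i2 _) (i2 _)) (i2 _).
by apply: eq_Int => x; rewrite -lapBE sum3; ring.
Qed.

Lemma weak_rot la y : 0 < la ->
  Int (fun x => (x.1.1 * wD o1 V x - x.1.2 * wD o0 V x) * Bm la (x - y)) = - Int (fun x => V x * rotB la y x) /\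
  intg (fun x => (x.1.1 * wD o1 V x - x.1.2 * wD o0 V x) * Bm la (x - y)).
Proof.
move=> la0; have hc := Cc_shift (- y) (Cc_Bm la0).
have hP := C1_shift (- y) (C1_Bm la).
have hx j := C1M (C1_coord j) hP.
have cx j : Cc (fun x => coord3 x j * Bm la (x - y)) by apply: Cc_mulr hc; exact: cont_coord.
have tx j : test_function (fun x => coord3 x j * Bm la (x - y)).
  have [_ [r hr]] := cx j; apply: smf_test hr; exact: smf_mul (smf_coord j) (smf_Bm la y).
have i1 i j : intg (fun x => wD i V x * (coord3 x j * Bm la (x - y))) by exact: sqint_Cc (wDP i hV).1 (cx j).
have i2 i j : intg (fun x => V x * ((j == i)%:R * Bm la (x - y) + coord3 x j * dBm la i (x - y))).
  exact: sqint_Cc hV.1 (C1_Cc i (hx j) (cx j)).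
have W i j : Int (fun x => wD i V x * (coord3 x j * Bm la (x - y))) = - Int (fun x => V x * ((j == i)%:R * Bm la (x - y) + coord3 x j * dBm la i (x - y))).
  by have := (wDP i hV).2 _ (tx j); rewrite (C1_partial (hx j)) => ->; rewrite opprK.
have E : (fun x => (x.1.1 * wD o1 V x - x.1.2 * wD o0 V x) * Bm la (x - y)) =
  (fun x => wD o1 V x * (coord3 x o0 * Bm la (x - y)) - wD o0 V x * (coord3 x o1 * Bm la (x - y))).
  by apply/funext => x; move: (wD _ _ _) (wD _ _ _) (Bm _ _) => a b c; rewrite /coord3 /tnth /=; ring.
rewrite E; split; last exact: intgB.
rewrite (IntB (i1 _ _) (i1 _ _)) !W.
transitivity (- Int (fun x => V x * ((o0 == o1)%:R * Bm la (x - y) + coord3 x o0 * dBm la o1 (x - y)) - V x * ((o1 == o0)%:R * Bm la (x - y) + coord3 x o1 * dBm la o0 (x - y)))).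
  by rewrite (IntB (i2 _ _) (i2 _ _)); genInt; ring.
by congr (- _); apply: eq_Int => x; rewrite -rotBE /coord3 /tnth /=; ring.
Qed.
End Weak.

Lemma cont_gp (Omega : R) : continuous (fun x : R3 R => enorm2 (rot_field Omega x) + (enorm2 x - 1) ^+ 2).
Proof.
have h := @cont_enorm2 R.
have -> : (fun x : R3 R => enorm2 (rot_field Omega x) + (enorm2 x - 1) ^+ 2) =
  (fun x : R3 R => ((Omega / 2 * x.1.2) ^+ 2 + (Omega / 2 * x.1.1) ^+ 2) + (enorm2 x - 1) ^+ 2).
  by apply/funext => x; rewrite enorm2E /=; ring.
by cont.
Qed.

(** The real and imaginary parts of the equation, tested with a translated bump. The weak
    derivatives are then moved onto the bump, in the rotation term onto a coordinate times the
    bump. *)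
Lemma GP_magsol (Omega a mu : R) (w : R3 R -> R[i]) : GP_solution Omega a mu w ->
  magsol (Omega / 2) (fun x => complex.Re (w x)) (fun x => complex.Im (w x))
    (fun x => gpF Omega a mu w x * complex.Re (w x)) (fun x => gpF Omega a mu w x * complex.Im (w x)).
Proof.
move=> [[cU cV] [[hU hV] _] eq _].
set U := fun x => complex.Re (w x); set V := fun x => complex.Im (w x).
have cF : continuous (gpF Omega a mu w).
  have -> : gpF Omega a mu w = (fun x => mu - ((enorm2 (rot_field Omega x) + (enorm2 x - 1) ^+ 2) - a * (U x ^+ 2 + V x ^+ 2))).
    by apply/funext => x; rewrite /gpF normc_sqr.
  have cP (P : R3 R -> R) : continuous P -> continuous (fun x => mu - (P x - a * (U x ^+ 2 + V x ^+ 2))).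
    by rewrite -/U in cU; rewrite -/V in cV; move=> cP; cont.
  exact: cP (@cont_gp Omega).
rewrite -/U in cU; rewrite -/V in cV.
apply/magsolE; split; [by []|by []|by cont|by cont|move=> la y la0].
have hc := Cc_shift (- y) (Cc_Bm la0); have [r hr] := hc.2.
have tB : test_function (fun x : R3 R => Bm la (x - y)) by exact: smf_test (smf_Bm la y) hr.
have [eR eI] : _ /\ _ := let: e := eq _ tB in conj (congr1 (@complex.Re R) e) (congr1 (@complex.Im R) e).
have [k1 i1] := weak_Bm hU y la0; have [k2 i2] := weak_Bm hV y la0.
have [l1 j1] := weak_rot hU y la0; have [l2 j2] := weak_rot hV y la0.
pose G x : R := enorm2 (rot_field Omega x) + (enorm2 x - 1) ^+ 2 - a * normc (w x) ^+ 2.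
have cG : continuous G.
  have -> : G = (fun x => mu - gpF Omega a mu w x) by apply/funext => x; rewrite /gpF /G; ring.
  by cont.
have iG (W : R3 R -> R) : continuous W -> intg (fun x => G x * W x * Bm la (x - y)) by move=> cW; apply: Cc_intg; apply: Cc_mulr => //; cont.
have iM (W : R3 R -> R) : continuous W -> intg (fun x => mu * W x * Bm la (x - y)) by move=> cW; apply: Cc_intg; apply: Cc_mulr => //; cont.
have ilap (W : R3 R -> R) : continuous W -> intg (fun x => W x * - lapB la (enorm2 (x - y))).
  move=> cW; have := @Lint_intg 0 la y W W la0 cW cW; congr intg; apply/funext => x; by rewrite /Lint mulr0 mul0r addr0.
have irot (W : R3 R -> R) : continuous W -> intg (fun x => W x * rotB la y x).
  move=> cW; have := @Lint_intg 2^-1 la y (fun=> 0) W la0 (@cont_cst _ _) cW; congr intg; apply/funext => x; by rewrite /Lint mul0r add0r divff ?mul1r// pnatr_eq0.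
have fin (W Z dW dZ : R3 R -> R) : continuous W -> continuous Z -> intg dW -> intg dZ ->
   Int dW = Int (fun x => W x * - lapB la (enorm2 (x - y))) -> Int dZ = - Int (fun x => Z x * rotB la y x) ->
   Int (fun x => dW x - Omega * dZ x + G x * W x * Bm la (x - y)) = Int (fun x => mu * W x * Bm la (x - y)) ->
   Int (Lint (Omega / 2) la y W Z) = Int (fun x => gpF Omega a mu w x * W x * Bm la (x - y)).
  move=> cW cZ idW idZ eW eZ.
  rewrite (IntD (intgB idW (intgZ Omega idZ)) (iG _ cW)) (IntB idW (intgZ Omega idZ)) (IntZ Omega idZ) eW eZ => e.
  transitivity (Int (fun x => W x * - lapB la (enorm2 (x - y)) + Omega * (Z x * rotB la y x))).
    by apply: eq_Int => x; rewrite /Lint; field.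
  rewrite (IntD (ilap _ cW) (intgZ Omega (irot _ cZ))) (IntZ Omega (irot _ cZ)).
  transitivity (Int (fun x => mu * W x * Bm la (x - y)) - Int (fun x => G x * W x * Bm la (x - y))).
    by rewrite -e; genInt; ring.
  rewrite -(IntB (iM _ cW) (iG _ cW)); apply: eq_Int => x.
  by rewrite /gpF -/(G x); ring.
split.
  apply: (fin U V _ _ cU cV i1 j2 k1 l2).
  transitivity (complex.Re (Cintegral (fun x : R3 R => mu%:C * w x * (Bm la (x - y))%:C))).
    rewrite -eR; apply: eq_Int => x; rewrite !sumC3 GPre -/(G x) sum3.
    rewrite /coord3 /tnth /rot_field /= /U /V.
    by genwD; field.
  by apply: eq_Int => x; rewrite !ReM /= /U; ring.
have j1' : intg (fun x => -1 * ((x.1.1 * wD o1 U x - x.1.2 * wD o0 U x) * Bm la (x - y))) by exact: intgZ.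
apply: (fin V (fun x => - U x) _ _ cV (contN cU) i2 j1' k2).
  rewrite (IntZ (-1) j1) l1 mulN1r -IntN; last exact: irot.
  by congr (- _); apply: eq_Int => x; rewrite mulNr.
transitivity (complex.Im (Cintegral (fun x : R3 R => mu%:C * w x * (Bm la (x - y))%:C))).
  rewrite -eI; apply: eq_Int => x; rewrite !sumC3 GPim -/(G x) sum3.
  rewrite /coord3 /tnth /rot_field /= /U /V.
  by genwD; field.
by apply: eq_Int => x; rewrite !ImM /= /V; ring.
Qed.

Lemma ground_magsol (Q : R3 R -> R) : ground_state Q ->
  magsol 0 Q (fun=> 0) (fun x => Q x ^+ 3 - Q x) (fun=> 0).
Proof.
move=> [cQ hQ _ _ eq]; apply/magsolE; split; [by []|exact: cont_cst|by cont|exact: cont_cst|move=> la y la0].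
have hc := Cc_shift (- y) (Cc_Bm la0); have [r hr] := hc.2.
have tB : test_function (fun x : R3 R => Bm la (x - y)) by exact: smf_test (smf_Bm la y) hr.
have [k1 i1] := weak_Bm hQ y la0.
have cf : continuous (fun x => Q x ^+ 3 - Q x) by cont.
have i2 := conv_intg y cf (Cc_Bm la0).
split; last by rewrite !Int_eq0// => x; rewrite /Lint; ring.
transitivity (Int (fun x => Q x * - lapB la (enorm2 (x - y)))).
  by apply: eq_Int => x; rewrite /Lint; ring.
rewrite -k1; apply/eqP; rewrite -subr_eq0 -(IntB i1 i2) -[X in _ == X](eq _ tB); apply/eqP.
by apply: eq_Int => x; ring.
Qed.
End GrossPitaevskiiTests.

(** * The ground state *)

Section Regularity.
Context {R : realType}.
Implicit Types (f h u k Phi : R3 R -> R) (du dv dPhi : 'I_3 -> R3 R -> R) (x y z : R3 R) (s t la ka : R).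

Lemma Int_orth f : continuous f -> (forall la y, 0 < la -> Int (fun x => f x * Bm la (x - y)) = 0) -> forall y, f y = 0.
Proof.
move=> cf h y; apply/eqP; rewrite -normr_le0; apply/ler_addgt0Pr => e e0; rewrite add0r.
have [N hN] := mol_locunif cf `|y| e0.
have := hN N (leqnn _) y (lexx _); rewrite /mol /cconv h ?ltr0n// mulr0 sub0r normrN; exact.
Qed.

Definition bmp3 la s : R := la ^+ 2 * (- la * (ebump' 4 (1 - la * s) - 2 * ebump' 3 (1 - la * s))).

Lemma bmp2_derive la s : is_derive (s : R) (1 : R) (bmp2 la) (bmp3 la s).
Proof.
pose F (t : R) : R := ebump 4 t - 2 * ebump 3 t.
pose F' (t : R) : R := ebump' 4 t - 2 * ebump' 3 t.
have hd (t : R) : is_derive (t : R) (1 : R) F (F' t).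
  by have h := derB (ebump_derive 4 t) (derZ 2 (ebump_derive 3 t)); exact h.
by have h := derZ (la ^+ 2) (affine_comp_derive la s hd); exact h.
Qed.

Lemma bmp3_cont la : continuous (bmp3 la).
Proof.
have ce n : continuous (fun s : R => ebump' n (1 - la * s)).
  move=> s; apply: cvgB; first exact: eta1_cont.
  by apply: cvgM; [exact: cvg_cst|exact: eta1_cont].
move=> s; apply: cvgM; first exact: cvg_cst.
apply: cvgM; first exact: cvg_cst.
by apply: cvgB; [exact: ce|apply: cvgM; [exact: cvg_cst|exact: ce]].
Qed.

Definition d3Bm la (j i k : 'I_3) z : R := 2 * ((j == i)%:R * (2 * (coord3 z k * bmp2 la (enorm2 z))) +
  2 * (((i == k)%:R * coord3 z j + coord3 z i * (j == k)%:R) * bmp2 la (enorm2 z) + coord3 z i * coord3 z j * (2 * (coord3 z k * bmp3 la (enorm2 z))))).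

Lemma C1_ddBm la j i : C1 (ddBm la j i) (d3Bm la j i).
Proof.
have h1 := C1_radial (bmp1_derive la) (@bmp2_cont _ la); have h2 := C1_radial (bmp2_derive la) (@bmp3_cont la).
have := C1Z 2 (C1D (C1Z (j == i)%:R h1) (C1Z 2 (C1M (C1M (C1_coord i) (C1_coord j)) h2))).
by apply: C1_ext => // k x; rewrite /d3Bm; ring.
Qed.

Lemma d3Bm_sym la j i z : d3Bm la j i i z = d3Bm la i i j z.
Proof. by rewrite /d3Bm !eqxx (eq_sym i j); ring. Qed.

(** The equation is tested with the [j]-th derivative of a bump. Two integrations by parts exchange
    the roles of [i] and [j], because the third derivatives of the bump are symmetric. *)
Lemma magsol_deriv u f df du dv j : sol 0 u (fun=> 0) f (fun=> 0) du dv -> C1 f df ->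
  magsol 0 (du j) (fun=> 0) (df j) (fun=> 0).
Proof.
move=> [hu hv cf _ h] hf; have [cu cdu _] := hu; have [_ cdf _] := hf.
apply/magsolE; split; [exact: cdu|exact: cont_cst|exact: cdf|exact: cont_cst|move=> la y la0].
split; last by rewrite !Int_eq0// => x; rewrite /Lint; ring.
have hc := Cc_shift (- y) (Cc_Bm la0); have hB := C1_shift (- y) (C1_Bm la).
have cd i := C1_Cc i hB hc.
have hd i := C1_shift (- y) (C1_dBm la i); have cdd i (l : 'I_3) := C1_Cc l (hd i) (cd i).
have hdd i (l : 'I_3) := C1_shift (- y) (C1_ddBm la i l).
have [e _] := h _ _ (hd j) (cd j).
have ie i i' l : intg (fun x => du i x * ddBm la i' l (x - y)) by apply: Cc_intg; apply: Cc_mulr => //; exact: (cdd i' l).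
have sw i : Int (fun x => du i x * ddBm la j i (x - y)) = Int (fun x => du j x * ddBm la i i (x - y)).
  have e1 := ibp i hu (hdd j i) (or_intror (cdd j i)); have e2 := ibp j hu (hdd i i) (or_intror (cdd i i)).
  apply: oppr_inj; rewrite -e1 -e2; apply: eq_Int => x; by rewrite d3Bm_sym.
have ib := ibp j hf hB (or_intror hc).
rewrite -[RHS]opprK -ib -e.
transitivity (- (Int (fun x => du o0 x * ddBm la j o0 (x - y) + du o1 x * ddBm la j o1 (x - y) + du o2 x * ddBm la j o2 (x - y)))); last first.
  by congr (- _); apply: eq_Int => x; rewrite /gdot sum3; ring.
rewrite (IntD (intgD (ie _ _ _) (ie _ _ _)) (ie _ _ _)) (IntD (ie _ _ _) (ie _ _ _)) !sw.
rewrite -(IntD (ie _ _ _) (ie _ _ _)) -(IntD (intgD (ie _ _ _) (ie _ _ _)) (ie _ _ _)) -IntN; last exact: intgD (intgD (ie _ _ _) (ie _ _ _)) (ie _ _ _).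
apply: eq_Int => x; rewrite /Lint -lapBE sum3; ring.
Qed.

Lemma sol0_pointwise u f du dv ddu : sol 0 u (fun=> 0) f (fun=> 0) du dv -> (forall j, C1 (du j) (ddu j)) ->
  forall x, - (\sum_j ddu j j x) = f x.
Proof.
move=> [hu hv cf _ h] hd x; have [cu cdu _] := hu.
have cdd j : continuous (ddu j j) by case: (hd j).
apply/eqP; rewrite -subr_eq0; apply/eqP; move: x.
apply: Int_orth => [|la y la0]; first by cont.
have hc := Cc_shift (- y) (Cc_Bm la0); have hB := C1_shift (- y) (C1_Bm la).
have [e _] := h _ _ hB hc.
have ib j : Int (fun x => du j x * dBm la j (x - y)) = - Int (fun x => ddu j j x * Bm la (x - y)) := ibp j (hd j) hB (or_intror hc).
have cd i := C1_Cc i hB hc.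
have i1 j : intg (fun x => du j x * dBm la j (x - y)) by apply: Cc_intg; exact: Cc_mulr (cdu j) (cd j).
have i2 j : intg (fun x => ddu j j x * Bm la (x - y)) by apply: Cc_intg; exact: Cc_mulr.
have i3 : intg (fun x => f x * Bm la (x - y)) by apply: Cc_intg; exact: Cc_mulr.
have iS := intgD (intgD (i2 o0) (i2 o1)) (i2 o2).
transitivity (-1 * Int (fun x => ddu o0 o0 x * Bm la (x - y) + ddu o1 o1 x * Bm la (x - y) + ddu o2 o2 x * Bm la (x - y)) - Int (fun x => f x * Bm la (x - y))).
  by rewrite -(IntZ (-1) iS) -(IntB (intgZ (-1) iS) i3); apply: eq_Int => x; rewrite sum3; ring.
rewrite -e (IntD (intgD (i2 _) (i2 _)) (i2 _)) (IntD (i2 _) (i2 _)).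
transitivity (Int (fun x => du o0 x * dBm la o0 (x - y) + du o1 x * dBm la o1 (x - y) + du o2 x * dBm la o2 (x - y)) - Int (fun x => gdot du (fun j x => dBm la j (x - y)) x + 2 * 0 * (0 * rotd (fun j x => dBm la j (x - y)) x))).
  rewrite (IntD (intgD (i1 _) (i1 _)) (i1 _)) (IntD (i1 _) (i1 _)) !ib.
  by rewrite mulN1r !opprD.
by apply/eqP; rewrite subr_eq0; apply/eqP; apply: eq_Int => x; rewrite /gdot sum3; ring.
Qed.

Lemma rot_ibp u du Phi dPhi : C1 u du -> C1 Phi dPhi -> Cc Phi ->
  Int (fun x => u x * rotd dPhi x) = - Int (fun x => rotd du x * Phi x).
Proof.
move=> hu hP cP; have hx0 := C1M (C1_coord o0) hu; have hx1 := C1M (C1_coord o1) hu.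
have E2 := ibp o1 hx0 hP (or_intror cP); have E3 := ibp o0 hx1 hP (or_intror cP).
have cdP j := C1_Cc j hP cP; have [c0 d0 _] := hx0; have [c1 d1 _] := hx1.
have i2 := Cc_intg (Cc_mulr c0 (cdP o1)); have i3 := Cc_intg (Cc_mulr c1 (cdP o0)).
have j2 := Cc_intg (Cc_mulr (d0 o1) cP); have j3 := Cc_intg (Cc_mulr (d1 o0) cP).
transitivity (Int (fun x => coord3 x o0 * u x * dPhi o1 x - coord3 x o1 * u x * dPhi o0 x)).
  by apply: eq_Int => x; rewrite /rotd /coord3 /tnth /=; ring.
rewrite (IntB i2 i3) E2 E3 -opprB opprK addrC -(IntB j2 j3); congr (- _).
by apply: eq_Int => x; rewrite /rotd /coord3 /tnth /=; ring.
Qed.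

(** A real solution without field solves the equation with any field, once the magnetic term is put
    on the right as an imaginary source. For the radial [Q] that source vanishes; for [psi] it does
    not, but it is of order [ka]. *)
Lemma sol_ka ka u f du dv : sol 0 u (fun=> 0) f (fun=> 0) du dv ->
  sol ka u (fun=> 0) f (fun x => 2 * ka * rotd du x) du (fun _ _ => 0).
Proof.
move=> [hu hv cf _ h]; have [cu cdu _] := hu.
have cr : continuous (rotd du) by rewrite /rotd; cont.
split; [exact: hu|exact: C1_cst|exact: cf|by cont|move=> Phi dPhi hP cP; split].
  by have [<- _] := h _ _ hP cP; apply: eq_Int => x; ring.
have i1 : intg (fun x => u x * rotd dPhi x).
  have cdP j := C1_Cc j hP cP; have [c0 [r hr]] := cP; apply: Cc_intg; split.
    by have cdP' j : continuous (dPhi j) := (cdP j).1; rewrite /rotd; cont.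
  by exists r => x xr; rewrite /rotd !(C1_vanish hP hr _ xr); ring.
have i2 : intg (fun x => rotd du x * Phi x) by apply: Cc_intg; exact: Cc_mulr.
transitivity (- (2 * ka) * Int (fun x => u x * rotd dPhi x)).
  by rewrite -(IntZ _ i1); apply: eq_Int => x; rewrite /gdot sum3; ring.
rewrite (rot_ibp hu hP cP) mulrNN -(IntZ _ i2); apply: eq_Int => x; ring.
Qed.

Lemma mvt0 (F F' : R -> R) (a b : R) : a < b -> (forall t, is_derive (t : R) (1 : R) F (F' t)) ->
  exists c, [/\ a < c, c < b & F b - F a = F' c * (b - a)].
Proof.
move=> ab hd; have cs : {within `[a, b], continuous F}.
  by apply: continuous_subspaceT => t; exact: derive_continuous hd t.
by have [c] := @MVT R F F' a b ab (fun t _ => hd t) cs; rewrite in_itv /= => /andP[? ?] ?; exists c.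
Qed.
End Regularity.

(** * The radial profile: monotonicity, decay, nondegeneracy at the origin *)

Section Profile.
Context {R : realType}.
Variables (Q : R3 R -> R) (dQ : 'I_3 -> R3 R -> R) (ddQ : 'I_3 -> 'I_3 -> R3 R -> R).
Hypotheses (Q0 : forall x, 0 < Q x) (Qr : forall x y : R3 R, enorm2 x = enorm2 y -> Q x = Q y)
  (hQ : C1 Q dQ) (hdQ : forall j, C1 (dQ j) (ddQ j))
  (eqQ : forall x, - (\sum_j ddQ j j x) = Q x ^+ 3 - Q x)
  (iQ : intg (fun x => Q x ^+ 2)).
Implicit Types (x y : R3 R) (s t : R).

Definition ray t : R3 R := t *: axis_vec o0 + 0.
Definition q t : R := Q (ray t).
Definition q1 t : R := dQ o0 (ray t).
Definition q2 t : R := ddQ o0 o0 (ray t).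

Lemma coord_ray t j : coord3 (ray t) j = (j == o0)%:R * t.
Proof. by rewrite /ray coordZD coord_axis /coord3 /tnth /= ; case: j => -[|[|[|]]] //= i; ring. Qed.

Lemma enorm2_ray t : enorm2 (ray t) = t ^+ 2.
Proof. by rewrite /enorm2 /dot sum3 !coord_ray /=; ring. Qed.

Lemma q_derive t : is_derive (t : R) (1 : R) q (q1 t).
Proof. by have [_ _ h] := hQ; exact: (slice_derive_at 0 t (h o0)). Qed.
Lemma q1_derive t : is_derive (t : R) (1 : R) q1 (q2 t).
Proof. by have [_ _ h] := hdQ o0; exact: (slice_derive_at 0 t (h o0)). Qed.
Lemma cont_ray (f : R3 R -> R) : continuous f -> continuous (fun t => f (ray t)).
Proof.
move=> cf t; apply: (@continuous_comp _ _ _ ray f); last exact: cf.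
by apply: cvgD; [apply: cvgZl; exact: cvg_id|exact: cvg_cst].
Qed.
Lemma q2_cont : continuous q2.
Proof. by apply: cont_ray; case: (hdQ o0). Qed.
Lemma q_cont : continuous q. Proof. exact: derive_continuous q_derive. Qed.
Lemma q1_cont : continuous q1. Proof. exact: derive_continuous q1_derive. Qed.
Lemma q_gt0 t : 0 < q t. Proof. exact: Q0. Qed.

Lemma Q_q x : Q x = q (Num.sqrt (enorm2 x)).
Proof. by apply: Qr; rewrite enorm2_ray sqr_sqrtr// enorm2_ge0. Qed.

Lemma enorm2_eq0 x : enorm2 x = 0 -> x = 0.
Proof.
move=> x0; apply/eqP; rewrite -normr_eq0 -sqrf_eq0 eq_le sqr_ge0 andbT.
by rewrite -x0; exact: sqr_norm_le_enorm2.
Qed.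

(** Multiplied through by [|x|], so that the origin is included. *)
Lemma dQ_radial j x : dQ j x * Num.sqrt (enorm2 x) = q1 (Num.sqrt (enorm2 x)) * coord3 x j.
Proof.
have [x0|x0] := eqVneq (enorm2 x) 0.
  by rewrite x0 sqrtr0 mulr0 (enorm2_eq0 x0) /coord3 /tnth /=; case: j => -[|[|[|]]] //= ?; rewrite mulr0.
have xp : 0 < enorm2 x by rewrite lt_def x0 enorm2_ge0.
have [_ _ hE] := @C1_enorm2 R; have [_ _ hq] := hQ.
have d1 := der_comp1 (q_derive (Num.sqrt (enorm2 x))) (is_derive1_sqrt xp).
have d2 := der_comp (hE j x) d1.
have d3 : is_derive x (axis_vec j) (fun y => q (Num.sqrt (enorm2 y))) (dQ j x).
  by apply: der_eqf (hq j x) => y; exact: Q_q.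
rewrite (der_unique d3 d2); have s0 : Num.sqrt (enorm2 x) != 0 by rewrite gt_eqF// sqrtr_gt0.
by field.
Qed.

Lemma dQ_rot j x : x.1.1 * dQ j x = coord3 x j * dQ o0 x.
Proof.
have [x0|x0] := eqVneq (enorm2 x) 0.
  by rewrite (enorm2_eq0 x0) /coord3 /tnth /=; case: j => -[|[|[|]]] //= ?; rewrite !mul0r.
have xp : 0 < enorm2 x by rewrite lt_def x0 enorm2_ge0.
have s0 : Num.sqrt (enorm2 x) != 0 by rewrite gt_eqF// sqrtr_gt0.
apply: (mulIf s0); rewrite -!mulrA !dQ_radial /coord3 /tnth /=; ring.
Qed.

(** Differentiate [x_1 d_j Q = x_j d_1 Q] in the direction [j] along the ray. This produces the term
    [2 q' / t] of the radial equation without spherical coordinates. *)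
Lemma ddQ_ray j t : j != o0 -> t * ddQ j j (ray t) = q1 t.
Proof.
move=> j0; have h1 := C1M (C1_coord o0) (hdQ j); have h2 := C1M (C1_coord j) (hdQ o0).
have [_ _ d1] := h1; have [_ _ d2] := h2.
have d3 : is_derive (ray t) (axis_vec j) (fun x => coord3 x o0 * dQ j x) (((j == j)%:R * dQ o0 (ray t) + coord3 (ray t) j * ddQ o0 j (ray t))).
  by apply: der_eqf (d2 j (ray t)) => y; rewrite -dQ_rot.
have := der_unique (d1 j (ray t)) d3.
by rewrite !coord_ray !eqxx (eq_sym o0) (negbTE j0) /q1 mulr0n mulr1n !mul0r add0r !mul1r addr0.
Qed.

Lemma q_ode t : t * q2 t + 2 * q1 t = t * (q t - q t ^+ 3).
Proof.
have := eqQ (ray t); rewrite sum3 -/(q t) -/(q2 t) => e.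
have e1 := @ddQ_ray o1 t isT; have e2 := @ddQ_ray o2 t isT.
have -> : q t - q t ^+ 3 = q2 t + ddQ o1 o1 (ray t) + ddQ o2 o2 (ray t) by lra.
by rewrite !mulrDr e1 e2; ring.
Qed.

(** The mechanical energy of the radial equation, read as motion in a potential with friction
    [2 q' / t]; the friction makes it decrease. *)
Definition en t : R := q1 t ^+ 2 / 2 - q t ^+ 2 / 2 + q t ^+ 4 / 4.
Definition en' t : R := q1 t * (q2 t - q t + q t ^+ 3).

Lemma en_derive t : is_derive (t : R) (1 : R) en (en' t).
Proof.
have h1 := derX 1 (q1_derive t); have h2 := derX 1 (q_derive t); have h3 := derX 3 (q_derive t).
have := derD (derB (derZ 2^-1 h1) (derZ 2^-1 h2)) (derZ 4^-1 h3).
have -> : (fun y : R => 2^-1 * q1 y ^+ 2 - 2^-1 * q y ^+ 2 + 4^-1 * q y ^+ 4) = en.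
  by apply/funext => y; rewrite /en; field.
by move=> h; apply: (der_eq h); rewrite /en'; field.
Qed.

Lemma q1_0 : q1 0 = 0.
Proof. by have := q_ode 0; rewrite !mul0r add0r => /eqP; rewrite mulf_eq0 pnatr_eq0 => /eqP. Qed.

Lemma en_noninc s t : 0 <= s -> s <= t -> en t <= en s.
Proof.
move=> s0; rewrite le_eqVlt => /predU1P[->//|st].
have [c [c1 c2 e]] := mvt0 st en_derive.
have c0 : 0 < c by lra.
have : c * en' c <= 0.
  have -> : c * en' c = - (2 * q1 c ^+ 2).
    have := q_ode c; rewrite /en'; move: (q2 c) (q1 c) (q c) => a b d h.
    have -> : c * (b * (a - d + d ^+ 3)) = b * (c * a - c * (d - d ^+ 3)) by ring.
    by rewrite -h; ring.
  by rewrite oppr_le0 mulr_ge0// sqr_ge0.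
rewrite pmulr_rle0// => h; rewrite -subr_le0 e; apply: mulr_le0_ge0 => //; lra.
Qed.

(** A negative energy would stay negative, and [q^2 >= - 2 en] would keep [Q] away from zero on a
    half-space, against square integrability. *)
Lemma en_ge0 t : 0 <= t -> 0 <= en t.
Proof.
move=> t0; rewrite leNgt; apply/negP => et.
set c := - (2 * en t); have c0 : 0 < c by rewrite /c; lra.
have hq s : t <= s -> c <= q s ^+ 2.
  move=> ts; have := en_noninc t0 ts; rewrite /en /c.
  have : 0 <= q1 s ^+ 2 by exact: sqr_ge0.
  have : 0 <= q s ^+ 4 by rewrite exprn_ge0// ltW// q_gt0.
  by rewrite /en; lra.
have hx x : t <= x.1.1 -> c <= Q x ^+ 2.
  move=> tx; rewrite Q_q; apply: hq; have x0 : 0 <= x.1.1 by lra.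
  rewrite -(ger0_norm t0) -sqrtr_sqr ler_wsqrtr// enorm2E.
  have : t ^+ 2 <= x.1.1 ^+ 2 by rewrite ler_sqr ?nnegrE.
  have := sqr_ge0 x.1.2; have := sqr_ge0 x.2; lra.
have [cQ _ _] := hQ.
pose G := Int (fun x => Q x ^+ 2).
have big r : 1 <= r -> c * r <= G.
  move=> r1; have r0 : 0 <= r by lra.
  (* The cube of half-side [r] with this centre lies in the half-space [t <= x_1]. *)
  pose a : R3 R := (t + r, 0, 0).
  have [i1 e1] := Int_translate a iQ.
  have cQa := @cont_shift _ Q a cQ.
  have cQ2 : continuous (fun x : R3 R => Q (x + a) ^+ 2) by cont.
  rewrite /G -e1; apply: le_trans (IntBox_le r cQ2 i1 (fun x => sqr_ge0 _)).
  apply: le_trans (_ : IntBox r (fun=> c) <= _); last first.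
    apply: le_IntBox => // [|x]; first exact: cont_cst.
    rewrite boxE => /and3P[x1 _ _]; apply: hx; rewrite /a /=.
    by move: x1; rewrite ler_norml => /andP[]; lra.
  rewrite IntBox_cst// ler_pM2l// exprMn.
  have : r <= r ^+ 3 by rewrite -{1}[r]expr1 ler_weXn2l.
  have : 0 <= r ^+ 3 by rewrite exprn_ge0.
  have -> : (2 : R) ^+ 3 = 8 by ring.
  lra.
have G0 : 0 <= G by apply: Int_ge0 => x; exact: sqr_ge0.
have ec : c * (G / c + 1) = G + c by field; rewrite gt_eqF.
have := big (G / c + 1); rewrite ec.
have : 0 <= G / c by rewrite divr_ge0// ltW.
by move=> h h'; have : G + c <= G; [apply: h'; lra|lra].
Qed.

(** At a critical point the energy is the potential [q^2 (q^2 - 2) / 4], which must be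
    nonnegative. *)
Lemma crit_ge2 t : 0 <= t -> q1 t = 0 -> 2 <= q t ^+ 2.
Proof.
move=> t0 h; have := en_ge0 t0; rewrite /en h expr0n /= mul0r add0r.
have qp : 0 < q t ^+ 2 by rewrite exprn_gt0// q_gt0.
have -> : - (q t ^+ 2 / 2) + q t ^+ 4 / 4 = q t ^+ 2 * (q t ^+ 2 - 2) / 4 by field.
by rewrite pmulr_lge0// pmulr_rge0// subr_ge0.
Qed.

(** If [q' (t) >= 0], the minimum of [q] over [[0, t]] is at a critical point, so [q^2 >= 2] on the
    whole interval. There [(s^2 q')' = s^2 (q - q^3)] is negative for [s > 0], which forces
    [t^2 q' (t) < 0]. *)
Lemma q1_lt0 t : 0 < t -> q1 t < 0.
Proof.
move=> t0; rewrite ltNge; apply/negP => qt.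
have cw : {within `[0, t], continuous q} by apply: continuous_subspaceT => s; exact: q_cont.
have [m mI hm] := EVT_min (ltW t0) cw.
have /andP[m0 mt] : 0 <= m <= t by move: mI; rewrite in_itv.
have qm : q1 m = 0.
  have [->|mn0] := eqVneq m 0; first exact: q1_0.
  apply/eqP; rewrite eq_le; apply/andP; split.
    rewrite leNgt; apply/negP => h.
    have hc : {for m, continuous q1} by exact: q1_cont.
    have : \forall s \near m, 0 < q1 s by move/cvgrPdist_lt : hc => /(_ _ h); apply: filterS => s; rewrite ltr_norml => /andP[]; lra.
    move=> /nbhs_ballP[d /= d0 hd].
    pose s := Num.max (m / 2) (m - d / 2).
    have sm : s < m by rewrite gt_max; apply/andP; split; lra.
    have [c [c1 c2 e]] := mvt0 sm q_derive.
    have s0 : 0 <= s by rewrite le_max; apply/orP; left; lra.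
    have sI : s \in `[0, t] by rewrite in_itv /= s0 /=; lra.
    have := hm s sI; have : 0 < q1 c.
      apply: hd; rewrite /ball /= gtr0_norm; last by lra.
      have : m - d / 2 <= s by rewrite le_max lexx orbT.
      lra.
    move=> q1c; have : 0 < q1 c * (m - s) by apply: mulr_gt0 => //; lra.
    by rewrite -e; lra.
  have [->//|mnt] := eqVneq m t.
  rewrite leNgt; apply/negP => h.
  have hc : {for m, continuous q1} by exact: q1_cont.
  have : \forall s \near m, q1 s < 0.
    have h' : 0 < - q1 m by lra.
    by move/cvgrPdist_lt : hc => /(_ _ h'); apply: filterS => s; rewrite ltr_norml => /andP[]; lra.
  move=> /nbhs_ballP[d /= d0 hd].
  pose s := Num.min t (m + d / 2).
  have sm : m < s by rewrite lt_min; apply/andP; split; lra.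
  have [c [c1 c2 e]] := mvt0 sm q_derive.
  have st : s <= t by rewrite ge_min lexx.
  have sI : s \in `[0, t] by rewrite in_itv /=; apply/andP; split; lra.
  have := hm s sI; have : q1 c < 0.
    apply: hd; rewrite /ball /= ltr0_norm; last by lra.
    have : s <= m + d / 2 by rewrite ge_min lexx orbT.
    lra.
  move=> q1c; have : q1 c * (s - m) < 0 by rewrite nmulr_rlt0//; lra.
  by rewrite -e; lra.
have q2m := crit_ge2 m0 qm.
have hs s : is_derive (s : R) (1 : R) (fun s => s ^+ 2 * q1 s) (s ^+ 2 * (q s - q s ^+ 3)).
  have h1 := derM (derX 1 (is_derive_id s (1 : R))) (q1_derive s).
  apply: (der_eq h1); have -> : s ^+ 2 * (q s - q s ^+ 3) = s * (s * (q s - q s ^+ 3)) by ring.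
  by rewrite -q_ode; ring.
have [c [c1 c2 e]] := mvt0 t0 hs.
have cI : c \in `[0, t] by rewrite in_itv /=; apply/andP; split; lra.
have qc : 2 <= q c ^+ 2.
  by apply: le_trans q2m _; rewrite ler_sqr ?nnegrE ?(ltW (q_gt0 _))//; exact: hm.
move: e; rewrite expr0n mul0r !subr0 => e.
have : 0 <= t ^+ 2 * q1 t by rewrite mulr_ge0// sqr_ge0.
rewrite e leNgt => /negP; apply; rewrite pmulr_llt0// pmulr_rlt0 ?exprn_gt0//.
have -> : q c - q c ^+ 3 = q c * (1 - q c ^+ 2) by ring.
by rewrite pmulr_rlt0 ?q_gt0//; lra.
Qed.

Lemma q_dec s t : 0 <= s -> s <= t -> q t <= q s.
Proof.
move=> s0; rewrite le_eqVlt => /predU1P[->//|st].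
have [c [c1 c2 e]] := mvt0 st q_derive.
have qc : q1 c < 0 by apply: q1_lt0; lra.
by rewrite -subr_le0 e; apply: mulr_le0_ge0; lra.
Qed.

(** Let [t] tend to zero in the radial equation: [3 q'' (0) = q (0) - q (0)^3], negative because
    [q (0)^2 >= 2]. The mean value theorem replaces [q' (t)] by [t q'' (c)], and continuity of [q'']
    and [q] does the rest. *)
Lemma q2_0 : q2 0 < 0.
Proof.
rewrite ltNge; apply/negP => h.
have g0 : 2 <= q 0 ^+ 2 by apply: crit_ge2 => //; exact: q1_0.
have qp := q_gt0 0.
pose e := q 0 ^+ 3 - q 0.
have e0 : 0 < e by rewrite /e (_ : _ - _ = q 0 * (q 0 ^+ 2 - 1)); [apply: mulr_gt0 => //; lra|ring].
have c3 : continuous (fun s => q s ^+ 3 - q s).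
  move=> s; apply: cvgB; last exact: q_cont.
  by apply: cvgM; [exact: q_cont|apply: cvgM; exact: q_cont].
have e4 : 0 < e / 8 by lra.
have /nbhs_ballP[d1 /= d10 h1] : \forall s \near (0 : R), `|q2 0 - q2 s| < e / 8 by have hc : {for (0 : R), continuous q2} := @q2_cont 0; move/cvgrPdist_lt : hc; exact.
have /nbhs_ballP[d2 /= d20 h2] : \forall s \near (0 : R), `|(q 0 ^+ 3 - q 0) - (q s ^+ 3 - q s)| < e / 8 by have hc : {for (0 : R), continuous (fun s => q s ^+ 3 - q s)} := c3 0; move/cvgrPdist_lt : hc; exact.
pose t := Num.min d1 d2 / 2; have t0 : 0 < t by rewrite divr_gt0// lt_min d10.
have td1 : t < d1.
  have : Num.min d1 d2 <= d1 by rewrite ge_min lexx.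
  by rewrite /t; lra.
have td2 : t < d2.
  have : Num.min d1 d2 <= d2 by rewrite ge_min lexx orbT.
  by rewrite /t; lra.
have [c [c1 c2 ec]] := mvt0 t0 q1_derive.
have ode := q_ode t; move: ec; rewrite q1_0 !subr0 => ec; rewrite ec in ode.
have E : q2 t + 2 * q2 c = q t - q t ^+ 3.
  by apply: (mulfI (lt0r_neq0 t0)); rewrite -ode; ring.
have b1 : `|q2 0 - q2 t| < e / 8 by apply: h1; rewrite /ball /= sub0r normrN gtr0_norm.
have b2 : `|q2 0 - q2 c| < e / 8 by apply: h1; rewrite /ball /= sub0r normrN gtr0_norm; lra.
have b3 : `|(q 0 ^+ 3 - q 0) - (q t ^+ 3 - q t)| < e / 8 by apply: h2; rewrite /ball /= sub0r normrN gtr0_norm.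
move: b1 b2 b3; rewrite !ltr_norml -/e => /andP[? ?] /andP[? ?] /andP[? ?]; lra.
Qed.

(** Near [0] the bound comes from [q'' (0) < 0], elsewhere from the maximum of [q'] on a compact
    interval away from [0]. *)
Lemma q1_lin K : 0 < K -> exists2 k0 : R, 0 < k0 & forall t, 0 <= t <= K -> k0 * t <= - q1 t.
Proof.
move=> K0; have q20 := q2_0.
pose e := - q2 0 / 2; have e0 : 0 < e by rewrite /e; lra.
have /nbhs_ballP[d /= d0 h1] : \forall s \near (0 : R), `|q2 0 - q2 s| < e by have hc : {for (0 : R), continuous q2} := @q2_cont 0; move/cvgrPdist_lt : hc; exact.
have small t : 0 <= t < d -> e * t <= - q1 t.
  move=> /andP[]; rewrite le_eqVlt => /predU1P[<- _|t0 td]; first by rewrite q1_0 mulr0 oppr0.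
  have [c [c1 c2 ec]] := mvt0 t0 q1_derive.
  move: ec; rewrite q1_0 !subr0 => ->; rewrite -mulNr ler_pM2r//.
  have : `|q2 0 - q2 c| < e by apply: h1; rewrite /ball /= sub0r normrN gtr0_norm; lra.
  by rewrite ltr_norml /e => /andP[]; lra.
have [dK|Kd] := leP d K; last first.
  by exists e => // t /andP[t0 tK]; apply: small; apply/andP; split=> //; lra.
have cw : {within `[d / 2, K], continuous q1} by apply: continuous_subspaceT => s; exact: q1_cont.
have d2K : d / 2 <= K by lra.
have [m mI hm] := EVT_max d2K cw.
have mp : q1 m < 0 by apply: q1_lt0; move: mI; rewrite in_itv /= => /andP[]; lra.
exists (Num.min e (- q1 m / K)); first by rewrite lt_min e0 divr_gt0//; lra.
move=> t /andP[t0 tK]; have [td|dt] := ltP t d.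
  apply: le_trans (small t _); last by rewrite t0.
  by apply: ler_wpM2r => //; rewrite ge_min lexx.
apply: le_trans (_ : - q1 m / K * t <= _); first by apply: ler_wpM2r => //; rewrite ge_min lexx orbT.
have tI : t \in `[d / 2, K] by rewrite in_itv /=; apply/andP; split; lra.
have := hm t tI => h.
rewrite mulrAC ler_pdivrMr//; apply: ler_pM => //; lra.
Qed.

(** [q] is decreasing: a value above [e] at [2 r] would persist on the cube of half-side [r], whose
    points have Euclidean norm at most [2 r], and its volume contradicts square integrability. *)
Lemma Q_decay (e : R) : 0 < e -> exists2 K : R, 0 <= K & forall x, K < `|x| -> Q x <= e.
Proof.
move=> e0; pose G := Int (fun x => Q x ^+ 2); have [cQ _ _] := hQ.
have G0 : 0 <= G by apply: Int_ge0 => x; exact: sqr_ge0.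
pose r := 1 + G / e ^+ 2; have e2 : 0 < e ^+ 2 by rewrite exprn_gt0.
have gq : 0 <= G / e ^+ 2 by rewrite divr_ge0// ltW.
have r1 : 1 <= r by rewrite /r; lra.
have r0 : 0 <= r by lra.
have cQ2 : continuous (fun x => Q x ^+ 2) by cont.
have key : q (2 * r) <= e.
  rewrite leNgt; apply/negP => h.
  have : IntBox r (fun=> e ^+ 2) <= G.
    apply: le_trans (IntBox_le r cQ2 iQ (fun x => sqr_ge0 _)).
    apply: le_IntBox => // [|x xr]; first exact: cont_cst.
    rewrite ler_sqr ?nnegrE ?(ltW e0)// ?(ltW (Q0 _))// Q_q.
    apply: le_trans (ltW h) _; apply: q_dec; first exact: sqrtr_ge0.
    have -> : 2 * r = Num.sqrt ((2 * r) ^+ 2) by rewrite sqrtr_sqr ger0_norm// mulr_ge0.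
    rewrite ler_wsqrtr//; apply: le_trans (enorm2_le x) _.
    have : `|x| ^+ 2 <= r ^+ 2 by rewrite ler_sqr ?nnegrE.
    by rewrite exprMn (_ : 2 ^+ 2 = 4 :> R)//; [have := sqr_ge0 r; lra|ring].
  rewrite IntBox_cst// exprMn (_ : 2 ^+ 3 = 8 :> R); last by ring.
  have : r <= r ^+ 3 by rewrite -{1}[r]expr1 ler_weXn2l.
  move=> r3 h2; have : e ^+ 2 * r <= G.
    apply: le_trans h2; rewrite ler_pM2l//; lra.
  by rewrite /r mulrDr mulr1 mulrC divfK ?gt_eqF//; lra.
exists (2 * r); first by rewrite mulr_ge0.
move=> x xr; rewrite Q_q; apply: le_trans key; apply: q_dec; first by rewrite mulr_ge0.
have -> : 2 * r = Num.sqrt ((2 * r) ^+ 2) by rewrite sqrtr_sqr ger0_norm// mulr_ge0.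
apply: ler_wsqrtr; apply: ltW; apply: enorm2_gt => //; by rewrite mulr_ge0.
Qed.

Lemma Q_le x : Q x <= Q 0.
Proof.
rewrite [Q x]Q_q [Q 0]Q_q; apply: q_dec; rewrite ?sqrtr_ge0// ler_wsqrtr//.
by rewrite enorm2E /= !expr0n /= !addr0 enorm2_ge0.
Qed.

Lemma psi_pos x : 0 < x.1.1 -> 0 < - dQ o0 x.
Proof.
move=> x1; have xp : 0 < enorm2 x.
  rewrite enorm2E; have : 0 < x.1.1 ^+ 2 by rewrite exprn_gt0.
  by have := sqr_ge0 x.1.2; have := sqr_ge0 x.2; lra.
have s0 : 0 < Num.sqrt (enorm2 x) by rewrite sqrtr_gt0.
rewrite -(pmulr_lgt0 _ s0) mulNr dQ_radial -mulNr; apply: mulr_gt0 => //.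
by have := q1_lt0 s0; lra.
Qed.

Lemma psi_odd x : dQ o0 (refl1 x) = - dQ o0 x.
Proof.
have eR : enorm2 (refl1 x) = enorm2 x by rewrite !enorm2E /= sqrrN.
have [x0|x0] := eqVneq (enorm2 x) 0.
  have -> : refl1 x = x by rewrite (enorm2_eq0 x0) /refl1 /= oppr0.
  rewrite (enorm2_eq0 x0); have := q1_0; rewrite /q1 /ray scale0r addr0 => ->; by rewrite oppr0.
have xp : 0 < enorm2 x by rewrite lt_def x0 enorm2_ge0.
have s0 : Num.sqrt (enorm2 x) != 0 by rewrite gt_eqF// sqrtr_gt0.
apply: (mulIf s0); rewrite mulNr dQ_radial -{1}eR dQ_radial eR /coord3 /tnth /=; ring.
Qed.

(** [psi] vanishes on the plane [x_1 = 0] to first order only. This makes the quotient by [psi] of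
    an odd [C^1] function with compact support bounded. *)
Lemma psi_lin K : 0 <= K -> exists2 k0 : R, 0 < k0 & forall x, `|x| <= K -> k0 * `|x.1.1| <= `|dQ o0 x|.
Proof.
move=> K0; have K1 : 0 < 2 * K + 1 by lra.
have [k0 k00 hk] := q1_lin K1; exists k0 => // x xK.
have [x0|x0] := eqVneq (enorm2 x) 0; first by rewrite (enorm2_eq0 x0) /= normr0 mulr0.
have xp : 0 < enorm2 x by rewrite lt_def x0 enorm2_ge0.
have s0 : 0 < Num.sqrt (enorm2 x) by rewrite sqrtr_gt0.
have sK : 0 <= Num.sqrt (enorm2 x) <= 2 * K + 1.
  rewrite sqrtr_ge0 /=; have -> : 2 * K + 1 = Num.sqrt ((2 * K + 1) ^+ 2) by rewrite sqrtr_sqr ger0_norm// ltW.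
  rewrite ler_wsqrtr//; apply: le_trans (enorm2_le x) _.
  have : `|x| ^+ 2 <= K ^+ 2 by rewrite ler_sqr ?nnegrE.
  by rewrite sqrrD exprMn expr1n; have := sqr_ge0 K; lra.
rewrite -(ler_pM2r s0) -{2}(gtr0_norm s0) -normrM dQ_radial normrM mulrAC.
apply: ler_wpM2r => //; have := hk _ sK; have := q1_lt0 s0 => h1 h2.
by rewrite ltr0_norm.
Qed.
End Profile.

(** What the rest of the proof knows about [Q] and [psi = - d_1 Q]. The last clause,
    [- d_11 Q (0) > 0], is the nondegeneracy that turns criticality at the maximum into information
    on the component along [psi]. *)
Record profile (R : realType) (Q : R3 R -> R) (dQ : 'I_3 -> R3 R -> R) (psi : R3 R -> R) (dpsi : 'I_3 -> R3 R -> R) : Prop := Profile {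
  profile_gt0 : forall x, 0 < Q x;
  profile_le : forall x, Q x <= Q 0;
  profile_radial : forall x y, enorm2 x = enorm2 y -> Q x = Q y;
  profile_L2 : intg (fun x => Q x ^+ 2);
  profile_decay : forall e : R, 0 < e -> exists2 K : R, 0 <= K & forall x : R3 R, K < `|x| -> Q x <= e;
  profile_sol : forall ka, sol ka Q (fun=> 0) (fun x => (Q x ^+ 2 - 1) * Q x) (fun=> 0) dQ (fun _ _ => 0);
  profile_dsol : forall ka, sol ka psi (fun=> 0) (fun x => (3 * Q x ^+ 2 - 1) * psi x) (fun x => 2 * ka * rotd dpsi x) dpsi (fun _ _ => 0);
  profile_odd : forall x, psi (refl1 x) = - psi x;
  profile_dgt0 : forall x, 0 < x.1.1 -> 0 < psi x;
  profile_lin : forall K, 0 <= K -> exists2 k0 : R, 0 < k0 & forall x, `|x| <= K -> k0 * `|x.1.1| <= `|psi x|;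
  profile_d0 : 0 < dpsi o0 0 }.

Lemma ground_profile (R : realType) (Q : R3 R -> R) : ground_state Q -> exists dQ psi dpsi, profile Q dQ psi dpsi.
Proof.
move=> gQ; have [cQ [sQ _] Q0 Qr _] := gQ; have [_ iQ] := (sqintE Q).1 sQ.
have z1 : `|0 : R| <= 1 by rewrite normr0.
have [dQ [dv hs]] := magsol_sol z1 (ground_magsol gQ).
have [hQ _ cf _ _] := hs.
have hf : C1 (fun x => Q x ^+ 3 - Q x) (fun j x => (3 * Q x ^+ 2 - 1) * dQ j x).
  by apply: C1_ext (C1B (C1M (C1M hQ hQ) hQ) hQ) => [x|j x]; ring.
(* A second use of regularity, on the differentiated equation: the derivatives of [Q] are [C^1], and
   the equation holds pointwise. *)
have hj j := magsol_sol z1 (magsol_deriv j hs hf).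
have ex j : exists p : ('I_3 -> R3 R -> R) * ('I_3 -> R3 R -> R), sol 0 (dQ j) (fun=> 0) (fun x => (3 * Q x ^+ 2 - 1) * dQ j x) (fun=> 0) p.1 p.2.
  by have [d1 [d2 h]] := hj j; exists (d1, d2).
pose pp j := sval (cid (ex j)); have hp j := svalP (cid (ex j)).
pose ddQ j := (pp j).1.
have hdQ j : C1 (dQ j) (ddQ j) by case: (hp j).
have eqQ := sol0_pointwise hs hdQ.
exists dQ, (fun x => - dQ o0 x), (fun i x => - ddQ o0 i x).
have hpsi : sol 0 (fun x => - dQ o0 x) (fun=> 0) (fun x => (3 * Q x ^+ 2 - 1) * - dQ o0 x) (fun=> 0) (fun i x => - ddQ o0 i x) (fun i x => - (pp o0).2 i x).
  have := sol_lin (-1) 0 (hp o0) (hp o0).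
  by congr sol; [apply/funext => x|apply/funext => x|apply/funext => x|apply/funext => x|apply/funext => i; apply/funext => x|apply/funext => i; apply/funext => x]; rewrite /ddQ /pp; ring.
split => //.
- exact: (Q_le Q0 Qr hQ hdQ eqQ iQ).
- move=> e e0; exact: (Q_decay Q0 Qr hQ hdQ eqQ iQ e0).
- move=> ka; have := (sol_ka ka hs).
  congr sol; apply/funext => x; first by ring.
  by rewrite /rotd; have := dQ_rot Qr hQ o1 x; rewrite /coord3 /tnth /= => ->; ring.
- by move=> ka; exact: (sol_ka ka hpsi).
- by move=> x; rewrite (psi_odd Qr hQ hdQ eqQ).
- by move=> x; exact: (psi_pos Q0 Qr hQ hdQ eqQ iQ).
- move=> K K0; have [k0 k00 h] := psi_lin Q0 Qr hQ hdQ eqQ iQ K0; exists k0 => // x xK.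
  by rewrite normrN; exact: h.
- have := q2_0 Q0 Qr hQ hdQ eqQ iQ; rewrite /q2 /ray scale0r addr0; lra.
Qed.

(** * Uniform closeness to the ground state *)

Section Hardy.
Context {R : realType}.
Local Notation m := (@mass R).
Implicit Types (f g h u v U : R3 R -> R) (du dv dU : 'I_3 -> R3 R -> R) (x : R3 R) (s t ka b : R).

(** A [C^1] quadratic spline rising from [0] to [1] on [[0, 2]]. *)
Definition step t : R := 2^-1 * (sqp t - 2 * sqp (t - 1) + sqp (t - 2)).
Definition step' t : R := 2^-1 * (sqp' t - 2 * sqp' (t - 1) + sqp' (t - 2)).

Lemma shift_derive (f f' : R -> R) (c t : R) : (forall t : R, is_derive (t : R) (1 : R) f (f' t)) ->
  is_derive (t : R) (1 : R) (fun t => f (t - c)) (f' (t - c)).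
Proof.
move=> h; have h1 : is_derive (t : R) (1 : R) (fun t => t - c) 1.
  by apply: (der_eq (derB (is_derive_id t (1 : R)) (der_cst t (1 : R) c))); rewrite subr0.
by apply: (der_eq (@der_comp1 _ f (fun t => t - c) t _ _ (h (t - c)) h1)); rewrite mul1r.
Qed.

Lemma step_derive t : is_derive (t : R) (1 : R) step (step' t).
Proof.
have h c := @shift_derive sqp sqp' c t (@sqp_derive R).
by have h2 := derZ 2^-1 (derD (derB (sqp_derive t) (derZ 2 (h 1))) (h 2)); exact h2.
Qed.

Lemma step'_cont : continuous step'.
Proof.
have c s : continuous (fun t : R => sqp' (t - s)).
  move=> t; apply: (@continuous_comp _ _ _ (fun t => t - s) sqp'); last exact: sqp'_continuous.
  by apply: cvgB; [exact: cvg_id|exact: cvg_cst].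
move=> t; apply: cvgM; first exact: cvg_cst.
apply: cvgD; last exact: c.
by apply: cvgB; [exact: sqp'_continuous|apply: cvgM; [exact: cvg_cst|exact: c]].
Qed.

Lemma step01 t : 0 <= step t <= 1.
Proof.
rewrite /step /sqp; case: (leP t 0) => t0.
  by rewrite !ifT; lra.
case: (leP (t - 1) 0) => t1.
  by rewrite ifT; [nra|lra].
by case: (leP (t - 2) 0) => t2; nra.
Qed.
Lemma step_le0 t : t <= 0 -> step t = 0.
Proof. by move=> t0; rewrite /step /sqp !ifT; lra. Qed.
Lemma step_ge2 t : 2 <= t -> step t = 1.
Proof.
move=> t2; have t0 : 0 < t by lra.
rewrite /step /sqp !leNgt t0 subr_gt0 (_ : 1 < t) /=; last by lra.
case: (ltP 0 (t - 2)) => h /=; first by field.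
have -> : t = 2 by lra.
by field.
Qed.

(** In the variable [s = |x|^2] the cutoff falls from [1] at [3] to [0] at [9]; hence it is [1] on
    the cube of half-side [1] and [0] outside that of half-side [3]. *)
Definition cutf s : R := 1 - step (3^-1 * s - 1).
Definition cutf' s : R := - (3^-1 * step' (3^-1 * s - 1)).
Lemma cutf_derive s : is_derive (s : R) (1 : R) cutf (cutf' s).
Proof.
have h := @scale_derive _ (fun t => step (t - 1)) (fun t => step' (t - 1)) 3^-1 s (fun t => shift_derive 1 t step_derive).
by have h2 := derB (der_cst s (1 : R) 1) h; apply: (der_eq h2); rewrite sub0r.
Qed.
Lemma cutf'_cont : continuous cutf'.
Proof.
move=> s; apply: cvgN; apply: cvgM; first exact: cvg_cst.
apply: (@continuous_comp _ _ _ (fun s => 3^-1 * s - 1) step'); last exact: step'_cont.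
by apply: cvgB; [apply: cvgM; [exact: cvg_cst|exact: cvg_id]|exact: cvg_cst].
Qed.

Definition cut x : R := cutf (enorm2 x).
Definition dcut (j : 'I_3) x : R := 2 * (coord3 x j * cutf' (enorm2 x)).
Lemma C1_cut : C1 cut dcut. Proof. exact: C1_radial cutf_derive cutf'_cont. Qed.
Lemma cut01 x : 0 <= cut x <= 1.
Proof. by have := step01 (3^-1 * enorm2 x - 1); rewrite /cut /cutf; lra. Qed.
Lemma cut1 x : `|x| <= 1 -> cut x = 1.
Proof.
move=> x1; rewrite /cut /cutf step_le0 ?subr0//.
have h1 : `|x| ^+ 2 <= 1 by rewrite expr_le1.
by have := enorm2_le x; lra.
Qed.
Lemma cut_vanish : vanish 3 cut.
Proof.
move=> x x3; rewrite /cut /cutf step_ge2 ?subrr//.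
have h0 : 0 <= (3 : R) by [].
by have := enorm2_gt h0 x3; lra.
Qed.
Lemma Cc_cut : Cc cut.
Proof. by split; [case: C1_cut|exists 3; exact: cut_vanish]. Qed.
Lemma cut_norm x : `|cut x| <= 1.
Proof. by have /andP[h0 h1] := cut01 x; rewrite ger0_norm. Qed.

Lemma C1_affine f df (al : R) (a : R3 R) : C1 f df -> C1 (fun x : R3 R => f (al *: x + a)) (fun j (x : R3 R) => al * df j (al *: x + a)).
Proof.
move=> [cf cdf h]; split; first exact: cont_affine.
  by move=> j; apply: contM; [exact: cont_cst|exact: cont_affine].
by move=> j x; apply: der_scale; exact: h.
Qed.

(** [N_b - N_1]. For [b = 4^n] it is the sum of the kernels [ker (4^i)], [i < n]: a truncation of
    [1/|x|] near [0], cut off at radius [1]. *)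
Definition Kn b s : R := b * newt0 (b ^+ 2 * s) - newt0 s.
Definition Kn1 b s : R := b * (b ^+ 2 * newt1 (b ^+ 2 * s)) - newt1 s.
Definition Kn2 b s : R := b * (b ^+ 2 * (b ^+ 2 * newt2 (b ^+ 2 * s))) - newt2 s.
Definition Kn3 b s : R := b * (b ^+ 2 * (b ^+ 2 * (b ^+ 2 * newt3 (b ^+ 2 * s)))) - newt3 s.
Lemma Kn_derive b s : is_derive (s : R) (1 : R) (Kn b) (Kn1 b s).
Proof. exact: derB (derZ _ (scale_derive _ _ newt0_derive)) (newt0_derive s). Qed.
Lemma Kn1_derive b s : is_derive (s : R) (1 : R) (Kn1 b) (Kn2 b s).
Proof. exact: derB (derZ _ (derZ _ (scale_derive _ _ newt1_derive))) (newt1_derive s). Qed.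
Lemma Kn2_derive b s : is_derive (s : R) (1 : R) (Kn2 b) (Kn3 b s).
Proof. exact: derB (derZ _ (derZ _ (derZ _ (scale_derive _ _ newt2_derive)))) (newt2_derive s). Qed.

Lemma Kn_vanish b s : 1 <= b -> 1 < s -> Kn b s = 0.
Proof.
move=> b1 s1; have b0 : 0 < b by lra.
have b2 : 1 <= b ^+ 2 by exact: exprn_ege1.
have s0 : 0 <= s by lra.
have t1 : 1 < b ^+ 2 * s by apply: lt_le_trans s1 _; exact: ler_peMl.
rewrite /Kn /newt0 !leNgt t1 s1 /= sqrtrM ?sqr_ge0// sqrtr_sqr gtr0_norm// !expr1 invfM mulrA divff ?gt_eqF// mul1r subrr //.
Qed.

Lemma Kn_ge0 n s : 0 <= s -> 0 <= Kn (4 ^+ n) s.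
Proof.
move=> s0; elim: n => [|n IH]; first by rewrite /Kn expr0 expr1n !mul1r subrr.
have -> : Kn (4 ^+ n.+1) s = Kn (4 ^+ n) s + ker (4 ^+ n) s.
  rewrite exprS /Kn /ker; set b := 4 ^+ n; have -> : (4 * b) ^+ 2 = 16 * b ^+ 2 by ring.
  ring.
by rewrite addr_ge0// ker_ge0.
Qed.

Lemma newt_sder s : 0 <= s -> 0 <= newt0 s + s * newt1 s <= 35 / 16.
Proof.
move=> s0; rewrite /newt0 /newt1; case: (leP s 1) => s1.
  have t0 : 0 <= 1 - s <= 1 by lra.
  have -> : 1 - 2^-1 * (s - 1) + 3 / 8 * (s - 1) ^+ 2 - 5 / 16 * (s - 1) ^+ 3 +
    s * (- 2^-1 + 3 / 4 * (s - 1) - 15 / 16 * (s - 1) ^+ 2) =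
    1 / 2 + 1 / 4 * (1 - s) + 3 / 16 * (1 - s) ^+ 2 + 5 / 4 * (1 - s) ^+ 3 by field.
  move: t0 => /andP[t0 t1]; have h2 : 0 <= (1 - s) ^+ 2 <= 1 by rewrite exprn_ge0// exprn_ile1.
  have h3 : 0 <= (1 - s) ^+ 3 <= 1 by rewrite exprn_ge0// exprn_ile1.
  lra.
have r0 : 0 < Num.sqrt s by rewrite sqrtr_gt0; lra.
have -> : Num.sqrt s ^- 1 + s * (- (1 / 2) * Num.sqrt s ^- 3) = (1 / 2) * Num.sqrt s ^- 1.
  by rewrite -{2}(sqr_sqrtr s0); field; rewrite gt_eqF.
by have := sqrtVn_le1 1 (ltW s1); lra.
Qed.

(** [3 Kn + 2 s Kn1] is the divergence of the field [x Kn (|x|^2)]; the [5] covers twice the bound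
    [35/16] of [newt_sder] for the part at scale [1]. *)
Lemma Kn_le_div b s : 1 <= b -> 0 <= s -> Kn b s <= 3 * Kn b s + 2 * s * Kn1 b s + 5.
Proof.
move=> b1 s0; have t0 : 0 <= b ^+ 2 * s by rewrite mulr_ge0// sqr_ge0.
have /andP[h1 _] := newt_sder t0; have /andP[_ h2] := newt_sder s0.
have h3 : 0 <= b * (newt0 (b ^+ 2 * s) + b ^+ 2 * s * newt1 (b ^+ 2 * s)) by apply: mulr_ge0 => //; lra.
have -> : 3 * Kn b s + 2 * s * Kn1 b s + 5 = Kn b s + 2 * (b * (newt0 (b ^+ 2 * s) + b ^+ 2 * s * newt1 (b ^+ 2 * s)))
   - 2 * (newt0 s + s * newt1 s) + 5 by rewrite /Kn /Kn1; ring.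
lra.
Qed.

Lemma coord_Kn n x j : `|coord3 x j| * Kn (4 ^+ n) (enorm2 x) <= 1.
Proof.
have e0 := enorm2_ge0 x; have b0 : 0 < (4 : R) ^+ n by rewrite exprn_gt0.
have cx : coord3 x j ^+ 2 <= enorm2 x.
  rewrite /enorm2 /dot (bigD1 j)//= expr2 lerDl; apply: sumr_ge0 => i _; rewrite -expr2; exact: sqr_ge0.
have [xz|xz] := eqVneq (enorm2 x) 0.
  have -> : coord3 x j = 0.
    by apply/eqP; rewrite -sqrf_eq0 eq_le sqr_ge0 andbT -xz.
  by rewrite normr0 mul0r.
have xp : 0 < enorm2 x by rewrite lt_def xz.
have s0 : 0 < Num.sqrt (enorm2 x) by rewrite sqrtr_gt0.
have cs : `|coord3 x j| <= Num.sqrt (enorm2 x) by rewrite -sqrtr_sqr ler_wsqrtr.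
have tp : 0 < (4 ^+ n) ^+ 2 * enorm2 x by rewrite mulr_gt0// exprn_gt0.
have h1 := newt0_le tp; have /andP[h2 _] := newt0_bound e0.
have h3 : Kn (4 ^+ n) (enorm2 x) <= Num.sqrt (enorm2 x) ^- 1.
  rewrite /Kn; apply: le_trans (_ : 4 ^+ n * newt0 ((4 ^+ n) ^+ 2 * enorm2 x) <= _); first by lra.
  rewrite -(ler_pM2l b0) in h1; apply: le_trans h1 _.
  by rewrite sqrtrM ?sqr_ge0// sqrtr_sqr gtr0_norm// !expr1 invfM mulrA divff ?mul1r// gt_eqF.
apply: le_trans (_ : Num.sqrt (enorm2 x) * Num.sqrt (enorm2 x) ^- 1 <= _); last by rewrite expr1 divff// gt_eqF.
by apply: ler_pM => //; exact: Kn_ge0.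
Qed.

Lemma Kn_cont b : continuous (fun x : R3 R => Kn b (enorm2 x)).
Proof. exact: cont_comp (@cont_enorm2 R) (derive_continuous (Kn_derive b)). Qed.

Lemma Kn_vanish3 b : 1 <= b -> vanish 1 (fun x : R3 R => Kn b (enorm2 x)).
Proof.
move=> b1 x x1; apply: Kn_vanish => //.
by have h0 : 0 <= (1 : R) by []; have := enorm2_gt h0 x1; rewrite expr1n.
Qed.

Lemma four_ge1 n : 1 <= (4 : R) ^+ n. Proof. by rewrite exprn_ege1// ler1n. Qed.

(* Hardy's inequality for the truncations of [1 / |x|], from
   [div (x Kn) >= Kn - 5]. *)
Lemma Hardy U dU n : C1 U dU ->
  Int (fun x => U x ^+ 2 * Kn (4 ^+ n) (enorm2 x)) <= 8 * Int (fun x => cut x * U x ^+ 2) + \sum_j Int (fun x => cut x * dU j x ^+ 2).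
Proof.
move=> hU; have [cU cdU _] := hU; set b : R := 4 ^+ n; have b1 : 1 <= b := four_ge1 n.
have cK := @Kn_cont b; have vK := Kn_vanish3 b1.
have hz j := C1_radial_coord (Kn_derive b) (derive_continuous (Kn1_derive b)) j.
have vz j : vanish 1 (fun x : R3 R => coord3 x j * Kn b (enorm2 x)) by move=> x x1; rewrite vK// mulr0.
have cz j : Cc (fun x : R3 R => coord3 x j * Kn b (enorm2 x)) by split; [case: (hz j)|exists 1; exact: vz].
have hU2 := C1M hU hU.
have E j := ibp j hU2 (hz j) (or_intror (cz j)).
have [ccut _] := Cc_cut.
pose D j x : R := (j == j)%:R * Kn b (enorm2 x) + 2 * (coord3 x j * coord3 x j * Kn1 b (enorm2 x)).
have cD j : continuous (D j) by have [_ h _] := hz j; exact: h.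
have vD j : vanish 1 (D j) by exact: (C1_vanish (hz j) (vz j) j).
pose L j x : R := (dU j x * U x + U x * dU j x) * (coord3 x j * Kn b (enorm2 x)).
have iD j : intg (fun x => U x * U x * D j x) by apply: (intg_mul _ _ (vD j)) => //; cont.
have iL j : intg (L j) by apply: (intg_mul _ _ (vz j)); [cont|case: (cz j)].
have ic (w : R3 R -> R) : continuous w -> intg (fun x => cut x * w x ^+ 2).
  move=> cw; apply: Cc_intg; split; first by cont.
  by exists 3 => x /cut_vanish ->; rewrite mul0r.
have i8 := ic _ cU; have idU j := ic _ (cdU j).
have iUK : intg (fun x => U x ^+ 2 * Kn b (enorm2 x)) by apply: (intg_mul _ _ vK); cont.
have ck x : `|x| <= 1 \/ Kn b (enorm2 x) = 0 by case: (leP `|x| 1) => h; [left|right; exact: vK].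
have S1 := intgD (intgD (iD o0) (iD o1)) (iD o2).
have S2 := intgD (intgD (intgD (iD o0) (iD o1)) (iD o2)) (intgZ 5 i8).
have le1 : Int (fun x => U x ^+ 2 * Kn b (enorm2 x)) <= Int (fun x => U x * U x * D o0 x) + Int (fun x => U x * U x * D o1 x) + Int (fun x => U x * U x * D o2 x) + 5 * Int (fun x => cut x * U x ^+ 2).
  rewrite -(IntZ 5 i8) -(IntD (iD o0) (iD o1)) -(IntD (intgD (iD o0) (iD o1)) (iD o2)) -(IntD S1 (intgZ 5 i8)).
  apply: le_Int => // x.
  have -> : U x * U x * D o0 x + U x * U x * D o1 x + U x * U x * D o2 x = U x ^+ 2 * (3 * Kn b (enorm2 x) + 2 * enorm2 x * Kn1 b (enorm2 x)).
    rewrite /D !eqxx; have hE : enorm2 x = coord3 x o0 * coord3 x o0 + coord3 x o1 * coord3 x o1 + coord3 x o2 * coord3 x o2 by rewrite /enorm2 /dot sum3.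
    by move: (Kn b _) (Kn1 b _) => k0 k1; rewrite hE mulr1n; ring.
  have [x1|x1] := ltP 1 `|x|.
    have h j := vD j x x1; have h0 := h o0; have h1 := h o1; have h2 := h o2.
    have -> : 3 * Kn b (enorm2 x) + 2 * enorm2 x * Kn1 b (enorm2 x) = D o0 x + D o1 x + D o2 x.
      rewrite /D !eqxx; have hE : enorm2 x = coord3 x o0 * coord3 x o0 + coord3 x o1 * coord3 x o1 + coord3 x o2 * coord3 x o2 by rewrite /enorm2 /dot sum3.
      by move: (Kn b _) (Kn1 b _) => k0 k1; rewrite hE mulr1n; ring.
    rewrite h0 h1 h2 vK// !addr0 !mulr0 add0r; have /andP[c0 _] := cut01 x.
    by apply: mulr_ge0 => //; apply: mulr_ge0 => //; exact: sqr_ge0.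
  rewrite cut1// mul1r -[5 * _]mulrC -mulrDr; apply: ler_wpM2l; first exact: sqr_ge0.
  by apply: Kn_le_div => //; exact: enorm2_ge0.
have le2 j : - Int (L j) <= Int (fun x => cut x * U x ^+ 2) + Int (fun x => cut x * dU j x ^+ 2).
  rewrite -(IntN (iL j)) -(IntD i8 (idU j)); apply: le_Int.
  - by have := intgZ (-1) (iL j); congr intg; apply/funext => x; rewrite mulN1r.
  - exact: intgD.
  - move=> x; rewrite /L; case: (ck x) => hx; last first.
      by rewrite hx !mulr0 oppr0; have /andP[c0 _] := cut01 x; rewrite addr_ge0// mulr_ge0// sqr_ge0.
    rewrite cut1// !mul1r; apply: le_trans (ler_norm _) _; rewrite normrN normrM.
    apply: le_trans (_ : `|dU j x * U x + U x * dU j x| * 1 <= _).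
      apply: ler_wpM2l => //; rewrite normrM [`|Kn _ _|]ger0_norm ?coord_Kn//.
      by apply: Kn_ge0; exact: enorm2_ge0.
    rewrite mulr1 ler_norml; apply/andP; split.
      by have := sqr_ge0 (U x + dU j x); rewrite sqrrD; lra.
    by have := sqr_ge0 (U x - dU j x); rewrite sqrrB; lra.
apply: le_trans le1 _; rewrite !E sum3.
by move: (le2 o0) (le2 o1) (le2 o2); rewrite /L; genInt => ? ? ?; lra.
Qed.

Lemma Kn_tele ka u v f g du dv b : 1 <= b -> sol ka u v f g du dv ->
  Int (fun x => u x * rho b x) - Int (fun x => u x * rho 1 x) = Int (fun x => f x * Kn b (enorm2 x)).
Proof.
move=> b1 h; have b0 : 0 < b by lra.
have z1 : 0 <= (1 : R) by [].
have kv s : 1 ^+ 2 < s -> Kn b s = 0 by rewrite expr1n; exact: Kn_vanish.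
rewrite -(sol_radial h (Kn_derive b) (Kn1_derive b) (Kn2_derive b) z1 kv).
have [[cu _ _] _ _ _ _] := h.
have ir c : 0 < c -> intg (fun x => u x * rho c x).
  by move=> c0; exact: intg_mul cu (@rho_continuous _ _) (rho_vanish c0).
rewrite -(IntB (ir _ b0) (ir _ ltr01)); apply: eq_Int => x; rewrite -mulrBr; congr (_ * _).
have e0 := enorm2_ge0 x; rewrite /rho.
have h2 : 0 <= b ^+ 2 * enorm2 x by rewrite mulr_ge0// sqr_ge0.
have h1 : 0 <= 1 ^+ 2 * enorm2 x by rewrite mulr_ge0// sqr_ge0.
rewrite -(newt_laplacian h1) -(newt_laplacian h2) /Kn1 /Kn2 expr1n !mul1r.
ring.
Qed.

(** Hardy's inequality for the constant [1], uniformly in [n]. *)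
Lemma Kn_mass n : Int (fun x : R3 R => Kn (4 ^+ n) (enorm2 x)) <= 8 * Int cut.
Proof.
have h := Hardy n (@C1_cst R 1).
have e1 : Int (fun x : R3 R => 1 ^+ 2 * Kn (4 ^+ n) (enorm2 x)) = Int (fun x : R3 R => Kn (4 ^+ n) (enorm2 x)).
  by apply: eq_Int => x; rewrite expr1n mul1r.
have e2 : Int (fun x : R3 R => cut x * 1 ^+ 2) = Int cut by apply: eq_Int => x; rewrite expr1n mulr1.
have e3 : Int (fun x : R3 R => cut x * 0 ^+ 2) = 0 by apply: Int_eq0 => x; rewrite expr0n mulr0.
by move: h; rewrite sum3 e1 e2 e3 !addr0.
Qed.

(* [c1], [c2] bound the right-hand side by [c1 + c2 h]; the potential theoretic
   estimate at 0 is linear in [c2], with a factor controlled by the H1 norm. *)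
Lemma sol_Kn_origin ka u v f g du dv (c1 c2 B : R) (h : R3 R -> R) : sol ka u v f g du dv -> continuous h ->
  0 <= c1 -> 0 <= c2 -> (forall x, `|x| <= 1 -> `|f x| <= c1 + c2 * h x) ->
  (forall n, Int (fun x => h x * Kn (4 ^+ n) (enorm2 x)) <= B) ->
  m * `|u 0| <= `|Int (fun x => u x * rho 1 x)| + c1 * (8 * Int cut) + c2 * B.
Proof.
move=> hs ch c10 c20 hf hB; have [[cu _ _] _ cf _ _] := hs.
apply: Int_rho_cvg_bound => // n.
have b1 := four_ge1 n; have e := Kn_tele b1 hs.
have vK := Kn_vanish3 b1; have cK := @Kn_cont (4 ^+ n).
have iK : intg (fun x : R3 R => Kn (4 ^+ n) (enorm2 x)) by apply: Cc_intg; split => //; exists 1.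
have ihK : intg (fun x : R3 R => h x * Kn (4 ^+ n) (enorm2 x)) by exact: intg_mul vK.
have ifK : intg (fun x : R3 R => f x * Kn (4 ^+ n) (enorm2 x)) by exact: intg_mul vK.
have S := intgD (intgZ c1 iK) (intgZ c2 ihK).
have key x : `|f x * Kn (4 ^+ n) (enorm2 x)| <= c1 * Kn (4 ^+ n) (enorm2 x) + c2 * (h x * Kn (4 ^+ n) (enorm2 x)).
  have K0 : 0 <= Kn (4 ^+ n) (enorm2 x) by apply: Kn_ge0; exact: enorm2_ge0.
  have [x1|x1] := leP `|x| 1; last by rewrite vK// !mulr0 normr0 addr0.
  by rewrite normrM [`|Kn _ _|]ger0_norm// mulrA -mulrDl; apply: ler_wpM2r => //; exact: hf.
have bd : `|Int (fun x : R3 R => f x * Kn (4 ^+ n) (enorm2 x))| <= c1 * (8 * Int cut) + c2 * B.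
  apply: le_trans (_ : c1 * Int (fun x : R3 R => Kn (4 ^+ n) (enorm2 x)) + c2 * Int (fun x : R3 R => h x * Kn (4 ^+ n) (enorm2 x)) <= _); last first.
    by apply: lerD; apply: ler_wpM2l => //; exact: Kn_mass.
  rewrite -(IntZ c1 iK) -(IntZ c2 ihK) -(IntD (intgZ c1 iK) (intgZ c2 ihK)).
  rewrite ler_norml -(IntN S); apply/andP; split; apply: le_Int => //.
  - by have := intgZ (-1) S; under eq_fun do rewrite mulN1r.
  - by move=> x; have := key x; rewrite ler_norml => /andP[].
  - by move=> x; have := key x; rewrite ler_norml => /andP[].
rewrite -e in bd; have := ler_normD (Int (fun x => u x * rho (4 ^+ n) x) - Int (fun x => u x * rho 1 x)) (Int (fun x => u x * rho 1 x)).
by rewrite subrK; lra.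
Qed.
End Hardy.

(** * The rescaled equation; Kato's inequality *)

Section Equation.
Context {R : realType}.
Local Notation m := (@mass R).
Implicit Types (f g h u v k Phi P : R3 R -> R) (du dv dPhi : 'I_3 -> R3 R -> R) (x : R3 R) (la ka b eps p : R).

(** The frequency, the rescaled trap, and [|A|^2], which the operator of [sol] leaves to the
    right-hand side. *)
Definition Pot eps p ka x : R :=
  1 + eps ^+ 2 * (enorm2 (eps *: x + (0, 0, p)) - 1) ^+ 2 + ka ^+ 2 * (x.1.1 ^+ 2 + x.1.2 ^+ 2).
Definition NL P u v x : R := u x ^+ 2 + v x ^+ 2 - P x.
Definition GPsol ka P u v du dv :=
  sol ka u v (fun x => NL P u v x * u x) (fun x => NL P u v x * v x) du dv.

Lemma cont_Pot eps p ka : continuous (Pot eps p ka).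
Proof.
have cE : continuous (fun x : R3 R => enorm2 (eps *: x + (0, 0, p))) by exact: cont_affine (@cont_enorm2 R).
have cc (G : R3 R -> R) : continuous G -> continuous (fun x => 1 + eps ^+ 2 * (G x - 1) ^+ 2 + ka ^+ 2 * (x.1.1 ^+ 2 + x.1.2 ^+ 2)).
  by move=> cG; cont.
exact: cc cE.
Qed.

Lemma Pot_ge eps p ka x : 1 + ka ^+ 2 * (x.1.1 ^+ 2 + x.1.2 ^+ 2) <= Pot eps p ka x.
Proof. by rewrite /Pot -addrA lerD2l lerDr mulr_ge0// sqr_ge0. Qed.

Lemma Pot_small (Om K d : R) : 0 <= K -> 0 < d -> exists2 e : R, 0 < e & forall eps p, 0 < eps <= e -> `|p| <= 2 ->
  forall x, `|x| <= K -> Pot eps p (eps ^+ 2 * Om) x - 1 <= d.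
Proof.
move=> K0 d0; pose C : R := (3 * (K + 2) ^+ 2 + 1) ^+ 2 + 2 * Om ^+ 2 * K ^+ 2.
have C0 : 0 <= C by apply: addr_ge0; [exact: sqr_ge0|apply: mulr_ge0; [apply: mulr_ge0 => //|]; exact: sqr_ge0].
have dC : 0 < d / (C + 1) by rewrite divr_gt0//; lra.
exists (Num.min 1 (d / (C + 1))); first by rewrite lt_min ltr01.
move=> eps p /andP[e0]; rewrite le_min => /andP[e1 ed] p2 x xK.
have s2 (a c : R) : `|a| <= c -> a ^+ 2 <= c ^+ 2.
  by move=> ac; have c0 := le_trans (normr_ge0 _) ac; rewrite -real_normK ?num_real// ler_sqr ?nnegrE.
have nX : `|eps *: x + (0, 0, p)| <= K + 2.
  apply: le_trans (ler_normD _ _) _; rewrite normrZ gtr0_norm//.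
  have h1 : eps * `|x| <= 1 * K by apply: ler_pM => //; exact: ltW.
  have h2 : `|((0, 0, p) : R3 R)| <= 2.
    by apply: sup_ge0_coord => j; rewrite /coord3 /tnth; case: j => -[|[|[|]]] //= ?; rewrite ?normr0.
  lra.
have hE : `|enorm2 (eps *: x + (0, 0, p)) - 1| <= 3 * (K + 2) ^+ 2 + 1.
  have h1 := enorm2_ge0 (eps *: x + (0, 0, p)); have h2 := enorm2_le (eps *: x + (0, 0, p)).
  have h3 : `|eps *: x + (0, 0, p)| ^+ 2 <= (K + 2) ^+ 2 by rewrite ler_sqr ?nnegrE//; lra.
  rewrite ler_norml; apply/andP; split; lra.
have x1 := s2 _ _ (le_trans (le_coord o0 x) xK); have x2 := s2 _ _ (le_trans (le_coord o1 x) xK).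
rewrite /coord3 /tnth /= in x1 x2.
have eps4 : eps ^+ 4 <= eps ^+ 2 by apply: ler_wiXn2l => //; lra.
have e2 : eps ^+ 2 <= eps by rewrite -{2}[eps]expr1; apply: ler_wiXn2l => //; lra.
have h1 : eps ^+ 2 * (enorm2 (eps *: x + (0, 0, p)) - 1) ^+ 2 <= eps ^+ 2 * (3 * (K + 2) ^+ 2 + 1) ^+ 2.
  by apply: ler_wpM2l; [exact: sqr_ge0|exact: s2].
have h2 : (eps ^+ 2 * Om) ^+ 2 * (x.1.1 ^+ 2 + x.1.2 ^+ 2) <= eps ^+ 2 * (2 * Om ^+ 2 * K ^+ 2).
  have -> : (eps ^+ 2 * Om) ^+ 2 * (x.1.1 ^+ 2 + x.1.2 ^+ 2) = eps ^+ 4 * (Om ^+ 2 * (x.1.1 ^+ 2 + x.1.2 ^+ 2)) by ring.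
  apply: ler_pM => //; [by rewrite exprn_ge0// ltW|by rewrite mulr_ge0 ?addr_ge0 ?sqr_ge0|].
  have -> : 2 * Om ^+ 2 * K ^+ 2 = Om ^+ 2 * (2 * K ^+ 2) by ring.
  apply: ler_wpM2l; [exact: sqr_ge0|lra].
have h3 : eps ^+ 2 * C <= eps * C by apply: ler_wpM2r.
have h4 : eps * (C + 1) <= d by rewrite -ler_pdivlMr//; lra.
have E : eps ^+ 2 * C = eps ^+ 2 * (3 * (K + 2) ^+ 2 + 1) ^+ 2 + eps ^+ 2 * (2 * Om ^+ 2 * K ^+ 2) by rewrite /C mulrDr.
have F : Pot eps p (eps ^+ 2 * Om) x - 1 = eps ^+ 2 * (enorm2 (eps *: x + (0, 0, p)) - 1) ^+ 2 + (eps ^+ 2 * Om) ^+ 2 * (x.1.1 ^+ 2 + x.1.2 ^+ 2) by rewrite /Pot; ring.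
rewrite F; apply: le_trans (lerD h1 h2) _; rewrite -E; apply: le_trans h3 _; apply: le_trans h4.
by apply: ler_wpM2l; clear -e0; lra.
Qed.

(** The energy identity: the two equations are tested with [u Phi] and [v Phi] and added. *)
Lemma EI ka u v f g du dv Phi dPhi : sol ka u v f g du dv -> C1 Phi dPhi -> Cc Phi ->
  Int (fun x => (gdot du du x + gdot dv dv x + 2 * ka * (v x * rotd du x - u x * rotd dv x)) * Phi x
     + (u x * gdot du dPhi x + v x * gdot dv dPhi x)) = Int (fun x => (f x * u x + g x * v x) * Phi x).
Proof.
move=> [hu hv cf cg h] hP cP; have [cu cdu _] := hu; have [cv cdv _] := hv.
have cuP := Cc_mulr cu cP; have cvP := Cc_mulr cv cP.
have huP := C1M hu hP; have hvP := C1M hv hP.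
have [e1 _] := h _ _ huP cuP; have [_ e2] := h _ _ hvP cvP.
have i1 : intg (fun x => f x * (u x * Phi x)) by apply: Cc_intg; exact: Cc_mulr.
have i2 : intg (fun x => g x * (v x * Phi x)) by apply: Cc_intg; exact: Cc_mulr.
have [cP0 cdP _] := hP; have [_ [r hr]] := cP; have vP j := C1_vanish hP hr j.
have j1 : intg (fun x => gdot du (fun j x => du j x * Phi x + u x * dPhi j x) x + 2 * ka * (v x * rotd (fun j x => du j x * Phi x + u x * dPhi j x) x)).
  apply: Cc_intg; split; first by rewrite /gdot /rotd; cont.
  by exists r => x xr; rewrite /gdot /rotd sum3 !vP// hr//; ring.
have j2 : intg (fun x => gdot dv (fun j x => dv j x * Phi x + v x * dPhi j x) x - 2 * ka * (u x * rotd (fun j x => dv j x * Phi x + v x * dPhi j x) x)).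
  apply: Cc_intg; split; first by rewrite /gdot /rotd; cont.
  by exists r => x xr; rewrite /gdot /rotd sum3 !vP// hr//; ring.
transitivity (Int (fun x => f x * (u x * Phi x) + g x * (v x * Phi x))); last by apply: eq_Int => x; ring.
rewrite (IntD i1 i2) -e1 -e2 -(IntD j1 j2); apply: eq_Int => x; rewrite /gdot /rotd !sum3; ring.
Qed.

(** The whole expression is [|(grad - i A) (u + i v)|^2]. *)
Lemma diamagnetic ka u v du dv x : 0 <= gdot du du x + gdot dv dv x + 2 * ka * (v x * rotd du x - u x * rotd dv x)
   + ka ^+ 2 * (x.1.1 ^+ 2 + x.1.2 ^+ 2) * (u x ^+ 2 + v x ^+ 2).
Proof.
have -> : gdot du du x + gdot dv dv x + 2 * ka * (v x * rotd du x - u x * rotd dv x)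
   + ka ^+ 2 * (x.1.1 ^+ 2 + x.1.2 ^+ 2) * (u x ^+ 2 + v x ^+ 2) =
   (du o0 x - ka * x.1.2 * v x) ^+ 2 + (dv o0 x + ka * x.1.2 * u x) ^+ 2 + ((du o1 x + ka * x.1.1 * v x) ^+ 2
   + (dv o1 x - ka * x.1.1 * u x) ^+ 2) + (du o2 x ^+ 2 + dv o2 x ^+ 2).
  by rewrite /gdot /rotd !sum3; ring.
by rewrite !addr_ge0// sqr_ge0.
Qed.

(** [u^2 + v^2] satisfies [- Delta h <= 2 M h] weakly: the energy identity bounds the covariant
    gradient from below by zero, and [P] dominates [|A|^2]. Neither the field nor the position
    enters the constant. *)
Lemma Kato ka P u v du dv (M : R) Phi dPhi : GPsol ka P u v du dv -> continuous P ->
  (forall x, ka ^+ 2 * (x.1.1 ^+ 2 + x.1.2 ^+ 2) <= P x) -> (forall x, u x ^+ 2 + v x ^+ 2 <= M) ->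
  C1 Phi dPhi -> Cc Phi -> (forall x, 0 <= Phi x) ->
  Int (gdot (fun j x => 2 * (u x * du j x + v x * dv j x)) dPhi) <= Int (fun x => 2 * M * ((u x ^+ 2 + v x ^+ 2) * Phi x)).
Proof.
move=> hs cP0 hP hM hPhi cPhi P0; have e := EI hs hPhi cPhi.
have [[cu cdu _] [cv cdv _] cf cg _] := hs; have [cp cdp _] := hPhi; have [_ [r hr]] := cPhi.
have vP j := C1_vanish hPhi hr j.
pose A x : R := ka ^+ 2 * (x.1.1 ^+ 2 + x.1.2 ^+ 2) * (u x ^+ 2 + v x ^+ 2) * Phi x.
have iA : intg A.
  by apply: Cc_intg; split; [rewrite /A; cont|exists r => x /hr h; rewrite /A h mulr0].
pose E x : R := (gdot du du x + gdot dv dv x + 2 * ka * (v x * rotd du x - u x * rotd dv x)) * Phi x.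
have iE : intg E.
  by apply: Cc_intg; split; [rewrite /E /gdot /rotd; cont|exists r => x /hr h; rewrite /E h mulr0].
have iG : intg (fun x => u x * gdot du dPhi x + v x * gdot dv dPhi x).
  apply: Cc_intg; split; first by rewrite /gdot; cont.
  by exists r => x xr; rewrite /gdot !sum3 !vP//; ring.
have cN : continuous (NL P u v) by rewrite /NL; cont.
have iF : intg (fun x => (NL P u v x * u x * u x + NL P u v x * v x * v x) * Phi x).
  by apply: Cc_intg; split; [cont|exists r => x /hr ->; rewrite mulr0].
have ih : intg (fun x => (u x ^+ 2 + v x ^+ 2) * Phi x).
  by apply: Cc_intg; split; [cont|exists r => x /hr ->; rewrite mulr0].
have -> : Int (gdot (fun j x => 2 * (u x * du j x + v x * dv j x)) dPhi) = 2 * Int (fun x => u x * gdot du dPhi x + v x * gdot dv dPhi x).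
  by rewrite -(IntZ 2 iG); apply: eq_Int => x; rewrite /gdot !sum3; ring.
rewrite (IntD iE iG) in e.
have h1 : - Int A <= Int E.
  rewrite -(IntN iA); apply: le_Int => //.
    by have := intgZ (-1) iA; congr intg; apply/funext => x; rewrite mulN1r.
  move=> x; rewrite /A /E -subr_ge0 opprK -mulrDl; apply: mulr_ge0 => //; exact: diamagnetic.
have h2 : Int (fun x => (NL P u v x * u x * u x + NL P u v x * v x * v x) * Phi x) + Int A <= M * Int (fun x => (u x ^+ 2 + v x ^+ 2) * Phi x).
  rewrite -(IntD iF iA) -(IntZ M ih); apply: le_Int; [exact: intgD|exact: intgZ|].
  move=> x; rewrite /A -mulrDl mulrA; apply: ler_wpM2r => //.
  have hh : 0 <= u x ^+ 2 + v x ^+ 2 by rewrite addr_ge0// sqr_ge0.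
  have -> : NL P u v x * u x * u x + NL P u v x * v x * v x + ka ^+ 2 * (x.1.1 ^+ 2 + x.1.2 ^+ 2) * (u x ^+ 2 + v x ^+ 2) =
    (u x ^+ 2 + v x ^+ 2 - (P x - ka ^+ 2 * (x.1.1 ^+ 2 + x.1.2 ^+ 2))) * (u x ^+ 2 + v x ^+ 2) by rewrite /NL; ring.
  by apply: ler_wpM2r => //; have := hM x; have := hP x; lra.
have -> : Int (fun x => 2 * M * ((u x ^+ 2 + v x ^+ 2) * Phi x)) = 2 * (M * Int (fun x => (u x ^+ 2 + v x ^+ 2) * Phi x)).
  by rewrite (IntZ (2 * M) ih); ring.
by move: e h1 h2; genInt => ? ? ?; lra.
Qed.

(** The integration by parts behind [sol_tele], for a bare [C^1] function and any centre: a
    subsolution has no equation to offer, only a bound for the left-hand side. *)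
Lemma radial_gdot h dh b x0 : 0 < b -> C1 h dh ->
  Int (gdot dh (fun j (x : R3 R) => 2 * (coord3 (x - x0) j * ker1 b (enorm2 (x - x0))))) =
  Int (fun x : R3 R => h (x + x0) * rho (4 * b) x) - Int (fun x : R3 R => h (x + x0) * rho b x).
Proof.
move=> b0 hh; have b4 : 0 < 4 * b by lra.
have hH := C1_shift x0 hh; have [cH cdH _] := hH.
have hP := C1_radial (ker_derive b) (derive_continuous (ker1_derive b)).
have ck2 : continuous (ker2 b) := derive_continuous (ker2_derive b).
have hd j := C1Z 2 (C1_radial_coord (ker1_derive b) ck2 j).
have vr : vanish b^-1 (fun x : R3 R => ker b (enorm2 x)).
  by move=> x xr; apply: ker_vanish => //; apply: enorm2_gt => //; rewrite invr_ge0 ltW.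
have vd j := C1_vanish hP vr j.
have [cP cdP _] := hP.
have igd : intg (gdot (fun j x => dh j (x + x0)) (fun j x => 2 * (coord3 x j * ker1 b (enorm2 x)))).
  apply: Cc_intg; split; first by apply: cont_sum => j; exact: contM.
  by exists b^-1 => x xr; rewrite /gdot sum3 !vd//; ring.
transitivity (Int (gdot (fun j x => dh j (x + x0)) (fun j (x : R3 R) => 2 * (coord3 x j * ker1 b (enorm2 x))))).
  have [_ <-] := Int_translate (- x0) igd; apply: eq_Int => x; rewrite /gdot.
  by apply: eq_bigr => j _; rewrite subrK.
rewrite (Int_gdot hH hP vr hd).
have ir c : 0 < c -> intg (fun x : R3 R => h (x + x0) * rho c x).
  by move=> c0; exact: intg_mul cH (@rho_continuous _ _) (rho_vanish c0).
rewrite -(IntB (ir _ b4) (ir _ b0)) -IntN; last first.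
  have cdd j i : continuous (fun x : R3 R => 2 * ((j == i)%:R * ker1 b (enorm2 x) + 2 * (coord3 x i * coord3 x j * ker2 b (enorm2 x)))) by have [_ h1 _] := hd j; exact: h1.
  apply: (@intg_mul _ _ _ b^-1) => //; first by apply: cont_sum => j; exact: cdd.
  by move=> x xr; rewrite big1// => j _; exact: (C1_vanish (hd j) (vd j) j xr).
apply: eq_Int => x; rewrite -mulrBr -mulrN; congr (_ * _); rewrite sum3 !eqxx !mul1r.
have e0 := enorm2_ge0 x; rewrite /rho.
have h2 : 0 <= b ^+ 2 * enorm2 x by rewrite mulr_ge0// sqr_ge0.
have h1 : 0 <= (4 * b) ^+ 2 * enorm2 x by rewrite mulr_ge0// sqr_ge0.
rewrite -(newt_laplacian h1) -(newt_laplacian h2).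
have hE : enorm2 x = coord3 x o0 * coord3 x o0 + coord3 x o1 * coord3 x o1 + coord3 x o2 * coord3 x o2.
  by rewrite /enorm2 /dot sum3.
transitivity (- (6 * ker1 b (enorm2 x) + 4 * enorm2 x * ker2 b (enorm2 x))).
  by move: (ker1 b _) (ker2 b _) => k1 k2; rewrite hE; ring.
have e4 : (4 * b) ^+ 2 = 16 * b ^+ 2 by ring.
by rewrite /ker1 /ker2 e4; ring.
Qed.

(** The telescoping argument with one-sided increments, which suffice for a subsolution. Unlike
    [sol_sup], the constant does not depend on [x0]. *)
Lemma GP_sup ka P u v du dv (M la : R) x0 : GPsol ka P u v du dv -> continuous P ->
  (forall x, ka ^+ 2 * (x.1.1 ^+ 2 + x.1.2 ^+ 2) <= P x) -> (forall x, u x ^+ 2 + v x ^+ 2 <= M) -> 0 < la ->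
  m * (u x0 ^+ 2 + v x0 ^+ 2) <= (7 + 18 * M) * (la * (M * IntBox 1 (fun x => u (x + x0) ^+ 2 + v (x + x0) ^+ 2)) + 8 / la).
Proof.
move=> hs cP hP hM la0; have [hu hv _ _ _] := hs.
pose h x := u x ^+ 2 + v x ^+ 2.
have h0 x : 0 <= h x by rewrite addr_ge0// sqr_ge0.
have M0 : 0 <= M := le_trans (h0 0) (hM 0).
have hh : C1 h (fun j x => 2 * (u x * du j x + v x * dv j x)).
  by apply: C1_ext (C1D (C1M hu hu) (C1M hv hv)) => [x|j x]; rewrite /h; ring.
have [ch _ _] := hh; have cH := @cont_shift _ h x0 ch.
set F := IntBox 1 (fun x => u (x + x0) ^+ 2 + v (x + x0) ^+ 2).
have F0 : 0 <= F by apply: IntBox_ge0 => x; exact: h0.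
have cH2 : continuous (fun x : R3 R => h (x + x0) ^+ 2) by cont.
have F2 : IntBox 1 (fun x : R3 R => h (x + x0) ^+ 2) <= M * F.
  rewrite -(IntBoxZ _ _ cH); apply: le_IntBox => [||x _]; [exact: cH2|by cont|].
  by rewrite expr2; apply: ler_wpM2r => //; exact: hM.
pose a i := Int (fun x : R3 R => h (x + x0) * rho (4 ^+ i) x).
pose S := la * (M * F) + 8 / la.
have S0 : 0 <= S by rewrite addr_ge0// ?divr_ge0 ?mulr_ge0// ltW.
have young (k : R3 R -> R) (K r l : R) : continuous k -> 0 <= r <= 1 -> (forall x, `|k x| <= K) -> vanish r k -> 0 < l ->
   Int (fun x : R3 R => h (x + x0) * k x) <= K / 2 * (l * (M * F) + 8 * r ^+ 3 / l).
  move=> ck r01 hK hr l0; have K0 : 0 <= K := le_trans (normr_ge0 _) (hK 0).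
  apply: le_trans (ler_norm _) _; apply: le_trans (young_ker cH ck r01 hK hr l0) _.
  by apply: ler_wpM2l; [lra|rewrite lerD2r; apply: ler_wpM2l => //; exact: ltW].
have ha i : a i.+1 - a i <= 9 * M * S * 2^-1 ^+ i.
  have b0 : 0 < 4 ^+ i :> R by rewrite exprn_gt0.
  have hPhi := C1_shift (- x0) (C1_radial (ker_derive (4 ^+ i)) (derive_continuous (ker1_derive (4 ^+ i)))).
  have r1 : 0 <= ((4 : R) ^+ i)^-1 <= 1.
    by rewrite invr_ge0 ltW//= invf_le1// exprn_ege1// ler1n.
  have hv' : vanish (4 ^+ i)^-1 (fun x : R3 R => ker (4 ^+ i) (enorm2 x)).
    by move=> x xr; apply: ker_vanish => //; apply: enorm2_gt => //; case/andP: r1.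
  have ck : continuous (fun x : R3 R => ker (4 ^+ i) (enorm2 x)).
    by apply: cont_comp; [exact: cont_enorm2|exact: derive_continuous (ker_derive _)].
  have cPhi : Cc (fun x : R3 R => ker (4 ^+ i) (enorm2 (x - x0))).
    by apply: (@Cc_shift _ (fun x : R3 R => ker (4 ^+ i) (enorm2 x))); split => //; exists (4 ^+ i)^-1.
  have k0 (x : R3 R) : 0 <= ker (4 ^+ i) (enorm2 (x - x0)) by apply: ker_ge0 => //; exact: enorm2_ge0.
  have := Kato hs cP hP hM hPhi cPhi k0; rewrite (radial_gdot _ b0 hh) /a exprS => e; apply: le_trans e _.
  have ih : intg (fun x : R3 R => h x * ker (4 ^+ i) (enorm2 (x - x0))) by apply: Cc_intg; exact: Cc_mulr.
  rewrite (IntZ (2 * M) ih).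
  have [_ <-] := Int_translate x0 ih.
  rewrite (@eq_Int _ _ (fun x : R3 R => h (x + x0) * ker (4 ^+ i) (enorm2 x))); last by move=> x; rewrite addrK.
  have hb (x : R3 R) : `|ker (4 ^+ i) (enorm2 x)| <= 9 * 4 ^+ i by apply: ker_bound => //; exact: enorm2_ge0.
  have q0 : 0 < 2^-1 ^+ i :> R by rewrite exprn_gt0.
  have la' : 0 < la * (2^-1 ^+ i * 2^-1 ^+ i * 2^-1 ^+ i) by rewrite !mulr_gt0.
  have := young _ _ _ _ ck r1 hb hv' la'.
  have E4 : 4 ^+ i = (2^-1 ^+ i * 2^-1 ^+ i)^-1 :> R by rewrite -inv4_pow invrK.
  rewrite E4 invrK /S; move: (2^-1 ^+ i) q0 => q q0.
  have -> : 9 * (q * q)^-1 / 2 * (la * (q * q * q) * (M * F) + 8 * (q * q) ^+ 3 / (la * (q * q * q))) = 9 / 2 * (la * (M * F) + 8 / la) * q.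
    by field; rewrite !gt_eqF.
  move=> hy; have -> : 9 * M * (la * (M * F) + 8 / la) * q = 2 * M * (9 / 2 * (la * (M * F) + 8 / la) * q) by field; rewrite gt_eqF.
  by apply: ler_wpM2l => //; rewrite mulr_ge0.
have hn n : a n <= a 0%N + 18 * M * S.
  have D0 : 0 <= 9 * M * S by rewrite !mulr_ge0.
  have : a n <= a 0%N + 9 * M * S * (2 - 2 * 2^-1 ^+ n).
    elim: n => [|n IH]; first by rewrite expr0; lra.
    by have := ha n; rewrite exprS; lra.
  have : 0 <= 9 * M * S * 2^-1 ^+ n by rewrite mulr_ge0// exprn_ge0.
  lra.
have a0 : a 0%N <= 7 * S.
  rewrite /a expr0.
  have hb x : `|rho 1 x| <= (105 / 8 : R).
    rewrite ger0_norm ?rho_ge0// /rho !expr1n !mul1r; apply: nbump_bound; exact: enorm2_ge0.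
  have r1 : 0 <= (1 : R) <= 1 by lra.
  have hv' : vanish 1 (@rho R 1) by have := @rho_vanish R 1 ltr01; rewrite invr1.
  by have := young _ _ _ _ (@rho_continuous _ 1) r1 hb hv' la0; rewrite expr1n mulr1 -/S; lra.
have lim : m * h x0 <= (7 + 18 * M) * S.
  apply/ler_addgt0Pr => e e0; have e1 : 0 < e / m by rewrite divr_gt0// mass_gt0.
  have [n hn'] := filter_ex (rho_approx cH e1).
  move: hn'; rewrite add0r [m * (e / m)]mulrC divfK ?gt_eqF ?mass_gt0// -/(a n) ler_norml => /andP[h1 h2].
  by have := hn n; lra.
exact: lim.
Qed.
End Equation.

Lemma sqr_le (R : realType) (a c : R) : `|a| <= c -> a ^+ 2 <= c ^+ 2.
Proof. by move=> ac; have c0 := le_trans (normr_ge0 _) ac; rewrite -real_normK ?num_real// ler_sqr ?nnegrE. Qed.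

Lemma norm_le1D (R : realType) (a : R) : `|a| <= 1 + a ^+ 2.
Proof. by have := sqr_ge0 (`|a| - 1); rewrite sqrrB real_normK ?num_real//; have := normr_ge0 a; lra. Qed.

Lemma norm_le_root (R : realType) (a b s : R) : a ^+ 2 + b ^+ 2 <= s ^+ 2 -> 0 <= s -> `|a| <= s.
Proof.
move=> h s0; rewrite -(@ler_pXn2r _ 2)// ?nnegrE// real_normK ?num_real//.
by have := sqr_ge0 b; lra.
Qed.

Lemma cubic_bound (R : realType) (a b q P s d : R) : `|a| <= s -> `|b| <= s -> 0 <= q <= s -> `|P - 1| <= d -> d <= 1 -> 1 <= s ->
  ((a ^+ 2 + b ^+ 2 - P) * a - (q ^+ 2 - 1) * q) ^+ 2 <= 100 * s ^+ 4 * ((a - q) ^+ 2 + b ^+ 2) + 3 * s ^+ 2 * d ^+ 2 /\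
  ((a ^+ 2 + b ^+ 2 - P) * b) ^+ 2 <= 100 * s ^+ 4 * ((a - q) ^+ 2 + b ^+ 2).
Proof.
move=> ha hb /andP[q0 hq] hP d1 s1; have s0 : 0 <= s by lra.
have a2 := sqr_le ha; have b2 := sqr_le hb.
have s21 : 1 <= s ^+ 2 by rewrite exprn_ege1.
have q2 : q ^+ 2 <= s ^+ 2 by rewrite ler_sqr ?nnegrE.
have aq : `|a * q| <= s ^+ 2 by rewrite normrM expr2 ler_pM// ger0_norm.
have ab : `|b * a| <= s ^+ 2 by rewrite normrM expr2 ler_pM.
have hA : `|a ^+ 2 + a * q + q ^+ 2 - 1| <= 4 * s ^+ 2.
  move: aq; rewrite !ler_norml => /andP[h1 h2]; have := sqr_ge0 a; have := sqr_ge0 q.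
  by move=> *; apply/andP; split; lra.
have hB : `|a ^+ 2 + b ^+ 2 - P| <= 5 * s ^+ 2.
  move: hP; rewrite !ler_norml => /andP[h1 h2]; have := sqr_ge0 a; have := sqr_ge0 b.
  by move=> *; apply/andP; split; lra.
have A2 := sqr_le hA; have B2 := sqr_le ab; have C2 := sqr_le hB; have P2 := sqr_le hP.
have w0 := sqr_ge0 (a - q); have v0 := sqr_ge0 b.
have t0 : 0 <= s ^+ 4 by rewrite exprn_ge0.
have m3 (x y z : R) : (x + y + z) ^+ 2 <= 3 * (x ^+ 2 + y ^+ 2 + z ^+ 2).
  have := sqr_ge0 (x - y); have := sqr_ge0 (y - z); have := sqr_ge0 (x - z); rewrite !sqrrB => *.
  have -> : (x + y + z) ^+ 2 = x ^+ 2 + y ^+ 2 + z ^+ 2 + 2 * (x * y) + 2 * (y * z) + 2 * (x * z) by ring.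
  lra.
have pm (x y X Y : R) : 0 <= x -> 0 <= y -> x <= X -> y <= Y -> x * y <= X * Y by move=> *; apply: ler_pM.
split.
  have -> : (a ^+ 2 + b ^+ 2 - P) * a - (q ^+ 2 - 1) * q =
    (a ^+ 2 + a * q + q ^+ 2 - 1) * (a - q) + (b * a) * b + (1 - P) * a by ring.
  apply: le_trans (m3 _ _ _) _; rewrite !exprMn.
  have e1 : (a ^+ 2 + a * q + q ^+ 2 - 1) ^+ 2 * (a - q) ^+ 2 <= (4 * s ^+ 2) ^+ 2 * (a - q) ^+ 2 by apply: ler_wpM2r.
  have e2 : (b * a) ^+ 2 * b ^+ 2 <= (s ^+ 2) ^+ 2 * b ^+ 2 by apply: ler_wpM2r.
  have e3 : (1 - P) ^+ 2 * a ^+ 2 <= d ^+ 2 * s ^+ 2.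
    by rewrite -[(1 - P) ^+ 2]sqrrN opprB; apply: pm => //; exact: sqr_ge0.
  have E4 : (4 * s ^+ 2) ^+ 2 = 16 * s ^+ 4 by ring.
  have E5 : (s ^+ 2) ^+ 2 = s ^+ 4 by ring.
  rewrite E4 in e1; rewrite E5 in e2; rewrite -exprMn in e2.
  have z1 : 0 <= s ^+ 4 * (a - q) ^+ 2 by apply: mulr_ge0.
  have z2 : 0 <= s ^+ 4 * b ^+ 2 by apply: mulr_ge0.
  rewrite exprMn in e2; clear -q0 e3 e1 e2 z1 z2; lra.
rewrite exprMn.
have e1 : (a ^+ 2 + b ^+ 2 - P) ^+ 2 * b ^+ 2 <= (5 * s ^+ 2) ^+ 2 * b ^+ 2 by apply: ler_wpM2r.
have E4 : (5 * s ^+ 2) ^+ 2 = 25 * s ^+ 4 by ring.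
rewrite E4 in e1.
have z1 : 0 <= s ^+ 4 * (a - q) ^+ 2 by apply: mulr_ge0.
have z2 : 0 <= s ^+ 4 * b ^+ 2 by apply: mulr_ge0.
clear -q0 e1 z1 z2; lra.
Qed.

(** * From closeness in [H^1] to uniform closeness *)

Section Closeness.
Context {R : realType}.
Local Notation m := (@mass R).
Variables (Q : R3 R -> R) (dQ : 'I_3 -> R3 R -> R) (psi : R3 R -> R) (dpsi : 'I_3 -> R3 R -> R).
Hypothesis pQ : profile Q dQ psi dpsi.
Implicit Types (f h u v U P : R3 R -> R) (du dv dU : 'I_3 -> R3 R -> R) (x y z : R3 R) (s t la ka b eps p : R).
Let q0 : R := Q 0.
Let q_gt0 : 0 < q0. Proof. exact: profile_gt0 pQ 0. Qed.
Let C1Q : C1 Q dQ. Proof. by have [] := profile_sol pQ 0. Qed.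
Ltac local_clear := clear -pQ C1Q q_gt0.
Ltac local_lra := local_clear; lra.

(** The last clause bounds the components of the covariant gradient of [u - Q + i v]. It is cut off
    near the origin, the only place where Hardy's inequality is applied. *)
Definition H1near ka u v du dv (d : R) := [/\ intg (fun x => (u x - Q x) ^+ 2), intg (fun x => v x ^+ 2),
  Int (fun x => (u x - Q x) ^+ 2) + Int (fun x => v x ^+ 2) <= d &
  forall j, Int (fun x => cut x * (du j x - dQ j x + drift x ka j * v x) ^+ 2) <= d /\
     Int (fun x => cut x * (dv j x - drift x ka j * (u x - Q x)) ^+ 2) <= d].

Lemma sol_sub ka P u v du dv : GPsol ka P u v du dv ->
  sol ka (fun x => u x - Q x) v (fun x => NL P u v x * u x - (Q x ^+ 2 - 1) * Q x) (fun x => NL P u v x * v x)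
    (fun j x => du j x - dQ j x) dv.
Proof.
move=> h; have := sol_lin 1 (-1) h (profile_sol pQ ka).
congr sol; apply/funext => x; try (apply/funext => y); ring.
Qed.

Lemma drift3 ka j x : `|ka| <= 1 -> `|x| <= 3 -> `|drift x ka j| <= 3.
Proof. by move=> k1 x3; apply: drift_le. Qed.

Lemma cont_drift ka j : continuous (fun x : R3 R => drift x ka j).
Proof. by rewrite /drift; cont. Qed.

(** On the support of [cut] the vector potential is at most [3], so passing from covariant to
    ordinary derivatives costs [18 v^2]; [sg] is the sign with which the two components are
    coupled. *)
Lemma cut_grad (U : R3 R -> R) (v : R3 R -> R) (dU : 'I_3 -> R3 R -> R) ka (sg : R) j (d : R) : sg ^+ 2 = 1 -> `|ka| <= 1 -> C1 U dU -> continuous v ->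
  intg (fun x => v x ^+ 2) -> Int (fun x => v x ^+ 2) <= d ->
  Int (fun x => cut x * (dU j x + sg * (drift x ka j * v x)) ^+ 2) <= d -> Int (fun x => cut x * dU j x ^+ 2) <= 20 * d.
Proof.
move=> sg1 k1 [_ cdU _] cv iv hv hH; have [cc _] := @Cc_cut R; have cd := @cont_drift ka j.
have ic (w : R3 R -> R) : continuous w -> intg (fun x => cut x * w x ^+ 2).
  move=> cw; apply: Cc_intg; split; first by cont.
  by exists 3 => x /cut_vanish ->; rewrite mul0r.
have cW : continuous (fun x => dU j x + sg * (drift x ka j * v x)) by cont.
have i1 := ic _ (cdU j); have i2 := ic _ cW.
apply: le_trans (_ : Int (fun x => 2 * (cut x * (dU j x + sg * (drift x ka j * v x)) ^+ 2) + 18 * v x ^+ 2) <= _); last first.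
  by rewrite (IntD (intgZ 2 i2) (intgZ 18 iv)) (IntZ 2 i2) (IntZ 18 iv); lra.
apply: le_Int => //; first exact: intgD (intgZ 2 i2) (intgZ 18 iv).
move=> x; have /andP[c0 c1] := cut01 x.
have [x3|x3] := leP `|x| 3; last first.
  by rewrite cut_vanish// !mul0r mulr0 add0r mulr_ge0// sqr_ge0.
have h9 : drift x ka j ^+ 2 <= 9.
  by have := sqr_le (drift3 j k1 x3); rewrite (_ : 3 ^+ 2 = 9 :> R)//; ring.
set D := drift x ka j in h9 *; set w := v x; set e := dU j x.
have h1 : e ^+ 2 <= 2 * (e + sg * (D * w)) ^+ 2 + 2 * (D ^+ 2 * w ^+ 2).
  have : 0 <= (e + 2 * (sg * (D * w))) ^+ 2 by exact: sqr_ge0.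
  have -> : 2 * (e + sg * (D * w)) ^+ 2 + 2 * (D ^+ 2 * w ^+ 2) = e ^+ 2 + (e + 2 * (sg * (D * w))) ^+ 2 + 2 * (1 - sg ^+ 2) * (D ^+ 2 * w ^+ 2) by ring.
  by rewrite sg1; lra.
have h2 : D ^+ 2 * w ^+ 2 <= 9 * w ^+ 2 by apply: ler_wpM2r => //; exact: sqr_ge0.
have h3 : cut x * e ^+ 2 <= cut x * (2 * (e + sg * (D * w)) ^+ 2 + 18 * w ^+ 2) by apply: ler_wpM2l => //; lra.
have h4 : cut x * w ^+ 2 <= w ^+ 2 by rewrite ler_piMl// sqr_ge0.
lra.
Qed.

(** Let [s] be the maximum of the modulus, attained at [0]. On the unit cube the right-hand sides
    are at most [c1 + c2 h], where [c2] contains [2 s], and the potential of [h] at [0] is [O(d)] by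
    Hardy. So [m s] is at most a constant plus [544 d s], and a small [d] absorbs the last term. *)
Lemma M_bound : exists d0 M : R, [/\ 0 < d0, 0 <= M & forall ka P u v du dv, `|ka| <= 1 -> GPsol ka P u v du dv ->
  (forall x, `|x| <= 1 -> 0 <= P x <= 2) -> (forall x, u x ^+ 2 + v x ^+ 2 <= u 0 ^+ 2 + v 0 ^+ 2) ->
  H1near ka u v du dv d0 -> forall x, u x ^+ 2 + v x ^+ 2 <= M].
Proof.
have m0 := @mass_gt0 R; have qp := ltW q_gt0.
pose I := Int (@cut R).
pose c1 : R := (2 * q0 ^+ 2 + 2) * (q0 + 1) + q0 ^+ 3 + q0.
have q20 : 0 <= q0 ^+ 2 by exact: sqr_ge0.
have q30 : 0 <= q0 ^+ 3 by rewrite exprn_ge0.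
have c10 : 0 <= c1 by rewrite /c1 !addr_ge0// mulr_ge0//; lra.
pose S : R := 2 / m * (m * q0 + 120 + 16 * c1 * I + 272 * (2 * q0 ^+ 2 + 2)).
have [D D0 DE] : exists2 D : R, 0 < D & D = 272 * 4 by exists (272 * 4); rewrite ?mulr_gt0 ?ltr0n.
exists (Num.min 1 (m / D)), (S ^+ 2); split; [by rewrite lt_min ltr01 divr_gt0|exact: sqr_ge0|].
move=> ka P u v du dv k1 hs hP hmax hH x; apply: le_trans (hmax x) _.
set d := Num.min _ _ in hH; have d1 : d <= 1 by rewrite ge_min lexx.
have dm : d * (272 * 4) <= m by rewrite -DE -ler_pdivlMr ?ge_min ?lexx ?orbT.
have [iU iv sum_le grad] := hH.
have pos (f : R3 R -> R) : 0 <= Int (fun x => f x ^+ 2) by apply: Int_ge0 => y; exact: sqr_ge0.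
have U2 : Int (fun x => (u x - Q x) ^+ 2) <= d by have := pos v; move: sum_le; local_lra.
have V2 : Int (fun x => v x ^+ 2) <= d by have := pos (fun x => u x - Q x); move: sum_le; local_lra.
have hU := sol_sub hs; have [hu hv cN1 cN2 _] := hs; have [cu _ _] := hu; have [cv _ _] := hv.
have [hU1 _ _ _ _] := hU; have [cU cdU _] := hU1.
pose s := Num.sqrt (u 0 ^+ 2 + v 0 ^+ 2); have s0 : 0 <= s by exact: sqrtr_ge0.
have s2 : s ^+ 2 = u 0 ^+ 2 + v 0 ^+ 2 by rewrite sqr_sqrtr// addr_ge0// sqr_ge0.
have us y : `|u y| <= s by apply: (@norm_le_root _ _ (v y)) => //; rewrite s2.
have vs y : `|v y| <= s by apply: (@norm_le_root _ _ (u y)) => //; rewrite s2 addrC.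
pose h y := (u y - Q y) ^+ 2 + v y ^+ 2.
have [cQ _ _] := C1Q.
have ch : continuous h by rewrite /h; cont.
pose c2 : R := 2 * q0 ^+ 2 + 2 + 2 * s.
have c20 : 0 <= c2 by rewrite /c2; move: q20 s0; local_lra.
have Qq y : 0 <= Q y <= q0 by rewrite (ltW (profile_gt0 pQ y)) (profile_le pQ y).
have Q2 y : Q y ^+ 2 <= q0 ^+ 2 by apply: sqr_le; have /andP[a1 a2] := Qq y; rewrite ger0_norm.
have hh y : u y ^+ 2 + v y ^+ 2 <= 2 * q0 ^+ 2 + 2 * h y.
  have := Q2 y; have := sqr_ge0 (u y - 2 * Q y); rewrite /h; have := sqr_ge0 (v y).
  by rewrite !sqrrB; local_lra.
have h0 y : 0 <= h y by rewrite addr_ge0// sqr_ge0.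
have NLb y (w : R) : `|y| <= 1 -> `|w| <= s -> `|NL P u v y * w| <= (2 * q0 ^+ 2 + 2) * `|w| + 2 * s * h y.
  move=> y1 ws; rewrite normrM; have /andP[P0 P2] := hP y y1.
  have n1 : `|NL P u v y| <= 2 * q0 ^+ 2 + 2 + 2 * h y.
    have := hh y; have := sqr_ge0 (u y); have := sqr_ge0 (v y); have := h0 y.
    by rewrite /NL ler_norml; move: P0 P2 q20; local_clear => *; apply/andP; split; lra.
  apply: le_trans (ler_wpM2r (normr_ge0 w) n1) _; rewrite mulrDl lerD2l.
  have : h y * `|w| <= h y * s by apply: ler_wpM2l.
  by local_lra.
have b1 y : `|y| <= 1 -> `|NL P u v y * u y - (Q y ^+ 2 - 1) * Q y| <= c1 + c2 * h y.
  move=> y1; have e1 := NLb y (u y) y1 (us y); have /andP[Q1 Q3] := Qq y.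
  have e2 : `|u y| <= q0 + 1 + h y.
    have := norm_le1D (u y - Q y); have := ler_normD (u y - Q y) (Q y); rewrite subrK [`|Q y|]ger0_norm// /h.
    by have := sqr_ge0 (v y); move: Q3; local_lra.
  have e3 : `|(Q y ^+ 2 - 1) * Q y| <= q0 ^+ 3 + q0.
    rewrite normrM [`|Q y|]ger0_norm//; have : `|Q y ^+ 2 - 1| <= q0 ^+ 2 + 1.
      by have := Q2 y; have := sqr_ge0 (Q y); rewrite ler_norml; local_lra.
    move=> e4; have -> : q0 ^+ 3 + q0 = (q0 ^+ 2 + 1) * q0 by ring.
    by apply: ler_pM.
  have e5 : (2 * q0 ^+ 2 + 2) * `|u y| <= (2 * q0 ^+ 2 + 2) * (q0 + 1 + h y) by apply: ler_wpM2l => //; move: q20; local_lra.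
  apply: le_trans (ler_normB _ _) _; rewrite /c1 /c2; move: e1 e3 e5; local_lra.
have b2 y : `|y| <= 1 -> `|NL P u v y * v y| <= c1 + c2 * h y.
  move=> y1; have e1 := NLb y (v y) y1 (vs y).
  have e2 : `|v y| <= 1 + h y.
    by have := norm_le1D (v y); rewrite /h; have := sqr_ge0 (u y - Q y); local_lra.
  have e5 : (2 * q0 ^+ 2 + 2) * `|v y| <= (2 * q0 ^+ 2 + 2) * (1 + h y) by apply: ler_wpM2l => //; move: q20; local_lra.
  have e6 : 0 <= (2 * q0 ^+ 2 + 2) * q0 by apply: mulr_ge0 => //; move: q20; local_lra.
  by rewrite /c1 /c2; move: e1 e5 e6 q30 qp; local_lra.
have cutle (w : R3 R -> R) : continuous w -> intg (fun x => w x ^+ 2) -> Int (fun x => w x ^+ 2) <= d -> Int (fun x => cut x * w x ^+ 2) <= d.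
  move=> cw iw; apply: le_trans; apply: le_Int => //.
    apply: Cc_intg; have [cc _] := @Cc_cut R; split; first by cont.
    by exists 3 => y /cut_vanish ->; rewrite mul0r.
  by move=> y; have /andP[_ y1] := cut01 y; rewrite ler_piMl// sqr_ge0.
have gU j : Int (fun x => cut x * (du j x - dQ j x) ^+ 2) <= 20 * d.
  have [g1 _] := grad j; have sg1 : (1 : R) ^+ 2 = 1 by rewrite expr1n.
  apply: (@cut_grad _ v _ ka 1 j d sg1 k1 hU1 cv iv V2).
  by rewrite (@eq_Int _ _ (fun x => cut x * (du j x - dQ j x + drift x ka j * v x) ^+ 2)) // => y; rewrite mul1r.
have gv j : Int (fun x => cut x * dv j x ^+ 2) <= 20 * d.
  have [_ g1] := grad j; have sg1 : (-1 : R) ^+ 2 = 1 by rewrite sqrrN expr1n.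
  apply: (@cut_grad _ (fun x => u x - Q x) _ ka (-1) j d sg1 k1 hv cU iU U2).
  by rewrite (@eq_Int _ _ (fun x => cut x * (dv j x - drift x ka j * (u x - Q x)) ^+ 2)) // => y; rewrite mulN1r.
(* Twice [8 d + 3 * 20 d]: Hardy's inequality for [u - Q] and for [v]. *)
have hB n : Int (fun x => h x * Kn (4 ^+ n) (enorm2 x)) <= 136 * d.
  have HU := Hardy n hU1; have Hv := Hardy n hv.
  have vK := Kn_vanish3 (@four_ge1 R n); have cK := @Kn_cont R (4 ^+ n).
  have k1' : intg (fun x => (u x - Q x) ^+ 2 * Kn (4 ^+ n) (enorm2 x)) by apply: (intg_mul _ _ vK) => //; cont.
  have k2' : intg (fun x => v x ^+ 2 * Kn (4 ^+ n) (enorm2 x)) by apply: (intg_mul _ _ vK) => //; cont.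
  have E : Int (fun x => h x * Kn (4 ^+ n) (enorm2 x)) = Int (fun x => (u x - Q x) ^+ 2 * Kn (4 ^+ n) (enorm2 x)) + Int (fun x => v x ^+ 2 * Kn (4 ^+ n) (enorm2 x)).
    by rewrite -(IntD k1' k2'); apply: eq_Int => y; rewrite /h mulrDl.
  rewrite E; rewrite !sum3 in HU Hv.
  have a1 := cutle _ cU iU U2; have a2 := cutle _ cv iv V2.
  have := gU o0; have := gU o1; have := gU o2; have := gv o0; have := gv o1; have := gv o2.
  by move: HU Hv a1 a2; local_clear; genInt => *; lra.
have rho1 (w : R3 R -> R) : continuous w -> intg (fun x => w x ^+ 2) -> Int (fun x => w x ^+ 2) <= d -> `|Int (fun x => w x * rho 1 x)| <= 60.
  move=> cw iw w2.
  have hb y : `|rho 1 y| <= (105 / 8 : R).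
    rewrite ger0_norm ?rho_ge0// /rho !expr1n !mul1r; apply: nbump_bound; exact: enorm2_ge0.
  have r1 : 0 <= (1 : R) <= 1 by rewrite ler01 lexx.
  have hv' : vanish 1 (@rho R 1) by have := @rho_vanish R 1 ltr01; rewrite invr1.
  apply: le_trans (young_ker cw (@rho_continuous _ 1) r1 hb hv' ltr01) _.
  have cw2 : continuous (fun x => w x ^+ 2) by cont.
  have E (t : R) : t <= 1 -> 105 / 8 / 2 * (1 * t + 8 * 1 ^+ 3 / 1) <= 60 by local_clear => t1; lra.
  apply: E; apply: le_trans (IntBox_le 1 cw2 iw (fun x => sqr_ge0 _)) (le_trans w2 d1).

have o1' := sol_Kn_origin hU ch c10 c20 b1 hB.
have o2' := sol_Kn_origin (sol_sym hU) ch c10 c20 b2 hB.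
have r1 := rho1 _ cU iU U2; have r2 := rho1 _ cv iv V2.
have sB : s <= q0 + `|u 0 - Q 0| + `|v 0|.
  rewrite -(@ler_pXn2r _ 2)// ?nnegrE// ?s2; last by rewrite !addr_ge0.
  have := ler_normD (u 0 - Q 0) (Q 0); rewrite subrK [`|Q 0|]gtr0_norm// => e1.
  have e2 : u 0 ^+ 2 <= (`|u 0 - Q 0| + Q 0) ^+ 2 by exact: sqr_le.
  rewrite -[v 0 ^+ 2]real_normK ?num_real// [leRHS]sqrrD.
  have : 0 <= (q0 + `|u 0 - Q 0|) * `|v 0| *+ 2 by rewrite mulrn_wge0// mulr_ge0// addr_ge0.
  by rewrite [q0 + _]addrC -/q0 in e2 *; move: e2; local_lra.
(* [544] is [2 * 2 * 136]: two components, the summand [2 s] of [c2], and the bound [hB]. The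
   threshold [m / 1088] for [d] leaves half of [m s]. *)
have ds : 544 * (d * s) <= m / 2 * s.
  by rewrite mulrA; apply: ler_wpM2r => //; move: dm; local_lra.
have key : m * s <= m * q0 + 120 + 16 * c1 * I + 272 * (2 * q0 ^+ 2 + 2) + m / 2 * s.
  have h1 : m * s <= m * (q0 + `|u 0 - Q 0| + `|v 0|) by rewrite ler_pM2l.
  have h2 : d * (2 * q0 ^+ 2 + 2) <= 2 * q0 ^+ 2 + 2 by rewrite ler_piMl//; move: q20; local_lra.
  by move: o1' o2' h1 h2 r1 r2 ds; rewrite -/I /c2; local_clear; genInt; lra.
have sS : s <= S.
  have e1 : m * s <= 2 * (m * q0 + 120 + 16 * c1 * I + 272 * (2 * q0 ^+ 2 + 2)) by move: key; local_lra.
  by rewrite /S mulrAC ler_pdivlMr// mulrC.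
by rewrite -s2; apply: sqr_le; rewrite ger0_norm.
Qed.

(** In [GP_sup] the weight [la] is taken so large that the term [8 / la] uses half of [e]; then [d]
    is chosen for the other half. *)
Lemma GP_small (M e : R) : 0 <= M -> 0 < e -> exists2 d : R, 0 < d & forall ka P u v du dv x0, GPsol ka P u v du dv -> continuous P ->
  (forall x, ka ^+ 2 * (x.1.1 ^+ 2 + x.1.2 ^+ 2) <= P x) -> (forall x, u x ^+ 2 + v x ^+ 2 <= M) ->
  IntBox 1 (fun x => u (x + x0) ^+ 2 + v (x + x0) ^+ 2) <= d -> u x0 ^+ 2 + v x0 ^+ 2 <= e.
Proof.
move=> M0 e0; have m0 := @mass_gt0 R; pose c : R := 7 + 18 * M; have c0 : 0 < c by rewrite /c; lra.
pose la : R := 16 * c / (m * e); have la0 : 0 < la by rewrite divr_gt0 ?mulr_gt0.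
pose d : R := m * e / (2 * (c * (la * (M + 1)))).
have D0 : 0 < 2 * (c * (la * (M + 1))) by rewrite mulr_gt0// mulr_gt0// mulr_gt0//; lra.
have d0 : 0 < d by rewrite divr_gt0// mulr_gt0.
exists d => // ka P u v du dv x0 hs cP hP hM hI.
have := GP_sup x0 hs cP hP hM la0; move: hI; set F := (X in X <= d -> _) => hI h.
have h1 : c * (8 / la) = m * e / 2 by rewrite /la; field; rewrite !gt_eqF.
have F0 : 0 <= F by apply: IntBox_ge0 => x; rewrite addr_ge0// sqr_ge0.
have h2 : c * (la * (M * F)) <= m * e / 2.
  apply: le_trans (_ : c * (la * ((M + 1) * d)) <= _).
    apply: ler_wpM2l; first exact: ltW.
    apply: ler_wpM2l; first exact: ltW.
    by apply: ler_pM => //; lra.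
  rewrite le_eqVlt; apply/orP; left; apply/eqP; rewrite /d; field.
  by rewrite !gt_eqF//; lra.
rewrite -(ler_pM2l m0); apply: le_trans (h : _ <= c * (la * (M * F) + 8 / la)) _.
by rewrite mulrDr h1; move: h2; local_lra.
Qed.

Lemma IntBox_shift_le f x0 (r : R) : continuous f -> intg f -> (forall x, 0 <= f x) ->
  IntBox r (fun x => f (x + x0)) <= Int f.
Proof.
move=> cf iF f0; have [i1 <-] := Int_translate x0 iF.
by apply: IntBox_le => //; apply: cont_shift.
Qed.

(** On a fixed cube [u - Q + i v] solves an equation whose right-hand side is Lipschitz in the
    difference, up to the error [P - 1]; the linear estimate [sol_sup] then turns smallness in [L^2]
    into smallness at each point. *)
Lemma local_small (K M e : R) : 0 <= K -> 0 <= M -> 0 < e -> exists2 d : R, 0 < d & forall ka P u v du dv, GPsol ka P u v du dv ->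
  `|ka| <= 1 -> continuous P -> (forall x, u x ^+ 2 + v x ^+ 2 <= M) -> (forall x, `|x| <= K + 1 -> `|P x - 1| <= d) ->
  intg (fun x => (u x - Q x) ^+ 2) -> intg (fun x => v x ^+ 2) ->
  Int (fun x => (u x - Q x) ^+ 2) + Int (fun x => v x ^+ 2) <= d ->
  forall x, `|x| <= K -> (u x - Q x) ^+ 2 + v x ^+ 2 <= e.
Proof.
move=> K0 M0 e0; pose s : R := M + q0 + 1; have s1 : 1 <= s by rewrite /s; have := q_gt0; lra.
have cs0 : 0 <= @Csup R by exact: sqr_ge0.
pose B : R := @Csup R * (3 + 2 * gbd K ^+ 2).
have B0 : 0 <= B by rewrite /B mulr_ge0// addr_ge0// mulr_ge0// sqr_ge0.
pose C : R := 1 + 200 * s ^+ 4 + 24 * s ^+ 2.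
have s40 : 0 <= s ^+ 4 by rewrite exprn_ge0//; lra.
have C0 : 0 <= C by rewrite /C; have := sqr_ge0 s; lra.
have D0 : 0 < 2 * (B * C) + 1 by have := mulr_ge0 B0 C0; lra.
exists (Num.min 1 (e / (2 * (B * C) + 1))); first by rewrite lt_min ltr01 divr_gt0.
move=> ka P u v du dv hs k1 cP hM hP iU iv hI x0 x0K.
move: hP hI; set d := Num.min _ _ => hP hI.
have d0 : 0 < d by rewrite lt_min ltr01 divr_gt0.
have d1 : d <= 1 by rewrite ge_min lexx.
have dd : d * (2 * (B * C) + 1) <= e by rewrite -ler_pdivlMr// ge_min lexx orbT.
have [hu hv _ _ _] := hs; have [cu _ _] := hu; have [cv _ _] := hv; have [cQ _ _] := C1Q.
have hU := sol_sub hs; pose h x := (u x - Q x) ^+ 2 + v x ^+ 2.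
have ch : continuous h by rewrite /h; cont.
have h0 x : 0 <= h x by rewrite addr_ge0// sqr_ge0.
have ih : intg h by exact: intgD.
have Ih : Int h <= d by rewrite /h (IntD iU iv).
have cN : continuous (NL P u v) by rewrite /NL; cont.
pose fu x := NL P u v x * u x - (Q x ^+ 2 - 1) * Q x; pose fv x := NL P u v x * v x.
have cfu : continuous fu by rewrite /fu; cont.
have cfv : continuous fv by rewrite /fv; cont.
have norms x : `|u x| <= s /\ `|v x| <= s.
  have hs2 : M <= s ^+ 2 by rewrite expr2; apply: le_trans (_ : 1 * s <= _); [rewrite /s; have := q_gt0; lra|apply: ler_wpM2r => //; lra].
  by split; [apply: (@norm_le_root _ _ (v x))|apply: (@norm_le_root _ _ (u x))] => //; have := hM x; lra.
have key (z : R3 R) : `|z| <= 1 -> (u (z + x0) - Q (z + x0)) ^+ 2 + v (z + x0) ^+ 2 + fu (z + x0) ^+ 2 + fv (z + x0) ^+ 2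
    <= (1 + 200 * s ^+ 4) * h (z + x0) + 3 * s ^+ 2 * d.
  move=> z1; have zx : `|z + x0| <= K + 1 by apply: le_trans (ler_normD _ _) _; lra.
  have [n1 n2] := norms (z + x0).
  have Qq : 0 <= Q (z + x0) <= s.
    by rewrite (ltW (profile_gt0 pQ _))/=; have := profile_le pQ (z + x0); rewrite /s /q0; move: M0; local_lra.
  have [e1 e2] := cubic_bound n1 n2 Qq (hP _ zx) d1 s1.
  have d2 : s ^+ 2 * d ^+ 2 <= s ^+ 2 * d.
    by apply: ler_wpM2l; [exact: sqr_ge0|rewrite expr2 ler_piMl// ltW].
  rewrite /fu /fv /NL /h; move: e1 e2 d2; local_lra.
have bound : IntBox 1 (fun z : R3 R => (u (z + x0) - Q (z + x0)) ^+ 2 + v (z + x0) ^+ 2 + fu (z + x0) ^+ 2 + fv (z + x0) ^+ 2) <= C * d.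
  have cH := @cont_shift _ h x0 ch.
  have cu' := @cont_shift _ _ x0 cu; have cQ' := @cont_shift _ _ x0 cQ; have cv' := @cont_shift _ _ x0 cv.
  have cfu' := @cont_shift _ _ x0 cfu; have cfv' := @cont_shift _ _ x0 cfv.
  apply: le_trans (_ : IntBox 1 (fun z : R3 R => (1 + 200 * s ^+ 4) * h (z + x0) + 3 * s ^+ 2 * d) <= _).
    by apply: le_IntBox => //; cont.
  rewrite IntBoxD; [|by cont|by cont].
  rewrite (IntBoxZ 1 _ cH) IntBox_cst//.
  have hb := le_trans (IntBox_shift_le x0 1 ch ih h0) Ih.
  have : (1 + 200 * s ^+ 4) * IntBox 1 (fun z : R3 R => h (z + x0)) <= (1 + 200 * s ^+ 4) * d.
    by apply: ler_wpM2l => //; move: s40; local_lra.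
  have E : (2 * 1) ^+ 3 = 8 :> R by ring.
  by rewrite E /C; local_lra.
have b1 := le_trans (sol_sup K0 x0K k1 hU) (ler_wpM2l B0 bound).
have b2 := sol_sup K0 x0K k1 (sol_sym hU).
have {}b2 : v x0 ^+ 2 <= B * (C * d).
  apply: le_trans b2 _; apply: ler_wpM2l => //; apply: le_trans bound; rewrite le_eqVlt; apply/orP; left; apply/eqP.
  by apply: eq_IntBox => z _; rewrite /fu /fv; ring.
have : 2 * (B * (C * d)) <= e by apply: le_trans dd; have := ltW d0; local_lra.
move: b1 b2; local_lra.
Qed.

(** What the symmetry argument receives, [Om] being half the angular velocity. Every clause is
    invariant under rotations about the third axis, so that one reflection yields all of them. *)
Definition good (e Om : R) u v := exists eps p, [/\ 0 < eps <= e, `|p| <= 2,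
   magsol (eps ^+ 2 * Om) u v (fun x => NL (Pot eps p (eps ^+ 2 * Om)) u v x * u x) (fun x => NL (Pot eps p (eps ^+ 2 * Om)) u v x * v x)
 & [/\ v 0 = 0, forall x, u x ^+ 2 + v x ^+ 2 <= u 0 ^+ 2, intg (fun x => u x ^+ 2), intg (fun x => v x ^+ 2) &
   forall x, `|u x - Q x| <= e /\ `|v x| <= e]].

(** Two regions. The decay of [Q] fixes a cube first, on which [local_small] applies. Outside it [Q]
    is small, hence so is the mass of [u^2 + v^2] on unit cubes, and [GP_small] applies with
    constants independent of the point. *)
Lemma global_small Om (e : R) : 0 < e -> exists2 d : R, 0 < d & forall eps p u v du dv, 0 < eps <= d -> `|p| <= 2 ->
  GPsol (eps ^+ 2 * Om) (Pot eps p (eps ^+ 2 * Om)) u v du dv -> `|eps ^+ 2 * Om| <= 1 ->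
  (forall x, u x ^+ 2 + v x ^+ 2 <= u 0 ^+ 2 + v 0 ^+ 2) -> H1near (eps ^+ 2 * Om) u v du dv d ->
  (exists2 M : R, 0 <= M & forall x, u x ^+ 2 + v x ^+ 2 <= M) /\ forall x, (u x - Q x) ^+ 2 + v x ^+ 2 <= e.
Proof.
move=> e0; have [dM [M [dM0 M0 hM]]] := M_bound.
have [d1 d10 h1] := GP_small M0 (divr_gt0 e0 (ltr0Sn _ 7)).
pose e2 : R := Num.min 1 (Num.min (e / 8) (d1 / 32)).
have e20 : 0 < e2 by rewrite !lt_min ltr01 !divr_gt0.
have [K0 K00 hK0] := profile_decay pQ e20.
have K1 : 0 <= K0 + 1 by lra.
have [d2 d20 h2] := local_small K1 M0 e0.
have K2 : 0 <= K0 + 1 + 1 by lra.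
have d2h : 0 < Num.min d2 1 by rewrite lt_min d20 ltr01.
have [d3 d30 h3] := Pot_small Om K2 d2h.
pose d : R := Num.min dM (Num.min d2 (Num.min d3 (d1 / 8))).
have d0 : 0 < d by rewrite !lt_min dM0 d20 d30 divr_gt0.
exists d => // eps p u v du dv /andP[eps0 epsd] p2 hs k1 hmax hH.
have dle : [/\ d <= dM, d <= d2, d <= d3 & d <= d1 / 8] by rewrite /d !ge_min !lexx !orbT.
case: dle => l1 l2 l3 l4.
have hP x : `|x| <= K0 + 1 + 1 -> 1 <= Pot eps p (eps ^+ 2 * Om) x <= 1 + Num.min d2 1.
  move=> xK; have := h3 eps p _ p2 x xK; rewrite eps0 (le_trans epsd l3) => /(_ isT) hh.
  have := Pot_ge eps p (eps ^+ 2 * Om) x.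
  have : 0 <= (eps ^+ 2 * Om) ^+ 2 * (x.1.1 ^+ 2 + x.1.2 ^+ 2) by rewrite mulr_ge0 ?addr_ge0 ?sqr_ge0.
  by move: hh; set D := Num.min _ _; local_clear => *; apply/andP; split; lra.
have m1 : Num.min d2 1 <= 1 by rewrite ge_min lexx orbT.
have m2 : Num.min d2 1 <= d2 by rewrite ge_min lexx.
have hP1 x : `|x| <= 1 -> 0 <= Pot eps p (eps ^+ 2 * Om) x <= 2.
  move=> x1; have x2 : `|x| <= K0 + 1 + 1 by lra.
  have /andP[] := hP x x2.
  by move: m1; local_clear => *; apply/andP; split; lra.
have [iU iv sum_le grad] := hH.
have hMx : forall x, u x ^+ 2 + v x ^+ 2 <= M.
  apply: (hM _ _ _ _ _ _ k1 hs hP1 hmax); split=> //; first exact: le_trans sum_le l1.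
  by move=> j; have [g1 g2] := grad j; split; [exact: le_trans g1 l1|exact: le_trans g2 l1].
split; first by exists M.
move=> x; have cP := @cont_Pot R eps p (eps ^+ 2 * Om).
have [xK|xK] := leP `|x| (K0 + 1).
  apply: (h2 _ _ _ _ _ _ hs k1 cP hMx _ iU iv (le_trans sum_le l2)) => // y yK.
  have /andP[a1 a2] := hP y yK; rewrite ger0_norm; last by lra.
  by move: a2 m2; local_clear => *; lra.
have pge y : (eps ^+ 2 * Om) ^+ 2 * (y.1.1 ^+ 2 + y.1.2 ^+ 2) <= Pot eps p (eps ^+ 2 * Om) y by have := Pot_ge eps p (eps ^+ 2 * Om) y; local_lra.
have [hu hv _ _ _] := hs; have [cu _ _] := hu; have [cv _ _] := hv; have [cQ _ _] := C1Q.
pose h y := (u y - Q y) ^+ 2 + v y ^+ 2.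
have ch : continuous h by rewrite /h; cont.
have h0 y : 0 <= h y by rewrite addr_ge0// sqr_ge0.
have ih : intg h by exact: intgD.
have Ih : Int h <= d by rewrite /h (IntD iU iv).
have Qfar (y : R3 R) : K0 < `|y| -> Q y ^+ 2 <= e2.
  move=> yK; have a1 := hK0 y yK; have a2 := ltW (profile_gt0 pQ y).
  have : Q y ^+ 2 <= 1 * e2.
    by rewrite expr2; apply: ler_pM => //; apply: le_trans a1 _; rewrite ge_min lexx.
  by rewrite mul1r.
have e2e : e2 <= e / 8 by rewrite !ge_min lexx orbT.
have e2d : e2 <= d1 / 32 by rewrite !ge_min lexx !orbT.
(* The unit cube around [x] stays outside the box [K0], where [Q^2 <= e2]; the margin [1] in
   [K0 + 1] is for this. *)
have small : u x ^+ 2 + v x ^+ 2 <= e / 8.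
  apply: (h1 _ _ _ _ _ _ x hs cP pge hMx).
  have cu' := @cont_shift _ _ x cu; have cv' := @cont_shift _ _ x cv; have ch' := @cont_shift _ _ x ch.
  apply: le_trans (_ : IntBox 1 (fun z : R3 R => 2 * h (z + x) + 2 * e2) <= _).
    apply: le_IntBox; [by cont|by cont|move=> z z1].
    have : K0 < `|z + x|.
      have : `|x| <= `|z + x| + `|z| by have := ler_normB (z + x) z; rewrite addrAC subrr add0r.
      move: xK z1; local_lra.
    move/Qfar; rewrite /h; have := sqr_ge0 (u (z + x) - 2 * Q (z + x)); have := sqr_ge0 (v (z + x)).
    by rewrite !sqrrB; local_lra.
  rewrite IntBoxD; [|by cont|by cont].
  rewrite (IntBoxZ 1 _ ch') IntBox_cst//.
  have hb := le_trans (IntBox_shift_le x 1 ch ih h0) Ih.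
  have E : (2 * 1) ^+ 3 = 8 :> R by ring.
  have fin t : t <= d -> 2 * t + 2 * e2 * 8 <= d1 by move: e2d l4 d10; local_lra.
  by rewrite E; exact: fin hb.
have q2 : Q x ^+ 2 <= e2 by apply: Qfar; lra.
have := sqr_ge0 (u x + Q x); have := sqr_ge0 (u x); have := sqr_ge0 (v x).
rewrite sqrrD sqrrB; move: small q2 e2e; local_lra.
Qed.

(** Since [1 - a <= |b|], undoing the phase [a + i b] changes the real part by no more than the
    products [|b| |c|] and [|b| |s|] allow. *)
Lemma phase_small (a b c s q e : R) : 0 <= e -> a ^+ 2 + b ^+ 2 <= 1 -> 0 <= a -> (c - q) ^+ 2 + s ^+ 2 <= e ^+ 2 -> `|b| * `|c| <= e -> `|b| * `|s| <= e ->
  a ^+ 2 + b ^+ 2 = 1 ->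
  `|a * c + b * s - q| <= 3 * e /\ `|a * s - b * c| <= 3 * e.
Proof.
move=> e0 ab a0 h h1 h2 ab1.
have b2 := sqr_ge0 b; have a2 := sqr_ge0 a.
have c1 : `|c - q| <= e by apply: norm_le_root h e0.
have s1 : `|s| <= e by apply: (@norm_le_root _ _ (c - q)) => //; lra.
have a1 : a <= 1 by rewrite -(@ler_pXn2r _ 2)// ?nnegrE// expr1n; lra.
have b1 : `|b| <= 1 by rewrite -(@ler_pXn2r _ 2)// ?nnegrE// real_normK ?num_real// expr1n; lra.
have ba : 1 - a <= `|b|.
  have : 1 - a <= `|b| ^+ 2.
    rewrite real_normK ?num_real//; have : a * a <= 1 * a by apply: ler_wpM2r.
    by rewrite -expr2; lra.
  have : `|b| ^+ 2 <= `|b| by rewrite expr2 ler_piMl.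
  lra.
have t1 : `|(1 - a) * c| <= e.
  by rewrite normrM ger0_norm ?subr_ge0//; apply: le_trans h1; apply: ler_wpM2r.
have t2 : `|b * s| <= e by rewrite normrM.
have t3 : `|b * c| <= e by rewrite normrM.
have t4 : `|a * s| <= e by rewrite normrM ger0_norm//; apply: le_trans s1; rewrite ler_piMl.
move: c1 t1 t2 t3 t4; rewrite !ler_norml => /andP[? ?] /andP[? ?] /andP[? ?] /andP[? ?] /andP[? ?].
by split; apply/andP; split; lra.
Qed.

(** The value at [0] is divided by its own phase, which makes it real and positive. That phase is
    close to [1] because [Q 0 > 0]. *)
Lemma main_good Om (e : R) : 0 < e -> exists2 d : R, 0 < d & forall eps p u v du dv, 0 < eps <= d -> `|p| <= 2 ->
  magsol (eps ^+ 2 * Om) u v (fun x => NL (Pot eps p (eps ^+ 2 * Om)) u v x * u x) (fun x => NL (Pot eps p (eps ^+ 2 * Om)) u v x * v x) ->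
  GPsol (eps ^+ 2 * Om) (Pot eps p (eps ^+ 2 * Om)) u v du dv ->
  (forall x, u x ^+ 2 + v x ^+ 2 <= u 0 ^+ 2 + v 0 ^+ 2) -> H1near (eps ^+ 2 * Om) u v du dv d ->
  exists a b : R, a ^+ 2 + b ^+ 2 = 1 /\ good e Om (fun x => a * u x + b * v x) (fun x => a * v x - b * u x).
Proof.
move=> e0.
(* b = v0/S with |v0| <= e1, S >= q0/2, and |u|,|v| <= q0 + e1 everywhere *)
pose e1 : R := Num.min (e / 3) (Num.min (q0 / 2) (e / 12)).
have e10 : 0 < e1 by rewrite !lt_min !divr_gt0.
have e1e : 3 * e1 <= e by rewrite mulrC -ler_pdivlMr// !ge_min lexx.
have e1q : e1 <= q0 / 2 by rewrite !ge_min lexx orbT.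
have e12 : 0 < e1 ^+ 2 by rewrite exprn_gt0.
have [d0 d00 h0] := global_small Om e12.
have O1 : 0 < `|Om| + 1 by have := normr_ge0 Om; lra.
pose d : R := Num.min d0 (Num.min e (Num.min 1 (`|Om| + 1)^-1)).
exists d; first by rewrite !lt_min d00 e0 ltr01 invr_gt0.
have [l1 l2 l3 l4] : [/\ d <= d0, d <= e, d <= 1 & d <= (`|Om| + 1)^-1] by rewrite /d !ge_min !lexx !orbT.
move=> eps p u v du dv /andP[eps0 epsd] p2 hmag hs hmax hH.
have k1 : `|eps ^+ 2 * Om| <= 1.
  rewrite normrM normrX [`|eps|]gtr0_norm//.
  have t1 : eps ^+ 2 <= eps by rewrite expr2 ler_piMl; move: l3 eps0 epsd; local_lra.
  have t2 : eps * (`|Om| + 1) <= 1 by rewrite -ler_pdivlMr// mul1r; lra.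
  have t3 : eps ^+ 2 * `|Om| <= eps * `|Om| by apply: ler_wpM2r.
  lra.
have [iU iv sum_le grad] := hH.
have hH0 : H1near (eps ^+ 2 * Om) u v du dv d0.
  split=> //; first exact: le_trans sum_le l1.
  by move=> j; have [g1 g2] := grad j; split; [exact: le_trans g1 l1|exact: le_trans g2 l1].
have epsd0 : 0 < eps <= d0 by rewrite eps0 (le_trans epsd).
have [[M M0 hM] hsm] := h0 eps p u v du dv epsd0 p2 hs k1 hmax hH0.
have c1 x : `|u x - Q x| <= e1 by apply: (norm_le_root (hsm x)); exact: ltW.
have s1 x : `|v x| <= e1 by apply: (@norm_le_root _ _ (u x - Q x)); [have := hsm x; lra|exact: ltW].
pose S : R := Num.sqrt (u 0 ^+ 2 + v 0 ^+ 2).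
have S2 : S ^+ 2 = u 0 ^+ 2 + v 0 ^+ 2 by rewrite sqr_sqrtr// addr_ge0// sqr_ge0.
have S0 : 0 <= S := sqrtr_ge0 _.
have u0 : q0 / 2 <= u 0 by have := c1 0; rewrite ler_norml -/q0 => /andP[t1 t2]; lra.
have uS : u 0 <= S.
  rewrite -(@ler_pXn2r _ 2)// ?nnegrE//; last by move: e10 e1q u0; local_lra.
  by rewrite S2; have := sqr_ge0 (v 0); local_lra.
have Sp : 0 < S by move: e10 e1q u0 uS; local_lra.
have Sle x : `|u x| <= S /\ `|v x| <= S.
  by split; [apply: (@norm_le_root _ _ (v x))|apply: (@norm_le_root _ _ (u x))] => //; rewrite S2; have := hmax x; local_lra.
pose a := u 0 / S; pose b := v 0 / S.
have aS : a * S = u 0 by rewrite /a divfK ?gt_eqF.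
have bS : b * S = v 0 by rewrite /b divfK ?gt_eqF.
have ab : a ^+ 2 + b ^+ 2 = 1.
  by rewrite /a /b !expr_div_n -mulrDl -S2 divff// expf_neq0// gt_eqF.
exists a, b; split=> //.
have a0 : 0 <= a by rewrite divr_ge0//; move: e10 e1q u0; local_lra.
(* [S] is the modulus at the maximum point, so any component [y] satisfies
   [|b| |y| <= |b| S = |v 0|]. *)
have bx (y : R) : `|y| <= S -> `|b| * `|y| <= e1.
  move=> yS; apply: le_trans (_ : `|b| * S <= _); first by apply: ler_wpM2l.
  by rewrite -[S]ger0_norm// -normrM bS.
have key x : `|a * u x + b * v x - Q x| <= 3 * e1 /\ `|a * v x - b * u x| <= 3 * e1.
  have [n1 n2] := Sle x; have ab1 : a ^+ 2 + b ^+ 2 <= 1 by rewrite ab.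
  exact: (phase_small (ltW e10) ab1 a0 (hsm x) (bx _ n1) (bx _ n2) ab).
have NLE x : NL (Pot eps p (eps ^+ 2 * Om)) (fun x => a * u x + b * v x) (fun x => a * v x - b * u x) x = NL (Pot eps p (eps ^+ 2 * Om)) u v x.
  rewrite /NL; congr (_ - _).
  by have -> : (a * u x + b * v x) ^+ 2 + (a * v x - b * u x) ^+ 2 = (a ^+ 2 + b ^+ 2) * (u x ^+ 2 + v x ^+ 2); [ring|rewrite ab mul1r].
have nrm x : (a * u x + b * v x) ^+ 2 + (a * v x - b * u x) ^+ 2 = u x ^+ 2 + v x ^+ 2.
  by have -> : (a * u x + b * v x) ^+ 2 + (a * v x - b * u x) ^+ 2 = (a ^+ 2 + b ^+ 2) * (u x ^+ 2 + v x ^+ 2); [ring|rewrite ab mul1r].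
have v00 : a * v 0 - b * u 0 = 0 by rewrite -aS -bS; ring.
have [hu hv _ _ _] := hs; have [cu _ _] := hu; have [cv _ _] := hv.
have iu : intg (fun x => u x ^+ 2).
  apply: (@intg_le _ _ (fun x => 2 * (u x - Q x) ^+ 2 + 2 * Q x ^+ 2)); [by apply: meas_cont; cont| |exact: intgD (intgZ 2 iU) (intgZ 2 (profile_L2 pQ))].
  move=> x; rewrite ger0_norm ?sqr_ge0//; have := sqr_ge0 (u x - 2 * Q x); rewrite !sqrrB; local_lra.
have ii (w w' : R3 R -> R) : continuous w -> (forall x, w x ^+ 2 + w' x ^+ 2 = u x ^+ 2 + v x ^+ 2) -> intg (fun x => w x ^+ 2).
  move=> cw hw; apply: (@intg_le _ _ (fun x => u x ^+ 2 + v x ^+ 2)); [by apply: meas_cont; cont| |exact: intgD].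
  by move=> x; rewrite ger0_norm ?sqr_ge0//; have := hw x; have := sqr_ge0 (w' x); local_lra.
exists eps, p; split=> //; first by rewrite eps0 (le_trans epsd).
  apply: magsol_ext (magsol_cmul a (- b) hmag) => x; rewrite ?NLE; ring.
split=> //.
- by move=> x; rewrite nrm; have := nrm 0; rewrite v00 expr0n addr0 => ->.
- by apply: (ii _ (fun x => a * v x - b * u x)) => //; cont.
- by apply: (ii _ (fun x => a * u x + b * v x)) => [|x]; [cont|rewrite addrC].
- by move=> x; have [t1 t2] := key x; split; [apply: le_trans t1 e1e|apply: le_trans t2 e1e].
Qed.
End Closeness.

(** * Jacobi's identity and rigidity of the linearization *)

Section Jacobi.
Context {R : realType}.
Implicit Types (f g h u k W psi chi D E F G Q : R3 R -> R) (dk dPhi dpsi df dh dchi dD dE : 'I_3 -> R3 R -> R) (x y z : R3 R) (s t ka b p : R).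

Lemma contI f : continuous f -> (forall x, f x != 0) -> continuous (fun x => (f x)^-1).
Proof. by move=> cf f0 x; apply: continuousV; [exact: f0|exact: cf]. Qed.

(** A [C^1] function equal to [t] for [t >= s] and bounded below by [s / 2]: division by
    [gam s (psi x)] makes sense on all of [R^3] and is division by [psi] where [psi >= s]. *)
Definition gam s t : R := if t <= s then 2^-1 * (s + s^-1 * t ^+ 2) else t.
Definition gam' s t : R := if t <= s then s^-1 * t else 1.

Lemma gam_derive s t : 0 < s -> is_derive (t : R) (1 : R) (gam s) (gam' s t).
Proof.
move=> s0; apply: (@glue_derive R s (fun t => 2^-1 * (s + s^-1 * t ^+ 2)) id (fun t => s^-1 * t) (fun=> 1)).
- move=> r _; apply: (der_eq (derZ 2^-1 (derD (der_cst _ _ _) (derZ s^-1 (derX 1 (is_derive_id r (1 : R))))))).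
  by rewrite expr1; field; rewrite gt_eqF.
- by rewrite /=; field; rewrite gt_eqF.
- by rewrite mulVf// gt_eqF.
Qed.

Lemma gam'_cont s : 0 < s -> continuous (gam' s).
Proof.
move=> s0; apply: glue_continuous; [by move=> t; apply: cvgM; [exact: cvg_cst|exact: cvg_id]|by move=> t _; exact: cvg_cst|].
by rewrite mulVf// gt_eqF.
Qed.

Lemma gam_cont s : 0 < s -> continuous (gam s).
Proof. by move=> s0; apply: derive_continuous => t; exact: gam_derive. Qed.

Lemma gam_ge s t : 0 < s -> s / 2 <= gam s t.
Proof.
move=> s0; rewrite /gam; have [ts|ts] := leP t s; last by lra.
by rewrite mulrC ler_pM2l ?invr_gt0// lerDl mulr_ge0 ?sqr_ge0// invr_ge0 ltW.
Qed.

Lemma gam_id s t : 0 < s -> s <= t -> gam s t = t.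
Proof.
move=> s0 st; rewrite /gam; case: leP => // ts; have -> : t = s by apply/le_anti/andP.
by field; rewrite gt_eqF.
Qed.

Lemma gam_id' s t : s <= t -> 0 < s -> gam' s t = 1.
Proof.
move=> st s0; rewrite /gam'; case: leP => // ts; have -> : t = s by apply/le_anti/andP.
by rewrite mulVf// gt_eqF.
Qed.

Lemma C1_inv f df : C1 f df -> (forall x, f x != 0) -> C1 (fun x => (f x)^-1) (fun j x => - (f x ^+ 2)^-1 * df j x).
Proof.
move=> [cf cdf hf] f0; have f20 x : f x ^+ 2 != 0 by rewrite expf_neq0.
split; first exact: contI.
  by move=> j; apply: contM; [apply: contN; apply: contI => //; cont|].
move=> j x; apply: (der_comp (hf j x)).
by apply: (der_eq (is_deriveV (f0 x) (is_derive_id (f x) (1 : R)))); rewrite /= /GRing.scale /= mulr1.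
Qed.

(** Bounds independent of the regularization [t]; they rest on [|f| <= C |p|] and provide the
    majorant for the limit in [picone]. *)
Lemma picone_term (f p q t a D C : R) : q = p ^+ 2 + t ^+ 2 -> 0 < q -> `|f| <= C * `|p| ->
  (a - f * D * p * q^-1) ^+ 2 <= 2 * a ^+ 2 + 2 * C ^+ 2 * D ^+ 2 /\ (f * D) ^+ 2 * t ^+ 2 * q^-1 ^+ 2 <= C ^+ 2 * D ^+ 2.
Proof.
move=> qE q0 fC; have C2 := sqr_ge0 C; have D2 := sqr_ge0 D; have p2 := sqr_ge0 p; have t2 := sqr_ge0 t.
have f2 : f ^+ 2 <= C ^+ 2 * p ^+ 2.
  by have := sqr_le fC; rewrite exprMn [`|p| ^+ 2]real_normK ?num_real.
have pt : 0 <= p ^+ 2 * t ^+ 2 by apply: mulr_ge0.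
have q2 : q ^+ 2 = p ^+ 2 * p ^+ 2 + 2 * (p ^+ 2 * t ^+ 2) + t ^+ 2 * t ^+ 2 by rewrite qE; ring.
have tt : 0 <= t ^+ 2 * t ^+ 2 by apply: mulr_ge0.
have pp : 0 <= p ^+ 2 * p ^+ 2 by apply: mulr_ge0.
have iq : 0 <= q^-1 ^+ 2 by exact: sqr_ge0.
have qq : q ^+ 2 * q^-1 ^+ 2 = 1 by rewrite -exprMn divff ?expr1n// gt_eqF.
have X (y : R) : 0 <= y -> p ^+ 2 * y <= q ^+ 2 -> f ^+ 2 * y * q^-1 ^+ 2 <= C ^+ 2.
  move=> y0 py; rewrite -[leRHS]mulr1 -qq mulrA; apply: ler_wpM2r => //.
  apply: le_trans (_ : C ^+ 2 * p ^+ 2 * y <= _); first exact: ler_wpM2r.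
  by rewrite -mulrA; apply: ler_wpM2l.
have x1 : f ^+ 2 * p ^+ 2 * q^-1 ^+ 2 <= C ^+ 2 by apply: X => //; lra.
have x2 : f ^+ 2 * t ^+ 2 * q^-1 ^+ 2 <= C ^+ 2 by apply: X => //; lra.
split; last first.
  by have -> : (f * D) ^+ 2 * t ^+ 2 * q^-1 ^+ 2 = f ^+ 2 * t ^+ 2 * q^-1 ^+ 2 * D ^+ 2; [ring|exact: ler_wpM2r].
have y1 : f ^+ 2 * p ^+ 2 * q^-1 ^+ 2 * D ^+ 2 <= C ^+ 2 * D ^+ 2 by exact: ler_wpM2r.
have := sqr_ge0 (a + f * D * p * q^-1); rewrite sqrrD sqrrB.
have -> : (f * D * p * q^-1) ^+ 2 = f ^+ 2 * p ^+ 2 * q^-1 ^+ 2 * D ^+ 2 by ring.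
lra.
Qed.

(* Jacobi's identity: testing the equation of [psi] with [f^2 / psi]. The
   quotient is regularized to [f^2 psi / (psi^2 + t^2)], which makes sense on
   the nodal set of [psi], and [t] tends to [0]. *)
Lemma picone W psi dpsi f df kap s (C : R) : sol 0 psi (fun=> 0) (fun x => W x * psi x) (fun=> 0) dpsi (fun _ _ => 0) ->
  continuous W -> C1 f df -> Cc f -> (forall x, `|f x| <= C * `|psi x|) -> 0 < s -> Cc kap -> (forall x, 0 <= kap x <= 1) ->
  (forall x, kap x != 0 -> s <= psi x) ->
  Int (fun x => kap x * \sum_j (df j x - f x * dpsi j x / gam s (psi x)) ^+ 2) <= Int (fun x => gdot df df x - W x * f x ^+ 2).
Proof.
move=> hs cW hf ccf fC s0 ck k01 ks; have [cf cdf _] := hf; have [hpsi _ _ _ weak] := hs; have [cp cdp _] := hpsi.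
have fp0 x : psi x = 0 -> f x = 0 by move=> p0; apply/eqP; rewrite -normr_le0; have := fC x; rewrite p0 normr0 mulr0.
have [r1 hr1] := ccf.2; have [r2 hr2] := ck.2; have [ckap _] := ck.
pose r : R := 1 + `|r1| + `|r2|; have r0 : 0 < r by rewrite /r; have := normr_ge0 r1; have := normr_ge0 r2; lra.
have vf : vanish r f by move=> x xr; apply: hr1; apply: le_lt_trans xr; rewrite /r; have := ler_norm r1; have := normr_ge0 r2; lra.
have vk : vanish r kap by move=> x xr; apply: hr2; apply: le_lt_trans xr; rewrite /r; have := ler_norm r2; have := normr_ge0 r1; lra.
have vdf j := C1_vanish hf vf j.
pose t_ (n : nat) : R := n.+1%:R^-1; have t0 n : 0 < t_ n by rewrite invr_gt0.
pose q n x : R := psi x ^+ 2 + t_ n ^+ 2.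
have q0 n x : 0 < q n x by rewrite ltr_wpDl ?sqr_ge0// exprn_gt0.
have qn0 n x : q n x != 0 by rewrite gt_eqF.
pose i n x : R := (q n x)^-1.
pose b j x : R := f x * dpsi j x.
pose T n j x : R := (df j x - b j x * psi x * i n x) ^+ 2.
pose V n j x : R := b j x ^+ 2 * t_ n ^+ 2 * i n x ^+ 2.
pose F n x : R := W x * f x ^+ 2 * psi x ^+ 2 * i n x + kap x * (\sum_j T n j x) - \sum_j V n j x.
pose L x : R := W x * f x ^+ 2 + kap x * \sum_j (df j x - f x * dpsi j x / gam s (psi x)) ^+ 2.
have cq n : continuous (q n) by rewrite /q; cont.
have ci n : continuous (i n) by exact: contI.
have cb j : continuous (b j) by rewrite /b; cont.
have cF n : continuous (F n).
  have cT j : continuous (T n j) by rewrite /T; cont.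
  have cV j : continuous (V n j) by rewrite /V; cont.
  by apply: contB; [apply: contD; [cont|apply: contM => //; exact: cont_sum]|exact: cont_sum].
have vF n : vanish r (F n).
  move=> x xr; rewrite /F /V /b vf// vk// expr0n !(mulr0, mul0r) add0r big1 ?subrr ?oppr0// => j _.
  by rewrite mul0r expr0n !mul0r.
have iG : intg (gdot df df).
  apply: Cc_intg; split; first by apply: cont_sum => j; cont.
  by exists r => x xr; rewrite /gdot big1 // => j _; rewrite vdf ?mul0r.
have FI n : Int (F n) <= Int (gdot df df).
  have hq : C1 (q n) (fun j x => 2 * psi x * dpsi j x).
    by apply: C1_ext (C1D (C1M hpsi hpsi) (C1_cst (t_ n ^+ 2))) => [x|j x]; rewrite /q; ring.
  pose dPhi (j : 'I_3) x : R := ((df j x * f x + f x * df j x) * psi x + f x * f x * dpsi j x) / q n x + f x * f x * psi x * (- q n x ^- 2 * (2 * psi x * dpsi j x)).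
  have hPhi : C1 (fun x => f x * f x * psi x / q n x) dPhi := C1M (C1M (C1M hf hf) hpsi) (C1_inv hq (qn0 n)).
  have cPhi : Cc (fun x => f x * f x * psi x / q n x).
    split; first by case: hPhi.
    by exists r => x xr; rewrite vf// !mul0r.
  have [] := weak _ _ hPhi cPhi; move: hPhi => [_ cdPhi _] => e _.
  have {}e : Int (gdot dpsi dPhi) = Int (fun x => W x * psi x * (f x * f x * psi x / q n x)).
    by rewrite -e; apply: eq_Int => x; rewrite mulr0 mul0r addr0.
  have iF : intg (F n) by apply: Cc_intg; split; [exact: cF|exists r; exact: vF].
  have iW : intg (fun x => W x * psi x * (f x * f x * psi x / q n x)) by apply: Cc_intg; apply: Cc_mulr cPhi; cont.
  have iD : intg (gdot dpsi dPhi).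
    apply: Cc_intg; split; first by apply: cont_sum => j; apply: contM.
    by exists r => x xr; rewrite /gdot big1 // => j _; rewrite /dPhi !vf// ?vdf//; ring.
  rewrite -[Int (gdot df df)]addr0 -(subrr (Int (fun x => W x * psi x * (f x * f x * psi x / q n x)))) -{2}e addrA -(IntD iG iW) -(IntB (intgD iG iW) iD).
  apply: le_Int => //; first exact: intgB (intgD iG iW) iD.
  move=> x; have /andP[k0 k1] := k01 x.
  apply: le_trans (_ : W x * f x ^+ 2 * psi x ^+ 2 * i n x + \sum_j T n j x - \sum_j V n j x <= _).
    by rewrite /F lerD2r lerD2l ler_piMl// sumr_ge0// => j _; exact: sqr_ge0.
  (* The pointwise identity: completing the square leaves [V], which carries the factor
     [t^2 = q - psi^2] and disappears in the limit. *)
  have E j : T n j x - V n j x = df j x * df j x - dpsi j x * dPhi j x.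
    rewrite /T /V /b /i /dPhi; have tq : t_ n ^+ 2 = q n x - psi x ^+ 2 by rewrite /q addrC addKr.
    by rewrite tq; field; exact: qn0.
  rewrite -addrA -sumrB (eq_bigr _ (fun j _ => E j)) sumrB /gdot le_eqVlt; apply/orP; left; apply/eqP.
  by rewrite /i; move: (\sum_j _) (\sum_j _) => s1 s2; ring.
pose H x : R := `|W x| * f x ^+ 2 + \sum_j (2 * df j x ^+ 2 + 3 * C ^+ 2 * dpsi j x ^+ 2).
have hFH n x : `|F n x| <= H x.
  have /andP[k0 k1] := k01 x.
  have hj j := @picone_term (f x) (psi x) (q n x) (t_ n) (df j x) (dpsi j x) C erefl (q0 n x) (fC x).
  have S1 : 0 <= \sum_j T n j x by apply: sumr_ge0 => j _; exact: sqr_ge0.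
  have S2 : 0 <= \sum_j V n j x by apply: sumr_ge0 => j _; rewrite /V -!exprMn; exact: sqr_ge0.
  have S3 : \sum_j T n j x + \sum_j V n j x <= \sum_j (2 * df j x ^+ 2 + 3 * C ^+ 2 * dpsi j x ^+ 2).
    by rewrite -big_split; apply: ler_sum => j _ /=; have [g1 g2] := hj j; rewrite /T /V /b /i; lra.
  have S4 : kap x * \sum_j T n j x <= \sum_j T n j x by rewrite ler_piMl.
  have S5 : 0 <= kap x * \sum_j T n j x by apply: mulr_ge0.
  have S6 : `|W x * f x ^+ 2 * psi x ^+ 2 * i n x| <= `|W x| * f x ^+ 2.
    have i0 : 0 <= i n x by rewrite invr_ge0 ltW.
    have pq : psi x ^+ 2 * i n x <= 1 by rewrite ler_pdivrMr// mul1r /q lerDl sqr_ge0.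
    have pi0 : 0 <= psi x ^+ 2 * i n x by apply: mulr_ge0 => //; exact: sqr_ge0.
    have f0 : 0 <= f x ^+ 2 by exact: sqr_ge0.
    rewrite -mulrA [leLHS]normrM (ger0_norm pi0) [`|W x * _|]normrM (ger0_norm f0).
    by rewrite ler_piMr// mulr_ge0.
  move: S6; rewrite /F /H !ler_norml => /andP[g1 g2].
  by move: S1 S2 S3 S4 S5 g1 g2; clear => *; apply/andP; split; lra.
have [] := @Int_cvg R F L (fun x => cut (r^-1 *: x + 0) * H x) cF.
- have cH : continuous H by apply: contD; [cont|apply: cont_sum => j; cont].
  apply: Cc_intg; split; first by apply: contM => //; apply: cont_affine; case: (@Cc_cut R).
  exists (3 * r) => x xr; rewrite cut_vanish ?mul0r// addr0 normrZ gtr0_norm ?invr_gt0//.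
  by rewrite mulrC ltr_pdivlMr.
- move=> n x; have [xr|xr] := leP `|x| r.
    by rewrite cut1 ?mul1r// addr0 normrZ gtr0_norm ?invr_gt0// mulrC ler_pdivrMr// mul1r.
  by rewrite vF// normr0 mulr_ge0//; [case/andP: (cut01 (r^-1 *: x + 0))|exact: le_trans (hFH 0%N x)].
(* On the nodal set [f] vanishes because [|f| <= C |psi|], and so does [kap]; both sides of the
   limit are zero there. *)
- move=> x; have [p0|p0] := eqVneq (psi x) 0.
    have kx0 : kap x = 0 by apply/eqP; apply: contraT => /ks; rewrite p0 leNgt s0.
    have -> : (fun n => F n x) = (fun=> L x); last exact: cvg_cst.
    apply/funext => n; rewrite /F /L kx0 /V /b fp0// expr0n !(mulr0, mul0r) !add0r big1 ?oppr0// => j _.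
    by rewrite mul0r expr0n !mul0r.
  pose c0 := kap x * \sum_j df j x ^+ 2.
  pose c1 := W x * f x ^+ 2 * psi x ^+ 2 - 2 * psi x * kap x * \sum_j df j x * b j x.
  pose c2 := kap x * psi x ^+ 2 * \sum_j b j x ^+ 2.
  pose c3 := \sum_j b j x ^+ 2.
  have -> : (fun n => F n x) = (fun n => c0 + c1 * i n x + c2 * (i n x * i n x) - c3 * (t_ n * t_ n) * (i n x * i n x)).
    by apply/funext => n; rewrite /F /c0 /c1 /c2 /c3 /T /V !sum3; ring.
  have ht : t_ n @[n --> \oo] --> (0 : R) by exact: cvg_harmonic.
  have p2 : psi x ^+ 2 + 0 * 0 != 0 by rewrite mulr0 addr0 expf_neq0.
  have hi : i n x @[n --> \oo] --> (psi x ^+ 2 + 0 * 0)^-1.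
    by apply: cvgV => //; apply: cvgD; [exact: cvg_cst|apply: cvgM].
  have -> : L x = c0 + c1 * (psi x ^+ 2 + 0 * 0)^-1 + c2 * ((psi x ^+ 2 + 0 * 0)^-1 * (psi x ^+ 2 + 0 * 0)^-1) - c3 * (0 * 0) * ((psi x ^+ 2 + 0 * 0)^-1 * (psi x ^+ 2 + 0 * 0)^-1).
    rewrite !mulr0 !mul0r subr0 addr0 /L /c0 /c1 /c2 /b !sum3.
    have g0 : gam s (psi x) != 0 by rewrite gt_eqF//; apply: lt_le_trans (gam_ge _ s0); rewrite divr_gt0.
    have [k0|k0] := eqVneq (kap x) 0; first by rewrite k0; field; rewrite ?g0 ?p0.
    by rewrite gam_id ?ks//; field; rewrite ?p0.
  apply: cvgB; last by apply: cvgM; apply: cvgM => //; [exact: cvg_cst|exact: cvgM].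
  by apply: cvgD; [apply: cvgD; [exact: cvg_cst|apply: cvgM => //; exact: cvg_cst]|apply: cvgM; [exact: cvg_cst|exact: cvgM]].
move=> lim iL.
have IL : Int L <= Int (gdot df df).
  have /cvg_lim <- // := lim; apply: limr_le; first by apply/cvg_ex; exists (Int L).
  by apply: nearW => n; exact: FI.
have iW2 : intg (fun x => W x * f x ^+ 2).
  by apply: Cc_intg; split; [cont|exists r => x xr; rewrite vf// expr0n mulr0].
have iK : intg (fun x => kap x * \sum_j (df j x - f x * dpsi j x / gam s (psi x)) ^+ 2).
  by have := intgB iL iW2; congr intg; apply/funext => x; rewrite /L addrC addKr.
by rewrite (IntB iG iW2) lerBrDl -(IntD iW2 iK).
Qed.

Lemma inv_sq (a c : R) : 0 < a -> a <= c -> c ^- 2 <= a ^- 2.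
Proof.
move=> a0 ac; have c0 : 0 < c by exact: lt_le_trans ac.
by rewrite lef_pV2 ?posrE ?exprn_gt0//; apply: lerXn2r => //; rewrite nnegrE ltW.
Qed.

Lemma vec_eq x y : (forall j, coord3 x j = coord3 y j) -> x = y.
Proof.
case: x y => -[x1 x2] x3 [[y1 y2] y3] h.
by have := h o0; have := h o1; have := h o2; rewrite /coord3 /tnth /= => -> -> ->.
Qed.

(** Move from [x] to [y] one coordinate at a time; a cube contains the intermediate corners, and
    three segments give the factor [3]. *)
Lemma C1_lipbox h dh z (r C : R) x y : C1 h dh -> (forall x, `|x - z| <= r -> forall j, `|dh j x| <= C) ->
  `|x - z| <= r -> `|y - z| <= r -> `|h y - h x| <= 3 * C * `|y - x|.
Proof.
move=> hh hC xr yr; have hs := C1_shift z hh.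
have hC' j (w : R3 R) : `|w| <= r -> `|dh j (w + z)| <= C by move=> wr; apply: hC; rewrite addrK.
pose a := x - z; pose d := y - z.
pose p1 : R3 R := (d.1.1, a.1.2, a.2); pose p2 : R3 R := (d.1.1, d.1.2, a.2).
move: (xr) (yr); rewrite !boxE => /and3P[x1 x2 x3] /and3P[y1 y2 y3].
have n1 : `|p1| <= r by rewrite boxE /p1 /= y1 x2 x3.
have n2 : `|p2| <= r by rewrite boxE /p2 /= y1 y2 x3.
have e1 : (d.1.1 - a.1.1) *: axis_vec o0 + a = p1.
  by apply: vec_eq => j; rewrite coordZD coord_axis; case: j => -[|[|[|]]] //= ?; rewrite ?mulr1 ?mulr0 ?add0r ?subrK.
have e2 : (d.1.2 - a.1.2) *: axis_vec o1 + p1 = p2.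
  by apply: vec_eq => j; rewrite coordZD coord_axis; case: j => -[|[|[|]]] //= ?; rewrite ?mulr1 ?mulr0 ?add0r ?subrK.
have e3 : (d.2 - a.2) *: axis_vec o2 + p2 = d.
  by apply: vec_eq => j; rewrite coordZD coord_axis; case: j => -[|[|[|]]] //= ?; rewrite ?mulr1 ?mulr0 ?add0r ?subrK.
have l1 := C1_lip hs (hC' o0) (x := a) (t := d.1.1 - a.1.1) xr; rewrite e1 in l1.
have l2 := C1_lip hs (hC' o1) (x := p1) (t := d.1.2 - a.1.2) n1; rewrite e2 in l2.
have l3 := C1_lip hs (hC' o2) (x := p2) (t := d.2 - a.2) n2; rewrite e3 in l3.
have {}l1 := l1 n1; have {}l2 := l2 n2; have {}l3 := l3 yr.
rewrite /d /a !subrK in l1 l2 l3.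
have C0 : 0 <= C := le_trans (normr_ge0 _) (hC x xr o0).
have dE : y - z - (x - z) = y - x by rewrite opprB addrA subrK.
have cd (j : 'I_3) : C * `|coord3 (y - z) j - coord3 (x - z) j| <= C * `|y - x|.
  by apply: ler_wpM2l => //; rewrite -coordB dE; exact: le_coord.
have := cd o0; have := cd o1; have := cd o2; rewrite /coord3 /tnth /= => c3 c2 c1.
have := ler_normD (h y - h (p2 + z)) (h (p2 + z) - h x).
have := ler_normD (h (p2 + z) - h (p1 + z)) (h (p1 + z) - h x).
rewrite !addrA !subrK; clear -l1 l2 l3 c3 c2 c1; lra.
Qed.

Lemma jensen u k : continuous u -> Cc k -> (forall x, 0 <= k x) -> Int k = 1 -> Int (fun x => u x * k x) ^+ 2 <= Int (fun x => u x ^+ 2 * k x).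
Proof.
move=> cu ck k0 k1; set a := Int (fun x => u x * k x).
have ik : intg k := Cc_intg ck.
have i1 : intg (fun x => u x * k x) by apply: Cc_intg; exact: Cc_mulr.
have i2 : intg (fun x => u x ^+ 2 * k x) by apply: Cc_intg; apply: Cc_mulr => //; cont.
have : 0 <= Int (fun x => u x ^+ 2 * k x - 2 * a * (u x * k x) + a ^+ 2 * k x).
  apply: Int_ge0 => x; have -> : u x ^+ 2 * k x - 2 * a * (u x * k x) + a ^+ 2 * k x = (u x - a) ^+ 2 * k x by ring.
  by apply: mulr_ge0 => //; exact: sqr_ge0.
rewrite (IntD (intgB i2 (intgZ (2 * a) i1)) (intgZ (a ^+ 2) ik)) (IntB i2 (intgZ (2 * a) i1)) (IntZ (2 * a) i1) (IntZ (a ^+ 2) ik) k1 -/a.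
lra.
Qed.

(** An [L^2] bound on the gradient at scale [b] controls oscillation: by Jensen the mollified
    function has gradient at most [th], and it differs from [h] by at most [3 L b]. The two errors
    and a path of length [2 r] give the constants. *)
Lemma osc h dh k dk z (r b L th : R) x y : C1 h dh -> C1 k dk -> 0 <= r -> 0 <= b -> vanish b k -> (forall x, 0 <= k x) -> Int k = 1 ->
  0 <= L -> 0 <= th -> (forall w, `|w - z| <= r + b -> forall j, `|dh j w| <= L) ->
  (forall w, `|w - z| <= r -> forall j, Int (fun x => dh j x ^+ 2 * k (x - w)) <= th ^+ 2) ->
  `|x - z| <= r -> `|y - z| <= r -> `|h y - h x| <= 6 * L * b + 6 * r * th.
Proof.
move=> hh hk r0 b0 vk k0 k1 L0 th0 hL hth xr yr; have [ch cdh _] := hh; have [ck cdk _] := hk.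
have cck : Cc k by split=> //; exists b.
have hg := conv_C1 ch hk cck.
have dg (w : R3 R) j : - cconv h (dk j) w = cconv (dh j) k w.
  have := ibp j hh (C1_shift (- w) hk) (or_intror (Cc_shift (- w) cck)).
  by rewrite /cconv => ->; rewrite opprK.
have gb (w : R3 R) : `|w - z| <= r -> forall j, `|- cconv h (dk j) w| <= th.
  move=> wr j; rewrite dg; apply: (@norm_le_root _ _ 0) => //; rewrite expr0n addr0.
  apply: le_trans (hth w wr j); apply: (jensen (cdh j) (Cc_shift (- w) cck)) => [t|]; first exact: k0.
  by have [_ ->] := Int_translate (- w) (Cc_intg cck).
have step1 := C1_lipbox hg gb xr yr.
have near (w : R3 R) : `|w - z| <= r -> `|cconv h k w - h w| <= 3 * L * b.
  move=> wr; rewrite (convE w ch cck).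
  have i1 : intg (fun t : R3 R => h (t + w) * k t).
    by apply: Cc_intg; apply: Cc_mulr => //; exact: (@cont_shift _ h w ch).
  have i2 := Cc_intg cck.
  have -> : h w = Int (fun q : R3 R => h w * k q) by rewrite (IntZ (h w) i2) k1 mulr1.
  have i3 := intgZ (h w) i2; have i4 := intgZ (3 * L * b) i2.
  have lip (t : R3 R) : `|h (t + w) * k t - h w * k t| <= 3 * L * b * k t.
    rewrite -mulrBl normrM [`|k t|]ger0_norm//.
    have [tb|tb] := leP `|t| b; last by rewrite (vk t tb) !mulr0.
    apply: ler_wpM2r => //; apply: le_trans (_ : 3 * L * `|t| <= _); last by apply: ler_wpM2l => //; rewrite mulr_ge0.
    have e : t + w - w = t by rewrite addrK.
    rewrite -{2}e; apply: (C1_lipbox hh hL); first by apply: le_trans wr _; rewrite lerDl.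
    by rewrite -addrA addrC; apply: le_trans (ler_normD _ _) _; exact: lerD.
  have iz : Int (fun q : R3 R => 3 * L * b * k q) = 3 * L * b by rewrite (IntZ _ i2) k1 mulr1.
  rewrite ler_norml -(IntB i1 i3) -iz -(IntN i4); apply/andP; split; apply: le_Int => //; try exact: intgB.
  - by have := intgZ (-1) i4; congr intg; apply/funext => t; rewrite mulN1r.
  - by move=> t; have := lip t; rewrite ler_norml => /andP[].
  - by move=> t; have := lip t; rewrite ler_norml => /andP[].
have xy : `|y - x| <= 2 * r.
  have -> : y - x = (y - z) - (x - z) by rewrite opprB addrA subrK.
  by apply: le_trans (ler_normB _ _) _; lra.
have e3 : 3 * th * `|y - x| <= 3 * th * (2 * r) by apply: ler_wpM2l => //; rewrite mulr_ge0.
move: (near x xr) (near y yr) step1 e3; rewrite !ler_norml => /andP[? ?] /andP[? ?] /andP[? ?] ?.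
by apply/andP; split; lra.
Qed.

(** [osc] applied to [f / psi], whose gradient is [(df - f dpsi / psi) / psi]. Where [psi >= s], the
    square of it is at most the integrand of Jacobi's identity over [s^2], so a small Jacobi form
    means a nearly constant quotient. *)
Lemma osc_picone W psi dpsi f df s (C : R) k dk z (Kx r b A B eta : R) x y :
  sol 0 psi (fun=> 0) (fun x => W x * psi x) (fun=> 0) dpsi (fun _ _ => 0) ->
  continuous W -> C1 f df -> Cc f -> (forall x, `|f x| <= C * `|psi x|) -> 0 < s ->
  C1 k dk -> 0 <= r -> 0 <= b -> vanish b k -> (forall x, 0 <= k x <= Kx) -> Int k = 1 -> 0 < Kx ->
  (forall w, `|w - z| <= r + b -> s <= psi w /\ forall j, [/\ `|f w| <= A, `|df j w| <= A & `|dpsi j w| <= B]) ->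
  Int (fun x => gdot df df x - W x * f x ^+ 2) <= eta -> 0 <= eta ->
  `|x - z| <= r -> `|y - z| <= r ->
  `|f y / psi y - f x / psi x| <= 6 * (A / s + A * B / s ^+ 2) * b + 6 * r * Num.sqrt (Kx * eta / s ^+ 2).
Proof.
move=> hs cW hf ccf fC s0 hk r0 b0 vk kb k1 Kx0 reg heta eta0 xr yr.
have [hpsi _ _ _ _] := hs; have [cp cdp _] := hpsi; have [cf cdf _] := hf; have [ck _ _] := hk.
have k0 w : 0 <= k w by case/andP: (kb w).
have cck : Cc k by split=> //; exists b.
have g0 w : gam s (psi w) != 0 by rewrite gt_eqF//; apply: lt_le_trans (gam_ge _ s0); rewrite divr_gt0.
have hgam : C1 (fun x => gam s (psi x)) (fun j x => gam' s (psi x) * dpsi j x).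
  apply: (C1_comp hpsi (h' := gam' s)) => [w||]; [exact: gam_derive|exact: gam_cont|].
  exact: cont_comp cp (gam'_cont s0).
have hh := C1M hf (C1_inv hgam g0).
have xreg w : `|w - z| <= r -> `|w - z| <= r + b by move=> wr; apply: le_trans wr _; rewrite lerDl.
have gE w : `|w - z| <= r + b -> gam s (psi w) = psi w by move=> /reg[sp _]; exact: gam_id.
have -> : f y / psi y - f x / psi x = f y / gam s (psi y) - f x / gam s (psi x).
  by rewrite !gE//; exact: xreg.
have s20 : 0 < s ^+ 2 by rewrite exprn_gt0.
have [_ regx] := reg x (xreg x xr); have [A1 _ B1] := regx o0.
have A0 := le_trans (normr_ge0 _) A1; have B0 := le_trans (normr_ge0 _) B1.
have is0 : 0 <= s^-1 by rewrite invr_ge0 ltW.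
have L0 : 0 <= A / s + A * B / s ^+ 2.
  by apply: addr_ge0; [exact: mulr_ge0|apply: mulr_ge0; [exact: mulr_ge0|rewrite invr_ge0 ltW]].
have q0 : 0 <= Kx * eta / s ^+ 2 by apply: mulr_ge0; [apply: mulr_ge0 => //; exact: ltW|rewrite invr_ge0 ltW].
apply: (osc hh hk r0 b0 vk k0 k1 L0 (sqrtr_ge0 _) _ _ xr yr).
  move=> w wr j; have [sp /(_ j) [f1 f2 f3]] := reg w wr; rewrite gE// gam_id'// mul1r.
  have p0 : 0 < psi w by apply: lt_le_trans sp.
  have ip : (psi w)^-1 <= s^-1 by rewrite lef_pV2 ?posrE.
  have ip0 : 0 <= (psi w)^-1 by rewrite invr_ge0 ltW.
  apply: le_trans (ler_normD _ _) _; apply: lerD; first by rewrite normrM [`|_^-1|]ger0_norm//; apply: ler_pM.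
  rewrite normrM normrM normrN -[leRHS]mulrA; apply: ler_pM => //.
  rewrite mulrC; apply: ler_pM => //.
  by rewrite ger0_norm ?invr_ge0 ?sqr_ge0//; exact: inv_sq.
move=> w wr j; rewrite sqr_sqrtr//.
(* Divided by its bound, the mollifier itself is the weight for [picone]; its support lies where
   [psi >= s]. *)
pose kap (t : R3 R) : R := Kx^-1 * k (t - w).
have ckap : Cc kap by apply: Cc_mulr; [exact: cont_cst|exact: Cc_shift].
have kap01 (t : R3 R) : 0 <= kap t <= 1.
  have /andP[a1 a2] := kb (t - w); rewrite /kap mulr_ge0 ?invr_ge0 ?(ltW Kx0)//=.
  by rewrite mulrC ler_pdivrMr// mul1r.
have kreg (t : R3 R) : k (t - w) != 0 -> `|t - z| <= r + b.
  move=> kt; have tw : `|t - w| <= b by rewrite leNgt; apply/negP => /vk; apply/eqP.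
  by have -> : t - z = (w - z) + (t - w); [rewrite [RHS]addrC addrA subrK|apply: le_trans (ler_normD _ _) _; exact: lerD].
have kaps (t : R3 R) : kap t != 0 -> s <= psi t.
  by rewrite /kap mulf_eq0 negb_or => /andP[_ /kreg /reg[]].
have := le_trans (picone hs cW hf ccf fC s0 ckap kap01 kaps) heta => pic.
have cterm i : continuous (fun t : R3 R => (df i t - f t * dpsi i t / gam s (psi t)) ^+ 2).
  have cg := contI (cont_comp cp (gam_cont s0)) g0.
  by cont.
have iK : intg (fun t : R3 R => kap t * \sum_i (df i t - f t * dpsi i t / gam s (psi t)) ^+ 2).
  have := Cc_intg (Cc_mulr (cont_sum cterm) ckap); congr intg; apply/funext => t; exact: mulrC.
have cd : continuous (fun t : R3 R => df j t * (gam s (psi t))^-1 + f t * (- (gam s (psi t) ^+ 2)^-1 * (gam' s (psi t) * dpsi j t))).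
  by case: hh => _ h _; exact: h.
apply: le_trans (_ : Int (fun t : R3 R => Kx / s ^+ 2 * (kap t * \sum_i (df i t - f t * dpsi i t / gam s (psi t)) ^+ 2)) <= _).
  apply: le_Int; [|exact: intgZ|].
    by apply: Cc_intg; apply: (Cc_mulr (contX cd) (Cc_shift (- w) cck)).
  move=> t; have [kt|kt] := eqVneq (k (t - w)) 0; first by rewrite /kap kt !(mulr0, mul0r).
  have [sp _] := reg t (kreg t kt); have p0 : 0 < psi t by apply: lt_le_trans sp.
  have pn0 : psi t != 0 by rewrite gt_eqF.
  rewrite gam_id// gam_id'// mul1r.
  have -> : (df j t / psi t + f t * (- psi t ^- 2 * dpsi j t)) ^+ 2 = (df j t - f t * dpsi j t / psi t) ^+ 2 / psi t ^+ 2 by field.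
  have -> : Kx / s ^+ 2 * (kap t * \sum_i (df i t - f t * dpsi i t / psi t) ^+ 2) = (\sum_i (df i t - f t * dpsi i t / psi t) ^+ 2) / s ^+ 2 * k (t - w).
    by rewrite /kap; move: (\sum_i _) => S; field; rewrite !gt_eqF.
  apply: ler_wpM2r => //; apply: ler_pM => //; [exact: sqr_ge0|by rewrite invr_ge0 sqr_ge0| |].
    by rewrite (bigD1 j)//= lerDl sumr_ge0// => i _; exact: sqr_ge0.
  exact: inv_sq.
rewrite (IntZ _ iK) [leRHS]mulrAC; apply: ler_wpM2l => //.
by apply: mulr_ge0; [exact: ltW|rewrite invr_ge0 ltW].
Qed.

(** * Energy estimates with a large cutoff *)

Definition dM f df g dg : 'I_3 -> R3 R -> R := fun j x => df j x * g x + f x * dg j x.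

(** The equations are tested with [chi^2 D] and [chi^2 E]. The magnetic cross term is absorbed with
    weight [de]: the difference of the two sides is [1 / de] times a sum of squares of
    [de grad (chi D)] and [de grad (chi E)] shifted by [A chi E] and [A chi D]. *)
Lemma energy ka D E F G dD dE chi dchi (de : R) : sol ka D E F G dD dE -> C1 chi dchi -> Cc chi -> 0 < de ->
  (1 - de) * Int (fun x => gdot (dM chi dchi D dD) (dM chi dchi D dD) x + gdot (dM chi dchi E dE) (dM chi dchi E dE) x) <=
  Int (fun x => gdot dchi dchi x * (D x ^+ 2 + E x ^+ 2)) +
  Int (fun x => chi x ^+ 2 * (F x * D x + G x * E x + ka ^+ 2 * (x.1.1 ^+ 2 + x.1.2 ^+ 2) / de * (D x ^+ 2 + E x ^+ 2))).
Proof.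
move=> hs hc cc de0; have [hD hE cF cG _] := hs; have [cD cdD _] := hD; have [cE cdE _] := hE; have [c1 c2 _] := hc.
have cc2 : Cc (fun x => chi x * chi x) by apply: Cc_mulr.
have [r hr] := cc.2; have vd j := C1_vanish hc hr j.
have e := EI hs (C1M hc hc) cc2.
have cg (w w' : 'I_3 -> R3 R -> R) : (forall j, continuous (w j)) -> (forall j, continuous (w' j)) -> continuous (gdot w w').
  by move=> h1 h2; apply: cont_sum => j; apply: contM.
have cr (w : 'I_3 -> R3 R -> R) : (forall j, continuous (w j)) -> continuous (rotd w).
  by move=> h1; rewrite /rotd; have h2 := h1 o1; cont.
have cdf j : continuous (dM chi dchi D dD j) by rewrite /dM; have := c2 j; have := cdD j => ? ?; cont.
have cdg j : continuous (dM chi dchi E dE j) by rewrite /dM; have := c2 j; have := cdE j => ? ?; cont.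
have vf j : vanish r (dM chi dchi D dD j) by move=> x xr; rewrite /dM vd// hr//; ring.
have vg j : vanish r (dM chi dchi E dE j) by move=> x xr; rewrite /dM vd// hr//; ring.
pose X x := gdot (dM chi dchi D dD) (dM chi dchi D dD) x + gdot (dM chi dchi E dE) (dM chi dchi E dE) x.
pose Y x := gdot dchi dchi x * (D x ^+ 2 + E x ^+ 2).
pose Z x := chi x ^+ 2 * (F x * D x + G x * E x + ka ^+ 2 * (x.1.1 ^+ 2 + x.1.2 ^+ 2) / de * (D x ^+ 2 + E x ^+ 2)).
pose T x := chi x ^+ 2 * (F x * D x + G x * E x).
have iX : intg X.
  apply: Cc_intg; split; first by apply: contD; exact: cg.
  by exists r => x xr; rewrite /X /gdot !big1 ?addr0// => j _; rewrite ?vf ?vg ?mul0r.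
have iY : intg Y.
  apply: Cc_intg; split; first by apply: contM; [exact: cg|cont].
  by exists r => x xr; rewrite /Y /gdot big1 ?mul0r// => j _; rewrite vd ?mul0r.
have iZ : intg Z.
  by apply: Cc_intg; split; [rewrite /Z; cont|exists r => x /hr h; rewrite /Z h expr0n mul0r].
have iT : intg T.
  by apply: Cc_intg; split; [rewrite /T; cont|exists r => x /hr h; rewrite /T h expr0n mul0r].
have eT : Int (fun x => (F x * D x + G x * E x) * (chi x * chi x)) = Int T by apply: eq_Int => x; rewrite /T; ring.
rewrite eT in e.
pose B x := (gdot dD dD x + gdot dE dE x + 2 * ka * (E x * rotd dD x - D x * rotd dE x)) * (chi x * chi x) +
        (D x * gdot dD (fun j y => dchi j y * chi y + chi y * dchi j y) x + E x * gdot dE (fun j y => dchi j y * chi y + chi y * dchi j y) x).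
have iB : intg B.
  have cdc j : continuous (fun y => dchi j y * chi y + chi y * dchi j y) by have := c2 j => ?; cont.
  apply: Cc_intg; split.
    have h1 := cg _ _ cdD cdD; have h2 := cg _ _ cdE cdE; have h3 := cr _ cdD; have h4 := cr _ cdE.
    have h5 := cg _ _ cdD cdc; have h6 := cg _ _ cdE cdc.
    by rewrite /B; cont.
  by exists r => x xr; rewrite /B /gdot hr// !mulr0 add0r !big1 ?mulr0 ?addr0// => j _; rewrite vd//; ring.
have le : Int (fun x => (1 - de) * X x - Y x - (Z x - T x)) <= Int B.
  apply: le_Int => //; first exact: intgB (intgB (intgZ _ iX) iY) (intgB iZ iT).
  move=> x; rewrite -subr_ge0.
  have -> : B x - ((1 - de) * X x - Y x - (Z x - T x)) = de^-1 * (
     ((de * dM chi dchi D dD o0 x - ka * x.1.2 * (chi x * E x)) ^+ 2 + (de * dM chi dchi D dD o1 x + ka * x.1.1 * (chi x * E x)) ^+ 2 + (de * dM chi dchi D dD o2 x) ^+ 2)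
    + ((de * dM chi dchi E dE o0 x + ka * x.1.2 * (chi x * D x)) ^+ 2 + (de * dM chi dchi E dE o1 x - ka * x.1.1 * (chi x * D x)) ^+ 2 + (de * dM chi dchi E dE o2 x) ^+ 2)).
    by rewrite /B /X /Y /Z /T /gdot /rotd /dM !sum3; field; rewrite gt_eqF.
  by rewrite mulr_ge0 ?invr_ge0 ?(ltW de0)// !addr_ge0// sqr_ge0.
rewrite (IntB (intgB (intgZ _ iX) iY) (intgB iZ iT)) (IntB (intgZ _ iX) iY) (IntB iZ iT) (IntZ _ iX) in le.
have eB : Int B = Int T by exact: e.
move: le; rewrite eB -/X -/Y -/Z.
by clear; move: (Int X) (Int Y) (Int Z) (Int T) => *; lra.
Qed.

(** One inequality with different weights. A small weight bounds the two Jacobi forms by a small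
    multiple of [Int N]. Weight [1] discards the gradients and leaves the potential terms, which are
    coercive outside the box [K] because [1 - 3 Q^2 >= 3/4] there. *)
Lemma energy_gap ka D E F G dD dE chi dchi (de eta q0 K : R) Q N : (forall x, N x = D x ^+ 2 + E x ^+ 2) -> sol ka D E F G dD dE -> C1 chi dchi -> Cc chi -> 0 < de <= 2^-1 -> 0 <= eta ->
  (forall x, 0 <= chi x <= 1) -> (forall x, gdot dchi dchi x <= eta) -> continuous Q -> (forall x, 0 <= Q x <= q0) ->
  (forall x, K < `|x| -> 3 * Q x ^+ 2 <= 4^-1) ->
  intg N ->
  (forall x, F x * D x + G x * E x + ka ^+ 2 * (x.1.1 ^+ 2 + x.1.2 ^+ 2) / de * N x <=
     (3 * Q x ^+ 2 - 1) * D x ^+ 2 + (Q x ^+ 2 - 1) * E x ^+ 2 + eta * N x) ->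
  Int (fun x => gdot (dM chi dchi D dD) (dM chi dchi D dD) x - (3 * Q x ^+ 2 - 1) * (chi x * D x) ^+ 2) +
  Int (fun x => gdot (dM chi dchi E dE) (dM chi dchi E dE) x - (Q x ^+ 2 - 1) * (chi x * E x) ^+ 2) <=
    (4 * eta + 6 * de * q0 ^+ 2) * Int N /\
  3 / 4 * Int (fun x => chi x ^+ 2 * N x) <= 2 * eta * Int N
    + 3 * q0 ^+ 2 * IntBox K N.
Proof.
move=> NE hs hc cc /andP[de0 de1] eta0 c01 ceta cQ hQ QK iN hF.
have [hD hE cF cG _] := hs; have [cD cdD _] := hD; have [cE cdE _] := hE; have [c1 c2 _] := hc.
have [r hr] := cc.2; have vd j := C1_vanish hc hr j.
have cN : continuous N by rewrite (funext NE); cont.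
have N0 x : 0 <= N x by rewrite NE addr_ge0// sqr_ge0.
have IN : 0 <= Int N by exact: Int_ge0.
have q20 : 0 <= q0 ^+ 2 by exact: sqr_ge0.
have Q2 x : 0 <= Q x ^+ 2 <= q0 ^+ 2.
  by rewrite sqr_ge0/=; apply: sqr_le; have /andP[a1 a2] := hQ x; rewrite ger0_norm.
have cg (w w' : 'I_3 -> R3 R -> R) : (forall j, continuous (w j)) -> (forall j, continuous (w' j)) -> continuous (gdot w w').
  by move=> h1 h2; apply: cont_sum => j; apply: contM.
have cdf j : continuous (dM chi dchi D dD j) by rewrite /dM; have := c2 j; have := cdD j => ? ?; cont.
have cdg j : continuous (dM chi dchi E dE j) by rewrite /dM; have := c2 j; have := cdE j => ? ?; cont.
have vf j : vanish r (dM chi dchi D dD j) by move=> x xr; rewrite /dM vd// hr//; ring.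
have vg j : vanish r (dM chi dchi E dE j) by move=> x xr; rewrite /dM vd// hr//; ring.
pose Gf := gdot (dM chi dchi D dD) (dM chi dchi D dD); pose Gg := gdot (dM chi dchi E dE) (dM chi dchi E dE).
have iGf : intg Gf.
  apply: Cc_intg; split; first exact: cg.
  by exists r => x xr; rewrite /Gf /gdot big1 ?addr0// => j _; rewrite ?vf ?mul0r.
have iGg : intg Gg.
  apply: Cc_intg; split; first exact: cg.
  by exists r => x xr; rewrite /Gg /gdot big1 ?addr0// => j _; rewrite ?vg ?mul0r.
pose A x := (3 * Q x ^+ 2 - 1) * (chi x * D x) ^+ 2; pose B x := (Q x ^+ 2 - 1) * (chi x * E x) ^+ 2.
have iA : intg A by apply: Cc_intg; split; [rewrite /A; cont|exists r => x /hr h; rewrite /A h mul0r expr0n mulr0].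
have iB : intg B by apply: Cc_intg; split; [rewrite /B; cont|exists r => x /hr h; rewrite /B h mul0r expr0n mulr0].
have iC : intg (fun x => chi x ^+ 2 * N x) by apply: Cc_intg; split; [cont|exists r => x /hr h; rewrite h expr0n mul0r].
have c2le x : 0 <= chi x ^+ 2 <= 1.
  by rewrite sqr_ge0/=; have /andP[a1 a2] := c01 x; rewrite expr_le1.
(* the hypothesis for [de] implies it for every larger constant *)
have key (a : R) : de <= a -> (1 - a) * (Int Gf + Int Gg) <= 2 * eta * Int N + (Int A + Int B).
  move=> dea; have a0 : 0 < a by exact: lt_le_trans dea.
  have := energy hs hc cc a0; rewrite (IntD iGf iGg) => h; apply: le_trans h _.
  under eq_Int do rewrite -NE.
  under [X in _ + X <= _]eq_Int do rewrite -NE.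
  have -> : 2 * eta * Int N + (Int A + Int B) = eta * Int N + (eta * Int N + (Int A + Int B)) by ring.
  apply: lerD.
    rewrite -(IntZ eta iN); apply: le_Int; [|exact: intgZ|].
      apply: Cc_intg; split; first by apply: contM; [exact: cg|].
      by exists r => x xr; rewrite /gdot big1 ?mul0r// => j _; rewrite vd ?mul0r.
    by move=> x; apply: ler_wpM2r; [exact: N0|exact: ceta].
  rewrite -(IntZ eta iN) -(IntD iA iB) -(IntD (intgZ eta iN) (intgD iA iB)); apply: le_Int.
  - by apply: Cc_intg; split; [cont|exists r => x /hr h'; rewrite h' expr0n mul0r].
  - exact: intgD (intgZ eta iN) (intgD iA iB).
  - move=> x; have /andP[k0 k1] := c2le x.
    apply: le_trans (_ : chi x ^+ 2 * ((3 * Q x ^+ 2 - 1) * D x ^+ 2 + (Q x ^+ 2 - 1) * E x ^+ 2 + eta * N x) <= _).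
      apply: ler_wpM2l => //; apply: le_trans (hF x); rewrite lerD2l; apply: ler_wpM2r; first exact: N0.
      apply: ler_wpM2l; first by rewrite mulr_ge0 ?sqr_ge0// addr_ge0// sqr_ge0.
      by rewrite lef_pV2 ?posrE.
    have : chi x ^+ 2 * (eta * N x) <= eta * N x by rewrite ler_piMl// mulr_ge0.
    rewrite /A /B NE !exprMn; move: (chi x ^+ 2) (Q x ^+ 2) (D x ^+ 2) (E x ^+ 2); clear => *; lra.
have CN : Int (fun x => chi x ^+ 2 * N x) <= Int N.
  by apply: le_Int => // x; have /andP[k0 k1] := c2le x; rewrite ler_piMl.
have dd (t : R) x : 0 <= t -> 0 <= t * (chi x ^+ 2 * D x ^+ 2) /\ 0 <= t * (chi x ^+ 2 * E x ^+ 2).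
  by move=> t0; split; apply: mulr_ge0 => //; rewrite mulr_ge0// sqr_ge0.
have AB : Int A + Int B <= 3 * q0 ^+ 2 * Int N.
  apply: le_trans (_ : 3 * q0 ^+ 2 * Int (fun x => chi x ^+ 2 * N x) <= _); last by apply: ler_wpM2l => //; rewrite mulr_ge0.
  rewrite -(IntD iA iB) -(IntZ (3 * q0 ^+ 2) iC); apply: le_Int; [exact: intgD|exact: intgZ|].
  move=> x; have /andP[p0 p1] := Q2 x; have [d1 d2] := dd 1 x ler01; have [_ e2] := dd _ x q20.
  have [|m1 m2] := dd (q0 ^+ 2 - Q x ^+ 2) x; first by rewrite subr_ge0.
  by rewrite /A /B NE !exprMn; move: m1 m2 d1 d2 e2; clear; lra.
split.
  rewrite (IntB iGf iA) (IntB iGg iB).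
  (* Weight [1/2] first bounds the full Dirichlet integral; multiplied by [de], that bound pays for
     the gradient which weight [de] takes away. *)
  have k1 := key de (lexx _); have k2 := key _ de1.
  have G2 : Int Gf + Int Gg <= (4 * eta + 6 * q0 ^+ 2) * Int N by move: k2 AB; clear; lra.
  have G3 : de * (Int Gf + Int Gg) <= de * ((4 * eta + 6 * q0 ^+ 2) * Int N) by apply: ler_wpM2l => //; exact: ltW.
  have G4 : de * (eta * Int N) <= 2^-1 * (eta * Int N) by apply: ler_wpM2r => //; exact: mulr_ge0.
  move: k1 G3 G4; clear; move: (Int Gf) (Int Gg) (Int A) (Int B) (Int N) => *; lra.
have h1 : de <= 1 by clear -de1; lra.
have k1 := key 1 h1.
rewrite subrr mul0r in k1.
have cW : continuous (fun x => 3 * q0 ^+ 2 * N x) by cont.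
have iR := intg_restrict K cW.
have -> : 3 * q0 ^+ 2 * IntBox K N = Int ((fun x => 3 * q0 ^+ 2 * N x) \_ (box K)).
  by rewrite -IntBoxE -(IntBoxZ _ _ cN).
have : 3 / 4 * Int (fun x => chi x ^+ 2 * N x) + (Int A + Int B) <= Int ((fun x => 3 * q0 ^+ 2 * N x) \_ (box K)).
  rewrite -(IntZ _ iC) -(IntD iA iB) -(IntD (intgZ _ iC) (intgD iA iB)); apply: le_Int => //.
    exact: intgD (intgZ _ iC) (intgD iA iB).
  move=> x; have /andP[k0 k2] := c2le x; have /andP[p0 p1] := Q2 x; rewrite box_restrict.
  have [d1 d2] := dd 1 x ler01; case: ifPn => xK.
    have [|m1 m2] := dd (q0 ^+ 2 - Q x ^+ 2) x; [by rewrite subr_ge0|have [_ e2] := dd _ x q20].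
    have m3 : 3 * q0 ^+ 2 * (chi x ^+ 2 * N x) <= 3 * q0 ^+ 2 * N x.
      by apply: ler_wpM2l; [rewrite mulr_ge0|rewrite ler_piMl].
    by move: m3; rewrite /A /B NE !exprMn; move: m1 m2 d1 d2 e2; clear; lra.
  have [|m1 m2] := dd (4^-1 - 3 * Q x ^+ 2) x; first by rewrite subr_ge0 QK// ltNge.
  by have [_ e2] := dd _ x p0; rewrite /A /B NE !exprMn; move: m1 m2 e2; clear; lra.
move: k1; clear.
move: (Int A) (Int B) (Int N) (Int (_ \_ _)) (Int (fun x => chi x ^+ 2 * N x)) => *; lra.
Qed.

(** Dilations of [cut]: their gradients tend to zero, and dominated convergence keeps three quarters
    of the integral. *)
Lemma large_cut h (eta r : R) : continuous h -> (forall x, 0 <= h x) -> intg h -> 0 < eta -> 0 < Int h -> exists chi dchi,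
  [/\ C1 chi dchi, Cc chi, forall x, 0 <= chi x <= 1, forall x, `|x| <= r -> chi x = 1 &
   (forall x, gdot dchi dchi x <= eta) /\ 3 / 4 * Int h <= Int (fun x => chi x ^+ 2 * h x)].
Proof.
move=> ch h0 ih eta0 Ih; have hc := @C1_cut R; have [cc cdc _] := hc.
have [C C0 hC] : exists2 C : R, 0 <= C & forall x j, `|dcut j x| <= C.
  have [a0 a00 h0'] := Cc_bounded (C1_Cc o0 hc (@Cc_cut R)).
  have [a1 a10 h1'] := Cc_bounded (C1_Cc o1 hc (@Cc_cut R)).
  have [a2 a20 h2'] := Cc_bounded (C1_Cc o2 hc (@Cc_cut R)).
  exists (a0 + a1 + a2); first by rewrite !addr_ge0.
  move=> x; have := h0' x; have := h1' x; have := h2' x => l2 l1 l0.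
  move=> j; have : j = o0 \/ j = o1 \/ j = o2 by case: j => -[|[|[|]]] //= i; [left|right; left|right; right]; apply: val_inj.
  by case=> [->|[->|->]]; lra.
pose X (n : nat) x := cut (n.+1%:R^-1 *: x + 0) : R.
have cX n : continuous (X n) by apply: (@cont_affine _ cut).
have X01 n x : 0 <= X n x <= 1 by exact: cut01.
have X1 (n : nat) x : `|x| <= n.+1%:R -> X n x = 1.
  by move=> xn; rewrite /X cut1// addr0 normrZ gtr0_norm ?invr_gt0// mulrC ler_pdivrMr// mul1r.
have lim : (Int (fun x => X n x ^+ 2 * h x) @[n --> \oo] --> Int h) /\ intg h.
  apply: (Int_cvg _ ih) => [n|n x|x].
  - by have := cX n => ?; cont.
  - have /andP[a b] := X01 n x; rewrite normrM [`|h x|]ger0_norm// ger0_norm ?sqr_ge0// ler_piMl//.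
    by rewrite expr_le1.
  - apply: cvg_near_cst; near=> n; rewrite X1 ?expr1n ?mul1r//.
    by apply: le_trans (_ : n%:R <= _); [near: n; exact: nbhs_infty_ger|rewrite ler_nat].
have lt : 3 / 4 * Int h < Int h by lra.
have ev1 : \forall n \near \oo, 3 / 4 * Int h <= Int (fun x => X n x ^+ 2 * h x).
  by apply: (cvgr_ge _ lim.1); exact: lt.
have ev2 : \forall n \near \oo, Num.max r (3 * C ^+ 2 / eta) <= n%:R by exact: nbhs_infty_ger.
have [n [l1]] := filter_ex (filterI ev1 ev2).
rewrite ge_max => /andP[l2 l3].
exists (X n), (fun j x => n.+1%:R^-1 * dcut j (n.+1%:R^-1 *: x + 0)); split.
- exact: C1_affine hc.
- split=> //; exists (3 * n.+1%:R) => x xr; rewrite /X cut_vanish// addr0 normrZ gtr0_norm ?invr_gt0//.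
  by rewrite mulrC ltr_pdivlMr.
- exact: X01.
- by move=> x xr; apply: X1; apply: le_trans xr _; apply: le_trans l2 _; rewrite ler_nat.
- split=> // x; rewrite /gdot.
  have n1 : 1 <= n.+1%:R :> R by rewrite ler1n.
  apply: le_trans (_ : \sum_(j < 3) n.+1%:R^-1 * C ^+ 2 <= _).
    apply: ler_sum => j _; rewrite mulrACA -!expr2; apply: ler_pM; [exact: sqr_ge0|exact: sqr_ge0| |exact: sqr_le].
    by rewrite expr2 ler_piMr ?invr_ge0 ?ler0n// invf_le1.
  rewrite sum3; have : 3 * C ^+ 2 <= eta * n.+1%:R.
    by rewrite [leRHS]mulrC -ler_pdivrMr//; apply: le_trans l3 _; rewrite ler_nat.
  move=> hh; have : n.+1%:R^-1 * (3 * C ^+ 2) <= eta by rewrite mulrC ler_pdivrMr.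
  by clear; move: (n.+1%:R^-1) => q; lra.
Unshelve. all: by end_near. Qed.
End Jacobi.

(** The quotient by [psi] is studied on a cube pushed off the nodal plane: even enlarged by [b] it
    stays in [x_1 >= ta], yet it contains [(K, 0, 0)] and the part [x_1 >= 2 ta] of the box [K]. *)
Lemma cube_geom (R : realType) (K ta b : R) (z := ((K + 2 * ta, 0, 0) : R3 R)) : 1 <= K -> 0 < ta <= 2^-1 -> b <= ta ->
  [/\ forall w, `|w - z| <= K + b -> ta <= w.1.1 /\ `|w| <= 2 * K + 4, `|((K, 0, 0) : R3 R) - z| <= K &
      forall w, `|w| <= K -> 2 * ta <= w.1.1 -> `|w - z| <= K].
Proof.
move=> K1 /andP[t0 t1] bt.
have zsub (w : R3 R) : w - z = (w.1.1 - (K + 2 * ta), w.1.2, w.2).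
  by apply: vec_eq => j; rewrite coordB; case: j => -[|[|[|]]] //= i; rewrite /coord3 /tnth /= ?subr0.
split=> [w||w].
- rewrite zsub !boxE /= => /and3P[]; rewrite !ler_norml => /andP[a1 a2] /andP[a3 a4] /andP[a5 a6].
  split; first lra.
  by apply/and3P; split; apply/andP; split; lra.
- rewrite zsub boxE /= !normr0 (le_trans ler01 K1) !andbT ler_norml; apply/andP; split; lra.
- rewrite zsub !boxE /= => /and3P[a1 -> ->]; rewrite !andbT; move: a1; rewrite !ler_norml => /andP[a1 a2] a3.
  by apply/andP; split; lra.
Qed.

(** * The reflection and the difference equation *)

Section Reflection.
Context {R : realType}.
Implicit Types (f g h u v P D E : R3 R -> R) (x y : R3 R) (t ka b eps p : R).
Lemma cont_map g f1 f2 f3 : continuous g -> continuous f1 -> continuous f2 -> continuous f3 -> continuous (fun x => g (f1 x, f2 x, f3 x)).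
Proof.
move=> cg h1 h2 h3 x; apply: (@continuous_comp _ _ _ (fun x => (f1 x, f2 x, f3 x))); last exact: cg.
apply/cvgrPdist_le => e e0; move/cvgrPdist_le : (h1 x) => /(_ e e0) n1; move/cvgrPdist_le : (h2 x) => /(_ e e0) n2.
move/cvgrPdist_le : (h3 x) => /(_ e e0) n3; near=> y.
by rewrite boxE /=; apply/and3P; split; near: y; [exact: n1|exact: n2|exact: n3].
Unshelve. all: by end_near. Qed.

(** The cubic terms are differenced and compared with the linearization at [q]. Any [P] is allowed,
    since it occurs in the same way on both sides. *)
Lemma cubic_diff (a b a' b' q P e c : R) : 0 <= q -> 0 <= e -> e <= 1 -> c = 20 * (q + 1) -> `|a - q| <= e -> `|a' - q| <= e -> `|b| <= e -> `|b'| <= e ->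
  `|(a ^+ 2 + b ^+ 2 - P) * a - (a' ^+ 2 + b' ^+ 2 - P) * a' - (3 * q ^+ 2 - P) * (a - a')| <= c * e * (`|a - a'| + `|b - b'|) /\
  `|(a ^+ 2 + b ^+ 2 - P) * b - (a' ^+ 2 + b' ^+ 2 - P) * b' - (q ^+ 2 - P) * (b - b')| <= c * e * (`|a - a'| + `|b - b'|).
Proof.
move=> q0' e0 e1 -> ha ha' hb hb'.
set D := `|a - a'|; set E := `|b - b'|; have D0 : 0 <= D := normr_ge0 _; have E0 : 0 <= E := normr_ge0 _.
have an (x : R) : `|x - q| <= e -> `|x| <= q + e.
  by move=> h; have := ler_normD (x - q) q; rewrite subrK (ger0_norm q0'); lra.
have A := an _ ha; have A' := an _ ha'.
have qe : 0 <= q + e by lra.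
have pr (x y X Y : R) : `|x| <= X -> `|y| <= Y -> `|x * y| <= X * Y by move=> hx hy; rewrite normrM ler_pM.
have sq (x : R) : `|x - q| <= e -> `|x ^+ 2 - q ^+ 2| <= e * (2 * q + e).
  move=> h; rewrite subr_sqr; apply: pr => //; apply: le_trans (ler_normD _ _) _; rewrite (ger0_norm q0').
  by have := an _ h; lra.
have b2 : `|b ^+ 2| <= e * e by rewrite expr2; exact: pr.
have b2' : `|b' ^+ 2| <= e * e by rewrite expr2; exact: pr.
have bb : `|b * b'| <= e * e by exact: pr.
have aa : `|a * a' - q ^+ 2| <= e * (q + e) + q * e.
  have -> : a * a' - q ^+ 2 = (a - q) * a' + q * (a' - q) by ring.
  by apply: le_trans (ler_normD _ _) _; apply: lerD; apply: pr; rewrite ?(ger0_norm q0').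
have s1 := sq _ ha; have s2 := sq _ ha'.
have ee : e * e <= e by rewrite ler_piMl.
have W1 : `|(a ^+ 2 - q ^+ 2) + (a * a' - q ^+ 2) + (a' ^+ 2 - q ^+ 2) + b ^+ 2| <= 10 * (q + 1) * e.
  apply: le_trans (ler_normD _ _) _; apply: le_trans (lerD (ler_normD _ _) (lexx _)) _.
  apply: le_trans (lerD (lerD (ler_normD _ _) (lexx _)) (lexx _)) _.
  by have := mulr_ge0 q0' e0; move: s1 s2 aa b2 ee e0; clear; lra.
have W2 : `|a' * (b + b')| <= 10 * (q + 1) * e.
  apply: le_trans (pr _ _ _ _ A' (ler_normD b b')) _; apply: le_trans (_ : (q + e) * (e + e) <= _).
    by apply: ler_wpM2l => //; exact: lerD.
  by have := mulr_ge0 q0' e0; move: ee e0; clear; lra.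
have W3 : `|(a ^+ 2 - q ^+ 2) + b ^+ 2 + b * b' + b' ^+ 2| <= 10 * (q + 1) * e.
  apply: le_trans (ler_normD _ _) _; apply: le_trans (lerD (ler_normD _ _) (lexx _)) _.
  apply: le_trans (lerD (lerD (ler_normD _ _) (lexx _)) (lexx _)) _.
  by have := mulr_ge0 q0' e0; move: s1 bb b2 b2' ee e0; clear; lra.
have W4 : `|b' * (a + a')| <= 10 * (q + 1) * e.
  apply: le_trans (pr _ _ _ _ hb' (ler_normD a a')) _; apply: le_trans (_ : e * (q + e + (q + e)) <= _).
    by apply: ler_wpM2l => //; exact: lerD.
  by have := mulr_ge0 q0' e0; move: ee e0; clear; lra.
have c0 : 0 <= 10 * (q + 1) * e by rewrite !mulr_ge0//; clear -q0'; lra.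
have cD := mulr_ge0 c0 D0; have cE := mulr_ge0 c0 E0.
split.
  have -> : (a ^+ 2 + b ^+ 2 - P) * a - (a' ^+ 2 + b' ^+ 2 - P) * a' - (3 * q ^+ 2 - P) * (a - a') =
    ((a ^+ 2 - q ^+ 2) + (a * a' - q ^+ 2) + (a' ^+ 2 - q ^+ 2) + b ^+ 2) * (a - a') + (a' * (b + b')) * (b - b') by ring.
  apply: le_trans (ler_normD _ _) _; have := pr _ _ _ _ W1 (lexx D); have := pr _ _ _ _ W2 (lexx E).
  by rewrite -/D -/E; move: cD cE; clear; lra.
have -> : (a ^+ 2 + b ^+ 2 - P) * b - (a' ^+ 2 + b' ^+ 2 - P) * b' - (q ^+ 2 - P) * (b - b') =
  ((a ^+ 2 - q ^+ 2) + b ^+ 2 + b * b' + b' ^+ 2) * (b - b') + (b' * (a + a')) * (a - a') by ring.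
apply: le_trans (ler_normD _ _) _; have := pr _ _ _ _ W3 (lexx E); have := pr _ _ _ _ W4 (lexx D).
by rewrite -/D -/E; move: cD cE; clear; lra.
Qed.

Lemma Pot_refl1 eps p ka x : Pot eps p ka (refl1 x) = Pot eps p ka x.
Proof.
rewrite /Pot; have -> : enorm2 (eps *: refl1 x + (0, 0, p)) = enorm2 (eps *: x + (0, 0, p)).
  have c (y : R3 R) j : coord3 (eps *: y + (0, 0, p)) j = eps * coord3 y j + coord3 ((0, 0, p) : R3 R) j by exact: coordZD.
  by rewrite /enorm2 /dot !sum3 !c /coord3 /tnth /=; ring.
by rewrite /refl1 /= sqrrN.
Qed.

(* The anisotropic part of the magnetic energy is absorbed by the trap, up to
   [O(eps^2)]: with [t = |eps x + p e_3|^2 >= |eps rho|^2] this is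
   [w t <= (t - 1)^2 + w + w^2 / 4]. *)
Lemma Pot_absorb eps p Om de x : 0 < de -> (eps ^+ 2 * Om) ^+ 2 * (x.1.1 ^+ 2 + x.1.2 ^+ 2) / de <=
  Pot eps p (eps ^+ 2 * Om) x - 1 + eps ^+ 2 * (Om ^+ 2 / de + (Om ^+ 2 / de) ^+ 2).
Proof.
move=> de0; set w := Om ^+ 2 / de; have w0 : 0 <= w by rewrite divr_ge0 ?sqr_ge0// ltW.
set T := enorm2 (eps *: x + (0, 0, p)).
have rT : eps ^+ 2 * (x.1.1 ^+ 2 + x.1.2 ^+ 2) <= T.
  have c j : coord3 (eps *: x + (0, 0, p)) j = eps * coord3 x j + coord3 ((0, 0, p) : R3 R) j by exact: coordZD.
  rewrite /T /enorm2 /dot sum3 !c /coord3 /tnth /=; have := sqr_ge0 (eps * x.2 + p); lra.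
have -> : (eps ^+ 2 * Om) ^+ 2 * (x.1.1 ^+ 2 + x.1.2 ^+ 2) / de = eps ^+ 2 * (w * (eps ^+ 2 * (x.1.1 ^+ 2 + x.1.2 ^+ 2))) by rewrite /w; field; rewrite gt_eqF.
have e2 := sqr_ge0 eps.
have k0 : 0 <= (eps ^+ 2 * Om) ^+ 2 * (x.1.1 ^+ 2 + x.1.2 ^+ 2) by rewrite mulr_ge0 ?sqr_ge0// addr_ge0 ?sqr_ge0.
have h1 : eps ^+ 2 * (w * (eps ^+ 2 * (x.1.1 ^+ 2 + x.1.2 ^+ 2))) <= eps ^+ 2 * (w * T) by apply: ler_wpM2l => //; exact: ler_wpM2l.
have h2 : w * T <= (T - 1) ^+ 2 + (w + w ^+ 2).
  by have := sqr_ge0 (2 * (T - 1) - w); have := sqr_ge0 w; lra.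
have h3 : eps ^+ 2 * (w * T) <= eps ^+ 2 * ((T - 1) ^+ 2 + (w + w ^+ 2)) by apply: ler_wpM2l.
rewrite /Pot -/T; move: h1 h3 k0; clear; lra.
Qed.

Lemma magsol_refl1 ka u v f g : magsol ka u v f g ->
  magsol ka (fun x => u (refl1 x)) (fun x => - v (refl1 x)) (fun x => f (refl1 x)) (fun x => - g (refl1 x)).
Proof.
move=> h; have s1 : (-1 : R) ^+ 2 = 1 by rewrite sqrrN expr1n.
have cT g0 : continuous g0 -> continuous (fun x => g0 (refl1 x)).
  by move=> cg; apply: (cont_map cg); [exact: contN (@continuous_c1 R)|exact: continuous_c2|exact: continuous_c3].
have eT x y : enorm2 (refl1 x - refl1 y) = enorm2 (x - y).
  by rewrite /enorm2 /dot !sum3 !coordB /coord3 /tnth /=; ring.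
have kT x y : crs (refl1 x) (refl1 y) = -1 * crs x y by rewrite /crs /=; ring.
have := magsol_iso s1 cT eT kT (@Int_refl1 R) h; apply: magsol_ext => x //; by rewrite mulN1r.
Qed.
End Reflection.

(** * Rigidity of the linearized problem *)

Section Linearization.
Context {R : realType}.
Variables (Q : R3 R -> R) (dQ : 'I_3 -> R3 R -> R) (psi : R3 R -> R) (dpsi : 'I_3 -> R3 R -> R).
Hypothesis pQ : profile Q dQ psi dpsi.
Implicit Types (f g h u v k P chi D E F G N : R3 R -> R) (du dv dk dU df dg dh dchi dD dE : 'I_3 -> R3 R -> R) (x y z : R3 R) (s t la ka b eps p : R).
Let q0 : R := Q 0.
Let q_gt0 : 0 < q0. Proof. exact: profile_gt0 pQ 0. Qed.
Let C1Q : C1 Q dQ. Proof. by have [] := profile_sol pQ 0. Qed.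
Let C1p : C1 psi dpsi. Proof. by have [] := profile_dsol pQ 0. Qed.
Let Qq x : 0 <= Q x <= q0. Proof. by rewrite (ltW (profile_gt0 pQ x)) (profile_le pQ). Qed.
Let solQ : sol 0 Q (fun=> 0) (fun x => (Q x ^+ 2 - 1) * Q x) (fun=> 0) dQ (fun _ _ => 0).
Proof. exact: profile_sol pQ 0. Qed.
Let solp : sol 0 psi (fun=> 0) (fun x => (3 * Q x ^+ 2 - 1) * psi x) (fun=> 0) dpsi (fun _ _ => 0).
Proof.
have := profile_dsol pQ 0; congr sol; apply/funext => x; by rewrite mulr0 mul0r.
Qed.
Ltac local_clear := clear -pQ q_gt0 C1Q C1p Qq solQ solp.
Ltac local_lra := local_clear; lra.

(* The linearized problem: [D + i E] solves a perturbation of the kernel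
   equations [(-Delta + 1 - 3 Q^2) D = 0] and [(-Delta + 1 - Q^2) E = 0]. *)
Definition near_kernel (e : R) ka D E F G dD dE N :=
  [/\ sol ka D E F G dD dE, `|ka| <= e, (forall x, N x = D x ^+ 2 + E x ^+ 2), intg N &
   [/\ (forall x, D (refl1 x) = - D x), E 0 = 0, dD o0 0 = 0,
    (forall x, F x * D x + G x * E x + ka ^+ 2 * (x.1.1 ^+ 2 + x.1.2 ^+ 2) / e * N x <=
       (3 * Q x ^+ 2 - 1) * D x ^+ 2 + (Q x ^+ 2 - 1) * E x ^+ 2 + e * N x) &
    (forall x, `|x| <= e^-1 -> `|F x - (3 * Q x ^+ 2 - 1) * D x| <= e * (`|D x| + `|E x|) /\
       `|G x - (Q x ^+ 2 - 1) * E x| <= e * (`|D x| + `|E x|))]].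

Lemma near_kernel_le (e e' : R) ka D E F G dD dE N : 0 < e -> e <= e' -> near_kernel e ka D E F G dD dE N -> near_kernel e' ka D E F G dD dE N.
Proof.
move=> e0 ee [h1 h2 NE h3 [h4 h5 h6 h7 h8]]; have e'0 : 0 < e' by exact: lt_le_trans ee.
have ie : e'^-1 <= e^-1 by rewrite lef_pV2 ?posrE.
split=> //; first exact: le_trans ee.
have N0 x : 0 <= N x by rewrite NE addr_ge0// sqr_ge0.
split=> // [x|x xe].
  apply: le_trans (_ : F x * D x + G x * E x + ka ^+ 2 * (x.1.1 ^+ 2 + x.1.2 ^+ 2) / e * N x <= _).
    rewrite lerD2l; apply: ler_wpM2r => //; apply: ler_wpM2l => //.
    by apply: mulr_ge0; [exact: sqr_ge0|rewrite addr_ge0// sqr_ge0].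
  apply: le_trans (h7 x) _; rewrite lerD2l; exact: ler_wpM2r.
have [a1 a2] := h8 x (le_trans xe ie).
by split; [apply: le_trans a1 _|apply: le_trans a2 _]; exact: ler_wpM2r.
Qed.

Lemma Cgrad_ge0 (K : R) : 0 <= K -> 0 <= Cgrad K.
Proof.
move=> K0; have g0 : 0 <= gbd K by rewrite /gbd addr_ge0// mulr_ge0// sqr_ge0.
rewrite /Cgrad; apply: addr_ge0 K0; apply: divr_ge0; last exact/ltW/mass_gt0.
by apply: mulr_ge0; [exact: mulr_ge0 (ler0n _ _) (ler0n _ _)|exact: addr_ge0 ler01 g0].
Qed.

(** On a fixed cube [F] and [G] are bounded by [D] and [E], so the linear estimates close and
    everything is measured by [sqrt (Int N)], the unit of all later bounds. *)
Lemma near_kernel_bound (K : R) : 0 <= K -> exists C e : R, [/\ 0 <= C, 0 < e & forall ka D E F G dD dE N, near_kernel e ka D E F G dD dE N ->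
  forall x, `|x| <= K -> [/\ `|D x| <= C * Num.sqrt (Int N), `|E x| <= C * Num.sqrt (Int N) &
     forall j, `|dD j x| <= C * Num.sqrt (Int N) /\ `|dE j x| <= C * Num.sqrt (Int N)]].
Proof.
move=> K0; have K1 : 0 <= K + 1 by lra.
pose B : R := @Csup R * (3 + 2 * gbd (K + 1) ^+ 2).
have B0 : 0 <= B by rewrite /B mulr_ge0 ?sqr_ge0// addr_ge0// mulr_ge0// sqr_ge0.
have q20 : 0 <= q0 ^+ 2 by exact: sqr_ge0.
pose c : R := 3 * q0 ^+ 2 + 2; have c1 : 1 <= c by rewrite /c; lra.
have c2 : 0 <= c ^+ 2 by exact: sqr_ge0.
pose c4 : R := B * (1 + 4 * c ^+ 2); have c40 : 0 <= c4 by rewrite /c4 mulr_ge0//; lra.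
pose C : R := 1 + c4; have G0 := Cgrad_ge0 K0.
have GC0 : 0 <= Cgrad K * (2 * c * C) by apply: mulr_ge0 => //; apply: mulr_ge0; [apply: mulr_ge0 => //|rewrite /C]; lra.
exists (C + Cgrad K * (2 * c * C)), (Num.min 1 (K + 3)^-1).
split; [by rewrite /C addr_ge0//; lra|by rewrite lt_min ltr01 invr_gt0; lra|].
move=> ka D E F G dD dE N; set e := Num.min _ _ => -[hs kae NE iN [_ _ _ _ hloc]].
have e0 : 0 < e by rewrite lt_min ltr01 invr_gt0; lra.
have e1 : e <= 1 by rewrite ge_min lexx.
have eK : K + 3 <= e^-1 by rewrite -[K + 3]invrK lef_pV2 ?posrE ?invr_gt0 ?ge_min ?lexx ?orbT//; lra.
have ka1 := le_trans kae e1.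
have [hD hE cF cG _] := hs; have [cD cdD _] := hD; have [cE cdE _] := hE.
have cN : continuous N by rewrite (funext NE); cont.
have N0 x : 0 <= N x by rewrite NE addr_ge0// sqr_ge0.
set S := Num.sqrt _; have S0 : 0 <= S := sqrtr_ge0 _.
have S2 : S ^+ 2 = Int N by rewrite sqr_sqrtr//; exact: Int_ge0.
have FG x : `|x| <= K + 3 -> `|F x| <= c * (`|D x| + `|E x|) /\ `|G x| <= c * (`|D x| + `|E x|).
  move=> xK; have [a1 a2] := hloc x (le_trans xK eK).
  have q2 : `|Q x ^+ 2| <= q0 ^+ 2.
    by rewrite ger0_norm ?sqr_ge0//; apply: sqr_le; rewrite gtr0_norm ?(profile_gt0 pQ)// (profile_le pQ).
  have ed : e * (`|D x| + `|E x|) <= `|D x| + `|E x| by rewrite ler_piMl.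
  have w1 : `|(3 * Q x ^+ 2 - 1) * D x| <= (3 * q0 ^+ 2 + 1) * `|D x|.
    rewrite normrM; apply: ler_wpM2r => //; apply: le_trans (ler_normB _ _) _.
    by rewrite normr1 normrM ger0_norm//; move: q2; local_lra.
  have w2 : `|(Q x ^+ 2 - 1) * E x| <= (3 * q0 ^+ 2 + 1) * `|E x|.
    rewrite normrM; apply: ler_wpM2r => //; apply: le_trans (ler_normB _ _) _.
    by rewrite normr1; move: q20 q2; local_lra.
  have m1 : 0 <= q0 ^+ 2 * `|D x| by apply: mulr_ge0.
  have m2 : 0 <= q0 ^+ 2 * `|E x| by apply: mulr_ge0.
  have n1 := ler_normD (F x - (3 * Q x ^+ 2 - 1) * D x) ((3 * Q x ^+ 2 - 1) * D x).
  have n2 := ler_normD (G x - (Q x ^+ 2 - 1) * E x) ((Q x ^+ 2 - 1) * E x).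
  rewrite subrK in n1; rewrite subrK in n2.
  have d0 := normr_ge0 (D x); have e0' := normr_ge0 (E x).
  by split; rewrite /c; [move: n1 a1 ed w1 m1 m2 d0 e0'|move: n2 a2 ed w2 m1 m2 d0 e0']; local_lra.
have FG2 x : `|x| <= K + 3 -> F x ^+ 2 + G x ^+ 2 <= 4 * c ^+ 2 * N x.
  move=> xK; have [a1 a2] := FG x xK.
  have h1 := sqr_le a1; have h2 := sqr_le a2; rewrite exprMn in h1 h2.
  have h3 : (`|D x| + `|E x|) ^+ 2 <= 2 * N x.
    rewrite NE -[D x ^+ 2]real_normK ?num_real// -[E x ^+ 2]real_normK ?num_real//.
    by have := sqr_ge0 (`|D x| - `|E x|); rewrite sqrrB sqrrD; local_lra.
  have h4 : c ^+ 2 * (`|D x| + `|E x|) ^+ 2 <= c ^+ 2 * (2 * N x) by apply: ler_wpM2l.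
  by move: h1 h2 h4; local_lra.
have sup x0 : `|x0| <= K + 1 -> IntBox 1 (fun z : R3 R => D (z + x0) ^+ 2 + E (z + x0) ^+ 2 + F (z + x0) ^+ 2 + G (z + x0) ^+ 2) <= (1 + 4 * c ^+ 2) * Int N.
  move=> x0K; have cN' := @cont_shift _ N x0 cN; have cD' := @cont_shift _ D x0 cD; have cE' := @cont_shift _ E x0 cE.
  have cF' := @cont_shift _ F x0 cF; have cG' := @cont_shift _ G x0 cG.
  apply: le_trans (_ : IntBox 1 (fun z : R3 R => (1 + 4 * c ^+ 2) * N (z + x0)) <= _).
    apply: le_IntBox; [by cont|by cont|move=> z z1].
    have zx : `|z + x0| <= K + 3 by apply: le_trans (ler_normD _ _) _; move: x0K z1; local_lra.
    by have := FG2 _ zx; rewrite NE; local_lra.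
  rewrite (IntBoxZ 1 _ cN'); apply: ler_wpM2l; first by move: c2; local_lra.
  exact: IntBox_shift_le.
have Sc (w : R) : w ^+ 2 <= B * ((1 + 4 * c ^+ 2) * Int N) -> `|w| <= C * S.
  move=> hw; have CS0 : 0 <= C * S by rewrite mulr_ge0// /C; move: c40; local_lra.
  apply: (@norm_le_root _ _ 0 _ _ CS0); rewrite expr0n addr0; apply: le_trans hw _; rewrite exprMn S2 mulrA -/c4.
  apply: ler_wpM2r; first exact: Int_ge0.
  by rewrite /C; have := sqr_ge0 c4; rewrite sqrrD; move: c40; local_lra.
have DE x : `|x| <= K + 1 -> `|D x| <= C * S /\ `|E x| <= C * S.
  move=> xK; split; apply: Sc.
    by apply: le_trans (sol_sup K1 xK ka1 hs) _; apply: ler_wpM2l => //; exact: sup.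
  apply: le_trans (sol_sup K1 xK ka1 (sol_sym hs)) _; apply: ler_wpM2l => //.
  apply: le_trans (sup x xK); rewrite le_eqVlt; apply/orP; left; apply/eqP.
  by apply: eq_IntBox => z _; ring.
move=> x xK; have xK1 : `|x| <= K + 1 by lra.
have [d1 d2] := DE x xK1; have CS : 0 <= C * S := le_trans (normr_ge0 _) d1.
have GS : 0 <= Cgrad K * (2 * c * C) * S by exact: mulr_ge0.
have hM y : `|y - x| <= 1 -> [/\ `|D y| <= 2 * c * C * S, `|E y| <= 2 * c * C * S, `|F y| <= 2 * c * C * S & `|G y| <= 2 * c * C * S].
  move=> y1; have yK : `|y| <= K + 1.
    by rewrite -[y](subrK x); apply: le_trans (ler_normD _ _) _; move: xK y1; local_lra.
  have yK3 : `|y| <= K + 3 by move: yK; local_lra.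
  have [f1 f2] := DE y yK; have [g1 g2] := FG y yK3.
  have f3 : c * (`|D y| + `|E y|) <= c * (C * S + C * S) by apply: ler_wpM2l; [exact: le_trans ler01 c1|exact: lerD].
  have f4 : C * S <= c * (C * S) by rewrite ler_peMl.
  by split; move: f1 f2 g1 g2 f3 f4 CS; local_lra.
split; [by rewrite mulrDl -[leLHS]addr0 lerD|by rewrite mulrDl -[leLHS]addr0 lerD|move=> j; split].
  by apply: le_trans (sol_grad K0 xK ka1 j hs hM) _; rewrite [leRHS]mulrDl [leLHS]mulrA lerDr.
have hM' y : `|y - x| <= 1 -> [/\ `|E y| <= 2 * c * C * S, `|- D y| <= 2 * c * C * S, `|G y| <= 2 * c * C * S & `|- F y| <= 2 * c * C * S].
  by move=> /hM[? ? ? ?]; rewrite !normrN.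
by apply: le_trans (sol_grad K0 xK ka1 j (sol_sym hs) hM') _; rewrite [leRHS]mulrDl [leLHS]mulrA lerDr.
Qed.

Lemma dcut_flat chi dchi (r : R) : C1 chi dchi -> (forall x, `|x| <= r -> chi x = 1) -> forall x j, `|x| < r -> dchi j x = 0.
Proof.
move=> [_ _ hc] h1 x j xr; apply: (der_unique (hc j x)).
apply: near_eq_is_derive (is_derive_cst (1 : R) x (axis_vec j)); near=> y; rewrite h1//; apply: ltW; near: y.
by apply: (cvgr_lt `|x|) => //; exact: norm_continuous.
Unshelve. all: by end_near. Qed.

Lemma lin_small (X sg B : R) : 0 <= X -> 0 < sg -> 0 < B -> exists b : R, [/\ 0 < b, b <= B & X * b <= sg].
Proof.
move=> X0 s0 B0; have D0 : 0 < sg / (X + 1) by rewrite divr_gt0//; lra.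
exists (Num.min B (sg / (X + 1))); split; [by rewrite lt_min B0|by rewrite ge_min lexx|].
set b := Num.min _ _; have bs : b * (X + 1) <= sg by rewrite -ler_pdivlMr ?ge_min ?lexx ?orbT//; lra.
have b0 : 0 < b by rewrite lt_min B0.
lra.
Qed.

Lemma sqrt_small (Y Z sg : R) : 0 <= Y -> 0 <= Z -> 0 < sg -> exists2 e : R, 0 < e & Y * Num.sqrt (Z * e) <= sg.
Proof.
move=> Y0 Z0 s0; have [a [a0 _ ha]] := lin_small Y0 s0 (@ltr01 R).
have [e [e0 _ he]] := lin_small Z0 (exprn_gt0 2 a0) (@ltr01 R).
exists e => //; apply: le_trans ha; apply: ler_wpM2l => //.
by rewrite -[leRHS]ger0_norm ?(ltW a0)// -sqrtr_sqr ler_sqrt// sqr_ge0.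
Qed.

Lemma unit_bump b : 0 < b -> exists k dk (Kx : R), [/\ C1 k dk, vanish b k, forall x, 0 <= k x <= Kx, Int k = 1 & 0 < Kx].
Proof.
move=> b0; pose la : R := b^-1 ^+ 2; have la0 : 0 < la by rewrite exprn_gt0// invr_gt0.
have M0 := Bm_mass_gt0 la0; have cB := Cc_Bm la0; have [C C0 hC] := Cc_bounded cB.
have hB := C1Z (Int (Bm la))^-1 (C1_Bm la).
exists (fun x => (Int (Bm la))^-1 * Bm la x), (fun j x => (Int (Bm la))^-1 * dBm la j x), ((Int (Bm la))^-1 * (C + 1)).
have i0 : 0 < (Int (Bm la))^-1 by rewrite invr_gt0.
split=> //.
- move=> x xb; rewrite (@Bm_vanish _ la b) ?mulr0 ?(ltW b0)// /la -exprMn mulVf ?expr1n// gt_eqF//.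
- move=> x; rewrite mulr_ge0 ?(ltW i0) ?Bm_ge0//=; apply: ler_wpM2l; first exact: ltW.
  by have := hC x; have := ler_norm (Bm la x); lra.
- by rewrite (IntZ _ (Cc_intg cB)) mulVf// gt_eqF.
- by rewrite mulr_gt0//; lra.
Qed.

Lemma odd_plane D x : (forall x, D (refl1 x) = - D x) -> x.1.1 = 0 -> D x = 0.
Proof.
move=> hD x0; have := hD x; have -> : refl1 x = x by case: x x0 => -[x1 x2] x3 /= ->; rewrite /refl1 /= oppr0.
lra.
Qed.

Lemma odd_lip D dD (r L : R) x : (forall x, D (refl1 x) = - D x) -> C1 D dD -> (forall x, `|x| <= r -> `|dD o0 x| <= L) -> `|x| <= r ->
  `|D x| <= L * `|x.1.1|.
Proof.
move=> hD cD hL xr; pose y : R3 R := (0, x.1.2, x.2).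
have yr : `|y| <= r by move: xr; rewrite !boxE => /and3P[a1 a2 a3]; rewrite /= normr0 a2 a3 (le_trans _ a1).
have e : x.1.1 *: axis_vec o0 + y = x.
  apply: vec_eq => j; rewrite coordZD coord_axis; case: j => -[|[|[|]]] //= i; rewrite /coord3 /tnth /= ?mulr1 ?mulr0 ?add0r ?addr0//.
have := C1_lip cD hL (x := y) (t := x.1.1) yr; rewrite e => /(_ xr).
by rewrite (odd_plane hD (x := y))// subr0.
Qed.

(** Two uses of [energy_gap]: a fixed part of the mass of [(D, E)] lies in the box [K], and the
    localized [chi D] and [chi E] have small Jacobi forms. *)
Lemma near_kernel_energy : exists2 K : R, 0 <= K & forall e ka D E F G dD dE N, near_kernel e ka D E F G dD dE N -> 0 < e <= 32^-1 -> 0 < Int N ->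
  Int N <= 6 * q0 ^+ 2 * IntBox K N /\ forall r, exists f df g dg (C : R),
  [/\ [/\ C1 f df, Cc f, forall x, `|f x| <= C * `|psi x|, forall x, `|x| < r -> f x = D x /\ forall j, df j x = dD j x &
    Int (fun x => gdot df df x - (3 * Q x ^+ 2 - 1) * f x ^+ 2) <= (4 + 6 * q0 ^+ 2) * e * Int N] &
   [/\ C1 g dg, Cc g, forall x, `|g x| <= C * `|Q x|, forall x, `|x| < r -> g x = E x /\ forall j, dg j x = dE j x &
    Int (fun x => gdot dg dg x - (Q x ^+ 2 - 1) * g x ^+ 2) <= (4 + 6 * q0 ^+ 2) * e * Int N]].
Proof.
have [K K0 hK] := profile_decay pQ (e := 4^-1) ltac:(by rewrite invr_gt0).
exists K => // e ka D E F G dD dE N [hs kae NE iN [oD E0 _ hF _]] /andP[e0 e1] N20.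
have [cQ cdQ _] := C1Q; have [hD hE cF cG _] := hs; have [cD cdD _] := hD; have [cE cdE _] := hE.
have cN : continuous N by rewrite (funext NE); cont.
have N0 x : 0 <= N x by rewrite NE addr_ge0// sqr_ge0.
have QK x : K < `|x| -> 3 * Q x ^+ 2 <= 4^-1.
  move=> /hK Qx; have := sqr_le (c := 4^-1) (a := Q x); rewrite ger0_norm; last by case/andP: (Qq x).
  by move=> /(_ Qx); lra.
have de : 0 < e <= 2^-1 by rewrite e0; lra.
split.
  have [chi [dchi [hc cc c01 c1 [cg clow]]]] := large_cut 0 cN N0 iN e0 N20.
  have [_ h2] := energy_gap NE hs hc cc de (ltW e0) c01 cg cQ Qq QK iN hF.
  (* With [eta = e <= 1/32] there remains [9/16 - 1/16 = 1/2] of [Int N] on the left, whence the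
     factor [6]. *)
  have : e * Int N <= 32^-1 * Int N by rewrite ler_pM2r.
  move: h2 clow; set I1 := Int (fun x => chi x ^+ 2 * N x); set I2 := IntBox K N.
  move: I1 I2 => I1 I2; lra.
move=> r; have [chi [dchi [hc cc c01 c1 [cg clow]]]] := large_cut r cN N0 iN e0 N20.
have [h1 _] := energy_gap NE hs hc cc de (ltW e0) c01 cg cQ Qq QK iN hF.
have hf : C1 (fun x => chi x * D x) (dM chi dchi D dD) := C1M hc hD.
have hg : C1 (fun x => chi x * E x) (dM chi dchi E dE) := C1M hc hE.
have cf : Cc (fun x => chi x * D x).
  by have := Cc_mulr cD cc; congr Cc; apply/funext => x; rewrite mulrC.
have cg' : Cc (fun x => chi x * E x).
  by have := Cc_mulr cE cc; congr Cc; apply/funext => x; rewrite mulrC.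
have [r2 r20 v2] := vanish_ge0 cc.
(* [D] is odd, hence at most a multiple of [|x_1|] on the support of [chi], and [psi] is at least
   such a multiple. *)
have [C1' fC1] : exists C : R, forall x, `|chi x * D x| <= C * `|psi x|.
  have [L L0 hL] := cont_bounded r2 (cdD o0); have [k0 k00 hk] := profile_lin pQ r20.
  exists (L / k0) => x; have [xr|xr] := leP `|x| r2; last by rewrite v2// mul0r normr0 mulr_ge0// divr_ge0// ltW.
  have := odd_lip oD hD hL xr => l1; have l2 := hk x xr.
  have /andP[a0 a1] := c01 x.
  rewrite normrM ger0_norm//; apply: le_trans (_ : `|D x| <= _); first by rewrite ler_piMl.
  apply: le_trans l1 _; rewrite -mulrA; apply: ler_wpM2l => //.
  by rewrite mulrC ler_pdivlMr// mulrC.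
have [C2' gC2] : exists C : R, forall x, `|chi x * E x| <= C * `|Q x|.
  have Qn0 x : Q x != 0 by rewrite gt_eqF// (profile_gt0 pQ).
  have [B B0 hB] := cont_bounded r2 (contI cQ Qn0); have [A A0 hA] := Cc_bounded cg'.
  exists (A * B) => x; have [xr|xr] := leP `|x| r2; last by rewrite v2// mul0r normr0 !mulr_ge0.
  rewrite -mulrA -[leLHS]mulr1; apply: ler_pM => //.
  by have := hB x xr; rewrite normfV -[X in X <= _]div1r ler_pdivrMr ?normr_gt0.
(* Only the sum of the two forms is known to be small. With weight [kap = 0], [picone] says that
   each is nonnegative, so each is small. *)
have pos W (p : R3 R -> R) dp f df C : sol 0 p (fun=> 0) (fun x => W x * p x) (fun=> 0) dp (fun _ _ => 0) -> continuous W -> C1 f df -> Cc f ->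
   (forall x, `|f x| <= C * `|p x|) -> 0 <= Int (fun x => gdot df df x - W x * f x ^+ 2).
  move=> hp cW hf0 cf0 hfC; have z0 : Cc (fun _ : R3 R => 0 : R) by split; [exact: cst_continuous|exists 0].
  have z1 (x : R3 R) : 0 <= (0 : R) <= 1 by rewrite lexx ler01.
  have z2 (x : R3 R) : (0 : R) != 0 -> 1 <= p x by rewrite eqxx.
  apply: le_trans (picone hp cW hf0 cf0 hfC (@ltr01 R) z0 z1 z2).
  by rewrite Int_eq0// => x; rewrite mul0r.
have cW : continuous (fun x => 3 * Q x ^+ 2 - 1) by cont.
have cW2 : continuous (fun x => Q x ^+ 2 - 1) by cont.
have p1 := pos _ _ _ _ _ _ solp cW hf cf fC1.
have p2 := pos _ _ _ _ _ _ solQ cW2 hg cg' gC2.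
have loc (X : R3 R -> R) (dX : 'I_3 -> R3 R -> R) x : `|x| < r -> chi x * X x = X x /\ forall j, dM chi dchi X dX j x = dX j x.
  move=> xr; rewrite c1 ?(ltW xr)// mul1r; split=> // j; rewrite /dM (dcut_flat hc c1 j xr) c1 ?(ltW xr)//.
  by rewrite mul0r mul1r add0r.
have hn : (4 * e + 6 * e * q0 ^+ 2) * Int N = (4 + 6 * q0 ^+ 2) * e * Int N by ring.
rewrite hn in h1.
exists (fun x => chi x * D x), (dM chi dchi D dD), (fun x => chi x * E x), (dM chi dchi E dE), (`|C1'| + `|C2'|).
split; split=> //.
- move=> x; apply: le_trans (fC1 x) _; apply: ler_wpM2r => //.
  by have := ler_norm C1'; have := normr_ge0 C2'; local_lra.
- by move=> x; exact: loc.
- by apply: le_trans h1; rewrite lerDl; exact: p2.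
- move=> x; apply: le_trans (gC2 x) _; apply: ler_wpM2r => //.
  by have := ler_norm C2'; have := normr_ge0 C1'; local_lra.
- by move=> x; exact: loc.
- by apply: le_trans h1; rewrite lerDr; exact: p1.
Qed.

Lemma bounded3 dU (r : R) : (forall j, continuous (dU j)) -> exists2 B : R, 0 <= B & forall x, `|x| <= r -> forall j, `|dU j x| <= B.
Proof.
move=> cU; have [a a0 ha] := cont_bounded r (cU o0); have [b b0 hb] := cont_bounded r (cU o1); have [c c0 hc] := cont_bounded r (cU o2).
exists (a + b + c); first by rewrite !addr_ge0.
move=> x xr j; have := ha x xr; have := hb x xr; have := hc x xr.
have : j = o0 \/ j = o1 \/ j = o2 by case: j => -[|[|[|]]] //= i; [left|right; left|right; right]; apply: val_inj.
by case=> [->|[->|->]]; lra.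
Qed.

(* The oscillation bound is linear in [S = sqrt (Int N)], with a constant made
   small by first shrinking the radius [b] of the bump, then [e]. *)
Lemma osc_const (A B r q s c3 sg B0 : R) : 0 <= A -> 0 <= B -> 0 <= r -> 0 <= q -> 0 < s -> 0 <= c3 -> 0 < sg -> 0 < B0 ->
  exists2 b : R, 0 < b <= B0 & forall Kx : R, 0 < Kx -> exists2 e : R, 0 < e & forall S : R, 0 <= S ->
   q * (6 * (A * S / s + A * S * B / s ^+ 2) * b + 6 * r * Num.sqrt (Kx * (c3 * e * S ^+ 2) / s ^+ 2)) <= sg * S.
Proof.
move=> A0 Bp r0 qp s0 c30 sg0 B00; have is0 : 0 <= s^-1 by rewrite invr_ge0 ltW.
have is2 : 0 <= s ^- 2 by rewrite invr_ge0 sqr_ge0.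
have X0 : 0 <= q * (6 * (A / s + A * B / s ^+ 2)).
  by rewrite mulr_ge0// mulr_ge0// addr_ge0// mulr_ge0// mulr_ge0.
have sg2 : 0 < sg / 2 by rewrite divr_gt0.
have [b [b0 bB hb]] := lin_small X0 sg2 B00.
exists b; first by rewrite b0.
move=> Kx Kx0; have Y0 : 0 <= q * (6 * r) by rewrite mulr_ge0// mulr_ge0.
have Z0 : 0 <= Kx * c3 / s ^+ 2 by rewrite mulr_ge0// mulr_ge0// ltW.
have [e e0 he] := sqrt_small Y0 Z0 sg2.
exists e => // S S0.
have -> : Kx * (c3 * e * S ^+ 2) / s ^+ 2 = Kx * c3 / s ^+ 2 * e * S ^+ 2 by ring.
have Ze : 0 <= Kx * c3 / s ^+ 2 * e by rewrite mulr_ge0// ltW.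
rewrite (sqrtrM _ Ze) sqrtr_sqr ger0_norm//.
have -> : q * (6 * (A * S / s + A * S * B / s ^+ 2) * b + 6 * r * (Num.sqrt (Kx * c3 / s ^+ 2 * e) * S)) =
  (q * (6 * (A / s + A * B / s ^+ 2)) * b + q * (6 * r) * Num.sqrt (Kx * c3 / s ^+ 2 * e)) * S by ring.
by apply: ler_wpM2r => //; move: (Num.sqrt _) he hb => w; local_clear => *; lra.
Qed.

Lemma sqS N : (forall x, 0 <= N x) -> Num.sqrt (Int N) ^+ 2 = Int N.
Proof. by move=> N0; rewrite sqr_sqrtr//; exact: Int_ge0. Qed.

(** [E / Q] is nearly constant on the box, and the constant is zero because [E 0 = 0]. *)
Lemma E_small (K sg : R) : 0 <= K -> 0 < sg -> exists2 e : R, 0 < e & forall ka D E F G dD dE N, near_kernel e ka D E F G dD dE N ->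
  forall x, `|x| <= K -> `|E x| <= sg * Num.sqrt (Int N).
Proof.
move=> K0 sg0; have [K_ _ hen] := near_kernel_energy; have K1 : 0 <= K + 1 by lra.
have [C [e1 [Cp e10 hb]]] := near_kernel_bound K1.
have [cQ cdQ _] := C1Q; have [Bd Bd0 hBd] := bounded3 (K + 1) cdQ.
have Qn0 x : Q x != 0 by rewrite gt_eqF// (profile_gt0 pQ).
have [B B0 hB] := cont_bounded (K + 1) (contI cQ Qn0).
pose s : R := (B + 1)^-1; have s0 : 0 < s by rewrite invr_gt0; move: B0; local_lra.
have Qs x : `|x| <= K + 1 -> s <= Q x.
  move=> /hB h; rewrite -[leRHS]invrK lef_pV2 ?posrE ?invr_gt0 ?(profile_gt0 pQ)//; last by move: B0; local_lra.
  by have := ler_norm (Q x)^-1; move: h; local_lra.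
have c30 : 0 <= 4 + 6 * q0 ^+ 2 by have := sqr_ge0 q0; local_lra.
have [b /andP[b0 b1] hosc] := osc_const Cp Bd0 K0 (ltW q_gt0) s0 c30 sg0 (@ltr01 R).
have [k [dk [Kx [hk vk kb k1 Kx0]]]] := unit_bump b0.
have [e2 e20 he2] := hosc Kx Kx0.
pose e := Num.min e1 (Num.min e2 32^-1).
have e0 : 0 < e by rewrite !lt_min e10 e20 invr_gt0 ltr0n.
have [l1 l2 l3] : [/\ e <= e1, e <= e2 & e <= 32^-1] by rewrite /e !ge_min !lexx !orbT.
exists e => // ka D E F G dD dE N hN x xK.
have [hs _ NE iN [_ E0 _ _ _]] := hN.
have N0 y : 0 <= N y by rewrite NE addr_ge0// sqr_ge0.
have hbd := hb _ _ _ _ _ _ _ _ (near_kernel_le e0 l1 hN).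
have xK1 : `|x| <= K + 1 by apply: le_trans xK _; rewrite lerDl.
set S := Num.sqrt _ in hbd *; have S0 : 0 <= S := sqrtr_ge0 _; have S2 : S ^+ 2 = Int N by exact: sqS.
have [NN0|Npos] := leP (Int N) 0.
  have Sz : S = 0 by apply/eqP; rewrite sqrtr_eq0.
  by have [_ h _] := hbd x xK1; move: h; rewrite Sz !mulr0.
have er : 0 < e <= 32^-1 by rewrite e0 l3.
have [_ /(_ (K + 2)) [f [df [g [dg [C' [_ [hg cg gC gloc gen]]]]]]]] := hen _ _ _ _ _ _ _ _ _ hN er Npos.
have K2 y : `|y| <= K + 1 -> `|y| < K + 2 by move=> h; apply: le_lt_trans h _; rewrite ltrD2l ltr1n.
have cW : continuous (fun x => Q x ^+ 2 - 1) by cont.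
have eta0 : 0 <= (4 + 6 * q0 ^+ 2) * e2 * S ^+ 2 by rewrite mulr_ge0 ?sqr_ge0// mulr_ge0// ltW.
have gen2 : Int (fun x => gdot dg dg x - (Q x ^+ 2 - 1) * g x ^+ 2) <= (4 + 6 * q0 ^+ 2) * e2 * S ^+ 2.
  apply: le_trans gen _; rewrite -S2; apply: ler_wpM2r; first exact: sqr_ge0.
  by apply: ler_wpM2l.
have reg w : `|w - 0| <= K + b -> s <= Q w /\ forall j, [/\ `|g w| <= C * S, `|dg j w| <= C * S & `|dQ j w| <= Bd].
  rewrite subr0 => wK; have wK1 : `|w| <= K + 1 by apply: le_trans wK _; rewrite lerD2l.
  have [g1 g2] := gloc w (K2 w wK1); have [_ e3 e4] := hbd w wK1.
  by split; [exact: Qs|move=> j; rewrite g1 g2; split=> //; [case: (e4 j)|exact: hBd]].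
have z0 : `|(0 : R3 R) - 0| <= K by rewrite subr0 normr0.
have xz : `|x - 0| <= K by rewrite subr0.
have := osc_picone solQ cW hg cg gC s0 hk K0 (ltW b0) vk kb k1 Kx0 reg gen2 eta0 z0 xz.
have [g1 _] := gloc x (K2 x xK1); have [g2 _] := gloc 0 (K2 0 ltac:(by rewrite normr0)).
rewrite g1 g2 E0 mul0r subr0 normrM normfV (gtr0_norm (profile_gt0 pQ x)) ler_pdivrMr ?(profile_gt0 pQ)// => hx.
apply: le_trans hx _; apply: le_trans (he2 S S0); rewrite mulrC; apply: ler_wpM2r; last by rewrite (profile_le pQ).
have is0 : 0 <= s^-1 by rewrite invr_ge0 ltW.
have CS : 0 <= C * S by exact: mulr_ge0.
apply: addr_ge0; apply: mulr_ge0; rewrite ?sqrtr_ge0 ?(ltW b0) ?mulr_ge0//.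
by apply: addr_ge0; apply: mulr_ge0 => //; [exact: mulr_ge0|rewrite invr_ge0 sqr_ge0].
Qed.

(** [D / psi] is nearly constant on the cube of [cube_geom], and by oddness on its mirror image. In
    the slab [|x_1| <= 2 ta] between them, [D] and [psi] are both [O(ta)], as they vanish on the
    plane. *)
Lemma D_prop (K : R) : 1 <= K -> exists2 C' : R, 0 <= C' & forall sg : R, 0 < sg -> exists2 e : R, 0 < e & forall ka D E F G dD dE N, near_kernel e ka D E F G dD dE N ->
  exists2 c : R, `|c| <= C' * Num.sqrt (Int N) & forall x, `|x| <= K -> `|D x - c * psi x| <= sg * Num.sqrt (Int N).
Proof.
move=> K1; have K0 : 0 <= K by lra.
have [K_ _ hen] := near_kernel_energy; pose r : R := 2 * K + 4; have r0 : 0 <= r by rewrite /r; lra.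
have Kr : K <= r by rewrite /r; lra.
have [C [e1 [Cp e10 hb]]] := near_kernel_bound r0.
have [cp cdp _] := C1p; have [Bd Bd0 hBd] := bounded3 r cdp.
have [Bp Bp0 hBp] := cont_bounded r cp; have [k0 k00 hk0] := profile_lin pQ r0.
have psi_ge x : 0 < x.1.1 -> `|x| <= r -> k0 * x.1.1 <= psi x.
  by move=> x0 xr; have := hk0 x xr; rewrite gtr0_norm// gtr0_norm// (profile_dgt0 pQ).
exists (C / k0); first by rewrite divr_ge0// ltW.
move=> sg sg0.
have X0 : 0 <= 2 * (C + C / k0 * Bd) by rewrite mulr_ge0// addr_ge0// mulr_ge0// divr_ge0// ltW.
have h2 : 0 < 2^-1 :> R by rewrite invr_gt0.
have [ta [ta0 ta1 hta]] := lin_small X0 sg0 h2.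
pose s : R := k0 * ta; have s0 : 0 < s by rewrite mulr_gt0.
have c30 : 0 <= 4 + 6 * q0 ^+ 2 by have := sqr_ge0 q0; local_lra.
have [b /andP[b0 b1] hosc] := osc_const Cp Bd0 K0 Bp0 s0 c30 sg0 ta0.
have ta01 : 0 < ta <= 2^-1 by rewrite ta0.
have [wreg xsz xz'] := cube_geom K1 ta01 b1; set z : R3 R := (K + 2 * ta, 0, 0) in wreg xsz xz'.
have [k [dk [Kx [hk vk kb k1 Kx0]]]] := unit_bump b0.
have [e2 e20 he2] := hosc Kx Kx0.
pose e := Num.min e1 (Num.min e2 32^-1).
have e0 : 0 < e by rewrite !lt_min e10 e20 invr_gt0 ltr0n.
have [l1 l2 l3] : [/\ e <= e1, e <= e2 & e <= 32^-1] by rewrite /e !ge_min !lexx !orbT.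
exists e => // ka D E F G dD dE N hN.
have [hs _ NE iN [oD E0 _ _ _]] := hN; have [hD _ _ _ _] := hs.
have N0 y : 0 <= N y by rewrite NE addr_ge0// sqr_ge0.
have hbd := hb _ _ _ _ _ _ _ _ (near_kernel_le e0 l1 hN).
set S := Num.sqrt _ in hbd *; have S0 : 0 <= S := sqrtr_ge0 _; have S2 : S ^+ 2 = Int N by exact: sqS.
have CS : 0 <= C * S by exact: mulr_ge0.
have [NN0|Npos] := leP (Int N) 0.
  have Sz : S = 0 by apply/eqP; rewrite sqrtr_eq0.
  exists 0; first by rewrite normr0 Sz mulr0.
  move=> x xK; have xr : `|x| <= r := le_trans xK Kr.
  by have [h _ _] := hbd x xr; move: h; rewrite Sz !mulr0 mul0r subr0.
have er : 0 < e <= 32^-1 by rewrite e0 l3.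
have [_ /(_ (r + 1)) [f [df [g [dg [C' [[hf cf fC floc fen] _]]]]]]] := hen _ _ _ _ _ _ _ _ _ hN er Npos.
have rlt y : `|y| <= r -> `|y| < r + 1 by move=> h; apply: le_lt_trans h _; rewrite ltrDl.
have [cQ _ _] := C1Q; have cW : continuous (fun x => 3 * Q x ^+ 2 - 1) by cont.
have eta0 : 0 <= (4 + 6 * q0 ^+ 2) * e2 * S ^+ 2 by rewrite mulr_ge0 ?sqr_ge0// mulr_ge0// ltW.
have fen2 : Int (fun x => gdot df df x - (3 * Q x ^+ 2 - 1) * f x ^+ 2) <= (4 + 6 * q0 ^+ 2) * e2 * S ^+ 2.
  apply: le_trans fen _; rewrite -S2; apply: ler_wpM2r; first exact: sqr_ge0.
  by apply: ler_wpM2l.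
have reg w : `|w - z| <= K + b -> s <= psi w /\ forall j, [/\ `|f w| <= C * S, `|df j w| <= C * S & `|dpsi j w| <= Bd].
  move=> /wreg[w1 wr]; have [g1 g2] := floc w (rlt w wr); have [e3 _ e4] := hbd w wr.
  split; last by move=> j; rewrite g1 g2; split=> //; [case: (e4 j)|exact: hBd].
  by apply: le_trans (psi_ge w (lt_le_trans ta0 w1) wr); rewrite /s ler_pM2l.
pose xs : R3 R := (K, 0, 0).
have xsr : `|xs| <= r by rewrite boxE /= !normr0 r0 !andbT ger0_norm.
have pxs : k0 <= psi xs.
  have xs0 : 0 < xs.1.1 by exact: lt_le_trans ltr01 K1.
  by apply: le_trans (psi_ge xs xs0 xsr); rewrite /= ler_peMr// ltW.
(* The constant is read off at the reference point [(K, 0, 0)], where [psi >= k0] bounds it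
   independently of [sg]. *)
pose c := D xs / psi xs; have pxs0 : 0 < psi xs by exact: lt_le_trans pxs.
have c_le : `|c| <= C / k0 * S.
  rewrite /c normrM normfV (gtr0_norm pxs0) mulrAC; apply: ler_pM => //; first by rewrite invr_ge0 ltW.
    by have [] := hbd xs xsr.
  by rewrite lef_pV2 ?posrE.
exists c => // .
have half x : `|x| <= K -> 2 * ta <= x.1.1 -> `|D x - c * psi x| <= sg * S.
  move=> xK x1; have xr : `|x| <= r := le_trans xK Kr.
  have xz := xz' x xK x1.
  have px0 : 0 < psi x by apply: (profile_dgt0 pQ); apply: lt_le_trans x1; rewrite mulr_gt0.
  have := osc_picone solp cW hf cf fC s0 hk K0 (ltW b0) vk kb k1 Kx0 reg fen2 eta0 xsz xz.
  have [-> _] := floc x (rlt x xr); have [-> _] := floc xs (rlt xs xsr).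
  rewrite -/c => h; have -> : D x - c * psi x = psi x * (D x / psi x - c) by field; rewrite gt_eqF.
  rewrite normrM; apply: le_trans (he2 S S0); apply: ler_pM => //.
  exact: hBp.
have oddm x : (D (refl1 x) - c * psi (refl1 x)) = - (D x - c * psi x) by rewrite oD (profile_odd pQ); ring.
have r1 x : `|refl1 x| = `|x|.
  have H a : (`|refl1 x| <= a) = (`|x| <= a) by rewrite !boxE /refl1 /= normrN.
  by apply/le_anti; rewrite H lexx -H lexx.
move=> x xK; have xr : `|x| <= r := le_trans xK Kr.
have [x1|x1] := leP (2 * ta) x.1.1; first exact: half.
have [x2|x2] := leP (2 * ta) (- x.1.1).
  by rewrite -normrN -oddm; apply: half; rewrite ?r1.
have ax : `|x.1.1| <= 2 * ta by rewrite ler_norml lerNl (ltW x1) (ltW x2).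
have dl : forall y, `|y| <= r -> `|dD o0 y| <= C * S by move=> y yr; have [_ _ /(_ o0) []] := hbd y yr.
have d1 := odd_lip oD hD dl xr.
have p1 := odd_lip (profile_odd pQ) C1p (fun y yr => hBd y yr o0) xr.
have d2 : C * S * `|x.1.1| <= C * S * (2 * ta) by apply: ler_wpM2l.
have p2 : Bd * `|x.1.1| <= Bd * (2 * ta) by apply: ler_wpM2l.
have cp2 : `|c| * `|psi x| <= C / k0 * S * (Bd * (2 * ta)).
  by apply: ler_pM => //; exact: le_trans p1 p2.
apply: le_trans (ler_normB _ _) _; rewrite normrM.
have : 2 * (C + C / k0 * Bd) * ta * S <= sg * S by apply: ler_wpM2r.
by move: d1 d2 cp2; local_clear; move: (k0^-1) => i; lra.
Qed.

(** It remains to see that the coefficient of [psi] is small. [D - c psi] solves an equation with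
    small data, so its gradient at [0] is small; but [d_1 D (0) = 0] while [d_1 psi (0) > 0], which
    leaves no room for [c]. *)
Lemma D_small (K sg : R) : 0 <= K -> 0 < sg -> exists2 e : R, 0 < e & forall ka D E F G dD dE N, near_kernel e ka D E F G dD dE N ->
  forall x, `|x| <= K -> `|D x| <= sg * Num.sqrt (Int N).
Proof.
move=> K0 sg0; have K1 : 1 <= K + 1 by lra.
have [C' C'0 hprop] := D_prop K1.
have z1 : 0 <= (1 : R) by []. have z0 : 0 <= (0 : R) by [].
have [Cb [eb [Cb0 eb0 hb]]] := near_kernel_bound z1.
have [cp cdp _] := C1p; have [Bp Bp0 hBp] := cont_bounded (K + 1) cp.
have cr : continuous (rotd dpsi) by rewrite /rotd; have := cdp o0; have := cdp o1 => ? ?; cont.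
have [Br Br0 hBr] := cont_bounded 1 cr.
have d0 := profile_d0 pQ; have G0 := Cgrad_ge0 z0.
have id0 : 0 <= (dpsi o0 0)^-1 by rewrite invr_ge0 ltW.
have q20 : 0 <= q0 ^+ 2 by exact: sqr_ge0.
pose T : R := Cgrad 0 / dpsi o0 0 * Bp; have T0 : 0 <= T by rewrite mulr_ge0// mulr_ge0.
pose c5 : R := 3 * q0 ^+ 2 + 2; have c50 : 0 <= c5 by rewrite /c5; move: q20; local_lra.
pose c6 : R := 2 * Cb + 2 * C' * Br; have c60 : 0 <= c6 by rewrite addr_ge0 ?mulr_ge0.
have sg2 : 0 < sg / 2 by rewrite divr_gt0.
have X1 : 0 <= T * c5 + 1 by have := mulr_ge0 T0 c50; local_lra.
have [s1 [s10 _ hs1]] := lin_small X1 sg2 (@ltr01 R).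
have [e1 e10 hE] := E_small z1 s10.
have [e2 e20 hD] := hprop s1 s10.
have em : 0 < Num.min (Num.min e1 e2) (Num.min eb 1) by rewrite !lt_min e10 e20 eb0 ltr01.
have [e [e0 ee he]] := lin_small (mulr_ge0 T0 c60) sg2 em.
have [l1 l2 l3 l4] : [/\ e <= e1, e <= e2, e <= eb & e <= 1] by move: ee; rewrite !le_min -!andbA => /and4P[].
exists e => // ka D E F G dD dE N hN x xK.
have hbd := hb _ _ _ _ _ _ _ _ (near_kernel_le e0 l3 hN).
have hEs := hE _ _ _ _ _ _ _ _ (near_kernel_le e0 l1 hN).
have [c cC hDc] := hD _ _ _ _ _ _ _ _ (near_kernel_le e0 l2 hN).
have [hs kae NE iN [oD E0 dD0 _ hloc]] := hN.
set S := Num.sqrt _ in hbd hEs cC hDc *; have S0 : 0 <= S := sqrtr_ge0 _.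
have ka1 := le_trans kae l4.
(* With the field [ka], [psi] carries the imaginary source [2 ka rotd dpsi], small because
   [|ka| <= e]. *)
have hc := sol_lin 1 (- c) hs (profile_dsol pQ ka).
pose M : R := (c5 * s1 + c6 * e) * S.
have s1S : 0 <= s1 * S by rewrite mulr_ge0// ltW.
have a1 : 0 <= e * (Cb * S) by rewrite mulr_ge0 ?(ltW e0)// mulr_ge0.
have a2 : 0 <= e * (C' * S * Br) by rewrite mulr_ge0 ?(ltW e0)// mulr_ge0// mulr_ge0.
have a3 : 0 <= q0 ^+ 2 * (s1 * S) by rewrite mulr_ge0.
have hM y : `|y - 0| <= 1 -> [/\ `|1 * D y + - c * psi y| <= M, `|1 * E y + - c * 0| <= M,
    `|1 * F y + - c * ((3 * Q y ^+ 2 - 1) * psi y)| <= M & `|1 * G y + - c * (2 * ka * rotd dpsi y)| <= M].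
  rewrite subr0 => y1; have yK : `|y| <= K + 1 by apply: le_trans y1 _; rewrite lerDr.
  have e1' : 1 <= e^-1 by rewrite -[leLHS]invr1 lef_pV2 ?posrE.
  have [f1 f2] := hloc y (le_trans y1 e1'); have [b1 b2 _] := hbd y y1.
  have h1 := hDc y yK; have h2 := hEs y y1.
  have q2 : `|Q y ^+ 2| <= q0 ^+ 2 by rewrite ger0_norm ?sqr_ge0//; apply: sqr_le; have /andP[a b'] := Qq y; rewrite ger0_norm.
  have fb : e * (`|D y| + `|E y|) <= e * (Cb * S + Cb * S) by apply: ler_wpM2l; [exact: ltW|exact: lerD].
  have w1 : `|(3 * Q y ^+ 2 - 1) * (D y - c * psi y)| <= (3 * q0 ^+ 2 + 1) * (s1 * S).
    rewrite normrM; apply: ler_pM => //; apply: le_trans (ler_normB _ _) _; rewrite normr1 normrM ger0_norm//.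
    by rewrite lerD2r ler_pM2l.
  have w2 : `|(Q y ^+ 2 - 1) * E y| <= (q0 ^+ 2 + 1) * (s1 * S).
    by rewrite normrM; apply: ler_pM => //; apply: le_trans (ler_normB _ _) _; rewrite normr1 lerD2r.
  have w3 : `|c * (2 * ka * rotd dpsi y)| <= C' * S * (2 * e * Br).
    rewrite normrM; apply: ler_pM => //; rewrite normrM; apply: ler_pM => //; last exact: hBr.
    by rewrite normrM [`|2|]ger0_norm// ler_pM2l.
  have E1 : 1 * F y + - c * ((3 * Q y ^+ 2 - 1) * psi y) = (F y - (3 * Q y ^+ 2 - 1) * D y) + (3 * Q y ^+ 2 - 1) * (D y - c * psi y) by ring.
  have E2 : 1 * G y + - c * (2 * ka * rotd dpsi y) = (G y - (Q y ^+ 2 - 1) * E y) + (Q y ^+ 2 - 1) * E y - c * (2 * ka * rotd dpsi y) by ring.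
  rewrite E1 E2 mul1r mulNr mul1r mulr0 addr0 /M /c5 /c6; split.
  - by move: h1 s1S a1 a2 a3; local_lra.
  - by move: h2 s1S a1 a2 a3; local_lra.
  - apply: le_trans (ler_normD _ _) _; move: f1 fb w1 s1S a1 a2 a3; local_lra.
  - apply: le_trans (ler_normB _ _) _; apply: le_trans (lerD (ler_normD _ _) (lexx _)) _.
    by move: f2 fb w2 w3 s1S a1 a2 a3; local_lra.
have n0 : `|0 : R3 R| <= 0 by rewrite normr0.
have := sol_grad z0 n0 ka1 o0 hc hM; rewrite dD0 mulr0 add0r mulNr normrN normrM (gtr0_norm d0) => hcd.
have hc1 : `|c| <= Cgrad 0 / dpsi o0 0 * M by rewrite mulrAC ler_pdivlMr.
have xK1 : `|x| <= K + 1 by apply: le_trans xK _; rewrite lerDl.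
have h1 := hDc x xK1; have h2 : `|c * psi x| <= Cgrad 0 / dpsi o0 0 * M * Bp by rewrite normrM; apply: ler_pM => //; exact: hBp.
have -> : D x = (D x - c * psi x) + c * psi x by rewrite subrK.
apply: le_trans (ler_normD _ _) _; apply: le_trans (lerD h1 h2) _.
have -> : s1 * S + Cgrad 0 / dpsi o0 0 * M * Bp = ((T * c5 + 1) * s1 + T * c6 * e) * S by rewrite /M /T; ring.
by apply: ler_wpM2r => //; move: hs1 he; local_lra.
Qed.

(** The box [K] holds a fixed part of [Int N], yet on it [N <= 2 sg^2 Int N]. For small [sg] this
    gives [Int N <= Int N / 2], and [N] vanishes by continuity. *)
Lemma rigid : exists2 e : R, 0 < e & forall ka D E F G dD dE N, near_kernel e ka D E F G dD dE N -> forall x, D x = 0 /\ E x = 0.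
Proof.
have [K K0 hen] := near_kernel_energy; have q20 : 0 <= q0 ^+ 2 by exact: sqr_ge0.
have K30 : 0 <= (2 * K) ^+ 3 by rewrite exprn_ge0// mulr_ge0.
have X0 : 0 <= 12 * (q0 ^+ 2 * (2 * K) ^+ 3) by rewrite mulr_ge0// mulr_ge0.
have h2 : 0 < 2^-1 :> R by rewrite invr_gt0.
have [sg [sg0 sg1 hsg]] := lin_small X0 h2 (@ltr01 R).
have [e1 e10 hE] := E_small K0 sg0; have [e2 e20 hD] := D_small K0 sg0.
pose e := Num.min e1 (Num.min e2 32^-1).
have e0 : 0 < e by rewrite !lt_min e10 e20 invr_gt0 ltr0n.
have [l1 l2 l3] : [/\ e <= e1, e <= e2 & e <= 32^-1] by rewrite /e !ge_min !lexx !orbT.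
exists e => // ka D E F G dD dE N hN.
have [[[cD _ _] [cE _ _] _ _ _] _ NE iN _] := hN.
have cN : continuous N by rewrite (funext NE); cont.
have N0 x : 0 <= N x by rewrite NE addr_ge0// sqr_ge0.
have IN0 : 0 <= Int N by exact: Int_ge0.
have Nz : Int N <= 0.
  rewrite leNgt; apply/negP => Npos; have er : 0 < e <= 32^-1 by rewrite e0 l3.
  have [h _] := hen _ _ _ _ _ _ _ _ _ hN er Npos.
  have hEs := hE _ _ _ _ _ _ _ _ (near_kernel_le e0 l1 hN); have hDs := hD _ _ _ _ _ _ _ _ (near_kernel_le e0 l2 hN).
  have ib : IntBox K N <= 2 * sg ^+ 2 * Int N * (2 * K) ^+ 3.
    rewrite -(IntBox_cst (2 * sg ^+ 2 * Int N) K0); apply: le_IntBox => //; first by cont.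
    move=> x xK; rewrite NE; have := sqr_le (hEs x xK); have := sqr_le (hDs x xK).
    by rewrite exprMn sqr_sqrtr//; move: (Int N) => I; local_lra.
  have s2 : sg ^+ 2 <= sg by rewrite expr2 ler_piMl// ltW.
  have a1 : 6 * q0 ^+ 2 * IntBox K N <= 6 * q0 ^+ 2 * (2 * sg ^+ 2 * Int N * (2 * K) ^+ 3) by apply: ler_wpM2l => //; rewrite mulr_ge0.
  have a2 : 12 * (q0 ^+ 2 * (2 * K) ^+ 3) * sg ^+ 2 <= 12 * (q0 ^+ 2 * (2 * K) ^+ 3) * sg by apply: ler_wpM2l.
  have a3 : 12 * (q0 ^+ 2 * (2 * K) ^+ 3) * sg ^+ 2 * Int N <= 2^-1 * Int N by apply: ler_wpM2r => //; exact: le_trans a2 hsg.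
  have a4 := le_trans h a1.
  by move: a3 a4 Npos; local_clear; move: (Int N) => I; lra.
have NZ x : N x = 0.
  apply/eqP; rewrite eq_le N0 andbT leNgt; apply/negP => Nx.
  have cc : Cc (fun y : R3 R => N y * cut (y - x)) by apply: Cc_mulr => //; exact: Cc_shift (@Cc_cut R).
  have p0 y : 0 <= N y * cut (y - x) by apply: mulr_ge0 => //; case/andP: (cut01 (y - x)).
  have px : 0 < N x * cut (x - x) by rewrite subrr cut1 ?mulr1// normr0.
  have := Int_gt0 cc p0 px; rewrite ltNge => /negP; apply; apply: le_trans Nz.
  by apply: le_Int => [|//|y]; [exact: Cc_intg|rewrite ler_piMr//; case/andP: (cut01 (y - x))].
move=> x; have := NZ x; rewrite NE => h; have d2 := sqr_ge0 (D x); have e2' := sqr_ge0 (E x).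
by split; apply/eqP; rewrite -sqrf_eq0; apply/eqP; move: h d2 e2'; local_lra.
Qed.

Lemma max_derive0 h dh x j : C1 h dh -> (forall y, h y <= h x) -> dh j x = 0.
Proof.
move=> [ch _ hd] hx; have hs (t : R) := (slice_derive_at x t (hd j)).
have d0 : is_derive (0 : R) (1 : R) (fun t => h (t *: axis_vec j + x)) 0.
  apply: (@derive1_at_max R _ (-1) 1) => //.
  - by rewrite in_itv /=; apply/andP; split; lra.
  - by move=> t _; rewrite scale0r add0r.
by apply: (der_unique (hd j x)); apply/slice_derive.
Qed.

(** The task is to place the antisymmetric part of a [good] pair in the class [near_kernel], with
    the error measured by the pair itself. *)
Lemma good_sym Om : exists2 e : R, 0 < e & forall u v, good Q e Om u v -> forall x, u (refl1 x) = u x /\ v (refl1 x) = - v x.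
Proof.
have [e0 e00 hrig] := rigid; have e02 : 0 < e0 / 2 by rewrite divr_gt0.
have ie0 : 0 <= e0^-1 by rewrite invr_ge0 ltW.
have [ep ep0 hP] := Pot_small Om ie0 e02.
have c0 : 0 <= 2 * (20 * (q0 + 1)) by rewrite mulr_ge0// mulr_ge0//; have := q_gt0; lra.
have h4 : 0 < e0 / 4 by rewrite divr_gt0.
have X0 : 0 <= Om ^+ 2 / e0 + (Om ^+ 2 / e0) ^+ 2 by rewrite addr_ge0 ?sqr_ge0// mulr_ge0 ?sqr_ge0.
have B0 : 0 < Num.min (Num.min 1 ep) (q0 / 2) by rewrite !lt_min ltr01 ep0 divr_gt0.
have [a1 [a10 a1B ha1]] := lin_small c0 h4 B0.
have [a2 [a20 a2B ha2]] := lin_small X0 h4 a10.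
have e01 : 0 < Num.min e0 1 by rewrite lt_min e00 ltr01.
have [e [ee0 eB he]] := lin_small (normr_ge0 Om) e01 a20.
have [b1 b2 b3] : [/\ a1 <= 1, a1 <= ep & a1 <= q0 / 2] by move: a1B; rewrite !le_min -andbA => /and3P[].
have e1 : e <= 1 by lra. have eep : e <= ep by lra. have eq : e <= q0 / 2 by lra.
exists e => // u v [eps [p [/andP[eps0 epse] p2 hm [v0 hmax iu iv hclose]]]].
set ka := eps ^+ 2 * Om in hm; set P := Pot eps p ka in hm.
have eps2 : eps ^+ 2 <= e by rewrite expr2; apply: le_trans (_ : 1 * e <= _); [apply: ler_pM; lra|rewrite mul1r].
have kae : `|ka| <= Num.min e0 1.
  rewrite /ka normrM ger0_norm ?sqr_ge0//; apply: le_trans he; rewrite [leRHS]mulrC; exact: ler_wpM2r.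
move: kae; rewrite le_min => /andP[kae ka1].
have [du [dv [hu hv _ _ _]]] := magsol_sol ka1 hm.
pose T := @refl1 R.
pose D x := u x - u (T x); pose E x := v x + v (T x).
pose F x := NL P u v x * u x - NL P u v (T x) * u (T x); pose G x := NL P u v x * v x + NL P u v (T x) * v (T x).
have hDE : magsol ka D E F G.
  by apply: magsol_ext (magsol_lin 1 (-1) hm (magsol_refl1 hm)) => x; rewrite /D /E /F /G /T; ring.
have [dD [dE hs]] := magsol_sol ka1 hDE.
have T2 x : T (T x) = x by case: x => -[x1 x2] x3; rewrite /T /refl1 /= opprK.
have T0 : T 0 = 0 by apply: vec_eq => j; case: j => -[|[|[|]]] //= i; rewrite /coord3 /tnth /= ?oppr0.
have QT x : Q (T x) = Q x.
  by apply: (profile_radial pQ); rewrite /enorm2 /dot !sum3 /coord3 /tnth /=; ring.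
have PT x : P (T x) = P x by exact: Pot_refl1.
(* The comparison keeps [P], because [P - 1] is unbounded; in this form it holds on the whole
   space. *)
have near x : `|F x - (3 * Q x ^+ 2 - P x) * D x| <= e0 / 8 * (`|D x| + `|E x|) /\ `|G x - (Q x ^+ 2 - P x) * E x| <= e0 / 8 * (`|D x| + `|E x|).
  have /andP[Q0 Qle] := Qq x; have [n1 n2] := hclose x; have [n3 n4] := hclose (T x); rewrite QT in n3.
  have n4' : `|- v (T x)| <= e by rewrite normrN.
  have [f1 f2] := cubic_diff (P x) Q0 (ltW ee0) e1 erefl n1 n3 n2 n4'.
  have cb : 20 * (Q x + 1) * e <= e0 / 8.
    have g1 : 20 * (Q x + 1) <= 20 * (q0 + 1) by rewrite ler_pM2l// lerD2r.
    have g2 : 20 * (Q x + 1) * e <= 20 * (q0 + 1) * e by apply: ler_wpM2r => //; exact: ltW.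
    have g3 : 2 * (20 * (q0 + 1)) * e <= 2 * (20 * (q0 + 1)) * a1 by apply: ler_wpM2l => //; exact: le_trans a2B.
    by move: g2 g3 ha1; local_lra.
  have Ee : v x - - v (T x) = E x by rewrite opprK.
  rewrite Ee in f1 f2.
  have f3 : 20 * (Q x + 1) * e * (`|D x| + `|E x|) <= e0 / 8 * (`|D x| + `|E x|) by apply: ler_wpM2r.
  split; [apply: le_trans f3; apply: le_trans f1|apply: le_trans f3; apply: le_trans f2];
    rewrite le_eqVlt; apply/orP; left; apply/eqP; congr `|_|; rewrite /F /G /NL PT; rewrite -?Ee /D; ring.
pose N x := D x ^+ 2 + E x ^+ 2.
have N0 x : 0 <= N x by rewrite addr_ge0// sqr_ge0.
have iu2 : intg (fun x => u (T x) ^+ 2) := scales_intg (@scales_opp1 R) iu.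
have iv2 : intg (fun x => v (T x) ^+ 2) := scales_intg (@scales_opp1 R) iv.
have [[cD _ _] [cE _ _] _ _ _] := hs.
have iN : intg N.
  apply: (@intg_le _ _ (fun x => 2 * u x ^+ 2 + 2 * u (T x) ^+ 2 + (2 * v x ^+ 2 + 2 * v (T x) ^+ 2))).
  - by apply: meas_cont; rewrite /N; cont.
  - move=> x; rewrite ger0_norm// /N /D /E; have := sqr_ge0 (u x + u (T x)); have := sqr_ge0 (v x - v (T x)).
    by rewrite !sqrrB !sqrrD; local_lra.
  - exact: intgD (intgD (intgZ 2 iu) (intgZ 2 iu2)) (intgD (intgZ 2 iv) (intgZ 2 iv2)).
(* At [0] the modulus is maximal, [v] vanishes and [u] is positive. *)
have du0 : du o0 0 = 0.
  have hh := C1D (C1M hu hu) (C1M hv hv).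
  have hm0 y : u y * u y + v y * v y <= u 0 * u 0 + v 0 * v 0.
    by have := hmax y; rewrite v0 mul0r addr0 !expr2.
  have := max_derive0 o0 hh hm0; rewrite v0 mul0r mulr0 !addr0 => hz.
  have u0 : 0 < u 0 by have [n1 _] := hclose 0; move: n1; rewrite ler_norml -/q0 => /andP[n1 _]; move: n1 eq q_gt0; local_lra.
  have : du o0 0 * u 0 = 0 by move: hz; local_lra.
  by move/eqP; rewrite mulf_eq0 (gt_eqF u0) orbF => /eqP.
have dD0 : dD o0 0 = 0.
  have [_ _ hdu] := hu; have [[_ _ hdD] _ _ _ _] := hs.
  apply: (der_unique (hdD o0 0)); rewrite -(subrr (0 : R)); apply: derB; first by rewrite -[X in is_derive _ _ _ X]du0; exact: hdu.
  have hd0 := hdu o0 0; rewrite -[X in is_derive X _ _ _]subr0 in hd0.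
  have := der_reflect hd0; rewrite du0 oppr0 => /slice_derive hsl; apply/slice_derive.
  suff -> : (fun t : R => u (T (t *: axis_vec o0 + 0))) = (fun t : R => u (0 - (t *: axis_vec o0 + 0))) by [].
  apply/funext => t; congr u; apply: vec_eq => j; rewrite coordB coordZD !coord0 coord_axis addr0 sub0r.
  by case: j => -[|[|[|]]] //= i; rewrite /coord3 /tnth /T /refl1 /= /axis_vec /= /GRing.scale /= ?mulr1 ?mulr0 ?addr0 ?oppr0.
have hk : near_kernel e0 ka D E F G dD dE N.
  split=> //; split=> //.
  - by move=> x; rewrite /D -/T T2; ring.
  - by rewrite /E T0 v0 addr0.
  - move=> x; have [n1 n2] := near x.
    have h1 := ler_pM (normr_ge0 _) (normr_ge0 _) n1 (lexx `|D x|).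
    have h2 := ler_pM (normr_ge0 _) (normr_ge0 _) n2 (lexx `|E x|).
    rewrite -normrM in h1; rewrite -normrM in h2.
    have h1' := le_trans (ler_norm _) h1; have h2' := le_trans (ler_norm _) h2.
    have h3 : (`|D x| + `|E x|) ^+ 2 <= 2 * N x.
      rewrite /N -[D x ^+ 2]real_normK ?num_real// -[E x ^+ 2]real_normK ?num_real//.
      by have := sqr_ge0 (`|D x| - `|E x|); rewrite sqrrB sqrrD; local_lra.
    (* In the quadratic form [P - 1] has the favourable sign; it pays for the magnetic energy up to
       an error of order [eps^2]. *)
    have h5 := ler_wpM2r (N0 x) (Pot_absorb eps p Om x e00); rewrite -/ka -/P in h5.
    have h6 : eps ^+ 2 * (Om ^+ 2 / e0 + (Om ^+ 2 / e0) ^+ 2) <= e0 / 4.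
      apply: le_trans ha2; rewrite [leRHS]mulrC; apply: ler_wpM2r => //; exact: le_trans eps2 eB.
    have h7 := ler_wpM2r (N0 x) h6.
    have h8 : e0 / 8 * (`|D x| + `|E x|) ^+ 2 <= e0 / 8 * (2 * N x) by apply: ler_wpM2l => //; rewrite divr_ge0// ltW.
    have h9 : 0 <= e0 * N x by rewrite mulr_ge0// ltW.
    move: h1' h2' h5 h7 h8 h9; move: (eps ^+ 2 * (Om ^+ 2 / e0 + (Om ^+ 2 / e0) ^+ 2)) (ka ^+ 2 * (x.1.1 ^+ 2 + x.1.2 ^+ 2) / e0) => m1 m2.
    by rewrite /N; local_clear; move: (`|D x|) (`|E x|) => dd ee *; lra.
  (* On the box of half-side [1 / e0], and only there, [P - 1] is small and can be replaced by
     [0]. *)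
  - move=> x xe; have [n1 n2] := near x.
    have epsep : 0 < eps <= ep by rewrite eps0 (le_trans epse).
    have Pm := hP eps p epsep p2 x xe; rewrite -/ka -/P in Pm.
    have P1 : 0 <= P x - 1.
      by rewrite subr_ge0; apply: le_trans (Pot_ge eps p ka x); rewrite lerDl mulr_ge0 ?sqr_ge0// addr_ge0 ?sqr_ge0.
    have w (y : R) : `|(P x - 1) * y| <= e0 / 2 * `|y| by rewrite normrM (ger0_norm P1); apply: ler_wpM2r.
    have w1 := w (D x); have w2 := w (E x).
    have m1 : 0 <= e0 * `|D x| by rewrite mulr_ge0// ltW. have m2 : 0 <= e0 * `|E x| by rewrite mulr_ge0// ltW.
    have -> : F x - (3 * Q x ^+ 2 - 1) * D x = (F x - (3 * Q x ^+ 2 - P x) * D x) - (P x - 1) * D x by ring.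
    have -> : G x - (Q x ^+ 2 - 1) * E x = (G x - (Q x ^+ 2 - P x) * E x) - (P x - 1) * E x by ring.
    by split; apply: le_trans (ler_normB _ _) _; [move: n1 w1 m1 m2|move: n2 w2 m1 m2]; local_lra.
move=> x; have [d e'] := hrig _ _ _ _ _ _ _ _ hk x.
by split; [apply/esym/eqP; rewrite -subr_eq0; apply/eqP|apply/eqP; rewrite -addr_eq0 addrC; apply/eqP].
Qed.
End Linearization.

(** * The concentrating family *)

Section Rescaling.
Import ComplexField.Normc.
Local Open Scope complex_scope.
Context {R : realType}.
Implicit Types (f g h u v phi U E : R3 R -> R) (dU dE : 'I_3 -> R3 R -> R) (x y z : R3 R) (s t ka b eps p : R).

Lemma magsol_rotz ka (c s : R) u v f g : c ^+ 2 + s ^+ 2 = 1 -> magsol ka u v f g ->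
  magsol ka (fun x => u (rotz c s x)) (fun x => v (rotz c s x)) (fun x => f (rotz c s x)) (fun x => g (rotz c s x)).
Proof.
move=> cs h; have s1 : (1 : R) ^+ 2 = 1 by rewrite expr1n.
have cT g0 : continuous g0 -> continuous (fun x => g0 (rotz c s x)).
  move=> cg; have c1 := @continuous_c1 R; have c2 := @continuous_c2 R.
  by apply: (cont_map cg); [cont|cont|exact: continuous_c3].
have eT x y : enorm2 (rotz c s x - rotz c s y) = enorm2 (x - y).
  rewrite /enorm2 /dot !sum3 !coordB /coord3 /tnth /=.
  transitivity ((c ^+ 2 + s ^+ 2) * ((x.1.1 - y.1.1) ^+ 2 + (x.1.2 - y.1.2) ^+ 2) + (x.2 - y.2) ^+ 2); first ring.
  by rewrite cs; ring.
have kT x y : crs (rotz c s x) (rotz c s y) = 1 * crs x y.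
  by rewrite -cs /crs /=; ring.
have iT h0 : intg h0 -> Int (fun x => h0 (rotz c s x)) = Int h0 by exact: Int_rotz.
by have := magsol_iso s1 cT eT kT iT h; apply: magsol_ext => x //; rewrite mul1r.
Qed.

Lemma normc_cov (a b c : R) (z : R[i]) : normc ((a +i* b) - (0 +i* 1) * c%:C * z) ^+ 2 = (a + c * complex.Im z) ^+ 2 + (b - c * complex.Re z) ^+ 2.
Proof. by case: z => p q; rewrite normc_sqr /=; ring. Qed.

(** The norm is an extended real; once it is at most [t], its integrand is integrable and dominates
    the square of each component, of the function and of its covariant weak derivatives. *)
Lemma eps_norm_le Omega eps (xa : R3 R) (V : R3 R -> R[i]) U v ka (t : R) : (forall x, V x = U x +i* v x) -> ka = eps ^+ 2 * (Omega / 2) ->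
  continuous U -> continuous v -> in_H1 U -> in_H1 v -> 0 <= t -> (eps_norm Omega eps xa V <= t%:E)%E ->
  [/\ intg (fun x => U x ^+ 2), intg (fun x => v x ^+ 2), Int (fun x => U x ^+ 2) + Int (fun x => v x ^+ 2) <= t ^+ 2 &
   forall j, [/\ square_integrable (fun x => wD j U x + drift x ka j * v x), Int (fun x => (wD j U x + drift x ka j * v x) ^+ 2) <= t ^+ 2,
     square_integrable (fun x => wD j v x - drift x ka j * U x) & Int (fun x => (wD j v x - drift x ka j * U x) ^+ 2) <= t ^+ 2]].
Proof.
move=> VE kE cU cv hU hv t0; rewrite /eps_norm.
have UE : (fun x => complex.Re (V x)) = U by apply/funext => x; rewrite VE.
have ZE : (fun x => complex.Im (V x)) = v by apply/funext => x; rewrite VE.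
pose A j x := wD j U x + drift x ka j * v x; pose B j x := wD j v x - drift x ka j * U x.
pose pot x := eps ^+ 2 * (enorm2 (eps *: x + xa) - 1) ^+ 2.
pose J x := \sum_j (A j x ^+ 2 + B j x ^+ 2) + (1 + pot x) * (U x ^+ 2 + v x ^+ 2).
have JE x : (\sum_(j < 3) normc (wDC j V x - (0 +i* 1) * (eps ^+ 2 * coord3 (rot_field Omega x) j)%:C * V x) ^+ 2)
   + (1 + eps ^+ 2 * (enorm2 (eps *: x + xa) - 1) ^+ 2) * normc (V x) ^+ 2 = J x.
  rewrite /J normc_sqr VE; congr (_ + _); apply: eq_bigr => j _; rewrite normc_cov /wDC UE ZE.
  have dE : eps ^+ 2 * coord3 (rot_field Omega x) j = drift x ka j.
    by rewrite /drift kE; case: j => -[|[|[|]]] //= i; rewrite /coord3 /tnth /rot_field /=; ring.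
  by rewrite dE.
have pot0 x : 0 <= pot x by apply: mulr_ge0; exact: sqr_ge0.
have mw j f : in_H1 f -> meas (wD j f) by move=> hf; have [/sqintE[]] := wDP j hf.
have cdr j : continuous (fun x => drift x ka j) by exact: cont_drift.
have mA j : meas (A j) by apply: measD (mw j _ hU) _; apply: meas_cont; apply: contM.
have mB j : meas (B j).
  have := measD (mw j _ hv) (meas_cont (contN (contM (cdr j) cU))); by congr meas; apply/funext.
have cpot : continuous pot.
  have cE : continuous (fun x : R3 R => enorm2 (eps *: x + xa)) by exact: cont_affine (@cont_enorm2 R).
  have cc (w : R3 R -> R) : continuous w -> continuous (fun x => eps ^+ 2 * (w x - 1) ^+ 2) by move=> cw; cont.
  exact: (cc _ cE).
have mJ : meas J.
  apply: measD; last by apply: meas_cont; cont.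
  have := measD (measD (measD (measX2 (mA o0)) (measX2 (mB o0))) (measD (measX2 (mA o1)) (measX2 (mB o1)))) (measD (measX2 (mA o2)) (measX2 (mB o2))).
  by congr meas; apply/funext => x; rewrite sum3.
have s0 x : 0 <= U x ^+ 2 + v x ^+ 2 by rewrite addr_ge0// sqr_ge0.
have S0 x : 0 <= \sum_j (A j x ^+ 2 + B j x ^+ 2) by apply: sumr_ge0 => j _; rewrite addr_ge0// sqr_ge0.
have J0 x : 0 <= J x by rewrite addr_ge0// mulr_ge0// addr_ge0.
under eq_integral do rewrite JE.
set I := (\int[_]_x _)%E => hI.
have I0 : (0 <= I)%E by apply: integral_ge0 => x _; rewrite lee_fin.
have It : (I <= (t ^+ 2)%:E)%E.
  rewrite -lee_sqrt ?lee_fin ?sqr_ge0//; apply: le_trans hI _.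
  by rewrite /sqrte lee_fin sqrtr_sqr ger0_norm.
have iJ : intg J.
  apply/integrableP; split; first by have /measurable_EFinP h := mJ; exact h.
  rewrite (_ : (\int[_]_(x in _) _)%E = I); first exact: le_lt_trans It (ltry _).
  by apply: eq_integral => x _ /=; rewrite ger0_norm.
have IJ : Int J <= t ^+ 2.
  rewrite /Rintegral -/I; have If : I \is a fin_num by rewrite ge0_fin_numE//; exact: le_lt_trans It (ltry _).
  by rewrite -lee_fin fineK.
have le1 w : meas w -> (forall x, w x ^+ 2 <= J x) -> square_integrable w /\ Int (fun x => w x ^+ 2) <= t ^+ 2.
  move=> mw' hw; have iw : intg (fun x => w x ^+ 2).
    by apply: intg_le (measX2 mw') _ iJ => x; rewrite ger0_norm ?sqr_ge0.
  by split; [apply/sqintE|apply: le_trans IJ; apply: le_Int].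
have UvJ x : U x ^+ 2 + v x ^+ 2 <= J x.
  by rewrite /J mulrDl mul1r; have := S0 x; have := mulr_ge0 (pot0 x) (s0 x); lra.
have AJ j x : A j x ^+ 2 + B j x ^+ 2 <= J x.
  apply: le_trans (_ : \sum_j (A j x ^+ 2 + B j x ^+ 2) <= _); last by rewrite lerDl mulr_ge0// addr_ge0.
  by rewrite (bigD1 j)//= lerDl sumr_ge0// => i _; rewrite addr_ge0// sqr_ge0.
have [/sqintE[_ iU] _] := hU; have [/sqintE[_ iv] _] := hv.
split=> //.
  by rewrite -(IntD iU iv); apply: le_trans IJ; apply: le_Int => //; exact: intgD.
move=> j.
have Aj x : A j x ^+ 2 <= J x by apply: le_trans (AJ j x); rewrite lerDl sqr_ge0.
have Bj x : B j x ^+ 2 <= J x by apply: le_trans (AJ j x); rewrite lerDr sqr_ge0.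
have [a1 a2] := le1 (A j) (mA j) Aj; have [b1 b2] := le1 (B j) (mB j) Bj.
by split.
Qed.

(** Classical and weak derivatives agree against test functions, so [weak_grad_L2] applies; the
    dilated cutoff is [1] on the support of [cut]. *)
Lemma cut_weak_grad (U : R3 R -> R) (dU : 'I_3 -> R3 R -> R) j (w : R3 R -> R) (c : R) : C1 U dU -> in_H1 U -> continuous w ->
  square_integrable (fun x => wD j U x + w x) -> Int (fun x => (wD j U x + w x) ^+ 2) <= c -> Int (fun x => cut x * (dU j x + w x) ^+ 2) <= c.
Proof.
move=> hU H1 cw sq hc; have [cU cdU _] := hU; have [ccut _] := @Cc_cut R.
have cchi : Cc (fun x : R3 R => cut (3^-1 *: x + 0)).
  split; first by apply: cont_affine.
  exists 9 => x x9; rewrite cut_vanish// addr0 normrZ gtr0_norm ?invr_gt0//.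
  by rewrite mulrC ltr_pdivlMr//; lra.
have cdj := cdU j; have cH : continuous (fun x => dU j x + w x) by cont.
have [sw hw] := wDP j H1.
have E phi : test_function phi -> Int (fun x => (dU j x + w x) * phi x) = Int (fun x => (wD j U x + w x) * phi x).
  move=> tp; have cp := test_Cc tp; have hp := test_C1 tp; have cdp := C1_Cc j hp cp.
  have i1 : intg (fun x => dU j x * phi x) by apply: Cc_intg; exact: Cc_mulr.
  have i2 : intg (fun x => w x * phi x) by apply: Cc_intg; exact: Cc_mulr.
  have i3 := sqint_Cc sw cp.
  rewrite (@eq_Int _ _ (fun x => dU j x * phi x + w x * phi x)) => [|x]; last by rewrite mulrDl.
  rewrite [RHS](@eq_Int _ _ (fun x => wD j U x * phi x + w x * phi x)) => [|x]; last by rewrite mulrDl.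
  rewrite (IntD i1 i2) (IntD i3 i2); congr (_ + _).
  have := ibp j hU hp (or_intror cp); have := hw phi tp; rewrite /partial => -> /eqP; rewrite eqr_opp => /eqP ->.
  by [].
have := weak_grad_L2 cH sq E cchi (fun x => cut_norm _) => h; apply: le_trans hc; apply: le_trans h.
have iC : intg (fun x : R3 R => cut (3^-1 *: x + 0) ^+ 2 * (dU j x + w x) ^+ 2).
  have := Cc_mulr (contX (n := 2) cH) (Cc_sq cchi) => /Cc_intg; congr intg; apply/funext => x; exact: mulrC.
apply: le_Int => //.
  by have := Cc_mulr (contX (n := 2) cH) (@Cc_cut R) => /Cc_intg; congr intg; apply/funext => x; exact: mulrC.
move=> x; apply: ler_wpM2r; first exact: sqr_ge0.
have [x3|x3] := leP `|x| 3; last by rewrite cut_vanish// sqr_ge0.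
rewrite [X in _ <= X ^+ 2]cut1 ?expr1n; first by case/andP: (cut01 x).
by rewrite addr0 normrZ gtr0_norm ?invr_gt0// mulrC ler_pdivrMr//; lra.
Qed.
End Rescaling.

(** * The rescaled family; phases and winding numbers *)

Section PhaseAndVortices.
Import ComplexField.Normc.
Local Open Scope complex_scope.
Context {R : realType}.
Implicit Types (h u v k : R3 R -> R) (du dv : 'I_3 -> R3 R -> R) (x z : R3 R) (s t ka eps p : R).

(** The maximum point lies on the axis, where the vector potential vanishes, so the phase in
    [rescaled] is constant. The relations [al^2 = eps^2 a] and [eps^2 mu = - 1] bring the cubic
    coefficient and the frequency to [1]. *)
Lemma scaled_state (Omega a mu sg p : R) (W : R3 R -> R[i]) : 0 < a -> mu < 0 -> GP_solution Omega a mu W ->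
  let eps := (Num.sqrt (- mu))^-1 in let ka := eps ^+ 2 * (Omega / 2) in let al := Num.sqrt (a / - mu) in
  let V := rescaled Omega a mu sg (0, 0, p) W in
  let u x := complex.Re (V x) in let v x := complex.Im (V x) in
  [/\ 0 < eps /\ 0 < al, magsol ka u v (fun x => NL (Pot eps p ka) u v x * u x) (fun x => NL (Pot eps p ka) u v x * v x),
    in_H1 u /\ in_H1 v, forall x, u x ^+ 2 + v x ^+ 2 = al ^+ 2 * normc (W (eps *: x + (0, 0, p))) ^+ 2 &
    forall x, V x = al%:C * W (eps *: x + (0, 0, p)) * cis (- sg)].
Proof.
move=> a0 mu0 hW eps ka al V u v.
have m0 : 0 < - mu by rewrite oppr_gt0.
have e0 : 0 < eps by rewrite invr_gt0 sqrtr_gt0.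
have al0 : 0 < al by rewrite sqrtr_gt0 divr_gt0.
have e2 : eps ^+ 2 = (- mu)^-1 by rewrite exprVn sqr_sqrtr// ltW.
have al2 : al ^+ 2 = eps ^+ 2 * a by rewrite sqr_sqrtr ?divr_ge0 ?ltW// e2 mulrC.
have em : eps ^+ 2 * mu = - 1 by rewrite e2 invrN mulNr mulVf// lt_eqF.
pose c := cos (- sg); pose s := sin (- sg).
have cs : c ^+ 2 + s ^+ 2 = 1 by exact: cos2Dsin2.
pose U x := complex.Re (W x); pose Z x := complex.Im (W x).
have VE x : V x = al%:C * W (eps *: x + (0, 0, p)) * cis (- sg).
  rewrite /V /rescaled -/eps -/al; congr (_ * cis _).
  by rewrite /dot sum3 /coord3 /tnth /rot_field /=; ring.
have uE x : u x = (al * c) * U (eps *: x + (0, 0, p)) - (al * s) * Z (eps *: x + (0, 0, p)).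
  by rewrite /u VE /U /Z /cis -/c -/s; case: (W _) => q r /=; ring.
have vE x : v x = (al * c) * Z (eps *: x + (0, 0, p)) + (al * s) * U (eps *: x + (0, 0, p)).
  by rewrite /v VE /U /Z /cis -/c -/s; case: (W _) => q r /=; ring.
have nE x : u x ^+ 2 + v x ^+ 2 = al ^+ 2 * normc (W (eps *: x + (0, 0, p))) ^+ 2.
  rewrite uE vE normc_sqr -/(U _) -/(Z _).
  transitivity (al ^+ 2 * (c ^+ 2 + s ^+ 2) * (U (eps *: x + (0, 0, p)) ^+ 2 + Z (eps *: x + (0, 0, p)) ^+ 2)); first ring.
  by rewrite cs mulr1.
have [_ [[hU hZ] _] _ _] := hW.
have hUs := in_H1_affine (0, 0, p) e0 hU; have hZs := in_H1_affine (0, 0, p) e0 hZ.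
split=> //.
- have := magsol_cmul (al * c) (al * s) (magsol_scale p e0 (GP_magsol hW)).
  have NE x : eps ^+ 2 * gpF Omega a mu W (eps *: x + (0, 0, p)) = NL (Pot eps p ka) u v x.
    rewrite /NL nE al2 /Pot /gpF /ka.
    transitivity (eps ^+ 2 * mu - (eps ^+ 2 * enorm2 (rot_field Omega (eps *: x + (0, 0, p))) + eps ^+ 2 * (enorm2 (eps *: x + (0, 0, p)) - 1) ^+ 2)
      + eps ^+ 2 * a * normc (W (eps *: x + (0, 0, p))) ^+ 2); first ring.
    rewrite em; have -> : eps ^+ 2 * enorm2 (rot_field Omega (eps *: x + (0, 0, p))) = (eps ^+ 2 * (Omega / 2)) ^+ 2 * (x.1.1 ^+ 2 + x.1.2 ^+ 2).
      have sE (q r : R) : q *: (r : R^o) = q * r by [].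
      by rewrite /enorm2 /dot sum3 /coord3 /tnth /rot_field /= !addr0 !sE; ring.
    ring.
  apply: magsol_ext => x; rewrite ?uE ?vE -?NE //.
  + by rewrite -/(U _) -/(Z _); ring.
  + by rewrite -/(U _) -/(Z _); ring.
- split.
  + by rewrite (_ : u = fun x => (al * c) * U (eps *: x + (0, 0, p)) + (- (al * s)) * Z (eps *: x + (0, 0, p))); [exact: in_H1_lin|apply/funext => x; rewrite uE mulNr].
  + by rewrite (_ : v = fun x => (al * c) * Z (eps *: x + (0, 0, p)) + (al * s) * U (eps *: x + (0, 0, p))); [exact: in_H1_lin|apply/funext => x; rewrite vE].
Qed.

Lemma scaled_near (Omega eps ka d t : R) (xa : R3 R) (V : R3 R -> R[i]) Q (dQ : 'I_3 -> R3 R -> R) :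
  let u x := complex.Re (V x) in let v x := complex.Im (V x) in
  ka = eps ^+ 2 * (Omega / 2) -> C1 Q dQ -> in_H1 Q -> in_H1 u -> in_H1 v ->
  forall du dv, C1 u du -> C1 v dv -> 0 <= t -> t ^+ 2 <= d ->
  (eps_norm Omega eps xa (fun x => (V x - (Q x)%:C)%R) <= t%:E)%E -> H1near Q dQ ka u v du dv d.
Proof.
move=> u v kE hQ iQ iu iv du dv hu hv t0 td hn.
have [cu _ _] := hu; have [cv _ _] := hv; have [cQ _ _] := hQ.
have VE x : V x - (Q x)%:C = (u x - Q x) +i* v x by rewrite /u /v; case: (V x) => q r; rewrite /= /GRing.add /= oppr0 addr0.
have cU : continuous (fun x => u x - Q x) by cont.
have iU : in_H1 (fun x => u x - Q x).
  rewrite (_ : (fun x => _) = fun x => 1 * u x + (- 1) * Q x); first exact: in_H1_lin.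
  by apply/funext => x; ring.
have [n1 n2 n3 n4] := eps_norm_le VE kE cU cv iU iv t0 hn.
split=> // [|j]; first exact: le_trans td.
have [s1 b1 s2 b2] := n4 j; have cd : continuous (fun x => drift x ka j) by exact: cont_drift.
have w1 : continuous (fun x => drift x ka j * v x) by cont.
have w2 : continuous (fun x => - (drift x ka j * (u x - Q x))) by cont.
by split; [exact: cut_weak_grad (C1B hu hQ) iU w1 s1 (le_trans b1 td)|exact: cut_weak_grad hv iv w2 s2 (le_trans b2 td)].
Qed.

Lemma unit_angle (al be : R) : al ^+ 2 + be ^+ 2 = 1 -> exists2 th : R, 0 <= th < 2 * pi & cos th = al /\ sin th = be.
Proof.
move=> h; have a1 : `|al| <= 1 by rewrite -(@ler_pXn2r _ 2) ?nnegrE// real_normK ?num_real// expr1n; have := sqr_ge0 be; lra.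
have ai : -1 <= al <= 1 by rewrite -ler_norml.
have sb : Num.sqrt (1 - al ^+ 2) = `|be| by rewrite -h addrAC subrr add0r sqrtr_sqr.
have p0 := pi_gt0 R.
have [b0|b0] := leP 0 be.
  exists (acos al); first by rewrite acos_ge0//= (le_lt_trans (acos_lepi ai))//; lra.
  by rewrite acosK ?in_itv//= sin_acos// sb ger0_norm.
have ac0 : 0 < acos al.
  rewrite lt_neqAle acos_ge0// andbT; apply/eqP => E.
  by have := sin_acos ai; rewrite -E sin0 sb ltr0_norm//; lra.
exists (2 * pi - acos al).
  by have := acos_lepi ai; move: ac0 => *; apply/andP; split; lra.
have -> : 2 * pi - acos al = - acos al + pi *+ 2 by rewrite mulr_natl addrC.
by rewrite cosD2pi sinD2pi cosN sinN acosK ?in_itv//= sin_acos// sb ltr0_norm ?opprK.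
Qed.

(** Along the curve the argument differs from [th0] by a multiple of [pi]; being continuous, it
    cannot move. *)
Lemma real_vortex_free (W : R3 R -> R[i]) : real_up_to_phase W -> vortex_free W.
Proof.
move=> [th0 [_ hr]] [c [k [[_ _ nz] [th [cth hph ht]] k0]]].
have S t : t \in `[0, 1] -> sin (th t - th0) = 0.
  move=> ti; have := hr (c t); have := hph t ti; rewrite /phase => E.
  have n0 : normc (W (c t)) != 0 by apply: contra (nz t ti) => /eqP/eq0_normc ->.
  have WE : W (c t) = cis (th t) * (normc (W (c t)))%:C.
    by rewrite -E divfK//; apply: contra n0 => /eqP[->].
  rewrite WE /cis cosN sinN => /=; rewrite -[normc _]/(normc (W (c t))).
  move: (normc _) n0 => n n0 /eqP E0.
  have : (cos th0 * sin (th t) - sin th0 * cos (th t)) * n = 0 by rewrite -[RHS](eqP E0); ring.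
  by move/eqP; rewrite mulf_eq0 (negPf n0) orbF => /eqP H; rewrite sinB -[RHS]H; ring.
have p0 := pi_gt0 R.
have i0 : (0 : R) \in `[0, 1] by rewrite in_itv/= lexx ler01.
have i1 : (1 : R) \in `[0, 1] by rewrite in_itv/= lexx ler01.
(* A continuous determination moving by at least [2 pi] would pass through [th 0 +- pi / 2], where the sine is [+- 1]. *)
have no (v : R) : Num.min (th 0) (th 1) <= v <= Num.max (th 0) (th 1) -> sin (v - th0) = 0.
  by move=> vi; have [t ti <-] := IVT ler01 cth vi; exact: S.
have k1 : 1 <= `|k|%:~R :> R by rewrite -[1]/(1%:~R) ler_int -gtz0_ge1 normr_gt0.
have gap : 2 * pi <= `|th 1 - th 0| by rewrite ht normrM gtr0_norm ?mulr_gt0// -intr_norm ler_peMr// mulr_ge0// ltW.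
have key e : e ^+ 2 = 1 -> sin (th 0 + e * (pi / 2) - th0) <> 0.
  move=> e2 E; have := S 0 i0 => E0.
  have := cos2Dsin2 (th 0 - th0); rewrite E0 expr0n addr0 => C1.
  have : sin (e * (pi / 2)) = 0.
    move: E; have -> : th 0 + e * (pi / 2) - th0 = (th 0 - th0) + e * (pi / 2) by ring.
    rewrite sinD E0 mul0r add0r => /eqP; rewrite mulf_eq0 => /orP[/eqP z|/eqP//].
    by move: C1; rewrite z expr0n => /esym/eqP; rewrite oner_eq0.
  have : (e - 1) * (e + 1) = 0 by rewrite -subr_sqr e2 expr1n subrr.
  move/eqP; rewrite mulf_eq0 => /orP[/eqP/subr0_eq ->|/eqP/eqP]; first by rewrite mul1r sin_pihalf => /eqP; rewrite oner_eq0.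
  by rewrite addr_eq0 => /eqP ->; rewrite mulN1r sinN sin_pihalf => /eqP; rewrite oppr_eq0 oner_eq0.
have [h|h] := leP (th 0) (th 1).
  move: gap; rewrite ger0_norm ?subr_ge0// => gap.
  by apply: (key 1); [rewrite expr1n|apply: no; rewrite min_l// max_r//; apply/andP; split; lra].
move: gap; rewrite ltr0_norm ?subr_lt0// => gap.
have hl := ltW h.
by apply: (key (-1)); [rewrite sqrrN expr1n|apply: no; rewrite (min_r hl) (max_l hl); apply/andP; split; lra].
Qed.
End PhaseAndVortices.

Section Rotations.
Import ComplexField.Normc.
Local Open Scope complex_scope.
Context {R : realType} (Q : R3 R -> R) (dQ : 'I_3 -> R3 R -> R) (psi : R3 R -> R) (dpsi : 'I_3 -> R3 R -> R).
Hypothesis pQ : profile Q dQ psi dpsi.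
Implicit Types (u v : R3 R -> R) (x y : R3 R).

Lemma good_rotz (e Om c s : R) u v : c ^+ 2 + s ^+ 2 = 1 -> good Q e Om u v ->
  good Q e Om (fun x => u (rotz c s x)) (fun x => v (rotz c s x)).
Proof.
move=> cs [eps [p [e0 hp hm [v0 hmax iu iv hq]]]].
have r0 : rotz c s 0 = 0 by rewrite /rotz /= !mulr0 subr0 addr0.
have h12 x : (rotz c s x).1.1 ^+ 2 + (rotz c s x).1.2 ^+ 2 = x.1.1 ^+ 2 + x.1.2 ^+ 2.
  transitivity ((c ^+ 2 + s ^+ 2) * (x.1.1 ^+ 2 + x.1.2 ^+ 2)); first by rewrite /=; ring.
  by rewrite cs mul1r.
have sE (q r : R) : q *: (r : R^o) = q * r by [].
have PE x : Pot eps p (eps ^+ 2 * Om) (rotz c s x) = Pot eps p (eps ^+ 2 * Om) x.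
  rewrite /Pot h12; congr (1 + _ * (_ - 1) ^+ 2 + _).
  rewrite /enorm2 /dot !sum3 /coord3 /tnth /= !addr0 !sE.
  have := h12 x => /= E; transitivity (eps ^+ 2 * ((c * x.1.1 - s * x.1.2) ^+ 2 + (s * x.1.1 + c * x.1.2) ^+ 2) + (eps * x.2 + p) ^+ 2); first ring.
  by rewrite E; ring.
have QE x : Q (rotz c s x) = Q x.
  by apply: (profile_radial pQ); rewrite /enorm2 /dot !sum3 /coord3 /tnth /= -!expr2 h12.
exists eps, p; split=> //.
  by have := magsol_rotz cs hm; apply: magsol_ext => x //; rewrite /NL PE.
rewrite r0; split=> //.
- by have := scales_intg (scales_rotz cs) iu.
- by have := scales_intg (scales_rotz cs) iv.
- by move=> x; have := hq (rotz c s x); rewrite QE.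
Qed.

(** On the plane [x_1 = 0], fixed by the reflection, [v = - v]. Any point is a rotation of a point
    of that plane, and rotated pairs are still [good]. *)
Lemma good_real Om : exists2 e : R, 0 < e & forall u v, good Q e Om u v -> forall x, v x = 0.
Proof.
have [e e0 he] := good_sym pQ Om; exists e => // u v g y.
have plane c s r z : c ^+ 2 + s ^+ 2 = 1 -> v (rotz c s (0, r, z)) = 0.
  move=> cs; have [_ ] := he _ _ (good_rotz cs g) (0, r, z).
  by rewrite /refl1 /= oppr0 => E; lra.
have [r0|r0] := eqVneq (y.1.1 ^+ 2 + y.1.2 ^+ 2) 0.
  have y1 : y.1.1 = 0 by move/eqP: r0; rewrite paddr_eq0 ?sqr_ge0// sqrf_eq0 => /andP[/eqP].
  have := plane 1 0 y.1.2 y.2; rewrite expr1n expr0n addr0 => /(_ erefl).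
  by rewrite /rotz /= mulr0 !mul0r !mul1r subrr add0r -[X in (X, _, _)]y1; case: (y) => -[].
pose r := Num.sqrt (y.1.1 ^+ 2 + y.1.2 ^+ 2).
have r2 : r ^+ 2 = y.1.1 ^+ 2 + y.1.2 ^+ 2 by rewrite sqr_sqrtr// addr_ge0 ?sqr_ge0.
have rn : r != 0 by rewrite -sqrf_eq0 r2.
(* The rotation with this cosine and sine sends [(0, r, y_3)] to [y]; points of the axis, where
   [r = 0], were treated apart. *)
have cs : (y.1.2 / r) ^+ 2 + (- y.1.1 / r) ^+ 2 = 1 by rewrite !expr_div_n sqrrN -mulrDl addrC -r2 divff// r2.
have := plane _ _ r y.2 cs; rewrite /rotz /= !mulr0 !add0r mulNr mulNr opprK !divfK//.
by case: (y) => -[].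
Qed.
End Rotations.

Import ComplexField.Normc.
Local Open Scope complex_scope.

Theorem proposition1p3 (R : realType) (Omega : R) (Q : R3 R -> R)
    (w : R -> R3 R -> R[i]) (xmax : R -> R3 R) (p : R -> R) :
  0 <= Omega ->
  ground_state Q ->
  concentrating Omega Q w xmax (0, 0, 1) ->
  (\forall a \near 0^'+, xmax a = (0, 0, p a)) ->
  p a @[a --> 0^'+] --> (1 : R) ->
  \forall a \near 0^'+, real_up_to_phase (w a) /\ vortex_free (w a).
Proof.
move=> _ gs [mu [sg [Hsol _ Hmu Hn]]] Hx Hp.
have [dQ [psi [dpsi pQ]]] := ground_profile gs.
have [e e0 he] := good_real pQ (Omega / 2).
have [d d0 hd] := main_good pQ (Omega / 2) e0.
(* The norm is small, the integrals in [H1near] are its square: [t <= 1] gives [t^2 <= d]. *)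
pose t := Num.min d 1; have t0 : 0 < t by rewrite lt_min d0 ltr01.
have td : t ^+ 2 <= d.
  apply: le_trans (_ : t * 1 <= _); first by rewrite expr2 ler_pM2l// ge_min lexx orbT.
  by rewrite mulr1 ge_min lexx.
(* The second bound on [eps] ensures [|ka| <= 1], which the regularity theorem asks for. *)
pose d1 := Num.min t (1 + `|Omega / 2|)^-1.
have o0 : 0 < 1 + `|Omega / 2| by rewrite ltr_wpDr.
have d10 : 0 < d1 by rewrite lt_min t0 invr_gt0.
have Hp2 : \forall a \near 0^'+, `|1 - p a| < 1 by move/cvgrPdist_lt: Hp; exact.
have Hmu2 : \forall a \near 0^'+, mu a <= - d1 ^- 2 by move/cvgrNyPle: Hmu; exact.
have Hn2 : \forall a \near 0^'+, (eps_norm Omega (Num.sqrt (- mu a))^-1 (xmax a)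
        (fun x => (rescaled Omega a (mu a) (sg a) (xmax a) (w a) x - (Q x)%:C)%R) < t%:E)%E.
  have N : nbhs (0%E : \bar R) [set y | (y < t%:E)%E].
    by apply: open_nbhs_nbhs; split; [exact: open_ereal_lt_ereal|rewrite /= lte_fin].
  exact: (Hn _ N).
near=> a.
have a0 : 0 < a by near: a; exact: nbhs_right_gt.
have [mu0 hW hmax _] : [/\ mu a < 0, GP_solution Omega a (mu a) (w a),
            (forall y, normc (w a y) <= normc (w a (xmax a))) & 0 <= sg a < 2 * pi] by near: a.
have xE : xmax a = (0, 0, p a) by near: a.
have p1 : `|1 - p a| < 1 by near: a.
have mu1 : mu a <= - d1 ^- 2 by near: a.
have nrm : (eps_norm Omega (Num.sqrt (- mu a))^-1 (xmax a)
        (fun x => (rescaled Omega a (mu a) (sg a) (xmax a) (w a) x - (Q x)%:C)%R) < t%:E)%E by near: a.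
suff hr : real_up_to_phase (w a) by split=> //; exact: real_vortex_free.
move: (w a) (mu a) (sg a) (p a) (xmax a) xE hW hmax mu0 p1 mu1 nrm => W m s q xa -> hW hmax m0 q1 m1 nrm.
pose eps := (Num.sqrt (- m))^-1; pose ka := eps ^+ 2 * (Omega / 2); pose al := Num.sqrt (a / - m).
pose V := rescaled Omega a m s (0, 0, q) W.
have := scaled_state s q a0 m0 hW; rewrite /= -/eps -/ka -/al -/V => -[[ep0 al0] hm [hu hv] hN VE].
have epd : eps <= d1.
  rewrite /eps invf_ple ?posrE ?sqrtr_gt0 ?oppr_gt0//.
  rewrite -[d1^-1]ger0_norm ?invr_ge0 ?(ltW d10)// -sqrtr_sqr ler_sqrt ?oppr_ge0 ?(ltW m0)//.
  by rewrite exprVn lerNr.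
have /andP[ept epO] : (eps <= t) && (eps <= (1 + `|Omega / 2|)^-1) by rewrite -le_min.
have /andP[epd0 ep1] : (eps <= d) && (eps <= 1) by rewrite -le_min.
have ka1 : `|ka| <= 1.
  rewrite normrM ger0_norm ?sqr_ge0//.
  have : eps * (1 + `|Omega / 2|) <= 1 by rewrite -ler_pdivlMr// mul1r.
  have : eps ^+ 2 * `|Omega / 2| <= eps * `|Omega / 2| by apply: ler_wpM2r => //; rewrite expr2 ler_piMr// ltW.
  by rewrite mulrDr mulr1; move: (eps ^+ 2 * _) (eps * _) => A B; lra.
have [du [dv hs]] := magsol_sol ka1 hm.
have [hu1 hv1 _ _ _] := hs.
have C1Q : C1 Q dQ by have [] := profile_sol pQ 0.
have [_ HQ _ _ _] := gs.
have hnear := scaled_near (erefl ka) C1Q HQ hu hv hu1 hv1 (ltW t0) td (ltW nrm).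
have ep : 0 < eps <= d by rewrite ep0.
have q2 : `|q| <= 2 by move: q1; rewrite ltr_norml ler_norml => /andP[*]; apply/andP; split; lra.
have hmx x : complex.Re (V x) ^+ 2 + complex.Im (V x) ^+ 2 <= complex.Re (V 0) ^+ 2 + complex.Im (V 0) ^+ 2.
  rewrite !hN scaler0 add0r; apply: ler_wpM2l; first exact: sqr_ge0.
  apply: lerXn2r; rewrite ?nnegrE.
  - by case: (W _) => A B /=; exact: sqrtr_ge0.
  - by case: (W _) => A B /=; exact: sqrtr_ge0.
  - exact: hmax.
have [a1 [b1 [ab g]]] := hd _ _ _ _ _ _ ep q2 hm hs hmx hnear.
have hz := he _ _ g.
(* The final phase is the sum of [s], removed by the rescaling, and of the angle of [a1 + i b1],
   removed by the normalization at the maximum. *)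
pose c := cos (- s); pose s1 := sin (- s); have cs : c ^+ 2 + s1 ^+ 2 = 1 by exact: cos2Dsin2.
have [|th hth [cth sth]] := @unit_angle R (a1 * c + b1 * s1) (b1 * c - a1 * s1).
  by transitivity ((a1 ^+ 2 + b1 ^+ 2) * (c ^+ 2 + s1 ^+ 2)); [ring|rewrite ab cs mulr1].
exists th; split=> // y.
have := hz (eps^-1 *: (y - (0, 0, q))).
rewrite !VE scalerA divff ?gt_eqF// scale1r subrK /cis -/c -/s1 cosN sinN cth sth.
case: (W y) => A B /= E; apply: (mulfI (lt0r_neq0 al0)); rewrite mulr0 -[RHS]E; ring.
Unshelve. all: by end_near.
Qed.
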